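(* Assume that \(\mathcal{S}\subseteq\{\text{full},\text{almost full},\text{bowtie}\}\) is nonempty. A graph \(G\) is \(\mathcal{S}\)-restricted if and only if the skeleton+ of each of its 3-connected components is \(\mathcal{S}\)-restricted.
   Context: All graphs are finite, simple and undirected. A drawing of a graph maps vertices injectively to points of the plane and edges to simple curves between their endpoints avoiding other vertices, with finitely many transversal crossings. A drawing is 1-planar if every edge is involved in at most one crossing and adjacent edges do not cross. For a crossing between edges \(uv\) and \(xy\) consider the pairs \(\{u,x\},\{u,y\},\{v,x\},\{v,y\}\); its type is full if all four are edges, almost full if exactly three are, bowtie if exactly two disjoint ones are, arrow if exactly two sharing a vertex are, chair if exactly one is, X if none is. A drawing (graph) is \(\mathcal{S}\)-restricted if it is (admits a drawing that is) 1-planar with all crossing types in \(\mathcal{S}\). For a 2-connected graph, consider its SPR-tree (the decomposition into triconnected components): every node \(x\) has a skeleton \(\mathrm{sk}(x)\), a multigraph on a subset of the vertices whose edges are real (edges of the graph) or virtual (each virtual edge \(uv\) corresponding to a 2-separator \(\{u,v\}\) and paired with a virtual edge of an adjacent node); S-nodes have cycles as skeletons, P-nodes dipoles, R-nodes 3-connected simple graphs. The 3-connected components of a 2-connected graph are the skeletons of its R-nodes; the 3-connected components of an arbitrary graph are those of its 2-connected components (blocks). The skeleton+ of a node \(x\) is the graph with vertex set \(V(\mathrm{sk}(x))\) together with, for each virtual edge \(uv\) of \(\mathrm{sk}(x)\), a new vertex \(t_{uv}\); its edges are the real edges of \(\mathrm{sk}(x)\), the edges \(ut_{uv}, t_{uv}v\)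 for each virtual edge \(uv\), and the edge \(uv\) for each virtual edge \(uv\) of \(\mathrm{sk}(x)\) such that \(uv\) is an edge of \(G\). *)

(* Defs.v *)
From HB Require Import structures.
From mathcomp Require Import all_boot all_order all_algebra.
From mathcomp Require Import all_classical all_reals all_analysis.

Set Implicit Arguments.
Unset Strict Implicit.
Unset Printing Implicit Defensive.

Import Order.TTheory GRing.Theory Num.Theory.
Import numFieldTopology.Exports numFieldNormedType.Exports.

Record sgraph := SGraph {
  vert :> finType;
  adj : rel vert;
  adj_sym : symmetric adj;
  adj_irrefl : irreflexive adj }.

(* The edge with endpoints u and v; edges are identified with 2-element sets. *)
Definition edge (V : finType) (u v : V) : {set V} := [set u; v]%SET.

Definition edges (G : sgraph) : {set {set G}} :=
  [set a : {set G} | [exists u, exists v, adj u v && (a == edge u v)]]%SET.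

Definition connected_on (V : finType) (r : rel V) (A : {set V}) : Prop :=
  {in A &, forall u v,
     connect [rel x y | [&& x \in A, y \in A & r x y]] u v}.

Definition k_connected (k : nat) (V : finType) (r : rel V) (A : {set V}) : Prop :=
  (k < #|A|)%N /\
  forall X : {set V}, (#|X| < k)%N -> connected_on r (A :\: X)%SET.

Section Induced.
Variables (G : sgraph) (B : {set G}).

Definition induced_adj : rel {v : G | v \in B} :=
  fun u v => adj (val u) (val v).

Lemma induced_adj_sym : symmetric induced_adj.
Proof. by move=> u v; rewrite /induced_adj adj_sym. Qed.

Lemma induced_adj_irrefl : irreflexive induced_adj.
Proof. by move=> u; rewrite /induced_adj adj_irrefl. Qed.

Definition induced_subgraph : sgraph := SGraph induced_adj_sym induced_adj_irrefl.

End Induced.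

(* Blocks with at least three vertices. The remaining blocks (bridges and
   isolated vertices) are not 2-connected and have no SPR-tree. Blocks are
   induced subgraphs, so the vertex set determines the block. *)
Definition biconnected_component (G : sgraph) (B : {set G}) : Prop :=
  k_connected 2 (@adj G) B /\
  forall C : {set G}, B \subset C -> k_connected 2 (@adj G) C -> C = B.

Inductive node_kind := Snode | Pnode | Rnode.

(* sk_edge collects the edges of all the skeletons, sk_node e being the node
   to whose skeleton e belongs. Parallel edges are allowed. The values of twin
   matter only at virtual edges. *)
Record spr_data (H : sgraph) := SprData {
  node : finType;
  kind : node -> node_kind;
  sk_vert : node -> {set H};
  sk_edge : finType;
  sk_node : sk_edge -> node;
  sk_ends : sk_edge -> {set H};
  virtual : pred sk_edge;
  twin : sk_edge -> sk_edge }.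

Section Spr.
Variables (H : sgraph) (T : spr_data H).

Definition sk_edges (x : node T) : {set sk_edge T} :=
  [set e | sk_node e == x]%SET.

Definition sk_adj (x : node T) : rel H :=
  fun u v => [exists e in sk_edges x, sk_ends e == edge u v].

Definition is_cycle (x : node T) : Prop :=
  [/\ (2 < #|sk_vert x|)%N,
      connected_on (sk_adj x) (sk_vert x) &
      {in sk_vert x, forall v, #|[set e in sk_edges x | v \in sk_ends e]%SET| = 2}].

(* Skeletons of P-nodes have at least three edges; otherwise a superfluous
   P-node with one real edge could be attached to any node. *)
Definition is_dipole (x : node T) : Prop :=
  #|sk_vert x| = 2 /\ (2 < #|sk_edges x|)%N.

Definition is_3connected_simple (x : node T) : Prop :=
  {in sk_edges x &, injective (@sk_ends H T)} /\
  k_connected 3 (sk_adj x) (sk_vert x).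

Definition tree_adj : rel (node T) :=
  fun x y => [exists e, [&& virtual e, sk_node e == x & sk_node (twin e) == y]].

Definition tree_adj_at (v : H) : rel (node T) :=
  fun x y => [exists e, [&& virtual e, v \in sk_ends e,
                            sk_node e == x & sk_node (twin e) == y]].

Record is_spr_tree : Prop := IsSprTree {
  spr_ends_card : forall e : sk_edge T, #|sk_ends e| = 2;
  spr_ends_sub : forall e : sk_edge T, sk_ends e \subset sk_vert (sk_node e);
  spr_kind : forall x : node T,
    match kind x with
    | Snode => is_cycle x
    | Pnode => is_dipole x
    | Rnode => is_3connected_simple x
    end;
  spr_twin_virtual : forall e : sk_edge T, virtual e -> virtual (twin e);
  spr_twinK : forall e : sk_edge T, virtual e -> twin (twin e) = e;
  spr_twin_ends : forall e : sk_edge T, virtual e -> sk_ends (twin e) = sk_ends e;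
  spr_twin_node : forall e : sk_edge T, virtual e -> sk_node (twin e) != sk_node e;
  (* the pairs of twins are the edges of a tree: a connected graph with one
     edge less than it has vertices *)
  spr_nonempty : (0 < #|node T|)%N;
  spr_connected : forall x y : node T, connect tree_adj x y;
  spr_acyclic : #|[set e : sk_edge T | virtual e]%SET| = (#|node T|.-1).*2;
  (* no two S-nodes and no two P-nodes are adjacent *)
  spr_reduced : forall x y : node T, tree_adj x y -> kind x = kind y -> kind x = Rnode;
  (* gluing the skeletons along the pairs of twins and deleting the virtual
     edges yields H: every edge of H is real in exactly one skeleton, and the
     copies of a vertex are identified exactly through twins incident to it *)
  spr_real_edge : forall e : sk_edge T, ~~ virtual e -> sk_ends e \in edges H;
  spr_real_ex : forall a, a \in edges H ->
    exists2 e : sk_edge T, ~~ virtual e & sk_ends e = a;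
  spr_real_inj : forall e f : sk_edge T, ~~ virtual e -> ~~ virtual f ->
    sk_ends e = sk_ends f -> e = f;
  spr_vert_ex : forall v : H, exists x : node T, v \in sk_vert x;
  spr_vert_connected : forall (v : H) (x y : node T),
    v \in sk_vert x -> v \in sk_vert y -> connect (tree_adj_at v) x y }.

Section SkeletonPlus.
Variable x : node T.

(* inl v is a vertex of the skeleton, inr e is the new vertex of the virtual
   edge e *)
Definition skp_vert : finType :=
  ({v : H | v \in sk_vert x} +
   {e : sk_edge T | (e \in sk_edges x) && virtual e})%type.

(* The condition u != v is automatic when T is an SPR-tree. *)
Definition skp_adj : rel skp_vert := fun a b =>
  match a, b with
  | inl u, inl v =>
      (u != v) &&
      [exists e in sk_edges x,
         (sk_ends e == edge (val u) (val v)) &&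
         (virtual e ==> adj (val u) (val v))]
  | inl u, inr e => val u \in sk_ends (val e)
  | inr e, inl u => val u \in sk_ends (val e)
  | inr _, inr _ => false
  end.

Lemma skp_adj_sym : symmetric skp_adj.
Proof.
move=> [u|e] [v|f] //=; rewrite eq_sym; congr andb; apply: eq_existsb => e.
by rewrite adj_sym /edge finset.setUC.
Qed.

Lemma skp_adj_irrefl : irreflexive skp_adj.
Proof. by move=> [u|e] //=; rewrite eqxx. Qed.

Definition skeleton_plus : sgraph := SGraph skp_adj_sym skp_adj_irrefl.

End SkeletonPlus.
End Spr.

Inductive crossing_type := Full | AlmostFull | Bowtie | Arrow | Chair | Xcross.

Definition type_of_crossing (G : sgraph) (u v x y : G) : crossing_type :=
  match (adj u x + adj u y + adj v x + adj v y)%N with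
  | 0 => Xcross
  | 1 => Chair
  | 2 => if (adj u x && adj v y) || (adj u y && adj v x) then Bowtie else Arrow
  | 3 => AlmostFull
  | _ => Full
  end.

Local Open Scope ring_scope.
Local Open Scope classical_set_scope.

Section Drawing.
Variable R : realType.

Definition plane : topologicalType := (R * R)%type.

Definition simple_curve (a b : plane) (A : set plane) : Prop :=
  exists gamma : R -> plane,
    [/\ {within `[0, 1], continuous gamma},
        {in `[0, 1] &, injective gamma},
        gamma 0 = a, gamma 1 = b & gamma @` `[0, 1] = A].

(* Some local chart, i.e., a homeomorphism phi from the plane onto an open
   neighbourhood of p, turns A and B into the two coordinate axes. *)
Definition transversal_at (p : plane) (A B : set plane) : Prop :=
  exists phi : plane -> plane,
    [/\ continuous phi, injective phi,
        (forall U : set plane, open U -> open (phi @` U)), phi (0, 0) = p &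
        phi @^-1` A = [set q | q.2 = 0] /\ phi @^-1` B = [set q | q.1 = 0]].

Record drawing_data (G : sgraph) := DrawingData {
  pos : G -> plane;
  curve : {set G} -> set plane }.

Definition crosses (G : sgraph) (D : drawing_data G) (a b : {set G}) (p : plane) :=
  [/\ a \in edges G, b \in edges G, a != b, curve D a p /\ curve D b p &
      ~ range (pos D) p].

Record is_drawing (G : sgraph) (D : drawing_data G) : Prop := IsDrawing {
  pos_inj : injective (pos D);
  curve_simple : forall u v : G, adj u v ->
    simple_curve (pos D u) (pos D v) (curve D (edge u v));
  curve_avoids : forall (a : {set G}) (w : G), a \in edges G -> w \notin a ->
    ~ curve D a (pos D w);
  crosses_finite : forall a b : {set G}, finite_set [set p | crosses D a b p];
  crosses_transversal : forall (a b : {set G}) (p : plane),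
    crosses D a b p -> transversal_at p (curve D a) (curve D b) }.

(* A crossing of the edge a is a pair of another edge and a point. *)
Definition one_planar (G : sgraph) (D : drawing_data G) : Prop :=
  [/\ is_drawing D,
      (forall (a b c : {set G}) (p q : plane),
         crosses D a b p -> crosses D a c q -> b = c /\ p = q) &
      (forall (a b : {set G}) (p : plane), crosses D a b p ->
         (a :&: b)%SET = finset.set0)].

Definition restricted_drawing (S : set crossing_type) (G : sgraph)
    (D : drawing_data G) : Prop :=
  one_planar D /\
  forall (u v x y : G) (p : plane),
    crosses D (edge u v) (edge x y) p -> S (type_of_crossing u v x y).

Definition restricted (S : set crossing_type) (G : sgraph) : Prop :=
  exists D : drawing_data G, restricted_drawing S D.

End Drawing.

(* Main.v *)
(** The only property of the crossing types in S that matters is that, when uv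
    crosses xy, two disjoint edges join {u, v} to {x, y}.

    Drawings are modified by four operations: contracting an uncrossed edge;
    rerouting an edge e that crosses f along f to an end of f, after which neither
    e nor f is crossed; inserting a path along an arc that meets the drawing only in
    its ends; and opening up a vertex of degree two in each of two drawings and
    placing one drawing inside the other, which yields k-sums for k at most 2.

    From G to the skeletons: let W be the set of vertices that a virtual edge uv of
    the skeleton separates from it.  If a vertex of W is adjacent to u and v, it
    serves as t_uv.  Otherwise, if uv is crossed by an edge ab inside W with a
    adjacent to u, rerouting ab along uv to v makes a serve as t_uv.  In the
    remaining case no edge at W is crossed by an edge that is kept, so a walk from
    u to v through W is an arc along which the path u, t_uv, v can be inserted.

    From the skeletons to G: if an edge u t_uv of the skeleton+ is crossed, then the
    crossing edge ends at v, and the path u, t_uv, v can be rerouted along it.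
    When all edges at the vertices t_uv are uncrossed, the skeletons are glued
    by 2-sums along the tree, S- and P-nodes being drawn on two pages of a book,
    and the blocks by 1-sums.

    SPR-trees exist: split skeletons along 2-separators as long as possible, then
    merge adjacent S-nodes and adjacent P-nodes as long as possible. *)
From mathcomp Require Import all_boot all_order all_algebra.
From mathcomp Require Import all_classical all_reals all_analysis.
From mathcomp Require Import ring lra zify.
Require Import Defs.

Set Implicit Arguments.
Unset Strict Implicit.
Unset Printing Implicit Defensive.

Import Order.TTheory GRing.Theory Num.Theory.
Import numFieldTopology.Exports numFieldNormedType.Exports.

Local Open Scope ring_scope.
Local Open Scope classical_set_scope.

(** * Edges of a simple graph *)

Lemma edgeC (V : finType) (u v : V) : edge u v = edge v u.
Proof. by rewrite /edge finset.setUC. Qed.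

Lemma in_edge (V : finType) (u v w : V) : (w \in edge u v) = (w == u) || (w == v).
Proof. by rewrite !inE. Qed.

Lemma edge_l (V : finType) (u v : V) : u \in edge u v.
Proof. by rewrite in_edge eqxx. Qed.

Lemma edge_r (V : finType) (u v : V) : v \in edge u v.
Proof. by rewrite in_edge eqxx orbT. Qed.

Lemma edge_sub (V : finType) (u v : V) (W : {set V}) :
  (edge u v \subset W) = (u \in W) && (v \in W).
Proof. by rewrite /edge finset.subUset !finset.sub1set. Qed.

Lemma edge_inj (V : finType) (u v x y : V) : u != v -> edge u v = edge x y ->
  (u = x /\ v = y) \/ (u = y /\ v = x).
Proof.
move=> uv E; have := edge_l u v; have := edge_r u v.
rewrite E !in_edge => /orP[/eqP vx|/eqP vx] /orP[/eqP ux|/eqP ux]; auto;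
  by rewrite ux vx eqxx in uv.
Qed.

Lemma edge_injr (V : finType) (u v w : V) : edge u v = edge u w -> v = w.
Proof.
move=> E; have : v \in edge u w by rewrite -E edge_r.
have : w \in edge u v by rewrite E edge_r.
by rewrite !in_edge => /orP[/eqP ->|/eqP ->//] /orP[/eqP ->|/eqP ->].
Qed.

Lemma card_edge (V : finType) (u v : V) : u != v -> #|edge u v| = 2.
Proof. by move=> uv; rewrite cards2 uv. Qed.

Lemma card2_edge (V : finType) (a : {set V}) (u : V) : #|a| = 2 -> u \in a ->
  exists2 v, a = edge u v & u != v.
Proof.
move=> a2 ua; move: a2; rewrite (cardsD1 u) ua => -[] /eqP/cards1P[v vE]; exists v.
  by rewrite -(finset.setD1K ua) vE.
have : v \in (a :\ u)%SET by rewrite vE inE.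
by rewrite !inE eq_sym => /andP[].
Qed.

Lemma imset_edge (V V' : finType) (s : V -> V') (u v : V) : (s @: edge u v)%SET = edge (s u) (s v).
Proof. by rewrite /edge finset.imsetU1 imset_set1. Qed.

Lemma adj_neq (G : sgraph) (u v : G) : adj u v -> u != v.
Proof. by apply: contraTneq => ->; rewrite adj_irrefl. Qed.

Lemma edgesP (G : sgraph) (a : {set G}) :
  reflect (exists u v, adj u v /\ a = edge u v) (a \in edges G).
Proof.
rewrite inE; apply: (iffP existsP) => [[u /existsP[v /andP[uv /eqP ->]]]|[u [v [uv ->]]]].
  by exists u, v.
by exists u; apply/existsP; exists v; rewrite uv eqxx.
Qed.

Lemma card_edges (G : sgraph) (a : {set G}) : a \in edges G -> #|a| = 2.
Proof. by case/edgesP=> u [v [/adj_neq uv ->]]; exact: card_edge. Qed.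

Lemma edge_edges (G : sgraph) (u v : G) : (edge u v \in edges G) = adj u v.
Proof.
apply/edgesP/idP => [[a [b [ab E]]]|uv]; last by exists u, v.
by case: (edge_inj (adj_neq ab) (esym E)) => -[<- <-] //; rewrite adj_sym.
Qed.

Section InducedEdges.
Variable G : sgraph.
Implicit Types (W : {set G}) (a : {set G}).

Definition edges_in W : {set {set G}} := [set a in edges G | a \subset W]%SET.

Lemma edges_inE W a : (a \in edges_in W) = (a \in edges G) && (a \subset W).
Proof. by rewrite [LHS]inE. Qed.

Lemma edges_inT : edges_in [set: G]%SET = edges G.
Proof. by apply/finset.setP => a; rewrite edges_inE finset.subsetT andbT. Qed.

Lemma edge_edges_in W u v : (edge u v \in edges_in W) = [&& adj u v, u \in W & v \in W].
Proof. by rewrite edges_inE edge_edges edge_sub. Qed.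

Lemma edges_inP W a : reflect (exists u v, [/\ a = edge u v, adj u v, u \in W & v \in W])
  (a \in edges_in W).
Proof.
apply: (iffP idP) => [|[u [v [-> uv uW vW]]]]; last by rewrite edge_edges_in uv uW.
rewrite edges_inE => /andP[/edgesP[u [v [uv ->]]]]; rewrite edge_sub => /andP[uW vW].
by exists u, v.
Qed.

Lemma edges_in_card W a : a \in edges_in W -> #|a| = 2.
Proof. by rewrite edges_inE => /andP[/card_edges]. Qed.

Lemma edges_in_sub W a : a \in edges_in W -> a \subset W.
Proof. by rewrite edges_inE => /andP[]. Qed.

End InducedEdges.

(** * Trees of skeletons *)

Lemma disconnected_component (V : finType) (r : rel V) (A : {set V}) : ~ connected_on r A ->
  exists (C : {set V}) (u v : V), [/\ C \subset A, u \in C, v \in (A :\: C)%SET &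
    forall a b, a \in C -> b \in A -> r a b -> b \in C].
Proof.
move=> disc; have [u [v [uA vA uv]]] : exists u v, [/\ u \in A, v \in A &
    ~~ connect [rel a b | [&& a \in A, b \in A & r a b]] u v].
  apply: contrapT => no; apply: disc => u v uA vA; apply: contrapT => /negP uv.
  by apply: no; exists u, v.
exists [set w in A | connect [rel a b | [&& a \in A, b \in A & r a b]] u w]%SET, u, v; split.
- by apply/fintype.subsetP => w; rewrite inE => /andP[].
- by rewrite inE uA connect0.
- by rewrite finset.in_setD vA inE (negbTE uv) andbF.
- move=> a b; rewrite !inE => /andP[aA ua] bA ab; rewrite bA; apply: (connect_trans ua).
  by apply: connect1; rewrite /= aA bA.
Qed.

Lemma connect_exit (N : finType) (r : rel N) (A : {pred N}) (x y : N) :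
  connect r x y -> x \in A -> y \notin A -> exists a b, [/\ r a b, a \in A & b \notin A].
Proof.
case/connectP=> p; elim: p x => [|z p IH] x /=; first by move=> _ -> ->.
case/andP=> xz pz yE xA yA; case: (boolP (z \in A)) => zA; first exact: (IH z).
by exists x, z.
Qed.

Section ConnectedArcs.
Variables (N A : finType) (Pa : {set A}) (tl hd : A -> N) (rev : A -> A).
Hypothesis revP : forall a, a \in Pa -> [/\ rev a \in Pa, tl (rev a) = hd a & hd (rev a) = tl a].

Definition arc_rel : rel N := fun x y => [exists a in Pa, (tl a == x) && (hd a == y)].

Let subtree (S : {set N}) (B : {set A}) :=
  [/\ B \subset Pa, {in B, forall a, tl a \in S /\ hd a \in S} & ((#|S|.-1).*2 <= #|B|)%N].

Let subtree_grow (S : {set N}) (B : {set A}) a : subtree S B -> (0 < #|S|)%N ->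
  a \in Pa -> tl a \in S -> hd a \notin S -> subtree (hd a |: S)%SET (a |: (rev a |: B))%SET.
Proof.
move=> [BP BS SB] S0 aP ta ha; have [rP rt rh] := revP aP.
have aB : a \notin B by apply: contraNN ha => /BS[].
have rB : rev a \notin B by apply: contraNN ha => /BS[]; rewrite rt.
have ar : a != rev a by apply: contraNneq ha => E; rewrite -rt -E.
split.
- by apply/fintype.subsetP => b; rewrite !inE => /or3P[/eqP ->|/eqP ->|/(fintype.subsetP BP)].
- move=> b; rewrite !inE => /or3P[/eqP ->|/eqP ->|/BS[-> ->]]; rewrite ?rt ?rh ?ta ?eqxx ?orbT //.
- rewrite cardsU1 ha /= cardsU1 !inE negb_or ar aB /= cardsU1 rB /= !add1n.
  by case: #|S| S0 SB => //= n _; rewrite doubleS !ltnS.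
Qed.

Lemma connected_card_arcs : (forall x y, connect arc_rel x y) -> ((#|N|.-1).*2 <= #|Pa|)%N.
Proof.
move=> con; case: (posnP #|N|) => [->//|N0].
have /card_gt0P[x0 _] : (0 < #|[pred x : N | true]|)%N by [].
suff [S [B [_ SN [BP _ SB]]]] : exists (S : {set N}) (B : {set A}),
  [/\ x0 \in S, #|S| = #|N| & subtree S B].
  by rewrite -SN; apply: leq_trans SB _; exact: subset_leq_card.
elim: {-2}#|N| (leqnn #|N|) N0 => // -[|k] IH kN _.
  exists [set x0]%SET, finset.set0; rewrite inE cards1; split => //.
  by split; rewrite ?finset.sub0set ?cards1 // => a; rewrite finset.in_set0.
have [S [B [x0S SN SB]]] := IH (ltnW kN) isT.
have [y yS] : exists y, y \notin S.
  apply/existsP; rewrite -negb_forall; apply/negP => /forallP SA.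
  by have : #|S| = #|N| by [apply: eq_card => y; rewrite SA]; rewrite SN => E; rewrite E ltnn in kN.
have [x [z [/exists_inP[a aP /andP[/eqP ta /eqP ha]] xS zS]]] := connect_exit (con x0 y) x0S yS.
exists (hd a |: S)%SET, (a |: (rev a |: B))%SET; split.
- by rewrite !inE x0S orbT.
- by rewrite cardsU1 ha zS SN.
- by apply: subtree_grow; rewrite ?ta ?ha // SN.
Qed.

End ConnectedArcs.

(* An SPR-tree without the conditions on the kinds of the nodes. *)
Record pre_tree (H : sgraph) (T : spr_data H) : Prop := PreTree {
  pt_ends_card : forall e : sk_edge T, #|sk_ends e| = 2;
  pt_ends_sub : forall e : sk_edge T, sk_ends e \subset sk_vert (sk_node e);
  pt_twin_virtual : forall e : sk_edge T, virtual e -> virtual (twin e);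
  pt_twinK : forall e : sk_edge T, virtual e -> twin (twin e) = e;
  pt_twin_ends : forall e : sk_edge T, virtual e -> sk_ends (twin e) = sk_ends e;
  pt_twin_node : forall e : sk_edge T, virtual e -> sk_node (twin e) != sk_node e;
  pt_nonempty : (0 < #|node T|)%N;
  pt_connected : forall x y : node T, connect (@tree_adj H T) x y;
  pt_acyclic : #|[set e : sk_edge T | virtual e]%SET| = (#|node T|.-1).*2;
  pt_real_edge : forall e : sk_edge T, ~~ virtual e -> sk_ends e \in edges H;
  pt_real_ex : forall a, a \in edges H -> exists2 e : sk_edge T, ~~ virtual e & sk_ends e = a;
  pt_real_inj : forall e f : sk_edge T, ~~ virtual e -> ~~ virtual f ->
    sk_ends e = sk_ends f -> e = f;
  pt_vert_ex : forall v : H, exists x : node T, v \in sk_vert x;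
  pt_vert_connected : forall (v : H) (x y : node T),
    v \in sk_vert x -> v \in sk_vert y -> connect (tree_adj_at (T := T) v) x y }.

Lemma spr_pre_tree (H : sgraph) (T : spr_data H) : is_spr_tree T -> pre_tree T.
Proof. by case. Qed.

Section FarSide.
Variables (H : sgraph) (T : spr_data H).
Hypothesis treeT : pre_tree T.
Implicit Types (e f : sk_edge T) (x y z : node T).

Lemma sk_ends_edge e : exists u v, sk_ends e = edge u v /\ u != v.
Proof. by have /eqP/cards2P[u [v [uv E]]] := pt_ends_card treeT e; exists u, v. Qed.

Lemma twin_inj e f : virtual e -> virtual f -> twin e = twin f -> e = f.
Proof. by move=> ve vf E; rewrite -(pt_twinK treeT ve) E (pt_twinK treeT vf). Qed.

Lemma twin_neq e : virtual e -> twin e != e.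
Proof. by move=> ve; apply: contraNneq (pt_twin_node treeT ve) => ->. Qed.

Let other_virtual e : {set sk_edge T} := ([set f | virtual f] :\ e :\ twin e)%SET.

Let other_virtual_twin e f : virtual e -> f \in other_virtual e -> twin f \in other_virtual e.
Proof.
move=> ve; rewrite !inE => /and3P[ft fe vf]; rewrite (pt_twin_virtual treeT) // andbT.
apply/andP; split; first by apply: contraNneq fe => /(twin_inj vf ve) ->.
by apply: contraNneq ft => <-; rewrite (pt_twinK treeT).
Qed.

Definition tree_minus e : rel (node T) :=
  arc_rel (other_virtual e) (@sk_node H T) (fun f => sk_node (twin f)).

Definition far e : {set node T} := [set z | connect (tree_minus e) (sk_node (twin e)) z]%SET.

Lemma tree_minusP e x y : reflect (exists f, [/\ virtual f, f != e, f != twin e,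
  sk_node f = x & sk_node (twin f) = y]) (tree_minus e x y).
Proof.
apply: (iffP exists_inP) => [[f]|[f [vf fe ft <- <-]]].
  by rewrite !inE => /and3P[ft fe vf] /andP[/eqP <- /eqP <-]; exists f.
by exists f; rewrite ?inE ?vf ?fe ?ft ?eqxx.
Qed.

Lemma tree_minus_sym e : virtual e -> symmetric (tree_minus e).
Proof.
move=> ve; suff sub x y : tree_minus e x y -> tree_minus e y x.
  by move=> x y; apply/idP/idP; exact: sub.
case/exists_inP=> f fO /andP[/eqP <- /eqP <-]; apply/exists_inP; exists (twin f).
  exact: other_virtual_twin.
by move: fO; rewrite !inE => /and3P[_ _ vf]; rewrite (pt_twinK treeT) // !eqxx.
Qed.

(* If the two sides of e were still connected without e, the tree would have too few edges. *)
Lemma sk_node_notin_far e : virtual e -> sk_node e \notin far e.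
Proof.
move=> ve; rewrite inE; apply/negP => con.
have symc : connect_sym (tree_minus e) by apply: sym_connect_sym; exact: tree_minus_sym.
have all_connected x y : connect (tree_minus e) x y.
  apply: (connect_sub _ (pt_connected treeT x y)) => {}x {}y /existsP[f /and3P[vf /eqP <- /eqP <-]].
  case: (eqVneq f e) => [->|fe]; first by rewrite symc.
  case: (eqVneq f (twin e)) => [->|ft]; first by rewrite (pt_twinK treeT).
  by apply: connect1; apply/tree_minusP; exists f.
have := @connected_card_arcs _ _ (other_virtual e) _ _ (@twin H T) _ all_connected.
rewrite leqNgt => /(_ _)/negP; apply; last first.
  rewrite -(pt_acyclic treeT) [in ltnRHS](cardsD1 e) [in ltnRHS](cardsD1 (twin e))
    !inE ve twin_neq //.
  by rewrite (pt_twin_virtual treeT ve) !add1n ltnS leqnSn.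
move=> f fO; split => //; first exact: other_virtual_twin.
by move: fO; rewrite !inE => /and3P[_ _ vf]; rewrite (pt_twinK treeT).
Qed.

Lemma twin_node_in_far e : sk_node (twin e) \in far e.
Proof. by rewrite inE connect0. Qed.

Lemma far_twin_node e f : virtual e -> virtual f -> f != e -> f != twin e ->
  (sk_node (twin f) \in far e) = (sk_node f \in far e).
Proof.
move=> ve vf fe ft; rewrite !inE.
have down : tree_minus e (sk_node f) (sk_node (twin f)) by apply/tree_minusP; exists f.
have up : tree_minus e (sk_node (twin f)) (sk_node f) by rewrite tree_minus_sym.
by apply/idP/idP => con; apply: (connect_trans con); exact: connect1.
Qed.

Lemma enters_far e f : virtual e -> virtual f ->
  sk_node f \notin far e -> sk_node (twin f) \in far e -> f = e.
Proof.
move=> ve vf fn tf; apply/eqP; apply: contraNT fn => fe.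
case: (eqVneq f (twin e)) => [->|ft]; first exact: twin_node_in_far.
by rewrite -far_twin_node.
Qed.

Lemma shared_vertex_in_ends e v x z : virtual e -> x \notin far e -> z \in far e ->
  v \in sk_vert x -> v \in sk_vert z -> v \in sk_ends e.
Proof.
move=> ve xn zf vx vz.
have [a [b [/existsP[f /and4P[vf vE /eqP <- /eqP <-]]]]] :=
  @connect_exit _ _ [predC far e] _ _ (pt_vert_connected treeT vx vz) xn (introT negPn zf).
by move=> /= fa /negPn/(enters_far ve vf fa) <-.
Qed.

Lemma far_twin e z : virtual e -> (z \in far (twin e)) = (z \notin far e).
Proof.
move=> ve; have vt := pt_twin_virtual treeT ve; have tt := pt_twinK treeT ve;
  apply/idP/idP => [|zn].
  rewrite inE tt => con; apply/negP => zf.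
  have [a [b [/tree_minusP[f [vf fe ft <- <-]]]]] :=
    @connect_exit _ _ [predC far e] _ _ con (sk_node_notin_far ve) (introT negPn zf).
  by move=> /= fa /negPn/(enters_far ve vf fa) E; rewrite tt E eqxx in ft.
apply: contraT => zt.
have start : sk_node e \in (far e :|: far (twin e))%SET.
  by rewrite finset.in_setU -{3}tt twin_node_in_far orbT.
have zU : z \notin (far e :|: far (twin e))%SET by rewrite finset.in_setU negb_or zn.
have [a [b [/existsP[f /and3P[vf /eqP <- /eqP <-]]]]] :=
  connect_exit (pt_connected treeT _ z) start zU.
rewrite !finset.in_setU negb_or => fa /andP[].
case: (eqVneq f e) => [->|fe]; first by rewrite twin_node_in_far.
case: (eqVneq f (twin e)) => [->|ft]; first by rewrite twin_node_in_far.
rewrite !far_twin_node ?tt //.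
by case/orP: fa => ->.
Qed.

Lemma far_disjoint e f z : virtual e -> virtual f -> sk_node e = sk_node f -> e != f ->
  z \in far e -> z \notin far f.
Proof.
move=> ve vf ef ne zf; apply/negP => zf'.
have start : sk_node (twin e) \in (far e :\: far f)%SET.
  have et : e != twin f by apply: contraNneq (pt_twin_node treeT vf) => <-; rewrite ef.
  by rewrite finset.in_setD twin_node_in_far far_twin_node // ef sk_node_notin_far.
have zD : z \notin (far e :\: far f)%SET by rewrite finset.in_setD zf'.
have con : connect (tree_minus e) (sk_node (twin e)) z by move: zf; rewrite inE.
have [a [b [/tree_minusP[k [vk ke kt <- <-]]]]] := connect_exit con start zD.
rewrite !finset.in_setD => /andP[ka kf]; rewrite (far_twin_node ve vk ke kt) kf andbT negbK.
move=> /(enters_far vf vk ka) kE.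
by have := sk_node_notin_far ve; rewrite ef -kE kf.
Qed.

Lemma far_cover x z : z != x -> exists e, [/\ virtual e, sk_node e = x & z \in far e].
Proof.
pose beyond z' := [exists e, [&& virtual e, sk_node e == x & z' \in far e]].
move=> zx; suff /existsP[e /and3P[ve /eqP ex zf]] : beyond z by exists e.
apply: contraT => zn; have zU : z \notin [predU1 x & beyond] by rewrite !inE negb_or zx.
have [a [b [/existsP[f /and3P[vf /eqP <- /eqP <-]]]]] :=
  connect_exit (pt_connected treeT x z) (predU1l _ erefl : x \in [predU1 x & beyond]) zU.
rewrite !inE negb_or => /orP[/eqP fx|/existsP[e /and3P[ve /eqP ex fe]]] /andP[bx /existsP[]].
  by exists f; rewrite vf fx eqxx twin_node_in_far.
exists e; rewrite ve ex eqxx far_twin_node //.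
  by apply: contraTneq fe => ->; exact: sk_node_notin_far.
by apply: contraNneq bx => ->; rewrite (pt_twinK treeT) // ex.
Qed.

Lemma sk_edge_of_adj x u v : u \in sk_vert x -> v \in sk_vert x -> adj u v ->
  exists2 e, e \in sk_edges x & sk_ends e = edge u v.
Proof.
move=> ux vx uv; have uvE : edge u v \in edges H by rewrite edge_edges.
have [f vf fE] := pt_real_ex treeT uvE.
case: (eqVneq (sk_node f) x) => [fx|fx]; first by exists f => //; rewrite inE fx.
have [e [ve ex zf]] := far_cover fx.
have in_f w : w \in edge u v -> w \in sk_vert (sk_node f).
  by rewrite -fE; exact: (fintype.subsetP (pt_ends_sub treeT f)).
have xn : x \notin far e by rewrite -ex sk_node_notin_far.
exists e; first by rewrite inE ex.
apply/esym/eqP; rewrite eqEcard (pt_ends_card treeT) card_edge ?adj_neq // andbT.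
apply/fintype.subsetP => w wuv; apply: (shared_vertex_in_ends ve xn zf _ (in_f _ wuv)).
by move: wuv; rewrite in_edge => /orP[/eqP ->|/eqP ->].
Qed.

Lemma adj_far e u v : virtual e -> (exists2 z, z \in far e & u \in sk_vert z) ->
  u \notin sk_ends e -> adj u v -> exists2 z, z \in far e & v \in sk_vert z.
Proof.
move=> ve [z zf uz] ue uv; have uvE : edge u v \in edges H by rewrite edge_edges.
have [f vf fE] := pt_real_ex treeT uvE; exists (sk_node f).
  apply: contraNT ue => fn; apply: (shared_vertex_in_ends ve fn zf) => //.
  by apply: (fintype.subsetP (pt_ends_sub treeT f)); rewrite fE edge_l.
by apply: (fintype.subsetP (pt_ends_sub treeT f)); rewrite fE edge_r.
Qed.

End FarSide.

(** * Continuous maps and the plane *)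

Section ContinuityRules.
Variables (R : realType) (T : topologicalType).

Lemma continuous_fun_id : continuous (fun t : T => t).
Proof. by move=> t. Qed.

Lemma continuous_fun_comp (U W : topologicalType) (f : T -> U) (g : U -> W) :
  continuous f -> continuous g -> continuous (fun t => g (f t)).
Proof. by move=> cf cg t; apply: (continuous_comp (cf t)); exact: cg. Qed.

Lemma continuous_fun_pair (U W : topologicalType) (f : T -> U) (g : T -> W) :
  continuous f -> continuous g -> continuous (fun t => (f t, g t)).
Proof. by move=> cf cg t; exact: (cvg_pair (cf t) (cg t)). Qed.

Lemma continuous_fun_fst (U W : topologicalType) (f : T -> U * W) :
  continuous f -> continuous (fun t => (f t).1).
Proof. by move=> cf t; apply: (continuous_comp (cf t)); exact: cvg_fst. Qed.

Lemma continuous_fun_snd (U W : topologicalType) (f : T -> U * W) :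
  continuous f -> continuous (fun t => (f t).2).
Proof. by move=> cf t; apply: (continuous_comp (cf t)); exact: cvg_snd. Qed.

Lemma continuous_funD (V : normedModType R) (f g : T -> V) :
  continuous f -> continuous g -> continuous (fun t => f t + g t).
Proof. by move=> cf cg t; apply: (continuousD (cf t)); exact: cg. Qed.

Lemma continuous_funN (V : normedModType R) (f : T -> V) :
  continuous f -> continuous (fun t => - f t).
Proof. by move=> cf t; exact: (continuousN (cf t)). Qed.

Lemma continuous_funZ (V : normedModType R) (k : T -> R) (f : T -> V) :
  continuous k -> continuous f -> continuous (fun t => k t *: f t).
Proof. by move=> ck cf t; exact: (continuousZ (ck t) (cf t)). Qed.

Lemma continuous_fun_norm (V : normedModType R) (f : T -> V) :
  continuous f -> continuous (fun t => `|f t|).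
Proof. by move=> cf t; apply: (continuous_comp (cf t)); exact: norm_continuous. Qed.

Lemma continuous_funM (f g : T -> R) :
  continuous f -> continuous g -> continuous (fun t => f t * g t).
Proof. by move=> cf cg t; apply: (continuousM (cf t)); exact: cg. Qed.

Lemma continuous_funV (f : T -> R) :
  continuous f -> (forall t, f t != 0) -> continuous (fun t => (f t)^-1).
Proof. by move=> cf f0 t; apply: cvgV => //; exact: cf. Qed.

Lemma continuous_fun_max (f g : T -> R) :
  continuous f -> continuous g -> continuous (fun t => Num.max (f t) (g t)).
Proof. by move=> cf cg t; apply: continuous_max; [exact: cf|exact: cg]. Qed.

Lemma continuous_fun_min (f g : T -> R) :
  continuous f -> continuous g -> continuous (fun t => Num.min (f t) (g t)).
Proof. by move=> cf cg t; apply: continuous_min; [exact: cf|exact: cg]. Qed.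

End ContinuityRules.

Ltac continuity := repeat lazymatch goal with
  | |- continuous (fun t => (@?f t, @?g t)) => apply: (@continuous_fun_pair _ _ _ f g)
  | |- continuous (fun t => (@?f t).1) => apply: (@continuous_fun_fst _ _ _ f)
  | |- continuous (fun t => (@?f t).2) => apply: (@continuous_fun_snd _ _ _ f)
  | |- continuous (fun t => @?f t + @?g t) => apply: (@continuous_funD _ _ _ f g)
  | |- continuous (fun t => - @?f t) => apply: (@continuous_funN _ _ _ f)
  | |- continuous (fun t => @?f t * @?g t) => apply: (@continuous_funM _ _ f g)
  | |- continuous (fun t => @?k t *: @?f t) => apply: (@continuous_funZ _ _ _ k f)
  | |- continuous (fun t => `|@?f t|) => apply: (@continuous_fun_norm _ _ _ f)
  | |- continuous (fun t => Num.max (@?f t) (@?g t)) => apply: (@continuous_fun_max _ _ f g)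
  | |- continuous (fun t => Num.min (@?f t) (@?g t)) => apply: (@continuous_fun_min _ _ f g)
  | _ => first [assumption | exact: cst_continuous | exact: continuous_fun_id]
  end.

Lemma continuous_near_lt (R : realType) (T : topologicalType) (f g : T -> R) (x : T) :
  continuous f -> continuous g -> f x < g x -> \forall y \near x, f y < g y.
Proof.
move=> cf cg fg; have cd : continuous (fun y => g y - f y) by continuity.
have d0 : 0 < g x - f x by rewrite subr_gt0.
by apply: filterS (cvgr_gt _ (cd x) _ d0) => y; rewrite subr_gt0.
Qed.

Section NormedModules.
Variables (R : realType) (V : normedModType R).
Implicit Types (A F K : set V) (x y : V).

Lemma open_normP A :
  open A <-> forall x, A x -> exists2 e : R, 0 < e & forall y, `|x - y| < e -> A y.
Proof.
rewrite openE; split=> oA x Ax; first by have /nbhs_normP[e e0 eA] := oA x Ax; exists e.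
by have [e e0 eA] := oA x Ax; apply/nbhs_normP; exists e.
Qed.

Lemma closed_dist_ge F x : closed F -> ~ F x ->
  exists2 e : R, 0 < e & forall y, F y -> e <= `|x - y|.
Proof.
move=> cF Fx; have [e e0 eF] := (open_normP _).1 (closed_openC cF) x Fx.
by exists e => // y Fy; rewrite leNgt; apply/negP => /eF; apply.
Qed.

Lemma compact_closed_dist_ge K F : compact K -> closed F -> (forall x, K x -> ~ F x) ->
  exists2 e : R, 0 < e & forall x y, K x -> F y -> e <= `|x - y|.
Proof.
move=> /compact_near_coveringP cK cF KF.
have small : \forall e \near 0^'+, K `<=` [set x | forall y, F y -> (e : R) <= `|x - y|].
  apply: (cK _ _ (fun e x => forall y, F y -> e <= `|x - y|)) => x /KF/(closed_dist_ge cF)[d d0 dF].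
  near=> z e => y /dF dy; have zx : `|x - z| < d / 2.
    near: z; apply: (@cvgr_dist_lt _ _ _ _ _ id x) => //; exact: divr_gt0.
  have ed : e <= d / 2 by near: e; apply: nbhs_right_le; exact: divr_gt0.
  by have /= := ler_normD (x - z) (z - y); rewrite addrA subrK; lra.
have [e [e0 eH]] := filter_ex (filterI (nbhs_right_gt (0 : R)) small).
by exists e => // x y Kx; exact: eH.
Unshelve. all: by end_near. Qed.

Lemma open_dist_gt x (r : R) : open [set y | r < `|x - y|].
Proof.
apply: (@open_comp _ _ (fun y => `|x - y|) [set s | r < s]); last exact: open_gt.
by have dist_continuous : continuous (fun y => `|x - y|) by [continuity]; move=> y _;
  exact: dist_continuous.
Qed.

End NormedModules.

Section Plane.
Variable R : realType.
Local Notation P := (R * R)%type.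
Implicit Types x y : P.

Lemma plane_ext x y : x.1 = y.1 -> x.2 = y.2 -> x = y.
Proof. by case: x y => [? ?] [? ?] /= -> ->. Qed.

Lemma plane_addE1 x y : (x + y).1 = x.1 + y.1. Proof. by []. Qed.
Lemma plane_addE2 x y : (x + y).2 = x.2 + y.2. Proof. by []. Qed.
Lemma plane_oppE1 x : (- x).1 = - x.1. Proof. by []. Qed.
Lemma plane_oppE2 x : (- x).2 = - x.2. Proof. by []. Qed.
Lemma plane_scaleE1 k x : (k *: x).1 = k * x.1. Proof. by []. Qed.
Lemma plane_scaleE2 k x : (k *: x).2 = k * x.2. Proof. by []. Qed.
Definition planeE :=
  (plane_addE1, plane_addE2, plane_oppE1, plane_oppE2, plane_scaleE1, plane_scaleE2).

Lemma plane_norm x : `|x| = Num.max `|x.1| `|x.2|.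
Proof. by []. Qed.

Lemma plane_norm_lt x e : (`|x| < e) = (`|x.1| < e) && (`|x.2| < e).
Proof. by rewrite plane_norm gt_max. Qed.

Lemma plane_norm_le x e : (`|x| <= e) = (`|x.1| <= e) && (`|x.2| <= e).
Proof. by rewrite plane_norm ge_max. Qed.

Lemma plane_hausdorff : hausdorff_space (P : topologicalType).
Proof. exact: norm_hausdorff. Qed.

(* Openness needs no explicit inverse: the intermediate value theorem is applied
   on each horizontal line. *)
Lemma horizontal_increasing_open (g : P -> R) (O : set P) : continuous g ->
  (forall x x' y : R, O (x, y) -> O (x', y) -> x < x' -> g (x, y) < g (x', y)) ->
  forall U, open U -> U `<=` O -> open ((fun q => (g q, q.2)) @` U).
Proof.
move=> cg gm U oU UO; rewrite openE => _ [[x y] Uxy <-] /=.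
have [d d0 dU] := (open_normP _).1 oU _ Uxy.
pose h := d / 2; have h0 : 0 < h by rewrite /h; lra.
have Uin (x' y' : R) : `|x - x'| <= h -> `|y - y'| < d -> U (x', y').
  by move=> xx yy; apply: dU; rewrite plane_norm_lt /= yy andbT (le_lt_trans xx) // /h; lra.
have yy : `|y - y| < d by rewrite subrr normr0.
have lo : g (x - h, y) < g (x, y).
  by apply: gm; [apply/UO/Uin => //; rewrite ler_norml; lra|exact: UO|lra].
have hi : g (x, y) < g (x + h, y).
  by apply: gm; [exact: UO|apply/UO/Uin => //; rewrite ler_norml; lra|lra].
have slice z : continuous (fun q : P => g (z, q.2)).
  by apply: (@continuous_fun_comp _ _ _ (fun q : P => (z, q.2)) g) => //; continuity.
rewrite /interior; near=> q.
have [c] : exists2 c, c \in `[x - h, x + h]%R & g (c, q.2) = q.1.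
  apply: (@IVT _ (fun c => g (c, q.2))); first by lra.
    apply: continuous_subspaceT.
    by apply: (@continuous_fun_comp _ _ _ (fun c : R => (c, q.2)) g) => //; continuity.
  rewrite ge_min le_max; apply/andP; split; apply/orP; [left|right]; apply: ltW.
    near: q; apply: (@continuous_near_lt _ _ (fun q : P => g (x - h, q.2)) fst) => //.
    by move=> q; exact: cvg_fst.
  near: q; apply: (@continuous_near_lt _ _ fst (fun q : P => g (x + h, q.2))) => //.
  by move=> q; exact: cvg_fst.
rewrite in_itv /= => /andP[c1 c2] cq; exists (c, q.2); last by rewrite cq -surjective_pairing.
apply: Uin; first by rewrite ler_norml; lra.
by near: q; apply: (@cvgr_dist_lt _ _ _ _ _ (snd : P -> R)) => //; exact: cvg_snd.
Unshelve. all: by end_near. Qed.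

End Plane.

(** * Arcs in the plane *)

Section Arcs.
Variable R : realType.
Local Notation P := (R * R)%type.
Implicit Types (s t : R) (g h : R -> P).

Definition in01 t := (0 <= t) && (t <= 1).

Definition clamp t : R := Num.max 0 (Num.min 1 t).

Lemma clamp_in01 t : in01 (clamp t).
Proof. by rewrite /in01 /clamp le_max lexx /= ge_max ler01 ge_min lexx. Qed.

Lemma clamp_id t : in01 t -> clamp t = t.
Proof. by rewrite /clamp => /andP[t0 t1]; rewrite (min_idPr t1) (max_idPr t0). Qed.

Lemma clamp_continuous : continuous clamp.
Proof. by rewrite /clamp; continuity. Qed.

Definition arc (a b : P) (A : set P) := exists g : R -> P,
  [/\ continuous g, (forall s t, in01 s -> in01 t -> g s = g t -> s = t),
      g 0 = a /\ g 1 = b, (forall t, A (g t)) &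
      forall x, A x -> exists2 t, in01 t & g t = x].

Lemma in01_itv t : in01 t = (t \in `[0, 1]%R).
Proof. by rewrite in_itv. Qed.

Lemma in01_set t : (t \in (`[0, 1]%classic : set R)) = in01 t.
Proof. by apply/idP/idP; rewrite inE /= in_itv. Qed.

Lemma in01_0 : in01 0. Proof. by rewrite /in01 lexx ler01. Qed.
Lemma in01_1 : in01 1. Proof. by rewrite /in01 lexx ler01. Qed.

Lemma simple_curveP a b A : simple_curve (R := R) a b A <-> arc a b A.
Proof.
split=> [[g [cg gi g0 g1 gA]]|[g [cg gi [g0 g1] gA Ag]]]; last first.
  exists g; split => //; first exact: continuous_subspaceT.
    by move=> s t; rewrite !in01_set; exact: gi.
  apply/seteqP; split=> [x [t _ <-]|x /Ag[t tI <-]]; first exact: gA.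
  by exists t => //=; rewrite -in01_itv.
exists (g \o clamp); split => /=.
- move=> t; have /subspace_continuousP/(_ (clamp t)) := cg.
  rewrite /= -in01_itv => /(_ (clamp_in01 t)) cgt N /cgt; rewrite /nbhs /= => gN.
  have := clamp_continuous gN; rewrite nbhs_simpl /=.
  by apply: filterS => s /=; apply; rewrite /= -in01_itv; exact: clamp_in01.
- by move=> s t sI tI; rewrite !clamp_id // => /gi; apply; rewrite in01_set.
- by rewrite !clamp_id ?in01_0 ?in01_1.
- by move=> t; rewrite -gA; exists (clamp t) => //=; rewrite -in01_itv; exact: clamp_in01.
- move=> x; rewrite -gA => -[t /=]; rewrite -in01_itv => tI <-; exists t => //.
  by rewrite clamp_id.
Qed.

Lemma arc_compact a b A : arc a b A -> compact A.
Proof.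
case=> g [cg _ _ gA Ag].
have -> : A = g @` `[0, 1].
  apply/seteqP; split=> [x /Ag[t tI <-]|x [t _ <-]]; last exact: gA.
  by exists t => //=; rewrite -in01_itv.
apply: continuous_compact; first exact: continuous_subspaceT.
exact: segment_compact.
Qed.

Lemma arc_closed a b A : arc a b A -> closed A.
Proof. by move/arc_compact; apply: compact_closed; exact: plane_hausdorff. Qed.

Lemma arc_ends a b A : arc a b A -> [/\ A a, A b & a != b].
Proof.
case=> g [cg gi [<- <-] gA _]; split => //; apply/eqP.
by move/(gi _ _ in01_0 in01_1)/eqP; rewrite eq_sym oner_eq0.
Qed.

Lemma arc_rev a b A : arc a b A -> arc b a A.
Proof.
case=> g [cg gi [g0 g1] gA Ag]; exists (fun t => g (1 - t)); split => //.
- by apply: (@continuous_fun_comp _ _ _ (fun t : R => 1 - t) g) => //; continuity.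
- move=> s t sI tI E; have sI' : in01 (1 - s) by move: sI; rewrite /in01; lra.
  have tI' : in01 (1 - t) by move: tI; rewrite /in01; lra.
  by have := gi _ _ sI' tI' E; lra.
- by rewrite subr0 subrr.
- move=> x /Ag[t tI <-]; exists (1 - t); first by move: tI; rewrite /in01; lra.
  by congr g; lra.
Qed.

Lemma arc_image (psi : P -> P) a b A : (forall x, A x -> {for x, continuous psi}) ->
  (forall x y, A x -> A y -> psi x = psi y -> x = y) ->
  arc a b A -> arc (psi a) (psi b) (psi @` A).
Proof.
move=> cpsi ipsi [g [cg gi [g0 g1] gA Ag]]; exists (psi \o g); split => /=.
- by move=> t; apply: (continuous_comp (cg t)); exact: cpsi.
- by move=> s t sI tI E; apply: gi => //; exact: ipsi.
- by rewrite g0 g1.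
- by move=> t; exists (g t).
- by move=> _ [x /Ag[t tI <-] <-]; exists t.
Qed.

Definition subcurve (g : R -> P) (s t : R) : set P := [set x | exists2 r, s <= r <= t & g r = x].

Lemma subcurve_arc g s t : continuous g ->
  (forall s t, in01 s -> in01 t -> g s = g t -> s = t) ->
  0 <= s -> s < t -> t <= 1 -> arc (g s) (g t) (subcurve g s t).
Proof.
move=> cg gi s0 st t1; have ts : t - s != 0 by lra.
exists (fun r => g (s + clamp r * (t - s))); split => /=.
- apply: (@continuous_fun_comp _ _ _ (fun r : R => s + clamp r * (t - s)) g) => //.
  by have cc := clamp_continuous; continuity.
- have affine_in01 r : in01 r -> in01 (s + r * (t - s)).
    rewrite /in01 => /andP[r0 r1]; apply/andP; split; nra.
  move=> x y xI yI; rewrite !clamp_id // => E.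
  have /addrI := gi _ _ (affine_in01 _ xI) (affine_in01 _ yI) E.
  by move/(mulIf ts).
- by rewrite !clamp_id ?in01_0 ?in01_1 // mul0r addr0 mul1r addrC subrK.
- move=> r; exists (s + clamp r * (t - s)) => //.
  by have /andP[] := clamp_in01 r; move: (clamp r) => c c0 c1; apply/andP; split; nra.
- move=> x [r /andP[sr rt] <-]; exists ((r - s) / (t - s)).
    by rewrite /in01 divr_ge0 ?ler_pdivrMr ?mul1r; lra.
  rewrite clamp_id; last by rewrite /in01 divr_ge0 ?ler_pdivrMr ?mul1r; lra.
  by congr g; rewrite divfK //; lra.
Qed.

Definition arc_inner (a b : P) (A : set P) : set P := [set x | [/\ A x, x <> a & x <> b]].

Lemma arc_split a b A p : arc a b A -> arc_inner a b A p ->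
  exists A1 A2, [/\ arc a p A1, arc p b A2, A = A1 `|` A2 & A1 `&` A2 = [set p]].
Proof.
case=> g [cg gi [g0 g1] gA Ag] [/Ag[t tI gt] pa pb].
have [t0 t1] : 0 < t /\ t < 1.
  by move: tI => /andP[]; rewrite !le_eqVlt => /predU1P[t0|->] /predU1P[t1|->] //;
    [case: pa|case: pa|case: pb]; rewrite -gt -?g0 -?g1 ?t0 ?t1.
exists (subcurve g 0 t), (subcurve g t 1); split.
- by rewrite -g0 -gt; apply: subcurve_arc => //; exact: ltW.
- by rewrite -g1 -gt; apply: subcurve_arc => //; exact: ltW.
- apply/seteqP; split=> [x /Ag[r /andP[r0 r1] <-]|x [[r _ <-]|[r _ <-]]] //.
  by case: (lerP r t) => rt; [left|right]; exists r => //; apply/andP; split => //; exact: ltW.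
- apply/seteqP; split=> [x [[r /andP[r0 rt] <-] [s /andP[ts s1]]]|x ->].
    move=> E; have rs : s = r by apply: gi => //; rewrite /in01; lra.
    by rewrite -gt; congr g; lra.
  by split; exists t => //; rewrite ?lexx ?ltW.
Qed.

Lemma arc_inner_connected a b A : arc a b A -> connected (arc_inner a b A).
Proof.
case=> g [cg gi [g0 g1] gA Ag].
have -> : arc_inner a b A = g @` [set t | 0 < t /\ t < 1].
  apply/seteqP; split=> [x [/Ag[t /andP[t0 t1] <-] xa xb]|_ [t [t0 t1] <-]].
    exists t => //=; split; rewrite lt_neqAle ?t0 ?t1 andbT.
      by apply/eqP => E; apply: xa; rewrite -E.
    by apply/eqP => E; apply: xb; rewrite E.
  have tI : in01 t by rewrite /in01 !ltW.
  split => //; [rewrite -g0 => /(gi _ _ tI in01_0)|rewrite -g1 => /(gi _ _ tI in01_1)]; lra.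
apply: connected_continuous_connected; last exact: continuous_subspaceT.
by apply/connected_intervalP => x y /= [x0 x1] [y0 y1] z /andP[xz zy]; split; lra.
Qed.

Lemma arc_inner_near a b A (r : R) : 0 < r -> arc a b A ->
  exists2 x, arc_inner a b A x & `|a - x| <= r.
Proof.
move=> r0 [g [cg gi [g0 g1] gA Ag]].
have near0 : \forall t \near (0 : R), `|a - g t| < r.
  have dist_continuous : continuous (fun t => `|a - g t|) by continuity.
  apply: (continuous_near_lt dist_continuous); first exact: cst_continuous.
  by rewrite g0 subrr normr0.
have near_a : \forall t \near 0^'+, `|a - g t| < r by exact: cvg_within near0.
have near_inner : \forall t \near (0 : R)^'+, 0 < t < 1.
  by apply: filterS (filterI (nbhs_right_gt (0 : R)) (nbhs_right_lt ltr01)) => t [-> ->].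
have [t [/= at_r /andP[t0 t1]]] : exists t, `|a - g t| < r /\ 0 < t < 1.
  by apply: (@filter_ex _ 0^'+); exact: filterI.
have tI : in01 t by rewrite /in01 !ltW.
exists (g t); last exact: ltW.
split => //; [rewrite -g0 => /(gi _ _ tI in01_0)|rewrite -g1 => /(gi _ _ tI in01_1)]; lra.
Qed.

Section Concatenation.
Variables g h : R -> P.
Hypotheses (cg : continuous g) (ch : continuous h) (gh : g 1 = h 0).

Definition concat t := g (clamp (2 * t)) + h (clamp (2 * t - 1)) - h 0.

Lemma concat_left t : t <= 1 / 2 -> concat t = g (clamp (2 * t)).
Proof.
move=> t2; rewrite /concat [clamp (_ - 1)](_ : _ = 0) ?addrK //.
by rewrite /clamp; apply/max_idPl; rewrite ge_min; apply/orP; right; lra.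
Qed.

Lemma concat_right t : 1 / 2 <= t -> concat t = h (clamp (2 * t - 1)).
Proof.
move=> t2; rewrite /concat [clamp (2 * t)](_ : _ = 1) ?gh ?[h 0 + _]addrC ?addrK //.
by rewrite /clamp (@min_idPl _ _ 1 (2 * t) _) ?(@max_idPr _ _ 0 1 _) //; lra.
Qed.

Lemma concat_continuous : continuous concat.
Proof.
have reparam (k : R -> P) (f : R -> R) : continuous k -> continuous f ->
    continuous (fun t => k (clamp (f t))).
  move=> ck cf; apply: (@continuous_fun_comp _ _ _ (fun t => clamp (f t)) k) => //.
  by apply: continuous_fun_comp => //; exact: clamp_continuous.
rewrite /concat; apply: continuous_funD; last by continuity.
apply: continuous_funD; first by apply: (reparam g (fun t => 2 * t)) => //; continuity.
by apply: (reparam h (fun t => 2 * t - 1)) => //; continuity.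
Qed.

Lemma concat_inj : (forall s t, in01 s -> in01 t -> g s = g t -> s = t) ->
  (forall s t, in01 s -> in01 t -> h s = h t -> s = t) ->
  (forall s t, in01 s -> in01 t -> g s = h t -> g s = h 0) ->
  forall s t, in01 s -> in01 t -> concat s = concat t -> s = t.
Proof.
move=> gi hi meet; have left01 t : in01 t -> t <= 1 / 2 -> in01 (2 * t) by rewrite /in01; lra.
have right01 t : in01 t -> 1 / 2 <= t -> in01 (2 * t - 1) by rewrite /in01; lra.
have mixed s t : in01 s -> in01 t -> s <= 1 / 2 -> 1 / 2 <= t -> concat s = concat t -> s = t.
  move=> sI tI s2 t2; rewrite concat_left // concat_right // !clamp_id ?left01 ?right01 // => E.
  have Eb := meet _ _ (left01 _ sI s2) (right01 _ tI t2) E.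
  have := gi _ _ (left01 _ sI s2) in01_1 (etrans Eb (esym gh)).
  by have := hi _ _ (right01 _ tI t2) in01_0 (etrans (esym E) Eb); lra.
move=> s t sI tI; case: (lerP s (1 / 2)) => s2; case: (lerP t (1 / 2)) => t2.
- by rewrite !concat_left // !clamp_id ?left01 // => /(gi _ _ (left01 _ sI s2) (left01 _ tI t2));
    lra.
- by apply: mixed => //; exact: ltW.
- by move=> E; apply/esym; apply: mixed => //; exact: ltW.
- rewrite !concat_right ?ltW // !clamp_id ?right01 ?ltW //.
  by move/(hi _ _ (right01 _ sI (ltW s2)) (right01 _ tI (ltW t2))); lra.
Qed.

End Concatenation.

Lemma arc_cat a b c A B : arc a b A -> arc b c B -> A `&` B `<=` [set b] ->
  arc a c (A `|` B).
Proof.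
case=> g [cg gi [g0 g1] gA Ag] [h [ch hi [h0 h1] hB Bh]] AB.
have gh : g 1 = h 0 by rewrite g1 h0.
exists (concat g h); split.
- exact: concat_continuous.
- apply: concat_inj => // s t sI tI E; rewrite h0; apply: (AB (g s)).
  by split; rewrite // E.
- rewrite concat_left; last by lra.
  rewrite concat_right //; last by lra.
  by rewrite (_ : 2 * 1 - 1 = 1) ?mulr0 ?clamp_id ?in01_0 ?in01_1 //; lra.
- by move=> t; case: (lerP t (1 / 2)) => t2;
    [left; rewrite concat_left|right; rewrite concat_right // ltW].
- move=> x [/Ag|/Bh] [t tI <-].
    exists (t / 2); first by move: tI; rewrite /in01; lra.
    rewrite concat_left; last by move: tI; rewrite /in01; lra.
    by rewrite (_ : 2 * _ = t) ?clamp_id //; lra.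
  exists ((t + 1) / 2); first by move: tI; rewrite /in01; lra.
  rewrite concat_right //; last by move: tI; rewrite /in01; lra.
  by rewrite (_ : 2 * _ - 1 = t) ?clamp_id //; lra.
Qed.

Lemma last_hit g (F : set P) : continuous g -> closed F -> F (g 0) ->
  exists t, [/\ in01 t, F (g t) & forall s, t < s -> s <= 1 -> ~ F (g s)].
Proof.
move=> cg cF F0; pose K := `[0, 1]%classic `&` (g @^-1` F).
have K0 : K !=set0 by exists 0; split => //=; rewrite -in01_itv in01_0.
have cK : compact K.
  by apply: compact_closedI; [exact: segment_compact|apply: preimage_closed => // x _; exact: cg].
have [t] := compact_EVT_max K0 cK (continuous_subspaceT (@continuous_fun_id R)).
rewrite inE => -[/=]; rewrite -in01_itv => tI Ft tmax; exists t; split => // s ts s1 Fs.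
have /tmax : s \in K.
  by rewrite inE; split => //=; rewrite -in01_itv /in01; move: tI; rewrite /in01; lra.
by lra.
Qed.

(* Follow the first arc from a only up to its last meeting point with the second. *)
Lemma arc_join a b c A B : arc a b A -> arc b c B -> a <> c ->
  exists2 C, arc a c C & C `<=` A `|` B.
Proof.
move=> aA aB ac; have [g [cg gi [g0 g1] gA Ag]] := arc_rev aA.
have [Bb Bc bc] := arc_ends aB.
have Bg0 : B (g 0) by rewrite g0.
have [t [tI Bt lastB]] := last_hit cg (arc_closed aB) Bg0.
have rest x : B x -> x <> c -> exists2 B', arc x c B' & B' `<=` B.
  move=> Bx xc; case: (pselect (x = b)) => [->|xb]; first by exists B.
  have [B1 [B2 [_ b2 BE _]]] := arc_split aB (And3 Bx xb xc).
  by exists B2 => // y; rewrite BE; right.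
case: (eqVneq t 1) => [t1|t1].
  have [B' b' B'B] : exists2 B', arc a c B' & B' `<=` B by apply: rest => //; rewrite -g1 -t1.
  by exists B' => // y /B'B; right.
move: (tI) => /andP[t0 t1'].
have t_lt1 : t < 1 by rewrite lt_neqAle t1.
have a_gt := arc_rev (subcurve_arc cg gi t0 t_lt1 (lexx 1)); rewrite g1 in a_gt.
have sub : subcurve g t 1 `<=` A by move=> _ [r _ <-].
case: (pselect (g t = c)) => [gc|gc].
  by exists (subcurve g t 1); [rewrite -gc|move=> x /sub; left].
have [B' b' B'B] := rest _ Bt gc.
exists (subcurve g t 1 `|` B'); last by move=> x [/sub|/B'B]; [left|right].
apply: (arc_cat a_gt b') => _ [[r /andP[tr r1] <-] /B'B Br] /=.
congr g; apply/eqP; rewrite eq_le tr andbT leNgt; apply/negP => {}tr.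
exact: (lastB r).
Qed.

End Arcs.

(** * Segments *)

Section Segments.
Variable R : realType.
Local Notation P := (R * R)%type.
Implicit Types a b x : P.

Definition seg a b : set P := [set x | exists2 t, in01 t & x = a + t *: (b - a)].

Lemma seg_arc a b : a != b -> arc a b (seg a b).
Proof.
move=> ab; exists (fun t => a + clamp t *: (b - a)); split.
- by have cc := @clamp_continuous R; continuity.
- move=> s t sI tI; rewrite !clamp_id // => /addrI /eqP.
  rewrite -subr_eq0 -scalerBl scaler_eq0 !subr_eq0 => /orP[/eqP //|/eqP E].
  by rewrite E eqxx in ab.
- by rewrite !clamp_id ?in01_0 ?in01_1 // scale0r addr0 scale1r addrC subrK.
- by move=> t; exists (clamp t) => //; exact: clamp_in01.
- by move=> x [t tI ->]; exists t => //; rewrite clamp_id.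
Qed.

Lemma seg_l a b : seg a b a.
Proof. by exists 0; [exact: in01_0|rewrite scale0r addr0]. Qed.

Lemma seg_r a b : seg a b b.
Proof. by exists 1; [exact: in01_1|rewrite scale1r addrC subrK]. Qed.

Lemma seg_sym a b : seg a b = seg b a.
Proof.
suff sub c d : seg c d `<=` seg d c by apply/seteqP; split; exact: sub.
move=> x [t tI ->]; exists (1 - t); first by move: tI; rewrite /in01; lra.
by apply: plane_ext; rewrite !planeE; ring.
Qed.

Lemma seg_refl a : seg a a = [set a].
Proof.
apply/seteqP; split=> [x [t _ ->]|x ->] /=; last exact: seg_l.
by rewrite subrr scaler0 addr0.
Qed.

Lemma seg_norm a b x : seg a b x ->
  exists2 t, in01 t & x = a + t *: (b - a) /\ `|a - x| = t * `|a - b|.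
Proof.
move=> [t tI ->]; exists t => //; split => //.
rewrite opprD addrA subrr sub0r normrN normrZ distrC.
by move: tI => /andP[t0 _]; rewrite (ger0_norm t0).
Qed.

Lemma seg_dist_le a b x : seg a b x -> `|a - x| <= `|a - b|.
Proof. by move=> /seg_norm[t /andP[t0 t1] [_ ->]]; have := normr_ge0 (a - b); nra. Qed.

Lemma seg_suffix a b t y : in01 t -> seg (a + t *: (b - a)) b y ->
  exists2 s, t <= s <= 1 & y = a + s *: (b - a).
Proof.
move=> /andP[t0 t1] [s /andP[s0 s1] ->]; exists (t + s * (1 - t)).
  by apply/andP; split; nra.
by apply: plane_ext; rewrite !planeE; ring.
Qed.

Lemma seg_subr a b x : seg a b x -> seg x b `<=` seg a b.
Proof.
move=> [t tI ->] _ /(seg_suffix tI)[s /andP[ts s1] ->]; exists s => //.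
by move: tI; rewrite /in01; lra.
Qed.

Lemma seg_subl a b x : seg a b x -> seg a x `<=` seg a b.
Proof. by rewrite (seg_sym a b) (seg_sym a x); exact: seg_subr. Qed.

Lemma seg_anti a b x : a != b -> seg a b x -> seg x b a -> x = a.
Proof.
move=> ab [t /andP[t0 t1] xE] [s /andP[s0 s1] aE].
have : (t + s * (1 - t)) *: (b - a) = 0.
  have : (x + s *: (b - x)) - a = 0 by rewrite -aE subrr.
  by move=> <-; rewrite xE; apply: plane_ext; rewrite !planeE; ring.
move/eqP; rewrite scaler_eq0 subr_eq0 (eq_sym b) (negbTE ab) orbF => /eqP ts.
have -> : x = a + t *: (b - a) by [].
have -> : t = 0 by nra.
by rewrite scale0r addr0.
Qed.

Lemma seg_closed a b : closed (seg a b).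
Proof.
case: (eqVneq a b) => [->|ab]; last exact: (arc_closed (seg_arc ab)).
by rewrite seg_refl; apply: compact_closed; [exact: plane_hausdorff|exact: compact_set1].
Qed.

Lemma seg_compact a b : compact (seg a b).
Proof.
case: (eqVneq a b) => [->|ab]; last exact: (arc_compact (seg_arc ab)).
by rewrite seg_refl; exact: compact_set1.
Qed.

Lemma seg_meet c a b x (r : R) : 0 < r -> `|c - a| = r -> `|c - b| = r ->
  seg c a x -> seg c b x -> x <> c -> a = b.
Proof.
move=> r0 ca cb /seg_norm[t tI [xt dt]] /seg_norm[s sI [xs ds]] xc.
have ts : t = s by apply: (@mulIf _ r); [lra|rewrite -{1}ca -cb -dt -ds].
have t0 : t != 0 by apply/eqP => t0; apply: xc; rewrite xt t0 scale0r addr0.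
have : t *: (a - c) = t *: (b - c) by apply: (@addrI _ c); rewrite -xt ts -xs.
by move/(scalerI t0)/addIr.
Qed.

End Segments.

(** * Drawings *)

Section Transversality.
Variable R : realType.
Local Notation P := (R * R)%type.

Record open_embedding (psi : P -> P) (O : set P) : Prop := OpenEmbedding {
  oe_open : open O;
  oe_continuous : forall x, O x -> {for x, continuous psi};
  oe_inj : forall x y, O x -> O y -> psi x = psi y -> x = y;
  oe_image : forall U, open U -> U `<=` O -> open (psi @` U) }.

Record collapse_map (psi : P -> P) (K : set P) (c : P) : Prop := CollapseMap {
  collapse_continuous : continuous psi;
  collapse_point : forall x, psi x = c <-> K x;
  collapse_embedding : open_embedding psi (~` K) }.

Definition squeeze (e r : R) : R := e * (r / (1 + `|r|)).

Lemma squeeze_continuous e : continuous (squeeze e).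
Proof.
have cV : continuous (fun r : R => (1 + `|r|)^-1).
  by apply: continuous_funV => [|r]; [continuity|have := normr_ge0 r; lra].
by rewrite /squeeze; continuity.
Qed.

Lemma squeeze_increasing e x y : 0 < e -> x < y -> squeeze e x < squeeze e y.
Proof.
move=> e0 xy; rewrite /squeeze ltr_pM2l //.
have px : 0 < 1 + `|x| by have := normr_ge0 x; lra.
have py : 0 < 1 + `|y| by have := normr_ge0 y; lra.
rewrite ltr_pdivrMr // mulrAC ltr_pdivlMr //.
case: (lerP 0 x) => x0; first by rewrite !ger0_norm; nra.
case: (lerP 0 y) => y0; first by rewrite (ger0_norm y0) (ltr0_norm x0); nra.
by rewrite (ltr0_norm y0) (ltr0_norm x0); nra.
Qed.

Lemma squeeze_inj e : 0 < e -> injective (squeeze e).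
Proof. by move=> e0 x y; case: (ltgtP x y) => // /(squeeze_increasing e0) + E; rewrite E ltxx. Qed.

Lemma squeeze0 e : squeeze e 0 = 0.
Proof. by rewrite /squeeze mul0r mulr0. Qed.

Lemma squeeze_eq0 e r : 0 < e -> squeeze e r = 0 <-> r = 0.
Proof.
by move=> e0; split=> [E|->]; [apply: (squeeze_inj e0); rewrite squeeze0|exact: squeeze0].
Qed.

Lemma squeeze_lt e r : 0 < e -> `|squeeze e r| < e.
Proof.
move=> e0; rewrite /squeeze normrM normrM normfV (gtr0_norm e0).
have p : 0 < 1 + `|r| by have := normr_ge0 r; lra.
rewrite (gtr0_norm p) gtr_pMr // ltr_pdivrMr // mul1r; lra.
Qed.

Lemma swap_open (U : set P) : open U -> open ((fun q : P => (q.2, q.1)) @` U).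
Proof.
move=> oU; have -> : (fun q : P => (q.2, q.1)) @` U = (fun q : P => (q.2, q.1)) @^-1` U.
  apply/seteqP; split=> [_ [[x y] Uxy <-] //|[x y] /= Uyx].
  by exists (y, x).
have swap_continuous : continuous (fun q : P => (q.2, q.1)) by continuity.
by apply: open_comp => // q _; exact: swap_continuous.
Qed.

Definition squeeze_plane (e : R) (q : P) : P := (squeeze e q.1, squeeze e q.2).

Lemma squeeze_plane_continuous e : continuous (squeeze_plane e).
Proof.
have squeeze_coord (f : P -> R) : continuous f -> continuous (fun q => squeeze e (f q)).
  by move=> cf; apply: continuous_fun_comp => //; exact: squeeze_continuous.
apply: continuous_fun_pair; first by apply: (squeeze_coord fst) => q; exact: cvg_fst.
by apply: (squeeze_coord snd) => q; exact: cvg_snd.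
Qed.

Lemma squeeze_plane_open e (U : set P) : 0 < e -> open U -> open (squeeze_plane e @` U).
Proof.
move=> e0 oU.
have squeeze1_open (W : set P) : open W -> open ((fun q : P => (squeeze e q.1, q.2)) @` W).
  move=> oW; apply: (@horizontal_increasing_open R (fun q => squeeze e q.1) setT) => //.
    apply: (@continuous_fun_comp _ _ _ fst (squeeze e)); last exact: squeeze_continuous.
    by move=> q; exact: cvg_fst.
  by move=> x x' y _ _ /= xx; exact: squeeze_increasing.
have := swap_open (squeeze1_open _ (swap_open (squeeze1_open _ oU))).
congr open; apply/seteqP; split.
  by move=> _ [_ [_ [_ [q Uq <-] <-] <-] <-] /=; exists q.
move=> _ [q Uq <-]; exists (squeeze e q.2, squeeze e q.1) => //.
exists (q.2, squeeze e q.1) => //; exists (squeeze e q.1, q.2) => //.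
by exists q.
Qed.

Lemma transversal_shrink (p : P) (A B W : set P) : open W -> W p ->
  transversal_at (R := R) p A B ->
  exists phi : P -> P,
    [/\ continuous phi, injective phi, (forall U : set P, open U -> open (phi @` U)),
        phi (0, 0) = p & [/\ forall q, W (phi q),
          forall q, A (phi q) <-> q.2 = 0 & forall q, B (phi q) <-> q.1 = 0]].
Proof.
move=> oW Wp [phi [cphi iphi ophi phi0 [phA phB]]].
have oV : open (phi @^-1` W) by apply: open_comp => // q _; exact: cphi.
have V0 : (phi @^-1` W) (0, 0) by rewrite /preimage /= phi0.
have [e e0 eV] := (open_normP _).1 oV _ V0.
exists (phi \o squeeze_plane e); split.
- by move=> q; apply: (continuous_comp (@squeeze_plane_continuous e q)); exact: cphi.
- by move=> [x y] [x' y'] /iphi [] /(squeeze_inj e0) -> /(squeeze_inj e0) ->.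
- by move=> U oU; rewrite -image_comp; apply: ophi; exact: squeeze_plane_open.
- by rewrite /= /squeeze_plane /= squeeze0.
- split=> q.
  + by apply: eV; rewrite plane_norm_lt /= !sub0r !normrN !squeeze_lt.
  + rewrite -[A _]/((phi @^-1` A) (squeeze_plane e q)) phA /=; exact: squeeze_eq0.
  + rewrite -[B _]/((phi @^-1` B) (squeeze_plane e q)) phB /=; exact: squeeze_eq0.
Qed.

Lemma transversal_transport (psi : P -> P) (O : set P) (p : P) (A B A' B' : set P) :
  open_embedding psi O -> O p ->
  (forall x, O x -> A' (psi x) <-> A x) -> (forall x, O x -> B' (psi x) <-> B x) ->
  transversal_at (R := R) p A B -> transversal_at (R := R) (psi p) A' B'.
Proof.
move=> emb Op AA BB /(transversal_shrink (oe_open emb) Op).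
move=> [phi [cphi iphi ophi phi0 [phO phA phB]]].
exists (psi \o phi); split.
- by move=> q; apply: (continuous_comp (cphi q)); exact: (oe_continuous emb).
- by move=> x y /= E; apply: iphi; exact: (oe_inj emb).
- move=> U oU; rewrite -image_comp; apply: (oe_image emb); first exact: ophi.
  by move=> _ [q _ <-].
- by rewrite /= phi0.
- by split; apply/seteqP; split=> q /=; rewrite ?AA ?BB ?phA ?phB.
Qed.

Lemma transversal_near (p : P) (A B A' B' : set P) :
  (\forall x \near p, A' x <-> A x) -> (\forall x \near p, B' x <-> B x) ->
  transversal_at (R := R) p A B -> transversal_at (R := R) p A' B'.
Proof.
move=> nearA nearB.
have [W [oW Wp] WAB] : exists2 W, open_nbhs p W &
    W `<=` [set x | (A' x <-> A x) /\ (B' x <-> B x)].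
  have : nbhs p [set x | (A' x <-> A x) /\ (B' x <-> B x)] by exact: filterI.
  by rewrite nbhsE.
apply: (@transversal_transport id W) => //; first last.
- by move=> x /WAB[].
- by move=> x /WAB[].
- by split => // [x _|U oU _]; [exact: cvg_id|rewrite image_id].
Qed.

End Transversality.

Section PlaneDrawings.
Variable R : realType.
Local Notation P := (R * R)%type.

Definition crossing (V E : finType) (Va : {set V}) (Ea : {set E}) (pos : V -> P)
    (cv : E -> set P) (e f : E) (p : P) : Prop :=
  [/\ e \in Ea, f \in Ea, e != f, cv e p /\ cv f p & forall w, w \in Va -> pos w <> p].

(* Only the vertices in Va and the edges in Ea are drawn, and only pairs of edges
   related by X may cross. *)
Record plane_drawing (V E : finType) (Va : {set V}) (Ea : {set E}) (src dst : E -> V)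
    (X : E -> E -> Prop) (pos : V -> P) (cv : E -> set P) : Prop := PlaneDrawing {
  pd_inj : {in Va &, injective pos};
  pd_ends : forall e, e \in Ea -> src e \in Va /\ dst e \in Va;
  pd_arc : forall e, e \in Ea -> arc (pos (src e)) (pos (dst e)) (cv e);
  pd_avoid : forall e w, e \in Ea -> w \in Va -> cv e (pos w) -> w = src e \/ w = dst e;
  pd_crossing : forall e f p, crossing Va Ea pos cv e f p ->
    X e f /\ transversal_at (R := R) p (cv e) (cv f);
  pd_one_crossing : forall e f g p q, crossing Va Ea pos cv e f p ->
    crossing Va Ea pos cv e g q -> f = g /\ p = q }.

Definition drawable (V E : finType) (Va : {set V}) (Ea : {set E}) (src dst : E -> V)
    (X : E -> E -> Prop) := exists pos cv, plane_drawing Va Ea src dst X pos cv.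

Definition joins (V E : finType) (src dst : E -> V) (e : E) (u v : V) : Prop :=
  (src e = u /\ dst e = v) \/ (src e = v /\ dst e = u).

Lemma joinsC (V E : finType) (src dst : E -> V) e u v :
  joins src dst e u v -> joins src dst e v u.
Proof. by case; [right|left]. Qed.

Section DrawingFacts.
Variables (V E : finType) (Va : {set V}) (Ea : {set E}) (src dst : E -> V).
Variables (X : E -> E -> Prop) (pos : V -> P) (cv : E -> set P).
Hypothesis D : plane_drawing Va Ea src dst X pos cv.

Lemma crossing_sym e f p : crossing Va Ea pos cv e f p -> crossing Va Ea pos cv f e p.
Proof. by case=> eE fE ef [ce cf] nv; split; rewrite // eq_sym. Qed.

Lemma pd_src e : e \in Ea -> src e \in Va.
Proof. by case/(pd_ends D). Qed.

Lemma pd_dst e : e \in Ea -> dst e \in Va.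
Proof. by case/(pd_ends D). Qed.

Lemma pd_neq e : e \in Ea -> src e != dst e.
Proof. by move=> eE; have [_ _] := arc_ends (pd_arc D eE); apply: contraNN => /eqP ->. Qed.

Lemma pd_joins_arc e u v : e \in Ea -> joins src dst e u v -> arc (pos u) (pos v) (cv e).
Proof. by move=> /(pd_arc D) arce [[<- <-]|[<- <-]] //; exact: arc_rev. Qed.

Lemma pd_joins_vert e u v : e \in Ea -> joins src dst e u v -> u \in Va /\ v \in Va.
Proof. by case/(pd_ends D) => sV dV [[<- <-]|[<- <-]]. Qed.

Lemma pd_joins_neq e u v : e \in Ea -> joins src dst e u v -> u != v.
Proof. by move=> /pd_neq ne [[<- <-]|[<- <-]] //; rewrite eq_sym. Qed.

Lemma pd_joins_avoid e u v w : e \in Ea -> joins src dst e u v -> w \in Va ->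
  cv e (pos w) -> w = u \/ w = v.
Proof. by move=> eE ends wV /(pd_avoid D eE wV); case: ends => -[<- <-] []; auto. Qed.

Lemma plane_drawing_relabel (V' E' : finType) (Va' : {set V'}) (Ea' : {set E'})
    (src' dst' : E' -> V')
    (X' : E' -> E' -> Prop) (s : V' -> V) (i : E' -> E) :
  {in Va' &, injective s} -> {in Ea' &, injective i} ->
  (forall w, w \in Va' -> s w \in Va) -> (forall e, e \in Ea' -> i e \in Ea) ->
  (forall e, e \in Ea' -> [/\ src' e \in Va', dst' e \in Va' &
     joins src dst (i e) (s (src' e)) (s (dst' e))]) ->
  (forall e f, e \in Ea' -> f \in Ea' -> e != f -> X (i e) (i f) -> X' e f) ->
  plane_drawing Va' Ea' src' dst' X' (pos \o s) (cv \o i).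
Proof.
move=> s_inj i_inj sV iE ends XX.
have lift_crossing e f p : crossing Va' Ea' (pos \o s) (cv \o i) e f p ->
    crossing Va Ea pos cv (i e) (i f) p.
  case=> eE fE ef [ce cf] nv; split; rewrite ?iE //.
    by apply: contraNN ef => /eqP /i_inj -> //.
  move=> w wV wp; have [sE dE iJ] := ends e eE.
  have ce' : cv (i e) (pos w) by rewrite wp.
  case: (pd_joins_avoid (iE _ eE) iJ wV ce') => ww; [have := nv _ sE|have := nv _ dE];
    by rewrite /= -ww wp.
split.
- by move=> w w' wV w'V /= /(pd_inj D (sV _ wV) (sV _ w'V)); exact: s_inj.
- by move=> e /ends[].
- by move=> e eE /=; have [_ _ iJ] := ends e eE; exact: pd_joins_arc (iE _ eE) iJ.
- move=> e w eE wV /= ce; have [sE dE iJ] := ends e eE.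
  by case: (pd_joins_avoid (iE _ eE) iJ (sV _ wV) ce) => /s_inj ->; auto.
- move=> e f p cef; have [Xef tr] := pd_crossing D (lift_crossing _ _ _ cef).
  by split => //; case: cef => eE fE ef _ _; exact: XX.
- move=> e f g p q cef ceg.
  have [fg pq] := pd_one_crossing D (lift_crossing _ _ _ cef) (lift_crossing _ _ _ ceg).
  by case: cef ceg => _ fE _ _ _ [_ gE _ _ _]; split => //; exact: i_inj.
Qed.

Lemma plane_drawing_restrict (Eb : {set E}) (Y : E -> E -> Prop) : Eb \subset Ea ->
  (forall e f p, e \in Eb -> f \in Eb -> crossing Va Ea pos cv e f p -> X e f -> Y e f) ->
  plane_drawing Va Eb src dst Y pos cv.
Proof.
move=> /fintype.subsetP sE XY.
have widen e f p : crossing Va Eb pos cv e f p -> crossing Va Ea pos cv e f p.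
  by case=> /sE eE /sE fE ef ce nv.
case: (D) => inj ends arcs avoid cross one; split => //.
- by move=> e /sE; exact: ends.
- by move=> e /sE; exact: arcs.
- by move=> e w /sE; exact: avoid.
- move=> e f p cef; have [Xef tr] := cross e f p (widen _ _ _ cef).
  by split => //; case: (cef) => eE fE _ _ _; exact: XY (widen _ _ _ cef) Xef.
- by move=> e f g p q /widen cef /widen; exact: one.
Qed.

(* The vertex map r takes care of the vertices that lie in the collapsed set K. *)
Section Collapse.
Variables (psi : P -> P) (K : set P) (c : P) (Va' : {set V}) (r : V -> V).
Hypothesis col : collapse_map psi K c.
Let psi_collapse := collapse_point col.
Let emb := collapse_embedding col.
Hypothesis edge_meets : forall e x, e \in Ea -> cv e x -> K x ->
  x = pos (src e) \/ x = pos (dst e).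
Hypothesis edge_not_in : forall e, e \in Ea -> ~ (K (pos (src e)) /\ K (pos (dst e))).
Hypothesis vert_meets : {in Va' &, forall w w', K (pos w) -> K (pos w') -> w = w'}.
Hypotheses (subV : Va' \subset Va) (r_id : {in Va', forall w, r w = w}).
Hypothesis r_collapse : {in Va, forall w, r w \in Va' /\ psi (pos (r w)) = psi (pos w)}.

Let psi_eq x y : psi x = psi y -> x = y \/ (K x /\ K y).
Proof.
move=> xy; case: (pselect (K x)) => Kx.
  by right; split => //; apply/psi_collapse; rewrite -xy; apply/psi_collapse.
left; apply: (oe_inj emb) => // Ky; apply: Kx.
by apply/psi_collapse; rewrite xy; apply/psi_collapse.
Qed.

Let psi_inj_on_curve e x y : e \in Ea -> cv e x -> cv e y -> psi x = psi y -> x = y.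
Proof.
move=> eE cx cy /psi_eq[//|[Kx Ky]].
case: (edge_meets eE cx Kx) (edge_meets eE cy Ky) => xE [] yE; rewrite xE yE //;
  by case: (edge_not_in eE); rewrite -xE -yE.
Qed.

Let image_curve e x : e \in Ea -> ~ K x -> (psi @` cv e) (psi x) <-> cv e x.
Proof. by move=> eE nK; split=> [[y cy /psi_eq[<-//|[_ //]]]|cx]; last exists x. Qed.

Let lift_crossing e f q : crossing Va' Ea (psi \o pos) (fun g => psi @` cv g) e f q ->
  exists x, [/\ ~ K x, psi x = q & crossing Va Ea pos cv e f x].
Proof.
case=> eE fE ef [[x cx <-] [y cy yx]] nv.
have novert w : w \in Va -> pos w <> x.
  by move=> /r_collapse[rV rE] wx; apply: (nv _ rV); rewrite /= rE wx.
have nK : ~ K x.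
  by case/(edge_meets eE cx) => xE; [case: (novert _ (pd_src eE))|case: (novert _ (pd_dst eE))].
by exists x; split => //; split => //; split => //; case: (psi_eq yx) => [<-//|[_ /nK]].
Qed.

Lemma plane_drawing_collapse :
  plane_drawing Va' Ea (r \o src) (r \o dst) X (psi \o pos) (fun e => psi @` cv e).
Proof.
split.
- move=> w w' wV w'V /= /psi_eq[|[]]; last exact: vert_meets.
  by apply: (pd_inj D); exact: (fintype.subsetP subV).
- by move=> e eE; have [[sV _] [dV _]] := (r_collapse (pd_src eE), r_collapse (pd_dst eE)).
- move=> e eE /=; have [[_ ->] [_ ->]] := (r_collapse (pd_src eE), r_collapse (pd_dst eE)).
  apply: arc_image (pd_arc D eE) => [x _|x y];
    [exact: (collapse_continuous col)|exact: psi_inj_on_curve].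
- move=> e w eE wV [x cx /= /psi_eq[xw|[Kx Kw]]].
    rewrite {}xw in cx; have := pd_avoid D eE (fintype.subsetP subV _ wV) cx.
    by move=> [] wE; [left|right]; rewrite /= -wE r_id.
  have same v : v \in Va -> x = pos v -> w = r v.
    move=> /r_collapse[rV rE] xv; apply: vert_meets => //.
    by apply/psi_collapse; rewrite rE -xv; apply/psi_collapse.
  by case: (edge_meets eE cx Kx) => /same wE; [left|right]; apply: wE;
    [exact: pd_src|exact: pd_dst].
- move=> e f q /lift_crossing[x [nK <- cef]]; have [Xef tr] := pd_crossing D cef.
  have [eE fE _ _ _] := cef; split => //.
  by apply: transversal_transport emb nK _ _ tr => y nKy; exact: image_curve.
- move=> e f g p q /lift_crossing[x [_ <- cef]] /lift_crossing[y [_ <- ceg]].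
  by have [-> ->] := pd_one_crossing D cef ceg.
Qed.

End Collapse.
End DrawingFacts.

Lemma drawable_relabel (V E V' E' : finType) (Va : {set V}) (Ea : {set E}) (src dst : E -> V)
    (X : E -> E -> Prop) (Va' : {set V'}) (Ea' : {set E'}) (src' dst' : E' -> V')
    (X' : E' -> E' -> Prop) (s : V' -> V) (i : E' -> E) :
  drawable Va Ea src dst X ->
  {in Va' &, injective s} -> {in Ea' &, injective i} ->
  (forall w, w \in Va' -> s w \in Va) -> (forall e, e \in Ea' -> i e \in Ea) ->
  (forall e, e \in Ea' -> [/\ src' e \in Va', dst' e \in Va' &
     joins src dst (i e) (s (src' e)) (s (dst' e))]) ->
  (forall e f, e \in Ea' -> f \in Ea' -> e != f -> X (i e) (i f) -> X' e f) ->
  drawable Va' Ea' src' dst' X'.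
Proof.
move=> [pos [cv D]] *; exists (pos \o s), (cv \o i).
exact: (plane_drawing_relabel D).
Qed.

End PlaneDrawings.

(** * Straightening a drawing near a vertex *)

Section CurveTails.
Variable R : realType.
Local Notation P := (R * R)%type.

Lemma last_exit (g : R -> P) (b : P) (rho : R) : continuous g ->
  `|b - g 0| <= rho -> rho < `|b - g 1| ->
  exists t, [/\ 0 <= t < 1, `|b - g t| = rho & forall s, t < s -> s <= 1 -> rho < `|b - g s|].
Proof.
move=> cg b0 b1.
have [t [/andP[t0 t1] bt after]] := last_hit cg (@closed_closed_ball_ _ _ b rho) b0.
have t_lt1 : t < 1 by rewrite lt_neqAle t1 andbT; apply: contraTneq b1 => <-; rewrite -leNgt.
exists t; split; [by rewrite t0| |by move=> s ts s1; rewrite ltNge; apply/negP; exact: after].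
apply/eqP; rewrite eq_le bt /= leNgt; apply/negP => inside.
have dist_continuous : continuous (fun s => `|b - g s|) by continuity.
have near_inside : \forall s \near t^'+, `|b - g s| < rho.
  have near_t : \forall s \near t, `|b - g s| < rho.
    by apply: (continuous_near_lt dist_continuous _ inside); exact: cst_continuous.
  exact: cvg_within near_t.
have near_later : \forall s \near t^'+, t < s < 1.
  by apply: filterS (filterI (nbhs_right_gt t) (nbhs_right_lt t_lt1)) => s [-> ->].
have [s [/= bs /andP[ts s1]]] : exists s, `|b - g s| < rho /\ t < s < 1.
  by apply: (@filter_ex _ t^'+); exact: filterI.
by apply: (after s ts (ltW s1)); exact: ltW.
Qed.

(* A is the part of the arc C after its last exit r from the disc of radius rho
   around its first end b. *)
Record curve_tail (b c : P) (C : set P) (r0 rho : R) (r : P) (A : set P) : Prop := CurveTail {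
  tail_dist : `|b - r| = rho;
  tail_arc : arc r c A;
  tail_sub : A `<=` C;
  tail_out : forall x, A x -> `|b - x| <= rho -> x = r;
  tail_far : forall x, C x -> r0 <= `|b - x| -> A x;
  tail_near : forall x, A x -> x <> r -> \forall y \near x, C y <-> A y }.

Lemma curve_tail_exists (b c : P) (C : set P) (r0 : R) : 0 < r0 -> arc b c C ->
  \forall rho \near 0^'+, exists r A, curve_tail b c C r0 rho r A.
Proof.
move=> r0_gt0 [g [cg gi [g0 g1] gC Cg]].
have dist_continuous : continuous (fun s => `|b - g s|) by continuity.
have [k k0 kH] : exists2 k : R, 0 < k & forall s, `|0 - s| < k -> `|b - g s| < r0.
  have : \forall s \near (0 : R), `|b - g s| < r0.
    apply: continuous_near_lt => //; first exact: cst_continuous.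
    by rewrite g0 subrr normr0.
  by move=> /nbhs_normP[k k0 kH]; exists k.
pose d := Num.min (k / 2) (1 / 2).
have d0 : 0 < d by rewrite lt_min; apply/andP; split; lra.
have d1 : d < 1 by rewrite gt_min; apply/orP; right; lra.
have dk : d < k by rewrite gt_min; apply/orP; left; lra.
have nb : ~ subcurve g d 1 b.
  move=> [s /andP[ds s1]]; rewrite -g0 => E; have sI : in01 s by rewrite /in01; lra.
  by have := gi _ _ sI (in01_0 R) E; lra.
have [e e0 eH] := closed_dist_ge (arc_closed (subcurve_arc cg gi (ltW d0) d1 (lexx 1))) nb.
near=> rho; have rho0 : 0 < rho by near: rho; exact: nbhs_right_gt.
have rhoe : rho < e by near: rho; exact: nbhs_right_lt.
have [||t [/andP[t0 t1] bt after]] := @last_exit g b rho cg; first by rewrite g0 subrr normr0 ltW.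
  by apply: lt_le_trans rhoe _; apply: eH; exists 1 => //; rewrite lexx ltW.
have td : t < d.
  rewrite ltNge; apply/negP => dt.
  by have : e <= `|b - g t| by [apply: eH; exists t => //; rewrite dt ltW]; lra.
have t_gt0 : 0 < t.
  by rewrite lt_neqAle t0 andbT; apply: contraPneq bt => <-; rewrite g0 subrr normr0; lra.
exists (g t), (subcurve g t 1); split => //.
- by rewrite -g1; exact: subcurve_arc.
- by move=> _ [s _ <-].
- move=> _ [s /andP[ts s1] <-] sr; congr g; apply/eqP.
  by rewrite eq_le ts andbT leNgt; apply/negP => /after/(_ s1); lra.
- move=> x /Cg[s /andP[s0 s1] <-] rs; exists s => //; rewrite s1 andbT leNgt; apply/negP => st.
  by have := kH s; rewrite sub0r normrN ger0_norm // => /(_ ltac:(lra)); lra.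
- move=> _ [s /andP[ts s1] <-] st.
  have head_closed := arc_closed (subcurve_arc cg gi (lexx 0) t_gt0 (ltW t1)).
  have off_head : ~ subcurve g 0 t (g s).
    move=> [s' /andP[s'0 s't]] E; apply: st; congr g.
    have : s' = s by apply: gi => //; rewrite /in01; lra.
    by lra.
  apply: filterS (open_nbhs_nbhs (conj (closed_openC head_closed) off_head)) => y ny.
  split=> [/Cg[s' /andP[s'0 s'1] E]|[s' _ <-]] //; exists s' => //.
  by rewrite s'1 andbT leNgt; apply/negP => s't; apply: ny; exists s' => //; rewrite s'0 ltW.
Unshelve. all: by end_near. Qed.

Lemma curve_tailW (b c : P) (C : set P) (r1 r0 rho : R) (r : P) (A : set P) : r1 <= r0 ->
  curve_tail b c C r1 rho r A -> curve_tail b c C r0 rho r A.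
Proof.
move=> r10 tail; case: (tail) => dist arcA sub out far near; split => // x cx xr.
by apply: far => //; exact: le_trans xr.
Qed.

End CurveTails.

Section Radial.
Variable R : realType.
Local Notation P := (R * R)%type.
Variables (V E : finType) (Va : {set V}) (Ea : {set E}) (src dst : E -> V).
Variables (X : E -> E -> Prop) (pos : V -> P) (cv : E -> set P).
Hypothesis D : plane_drawing Va Ea src dst X pos cv.
Variable b : V.
Hypothesis bV : b \in Va.

Definition at_vert (e : E) := (src e == b) || (dst e == b).
Definition other_end (e : E) := if src e == b then dst e else src e.

Lemma at_vert_joins e : at_vert e -> joins src dst e b (other_end e).
Proof.
by rewrite /at_vert /other_end; case: eqP => [<- _|_ /= /eqP <-]; [left|right].
Qed.

Lemma at_vert_arc e : e \in Ea -> at_vert e -> arc (pos b) (pos (other_end e)) (cv e).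
Proof. by move=> eE /at_vert_joins; exact: (pd_joins_arc D eE). Qed.

Lemma pos_notin_curve e : e \in Ea -> ~~ at_vert e -> ~ cv e (pos b).
Proof. by move=> eE + /(pd_avoid D eE bV)[] bE; rewrite /at_vert -bE eqxx ?orbT. Qed.

Record radial_cut (r0 rho : R) (rr : E -> P) (A : E -> set P) : Prop := RadialCut {
  cut_vert : forall w, w \in Va -> w != b -> rho < `|pos b - pos w|;
  cut_edge : forall e x, e \in Ea -> ~~ at_vert e -> cv e x -> rho < `|pos b - x|;
  cut_tail : forall e, e \in Ea -> at_vert e ->
    curve_tail (pos b) (pos (other_end e)) (cv e) r0 rho (rr e) (A e);
  cut_crossing : forall e f x, at_vert e -> crossing Va Ea pos cv e f x ->
    A e x /\ rho < `|pos b - x| }.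

Lemma near_vert_dist : \forall rho \near (0 : R)^'+,
  forall w, w \in Va -> w != b -> rho < `|pos b - pos w|.
Proof.
apply: filter_forall => w; case: (boolP ((w \in Va) && (w != b))) => [/andP[wV wb]|nw]; last first.
  by apply: nearW => rho wV wb; rewrite wV wb in nw.
have d0 : 0 < `|pos b - pos w|.
  by rewrite normr_gt0 subr_eq0; apply: contraNN wb => /eqP /(pd_inj D bV wV) ->.
by apply: filterS (nbhs_right_lt d0) => rho + _ _.
Qed.

Lemma near_edge_dist : \forall rho \near (0 : R)^'+,
  forall e, e \in Ea -> ~~ at_vert e -> forall x, cv e x -> rho < `|pos b - x|.
Proof.
apply: filter_forall => e; case: (boolP ((e \in Ea) && ~~ at_vert e)) => [/andP[eE ne]|ne].
  have [d d0 dH] := closed_dist_ge (arc_closed (pd_arc D eE)) (pos_notin_curve eE ne).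
  by apply: filterS (nbhs_right_lt d0) => rho + _ _ x /dH; exact: lt_le_trans.
by apply: nearW => rho eE nae; rewrite eE nae in ne.
Qed.

Lemma crossing_dist e r0 : 0 < r0 -> exists r1 : R, [/\ 0 < r1, r1 <= r0 &
  forall f x, crossing Va Ea pos cv e f x -> r1 <= `|pos b - x|].
Proof.
move=> r0_gt0; case: (pselect (exists f x, crossing Va Ea pos cv e f x)) => [[f [x cef]]|none].
  exists (Num.min r0 `|pos b - x|); split; last first.
  - by move=> g y ceg; have [_ ->] := pd_one_crossing D ceg cef; rewrite ge_min lexx orbT.
  - by rewrite ge_min lexx.
  - rewrite lt_min r0_gt0 normr_gt0 subr_eq0; apply/eqP.
    by case: cef => _ _ _ _; exact.
by exists r0; split => // f x cef; case: none; exists f, x.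
Qed.

Lemma near_tail r0 : 0 < r0 -> \forall rho \near 0^'+,
  forall e, e \in Ea -> at_vert e -> exists q : P * set P,
    curve_tail (pos b) (pos (other_end e)) (cv e) r0 rho q.1 q.2 /\
    forall f x, crossing Va Ea pos cv e f x -> q.2 x /\ rho < `|pos b - x|.
Proof.
move=> r0_gt0; apply: filter_forall => e.
case: (boolP ((e \in Ea) && at_vert e)) => [/andP[eE ae]|ne]; last first.
  by apply: nearW => rho eE ae; rewrite eE ae in ne.
have [r1 [r1_gt0 r10 far]] := crossing_dist e r0_gt0.
have tail_near := curve_tail_exists r1_gt0 (at_vert_arc eE ae).
apply: filterS (filterI (nbhs_right_lt r1_gt0) tail_near) => rho [rho_r1 [r [A tail]]] _ _.
exists (r, A); split.
  exact: curve_tailW tail.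
move=> f x cef; have r1x := far f x cef; split; last exact: lt_le_trans rho_r1 _.
by apply: (tail_far tail) => //; case: cef => _ _ _ [].
Qed.

Lemma radial_cut_exists r0 : 0 < r0 ->
  exists (rho : R) (rr : E -> P) (A : E -> set P), 0 < rho < r0 /\ radial_cut r0 rho rr A.
Proof.
move=> r0_gt0; have [rho [[rho0 rho_r0] [vert [edge tail]]]] :=
  filter_ex (filterI (filterI (nbhs_right_gt (0 : R)) (nbhs_right_lt r0_gt0))
    (filterI near_vert_dist (filterI near_edge_dist (near_tail r0_gt0)))).
have /boolp.choice[q qH] : forall e, exists q : P * set P, e \in Ea -> at_vert e ->
    curve_tail (pos b) (pos (other_end e)) (cv e) r0 rho q.1 q.2 /\
    forall f x, crossing Va Ea pos cv e f x -> q.2 x /\ rho < `|pos b - x|.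
  move=> e; case: (boolP ((e \in Ea) && at_vert e)) => [/andP[eE ae]|ne]; last first.
    by exists (0, set0) => eE ae; rewrite eE ae in ne.
  by have [q qH] := tail e eE ae; exists q.
exists rho, (fun e => (q e).1), (fun e => (q e).2); rewrite rho0 rho_r0; split => //; split.
- exact: vert.
- by move=> e x eE ae; exact: edge.
- by move=> e eE ae; have [] := qH e eE ae.
- by move=> e f x ae cef; have [eE _ _ _ _] := cef; have [_] := qH e eE ae; apply; exact: cef.
Qed.

Section RadialCurves.
Variables (r0 rho : R) (rr : E -> P) (A : E -> set P).
Hypotheses (rho0 : 0 < rho) (cut : radial_cut r0 rho rr A).

Lemma radial_cut_end_neq e f : e \in Ea -> f \in Ea -> at_vert e -> at_vert f -> e != f ->
  rr e <> rr f.
Proof.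
move=> eE fE ae af ef rE.
have [de arce subA _ _ _] := cut_tail cut eE ae; have [_ arcf subAf _ _ _] := cut_tail cut fE af.
have [re _ _] := arc_ends arce; have [rf _ _] := arc_ends arcf.
have novert w : w \in Va -> pos w <> rr e.
  move=> wV wr; case: (eqVneq w b) => [wb|wb].
    by move: rho0; rewrite -de -wr wb subrr normr0 ltxx.
  by have := cut_vert cut wV wb; rewrite wr de ltxx.
have cef : crossing Va Ea pos cv e f (rr e).
  by split => //; split; [exact: subA|rewrite rE; exact: subAf].
by have [_] := cut_crossing cut ae cef; rewrite de ltxx.
Qed.

Definition radial_curve e := if at_vert e then seg (pos b) (rr e) `|` A e else cv e.

Lemma spoke_dist e x : e \in Ea -> at_vert e -> seg (pos b) (rr e) x -> `|pos b - x| <= rho.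
Proof. by move=> eE ae /seg_dist_le; rewrite (tail_dist (cut_tail cut eE ae)). Qed.

Lemma radial_curve_inside e x : e \in Ea -> radial_curve e x -> `|pos b - x| <= rho ->
  at_vert e /\ seg (pos b) (rr e) x.
Proof.
rewrite /radial_curve => eE; case: ifPn => ae; last by move=> /(cut_edge cut eE ae); lra.
case=> // Ax xr; split => //; rewrite (tail_out (cut_tail cut eE ae) Ax xr); exact: seg_r.
Qed.

Lemma radial_curve_outside e x : e \in Ea -> radial_curve e x -> rho < `|pos b - x| ->
  cv e x /\ \forall y \near x, radial_curve e y <-> cv e y.
Proof.
rewrite /radial_curve => eE; case: ifPn => ae cx xr; last first.
  by split => //; apply: (@nearW _ (nbhs x)) => y; split.
have tail := cut_tail cut eE ae.
case: cx => [/(spoke_dist eE ae)|Ax]; first by lra.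
split; first exact: (tail_sub tail).
have xn : x <> rr e by move=> xe; move: xr; rewrite xe (tail_dist tail) ltxx.
have far := open_nbhs_nbhs (conj (@open_dist_gt _ _ (pos b) rho) xr).
apply: filterS (filterI far (tail_near tail Ax xn)) => y [/= yr ->].
by split=> [[/(spoke_dist eE ae)|//]|Ay]; [lra|right].
Qed.

Lemma radial_curve_far e x : e \in Ea -> rho < r0 -> r0 <= `|pos b - x| ->
  radial_curve e x <-> cv e x.
Proof.
rewrite /radial_curve => eE rho_r0 xr; case: ifPn => // ae; have tail := cut_tail cut eE ae.
split=> [[/(spoke_dist eE ae)|/(tail_sub tail) //]|cx]; first by lra.
by right; exact: (tail_far tail).
Qed.

Lemma radial_curve_arc e : e \in Ea -> arc (pos (src e)) (pos (dst e)) (radial_curve e).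
Proof.
rewrite /radial_curve => eE; case: ifPn => ae; last exact: (pd_arc D).
have tail := cut_tail cut eE ae.
have : arc (pos b) (pos (other_end e)) (seg (pos b) (rr e) `|` A e).
  apply: arc_cat (tail_arc tail) _; last first.
    by move=> x [/(spoke_dist eE ae) xr Ax]; exact: (tail_out tail).
  by apply: seg_arc; apply: contraTneq rho0 => br; rewrite -(tail_dist tail) br subrr normr0 ltxx.
by case: (at_vert_joins ae) => -[-> ->] //; exact: arc_rev.
Qed.

Lemma radial_crossing e f p : crossing Va Ea pos radial_curve e f p ->
  crossing Va Ea pos cv e f p /\ rho < `|pos b - p|.
Proof.
case=> eE fE ef [ce cf] nv; suff pr : rho < `|pos b - p|.
  by have [[? _] [? _]] := (radial_curve_outside eE ce pr, radial_curve_outside fE cf pr).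
rewrite ltNge; apply/negP => pr.
have [ae se] := radial_curve_inside eE ce pr; have [af sf] := radial_curve_inside fE cf pr.
apply: (radial_cut_end_neq eE fE ae af ef); apply: (seg_meet rho0 _ _ se sf).
- exact: (tail_dist (cut_tail cut eE ae)).
- exact: (tail_dist (cut_tail cut fE af)).
- by move/esym; exact: nv.
Qed.

Lemma radial_curve_drawing : plane_drawing Va Ea src dst X pos radial_curve.
Proof.
split; [exact: (pd_inj D)|exact: (pd_ends D)|exact: radial_curve_arc| | | ].
- move=> e w eE wV ce; case: (lerP `|pos b - pos w| rho) => wr.
    have [ae _] := radial_curve_inside eE ce wr.
    have wb : w = b by apply: contraTeq wr => wb; rewrite -ltNge; exact: (cut_vert cut).
    by case: (at_vert_joins ae) => -[sE dE]; rewrite wb; [left; rewrite sE|right; rewrite dE].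
  by have [ce' _] := radial_curve_outside eE ce wr; exact: (pd_avoid D).
- move=> e f p cef; have [cef' pr] := radial_crossing cef.
  have [eE fE _ [ce cf] _] := cef; have [Xef tr] := pd_crossing D cef'; split => //.
  have [[_ near_e] [_ near_f]] := (radial_curve_outside eE ce pr, radial_curve_outside fE cf pr).
  exact: transversal_near near_e near_f tr.
- move=> e f g p q /radial_crossing[cef _] /radial_crossing[ceg _].
  exact: (pd_one_crossing D cef ceg).
Qed.

End RadialCurves.

Record radial (rho : R) (rr : E -> P) (cv' : E -> set P) : Prop := Radial {
  radial_vert : forall w, w \in Va -> w != b -> rho < `|pos b - pos w|;
  radial_edge : forall e x, e \in Ea -> ~~ at_vert e -> cv' e x -> rho < `|pos b - x|;
  radial_dist : forall e, e \in Ea -> at_vert e -> `|pos b - rr e| = rho;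
  radial_seg : forall e x, e \in Ea -> at_vert e -> `|pos b - x| <= rho ->
    cv' e x <-> seg (pos b) (rr e) x }.

Lemma radial_redraw r0 : 0 < r0 -> exists (rho : R) (rr : E -> P) (cv' : E -> set P),
  [/\ 0 < rho < r0, plane_drawing Va Ea src dst X pos cv', radial rho rr cv' &
      forall e x, e \in Ea -> r0 <= `|pos b - x| -> cv' e x <-> cv e x].
Proof.
move=> /radial_cut_exists[rho [rr [A [/andP[rho0 rho_r0] cut]]]].
exists rho, rr, (radial_curve rr A); split.
- by rewrite rho0.
- exact: (radial_curve_drawing rho0 cut).
- split.
  + exact: (cut_vert cut).
  + by move=> e x eE ae; rewrite /radial_curve (negbTE ae); exact: (cut_edge cut).
  + by move=> e eE ae; exact: (tail_dist (cut_tail cut eE ae)).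
  + move=> e x eE ae xr; split=> [/(radial_curve_inside cut eE)/(_ xr)[]//|sx].
    by rewrite /radial_curve ae; left.
- by move=> e x eE; exact: (radial_curve_far cut).
Qed.

End Radial.

(** * Polygonal arcs *)

Section PolygonalArcs.
Variable R : realType.
Local Notation P := (R * R)%type.
Variables (W : set P) (q : P).
Implicit Types (p w x : P) (Q : set P).

(* Simple polygonal arcs ending at q whose interior lies in W. *)
Inductive polyarc : P -> set P -> Prop :=
| polyarc_seg p : p != q -> (forall x, seg p q x -> x <> p -> x <> q -> W x) ->
    polyarc p (seg p q)
| polyarc_cons p w Q : p != w -> (forall x, seg p w x -> x <> p -> W x) ->
    polyarc w Q -> seg p w `&` Q `<=` [set w] -> polyarc p (seg p w `|` Q).

Lemma polyarc_closed p Q : polyarc p Q -> closed Q.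
Proof.
elim=> {p Q} [p _ _|p w Q _ _ _ cQ _]; first exact: seg_closed.
by apply: closedU => //; exact: seg_closed.
Qed.

Lemma polyarc_sub p Q x : polyarc p Q -> Q x -> [\/ x = p, x = q | W x].
Proof.
move=> sp; elim: sp => {p Q} [p _ sW|p w Q _ sW _ IH _].
  move=> sx; case: (pselect (x = p)) => xp; first by constructor 1.
  by case: (pselect (x = q)) => xq; [constructor 2|constructor 3; exact: sW].
case: (pselect (x = p)) => xp; first by constructor 1.
case=> [sx|Qx]; first by constructor 3; exact: sW.
case: (IH Qx) => [xw|->|Wx]; [|by constructor 2|by constructor 3].
by constructor 3; apply: sW => //; rewrite xw; exact: seg_r.
Qed.

Lemma polyarc_ends p Q : polyarc p Q -> [/\ Q p, Q q & p != q].
Proof.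
elim=> {p Q} [p pq _|p w Q pw sW _ [Qw Qq wq] meet].
  by split; [exact: seg_l|exact: seg_r|].
split; [by left; exact: seg_l|by right|].
apply/eqP => pq; have : (seg p w `&` Q) p by split; [exact: seg_l|rewrite pq].
by move/meet => /= E; rewrite E eqxx in pw.
Qed.

Hypothesis qW : ~ W q.

Lemma polyarc_trunc p Q x : polyarc p Q -> Q x -> x <> q ->
  exists2 Q', polyarc x Q' & Q' `<=` Q.
Proof.
elim=> {p Q} [p pq sW|p w Q pw sW polyQ IH meet].
  move=> sx xq; exists (seg x q); last exact: seg_subr.
  constructor; first exact/eqP.
  move=> y sy yx yq; apply: sW => //; first exact: (seg_subr sx).
  move=> yp; apply: yx; rewrite yp; apply/esym; apply: (seg_anti pq sx).
  by rewrite -yp.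
move=> Qx xq; case: (pselect (Q x)) => [/IH/(_ xq)[Q' sp' Q'Q]|nQ].
  by exists Q' => // y /Q'Q; right.
case: Qx => // sx; exists (seg x w `|` Q); last first.
  by move=> y [/(seg_subr sx)|]; [left|right].
have [Qw _ _] := polyarc_ends polyQ.
constructor => //.
- by apply/eqP => xw; apply: nQ; rewrite xw.
- move=> y sy yx; apply: sW; first exact: (seg_subr sx).
  move=> yp; apply: yx; rewrite yp; apply/esym; apply: (seg_anti pw sx).
  by rewrite -yp.
- by move=> y [/(seg_subr sx) sy Qy]; apply: meet.
Qed.

(* From p' follow the segment towards p up to its first point on Q. *)
Lemma polyarc_extend p p' Q : polyarc p Q -> p' <> q ->
  (forall y, seg p' p y -> y <> p' -> W y) -> exists Q', polyarc p' Q'.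
Proof.
move=> polyQ p'q sW; have [Qp Qq pq] := polyarc_ends polyQ.
have line_continuous : continuous (fun t : R => p + t *: (p' - p)) by continuity.
have start : Q (p + 0 *: (p' - p)) by rewrite scale0r addr0.
have [t [tI Qt after]] := last_hit line_continuous (polyarc_closed polyQ) start.
set x := p + t *: (p' - p) in Qt.
have sx : seg p' p x by rewrite seg_sym; exists t.
have xq : x <> q.
  by case: (pselect (x = p')) => [->//|xp] xq; apply: qW; rewrite -xq; exact: sW.
have [Q' polyQ' Q'Q] := polyarc_trunc polyQ Qt xq.
case: (pselect (x = p')) => [xp|xp]; first by exists Q'; rewrite -xp.
exists (seg p' x `|` Q'); constructor => //.
- by apply/eqP => E; apply: xp.
- by move=> y sy; apply: sW; exact: (seg_subl sx).
- move=> y [] /=; rewrite seg_sym => /(seg_suffix tI)[s /andP[ts s1] yE] /Q'Q Qy.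
  rewrite yE /x; move: ts; rewrite le_eqVlt => /predU1P[<- //|ts].
  by case: (after s ts s1); rewrite -yE.
Qed.

Lemma polyarc_connected (C : set P) : open W -> connected C -> C `<=` W ->
  (exists x Q, C x /\ polyarc x Q) -> forall x, C x -> exists Q, polyarc x Q.
Proof.
move=> oW cC CW [x0 [Q0 [Cx0 poly0]]].
pose reach := [set x | W x /\ exists Q, polyarc x Q].
have reach_ball x y e : (forall y : P, `|x - y| < e -> W y) -> `|x - y| < e ->
    (reach x <-> reach y).
  move=> eW xy.
  have extend a c : (forall z, seg a c z -> `|x - z| < e) -> W a -> reach c -> reach a.
    move=> ac Wa [Wc [Q poly]]; split => //.
    apply: (polyarc_extend poly); first by move=> aq; rewrite aq in Wa.
    by move=> z sz _; apply: eW; exact: ac.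
  have sxy z : seg x y z -> `|x - z| < e by move/seg_dist_le/le_lt_trans; apply.
  have xx : `|x - x| < e by rewrite subrr normr0; exact: le_lt_trans xy.
  split; apply: extend => //; try exact: eW.
  by move=> z; rewrite seg_sym; exact: sxy.
have open_reach : open reach.
  apply/open_normP => x rx; have [Wx _] := rx.
  have [e e0 eW] := (open_normP _).1 oW x Wx; exists e => // y xy.
  by apply/(reach_ball x y e).
have open_unreach : open (W `\` reach).
  apply/open_normP => x [Wx nr]; have [e e0 eW] := (open_normP _).1 oW x Wx.
  exists e => // y xy; split; first exact: eW.
  by move=> ry; apply: nr; apply/(reach_ball x y e).
have CE : C `&` reach = C.
  apply: cC; first by exists x0; split => //; split; [exact: CW|exists Q0].
    by exists reach.
  exists (~` (W `\` reach)); first exact: open_closedC.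
  apply/seteqP; split=> x [Cx H]; split => //; first by move=> [].
  by apply: contrapT => nr; apply: H; split => //; exact: CW.
by move=> x Cx; have [_ [_ polyx]] : (C `&` reach) x by rewrite CE.
Qed.

End PolygonalArcs.

(** * Contracting edges *)

Section UnitCollapse.
Variable R : realType.
Local Notation P := (R * R)%type.

Definition unit_seg (q : P) := q.2 = 0 /\ -1 <= q.1 <= 0.

(* Collapses unit_seg to the origin by moving the points horizontally to the right;
   a point q is moved only if |q.2| < -q.1 / N and q.1 > -1 - 1 / N. *)
Definition unit_collapse (N : R) (q : P) : P :=
  (Num.max q.1 (Num.min (q.1 * Num.min 1 `|q.2| - N * `|q.2|)
                        (q.1 + ((q.1 + 1) * N + 1) - N * `|q.2|)), q.2).

Lemma unit_collapse_continuous N : continuous (unit_collapse N).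
Proof. by rewrite /unit_collapse; continuity. Qed.

Let min10 : Num.min 1 (0 : R) = 0. Proof. by apply/min_idPr; exact: ler01. Qed.

Lemma unit_collapse_seg N q : 0 < N -> unit_seg q -> unit_collapse N q = 0.
Proof.
move=> N0 [y0 /andP[x0 x1]]; rewrite /unit_collapse y0; congr (_, _).
rewrite normr0 mulr0 !subr0 min10 mulr0.
have -> : Num.min 0 (q.1 + ((q.1 + 1) * N + 1)) = 0 by apply/min_idPl; nra.
exact/max_idPr.
Qed.

Lemma unit_seg_sides (x : R) : ~ unit_seg (x, 0) -> x < -1 \/ 0 < x.
Proof.
move=> nx; case: (ltrP x (-1)) => x1; [by left|right].
by rewrite ltNge; apply/negP => x0; apply: nx; split => //; rewrite x1.
Qed.

Lemma unit_collapse_increasing N (x x' y : R) : 0 < N -> ~ unit_seg (x, y) ->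
  ~ unit_seg (x', y) -> x < x' -> (unit_collapse N (x, y)).1 < (unit_collapse N (x', y)).1.
Proof.
move=> N0 nx nx' xx /=.
have c0 : 0 <= N * `|y| by apply: mulr_ge0; [exact: ltW|exact: normr_ge0].
have right_lt : x + ((x + 1) * N + 1) - N * `|y| < x' + ((x' + 1) * N + 1) - N * `|y| by nra.
case: (eqVneq y 0) => [y0|y0]; last first.
  have m0 : 0 < Num.min 1 `|y| by rewrite lt_min ltr01 normr_gt0.
  have left_lt : x * Num.min 1 `|y| - N * `|y| < x' * Num.min 1 `|y| - N * `|y|.
    by rewrite ltrD2r ltr_pM2r.
  rewrite gt_max !lt_max xx /= lt_min !gt_min left_lt right_lt /= orbT.
  by rewrite orbT.
move: right_lt nx'; rewrite y0 normr0 mulr0 !subr0 min10 !mulr0 => right_lt /unit_seg_sides[]x'0.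
  rewrite gt_max !lt_max xx /=; apply/orP; right.
  have x_neg : x + ((x + 1) * N + 1) < 0 by nra.
  by rewrite lt_min !gt_min right_lt x_neg !orbT.
by rewrite gt_max !lt_max xx gt_min x'0.
Qed.

Lemma unit_collapse_id_wide N q : 0 < N -> - q.1 <= N * `|q.2| -> unit_collapse N q = q.
Proof.
move=> N0 wide; rewrite /unit_collapse [RHS]surjective_pairing; congr (_, _).
apply/max_idPl; rewrite ge_min; apply/orP; left.
have m1 : Num.min 1 `|q.2| <= 1 by rewrite ge_min lexx.
have m0 : 0 <= Num.min 1 `|q.2| by rewrite le_min ler01 normr_ge0.
have c0 : 0 <= N * `|q.2| by apply: mulr_ge0; [exact: ltW|exact: normr_ge0].
by case: (lerP 0 q.1) => x0; nra.
Qed.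

Lemma unit_collapse_id_left N q : 0 < N -> (q.1 + 1) * N + 1 <= 0 -> unit_collapse N q = q.
Proof.
move=> N0 left; rewrite /unit_collapse [RHS]surjective_pairing; congr (_, _).
apply/max_idPl; rewrite ge_min; apply/orP; right.
have c0 : 0 <= N * `|q.2| by apply: mulr_ge0; [exact: ltW|exact: normr_ge0].
by lra.
Qed.

Lemma unit_collapse_eq0 N q : 0 < N -> unit_collapse N q = 0 <-> unit_seg q.
Proof.
move=> N0; split=> [|]; last exact: unit_collapse_seg.
case: q => x y [] + /= y0; rewrite {}y0 normr0 mulr0 !subr0 => x_to0.
apply: contrapT => /unit_seg_sides[] x0.
  have : Num.max x (Num.min (x * Num.min 1 0) (x + ((x + 1) * N + 1))) < 0.
    rewrite gt_max; apply/andP; split; first by lra.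
    by rewrite gt_min; apply/orP; right; nra.
  by rewrite x_to0 ltxx.
have : x <= 0 by rewrite -x_to0 le_max lexx.
by lra.
Qed.

Lemma unit_collapse_open N (U : set P) : 0 < N -> open U -> U `<=` ~` [set q | unit_seg q] ->
  open (unit_collapse N @` U).
Proof.
move=> N0; apply: (@horizontal_increasing_open R (fun q => (unit_collapse N q).1)).
  by apply: continuous_fun_fst; exact: unit_collapse_continuous.
by move=> x x' y; exact: unit_collapse_increasing.
Qed.

End UnitCollapse.

Section SegmentCollapse.
Variable R : realType.
Local Notation P := (R * R)%type.
Variables (p w : P).
Hypothesis pw : p != w.
Let u : P := w - p.
Let n2 : R := u.1 * u.1 + u.2 * u.2.

Let n2_neq0 : n2 != 0.
Proof.
have : u != 0 by rewrite subr_eq0 eq_sym.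
apply: contraNneq; rewrite /n2 -!expr2 => /eqP.
rewrite paddr_eq0 ?sqr_ge0 // !sqrf_eq0 => /andP[/eqP u1 /eqP u2].
by apply/eqP; apply: plane_ext.
Qed.

(* The similarity that maps the segment from w to p to unit_seg. *)
Definition to_unit (z : P) : P :=
  (((z - w).1 * u.1 + (z - w).2 * u.2) / n2, (u.1 * (z - w).2 - u.2 * (z - w).1) / n2).
Definition of_unit (q : P) : P := (w.1 + q.1 * u.1 - q.2 * u.2, w.2 + q.1 * u.2 + q.2 * u.1).

Lemma of_unitK : cancel of_unit to_unit.
Proof.
have n0 := n2_neq0; rewrite /n2 in n0.
by move=> q; apply: plane_ext; rewrite /to_unit /of_unit /n2 /=; field.
Qed.

Lemma to_unitK : cancel to_unit of_unit.
Proof.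
have n0 := n2_neq0; rewrite /n2 in n0.
by move=> z; apply: plane_ext; rewrite /to_unit /of_unit /n2 !planeE /=; field.
Qed.

Lemma of_unit0 : of_unit 0 = w.
Proof. by apply: plane_ext => /=; ring. Qed.

Lemma to_unit_line t (v : P) : to_unit (w + t *: (v - w)) = t *: to_unit v.
Proof. by apply: plane_ext; rewrite /to_unit !planeE /=; ring. Qed.

Lemma to_unit_continuous : continuous to_unit.
Proof. by rewrite /to_unit; continuity. Qed.

Lemma of_unit_continuous : continuous of_unit.
Proof. by rewrite /of_unit; continuity. Qed.

Lemma unit_segP z : unit_seg (to_unit z) <-> seg p w z.
Proof.
split=> [[z2 /andP[z1 z1']]|].
  rewrite -(to_unitK z) seg_sym; exists (- (to_unit z).1); first by rewrite /in01; lra.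
  by apply: plane_ext; rewrite /of_unit z2 /u !planeE /=; ring.
rewrite seg_sym => -[t /andP[t0 t1] ->]; rewrite to_unit_line.
have -> : to_unit p = (-1, 0).
  have n0 := n2_neq0; rewrite /n2 in n0.
  by apply: plane_ext; rewrite /to_unit /n2 /u !planeE /= in n0 *; field.
by split; rewrite !planeE /=; [rewrite mulr0|lra].
Qed.

Lemma of_unit_dist (q q' : P) : `|of_unit q - of_unit q'| <=
  (`|q.1 - q'.1| + `|q.2 - q'.2|) * `|u|.
Proof.
have u1 : `|u.1| <= `|u| by rewrite plane_norm le_max lexx.
have u2 : `|u.2| <= `|u| by rewrite plane_norm le_max lexx orbT.
rewrite plane_norm_le; apply/andP; split.
  have -> : (of_unit q - of_unit q').1 = (q.1 - q'.1) * u.1 - (q.2 - q'.2) * u.2.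
    by rewrite /of_unit !planeE /=; ring.
  apply: (le_trans (ler_normB _ _)); rewrite !normrM mulrDl.
  by apply: lerD; apply: ler_wpM2l.
have -> : (of_unit q - of_unit q').2 = (q.1 - q'.1) * u.2 + (q.2 - q'.2) * u.1.
  by rewrite /of_unit !planeE /=; ring.
apply: (le_trans (ler_normD _ _)); rewrite !normrM mulrDl.
by apply: lerD; apply: ler_wpM2l.
Qed.

Definition seg_collapse (N : R) (z : P) : P := of_unit (unit_collapse N (to_unit z)).

Lemma seg_collapse_open N U : 0 < N -> open U -> U `<=` ~` seg p w -> open (seg_collapse N @` U).
Proof.
move=> N0 oU Useg; have -> : seg_collapse N @` U =
    to_unit @^-1` (unit_collapse N @` (of_unit @^-1` U)).
  apply/seteqP; split=> [_ [z Uz <-]|z [q Uq E]].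
    by rewrite /preimage /= /seg_collapse of_unitK; exists (to_unit z) => //=; rewrite to_unitK.
  by exists (of_unit q) => //; rewrite /seg_collapse of_unitK E to_unitK.
apply: open_comp; first by move=> z _; exact: to_unit_continuous.
apply: unit_collapse_open => //; first by apply: open_comp => // q _; exact: of_unit_continuous.
by move=> q /Useg; rewrite /= -unit_segP of_unitK.
Qed.

Lemma seg_collapse_inj N x y : 0 < N -> ~ seg p w x -> ~ seg p w y ->
  seg_collapse N x = seg_collapse N y -> x = y.
Proof.
move=> N0; rewrite -!unit_segP => xs ys /(can_inj of_unitK) E.
apply: (can_inj to_unitK); move: xs ys E.
case: (to_unit x) => x1 x2; case: (to_unit y) => y1 y2 xs ys [E1 E2]; rewrite {}E2 in E1 xs *.
by case: (ltgtP x1 y1) => [xy|xy|-> //]; [have := unit_collapse_increasing N0 xs ys xy|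
  have := unit_collapse_increasing N0 ys xs xy]; rewrite /= E1 ltxx.
Qed.

Lemma seg_collapse_map N : 0 < N -> collapse_map (seg_collapse N) (seg p w) w.
Proof.
move=> N0; have cont : continuous (seg_collapse N).
  apply: (@continuous_fun_comp _ _ _ _ of_unit); last exact: of_unit_continuous.
  apply: (@continuous_fun_comp _ _ _ to_unit); first exact: to_unit_continuous.
  exact: unit_collapse_continuous.
split=> // [x|].
  rewrite -unit_segP -(unit_collapse_eq0 _ N0); split=> [E|E].
    by rewrite -[LHS]of_unitK -/(seg_collapse N x) E -of_unit0 of_unitK.
  by rewrite /seg_collapse E of_unit0.
split=> [|x _|x y xs ys|U oU Us].
- by apply: closed_openC; exact: seg_closed.
- exact: cont.
- exact: seg_collapse_inj.
- exact: seg_collapse_open.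
Qed.

Lemma seg_collapse_id_line (w2 : P) : w2 != w -> seg w w2 `&` seg p w `<=` [set w] ->
  exists2 N1 : R, 0 < N1 & forall N x, N1 <= N -> seg w w2 x -> seg_collapse N x = x.
Proof.
move=> w2w disj; set c := to_unit w2.
suff [N1 N10 wide] : exists2 N1 : R, 0 < N1 & forall N, N1 <= N -> - c.1 <= N * `|c.2|.
  exists N1 => // N _ NN1 [t /andP[t0 t1] ->];
    rewrite /seg_collapse unit_collapse_id_wide ?to_unitK //.
    exact: lt_le_trans N10 NN1.
  by rewrite to_unit_line !planeE -/c normrM (ger0_norm t0); have := wide N NN1; nra.
case: (lerP 0 c.1) => x2; first by exists 1 => // N N1; have := normr_ge0 c.2; nra.
have y2 : c.2 != 0.
  apply/eqP => y2; pose t := Num.min 1 (- c.1)^-1.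
  have t0 : 0 < t by rewrite lt_min ltr01 invr_gt0; lra.
  have tx : t * - c.1 <= 1.
    rewrite -(@mulVf _ (- c.1)); last by lra.
    by apply: ler_wpM2r; [lra|rewrite ge_min lexx orbT].
  have : w + t *: (w2 - w) = w.
    apply: disj; split; first by exists t => //; rewrite /in01 ltW //= ge_min lexx.
    by apply/unit_segP; rewrite to_unit_line; split; rewrite !planeE -/c ?y2 ?mulr0 //; nra.
  move/eqP; rewrite -subr_eq0 addrAC subrr add0r scaler_eq0 subr_eq0 (negbTE w2w) orbF.
  by rewrite gt_eqF.
exists (- c.1 / `|c.2|) => [|N]; last by rewrite ler_pdivrMr ?normr_gt0.
by rewrite divr_gt0 ?normr_gt0 //; lra.
Qed.

Lemma seg_collapse_id_far (d N : R) x : (forall y, seg p w y -> d <= `|y - x|) ->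
  1 <= N -> 3 * `|u| < N * d -> seg_collapse N x = x.
Proof.
move=> far N1 Nd; have N0 : 0 < N by lra.
suff E : unit_collapse N (to_unit x) = to_unit x by rewrite /seg_collapse E to_unitK.
case: (lerP (- (to_unit x).1) (N * `|(to_unit x).2|)) => thin; first exact: unit_collapse_id_wide.
case: (lerP (((to_unit x).1 + 1) * N + 1) 0) => right; first exact: unit_collapse_id_left.
exfalso; set a := (to_unit x).1 in thin right; set b := (to_unit x).2 in thin right.
have b0 := normr_ge0 b; have a0 : a < 0 by nra.
pose a' := Num.max (-1) a.
have a'1 : -1 <= a' by rewrite le_max lexx.
have a'0 : a' <= 0 by rewrite ge_max; apply/andP; split; lra.
have aN : `|a' - a| * N <= 1.
  rewrite /a'; case: (lerP a (-1)) => ha; last by rewrite subrr normr0 mul0r.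
  by rewrite ger0_norm; [nra|lra].
have bN : `|b| * N <= 2 by nra.
have on_seg : seg p w (of_unit (a', 0)) by rewrite -unit_segP of_unitK; split; rewrite //= a'1.
have d_le : d <= (`|a' - a| + `|b|) * `|u|.
  apply: le_trans (far _ on_seg) _; rewrite -{1}(to_unitK x).
  by have := of_unit_dist (a', 0) (to_unit x); rewrite /= sub0r normrN.
have : d * N <= 3 * `|u| by apply: (le_trans (ler_wpM2r (ltW N0) d_le)); have := normr_ge0 u; nra.
by rewrite mulrC; lra.
Qed.

(* Pushes p along the segment from p to w onto w; the support is a wedge at w so thin
   that it misses the rest of the polygonal arc. *)
Lemma seg_collapse_exists (w2 : P) (Q : set P) : w2 != w -> closed Q -> ~ Q w ->
  (seg w w2 `|` Q) `&` seg p w `<=` [set w] ->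
  exists2 psi : P -> P, collapse_map psi (seg p w) w &
    forall x, (seg w w2 `|` Q) x -> psi x = x.
Proof.
move=> w2w cQ nQ disj.
have [d d0 far] : exists2 d : R, 0 < d & forall y x, seg p w y -> Q x -> d <= `|y - x|.
  apply: compact_closed_dist_ge => //; first exact: seg_compact.
  by move=> y sy Qy; apply: nQ; rewrite -(disj y) //; split => //; right.
have [N1 N1_gt0 line] : exists2 N1 : R, 0 < N1 &
    forall N x, N1 <= N -> seg w w2 x -> seg_collapse N x = x.
  by apply: seg_collapse_id_line => // x [sx px]; apply: disj; split => //; left.
pose N := 1 + N1 + 3 * `|u| / d.
have q0 : 0 <= 3 * `|u| / d by rewrite divr_ge0 ?mulr_ge0 // ltW.
have Nd : 3 * `|u| < N * d by rewrite -ltr_pdivrMr // /N; lra.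
exists (seg_collapse N); first by apply: seg_collapse_map; rewrite /N; lra.
move=> x [sx|Qx]; first by apply: line => //; rewrite /N; lra.
by apply: (seg_collapse_id_far (d := d)) Nd => [y sy|]; [exact: far|rewrite /N; lra].
Qed.

End SegmentCollapse.

Section ContractEdge.
Variable R : realType.
Local Notation P := (R * R)%type.

Definition free_point (V E : finType) (Va : {set V}) (Ea : {set E}) (pos : V -> P)
    (cv : E -> set P) (x : P) : Prop :=
  (forall w, w \in Va -> pos w <> x) /\ (forall e, e \in Ea -> ~ cv e x).

Definition merge_vert (V : eqType) (a b w : V) : V := if w == b then a else w.

Lemma open_free_point (V E : finType) (Va : {set V}) (Ea : {set E}) (src dst : E -> V) X pos cv :
  plane_drawing Va Ea src dst X pos cv -> open (free_point Va Ea pos cv).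
Proof.
move=> D; rewrite openE => x [freeV freeE]; rewrite /interior.
have near_vert : \forall y \near x, forall w, w \in Va -> pos w <> y.
  apply: (@filter_forall _ _ _ (nbhs x)) => w.
  case: (boolP (w \in Va)) => wV; last by apply: (@nearW _ (nbhs x)).
  have wx : `|x - pos w| != 0 by rewrite normr_eq0 subr_eq0; apply/eqP => /esym; exact: freeV.
  have := open_nbhs_nbhs (conj (@open_dist_gt _ _ (pos w) 0) _).
  move=> /(_ x); rewrite /= distrC lt_neqAle eq_sym wx normr_ge0 => /(_ isT).
  by apply: filterS => y /= + _ wy; rewrite wy subrr normr0 ltxx.
have near_edge : \forall y \near x, forall e, e \in Ea -> ~ cv e y.
  apply: (@filter_forall _ _ _ (nbhs x)) => e.
  case: (boolP (e \in Ea)) => eE; last by apply: (@nearW _ (nbhs x)).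
  have := open_nbhs_nbhs (conj (closed_openC (arc_closed (pd_arc D eE))) (freeE e eE)).
  by apply: filterS => y ny _.
by apply: filterS (filterI near_vert near_edge) => y [].
Qed.

Section ContractPolyarc.
Variables (V E : finType) (Va : {set V}) (Ea : {set E}) (src dst : E -> V).
Variables (X : E -> E -> Prop) (a b : V).
Hypotheses (aV : a \in Va) (bV : b \in Va) (ab : a != b).
Hypothesis no_joins : forall e, e \in Ea -> ~ joins src dst e a b.

Let contracted := drawable R (Va :\ b)%SET Ea (merge_vert a b \o src) (merge_vert a b \o dst) X.

Lemma contract_segment pos cv : plane_drawing Va Ea src dst X pos cv ->
  (forall x, seg (pos b) (pos a) x -> x <> pos b -> x <> pos a -> free_point Va Ea pos cv x) ->
  contracted.
Proof.
move=> D free; set p := pos b; set q := pos a.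
have pq : p != q by apply: contraNN ab => /eqP /(pd_inj D bV aV) ->.
have qq : q + (q - p) != q by rewrite -subr_eq0 addrAC subrr add0r subr_eq0 eq_sym.
have ray : (seg q (q + (q - p)) `|` set0) `&` seg p q `<=` [set q].
  move=> x [[|//]]; move=> [t /andP[t0 t1] ->] [s /andP[s0 s1]] E'.
  have : (1 - s + t) *: (q - p) = 0.
    have := subrr (p + s *: (q - p)); rewrite -{1}E' => <-.
    by apply: plane_ext; rewrite !planeE; ring.
  move/eqP; rewrite scaler_eq0 subr_eq0 (eq_sym q) (negbTE pq) orbF => /eqP ts.
  have -> : t = 0 by lra.
  by rewrite scale0r addr0.
have [psi col _] := seg_collapse_exists pq qq (@closed0 _) (fun x => x) ray.
have vert_on w : w \in Va -> seg p q (pos w) -> w = a \/ w = b.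
  move=> wV sw; case: (pselect (pos w = q)) => [/(pd_inj D wV aV)|wq]; first by left.
  case: (pselect (pos w = p)) => [/(pd_inj D wV bV)|wp]; first by right.
  by have [/(_ w wV)] := free _ sw wp wq.
have edge_on e x : e \in Ea -> cv e x -> seg p q x -> x = pos (src e) \/ x = pos (dst e).
  move=> eE cx sx; case: (pselect (x = p)) => [xp|xp].
    by case: (pd_avoid D eE bV (eq_ind _ (cv e) cx _ xp)) => <-; auto.
  case: (pselect (x = q)) => [xq|xq].
    by case: (pd_avoid D eE aV (eq_ind _ (cv e) cx _ xq)) => <-; auto.
  by have [_ /(_ e eE)] := free _ sx xp xq.
exists (psi \o pos), (fun e => psi @` cv e).
apply: (plane_drawing_collapse D col edge_on).
- move=> e eE [/(vert_on _ (pd_src D eE)) sE /(vert_on _ (pd_dst D eE)) dE].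
  have := pd_neq D eE; case: sE dE => sE [] dE; rewrite sE dE ?eqxx // => _;
    by case: (no_joins eE); rewrite /joins sE dE; auto.
- move=> w w'; rewrite !inE => /andP[wb wV] /andP[w'b w'V].
  move=> /(vert_on _ wV)[->|wE] /(vert_on _ w'V)[->|w'E] //.
  + by rewrite w'E eqxx in w'b.
  + by rewrite wE eqxx in wb.
  + by rewrite wE w'E.
- exact: subD1set.
- by move=> w; rewrite /merge_vert !inE => /andP[/negbTE ->].
- move=> w wV; rewrite /merge_vert; case: eqP => [->|/eqP wb]; last by rewrite !inE wb wV.
  rewrite !inE ab aV; split => //; transitivity q; last apply/esym; apply/(collapse_point col).
    exact: seg_r.
  exact: seg_l.
Qed.

Lemma slide_vertex pos cv w psi : plane_drawing Va Ea src dst X pos cv ->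
  collapse_map psi (seg (pos b) w) w ->
  (forall x, seg (pos b) w x -> x <> pos b -> free_point Va Ea pos cv x) ->
  plane_drawing Va Ea src dst X (psi \o pos) (fun e => psi @` cv e).
Proof.
move=> D col free.
have vert_on v : v \in Va -> seg (pos b) w (pos v) -> v = b.
  move=> vV sv; case: (pselect (pos v = pos b)) => [/(pd_inj D vV bV)//|vb].
  by have [/(_ v vV)] := free _ sv vb.
apply: (@plane_drawing_collapse _ _ _ _ _ _ _ _ _ _ D psi (seg (pos b) w) w Va id) => //.
- move=> e x eE cx sx; case: (pselect (x = pos b)) => [xb|xb].
    by case: (pd_avoid D eE bV (eq_ind _ (cv e) cx _ xb)) => <-; auto.
  by have [_ /(_ e eE)] := free _ sx xb.
- move=> e eE [/(vert_on _ (pd_src D eE)) sE /(vert_on _ (pd_dst D eE)) dE].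
  by have := pd_neq D eE; rewrite sE dE eqxx.
- by move=> v v' vV v'V /(vert_on _ vV) -> /(vert_on _ v'V) ->.
Qed.

Lemma polyarc_head (W : set P) q w Q : polyarc W q w Q -> exists w2 Q2,
  [/\ w2 != w, closed Q2, ~ Q2 w & Q = seg w w2 `|` Q2].
Proof.
case=> [{}w wq _|{}w w2 Q' ww2 _ poly' disj].
  by exists q, set0; rewrite setU0 eq_sym; split => //; exact: closed0.
exists w2, Q'; rewrite eq_sym; split => //; first exact: (polyarc_closed poly').
move=> Qw; have /disj /= ww : (seg w w2 `&` Q') w by split => //; exact: seg_l.
by rewrite ww eqxx in ww2.
Qed.

Lemma contract_polyarc W q p Q : ~ W q -> polyarc W q p Q ->
  forall pos cv, plane_drawing Va Ea src dst X pos cv -> pos b = p -> pos a = q ->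
  (forall x, Q x -> x <> p -> x <> q -> free_point Va Ea pos cv x) -> contracted.
Proof.
move=> qW; elim=> {p Q} [p pq _|p w Q pw _ polyQ IH disj] pos cv D pb pa free.
  by apply: (contract_segment D); rewrite pa pb.
have [Qw Qq wq] := polyarc_ends polyQ.
have [w2 [Q2 [w2w cQ2 nQ2 QE]]] := polyarc_head polyQ.
have QpE : (seg w w2 `|` Q2) `&` seg p w `<=` [set w] by rewrite -QE setIC.
have [psi col psi_id] := seg_collapse_exists pw w2w cQ2 nQ2 QpE.
rewrite -QE in psi_id.
have seg_Q x : seg p w x -> Q x -> x = w by move=> sx Qx; exact: disj.
have seg_q x : seg p w x -> x <> q.
  by move=> + xq; rewrite {}xq => /seg_Q/(_ Qq) qw; rewrite qw eqxx in wq.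
have Dpsi := @slide_vertex pos cv w psi D; rewrite pb in Dpsi.
apply: (IH _ _ (Dpsi col _)) => /=.
- by move=> x sx xp; apply: free xp (seg_q _ sx); left.
- by rewrite pb; apply/(collapse_point col); exact: seg_l.
- by rewrite pa psi_id.
- move=> x Qx xw xq; have nsx : ~ seg p w x by move=> /seg_Q/(_ Qx).
  have xp : x <> p by move=> xp; apply: nsx; rewrite xp; exact: seg_l.
  have [freeV freeE] := free x (or_intror Qx) xp xq.
  have back y : psi y = x -> y = x.
    move=> yx; case: (pselect (seg p w y)) => sy.
      by case: xw; rewrite -yx; apply/(collapse_point col).
    by apply: (oe_inj (collapse_embedding col)) => //; rewrite yx psi_id.
  split=> [v vV /back|e eE [y cy /back yx]]; first exact: freeV.
  by apply: (freeE e eE); rewrite -yx.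
Qed.

End ContractPolyarc.

Section ContractUncrossed.
Variables (V E : finType) (Va : {set V}) (Ea : {set E}) (src dst : E -> V).
Variables (X : E -> E -> Prop) (e0 : E) (a b : V).
Hypotheses (e0E : e0 \in Ea) (uncrossed : forall f, f \in Ea -> ~ X e0 f).
Hypothesis e0_joins : joins src dst e0 a b.

Definition spoke (cv : E -> set P) (c : P) (rho : R) (r : P) : Prop :=
  0 < rho /\ forall x, `|c - x| <= rho -> cv e0 x <-> seg c r x.

Lemma straighten_ends pos cv : plane_drawing Va Ea src dst X pos cv -> exists cv',
  [/\ plane_drawing Va Ea src dst X pos cv',
      exists2 rho, rho < `|pos a - pos b| & exists r, spoke cv' (pos a) rho r &
      exists2 rho, rho < `|pos a - pos b| & exists r, spoke cv' (pos b) rho r].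
Proof.
move=> D; have [aV bV] := pd_joins_vert D e0E e0_joins.
have ab : a != b := pd_joins_neq D e0E e0_joins.
have d0 : 0 < `|pos a - pos b|.
  by rewrite normr_gt0 subr_eq0; apply: contraNN ab => /eqP /(pd_inj D aV bV) ->.
pose h := `|pos a - pos b| / 2.
have h0 : 0 < h by rewrite divr_gt0.
have h2 : h + h = `|pos a - pos b| by rewrite /h; lra.
have [rb [sb [cv1 [/andP[rb0 rbh] D1 rad1 _]]]] := radial_redraw D bV h0.
have [ra [sa [cv2 [/andP[ra0 rah] D2 rad2 keep]]]] := radial_redraw D1 aV h0.
have [e0a e0b] : at_vert src dst a e0 /\ at_vert src dst b e0.
  by rewrite /at_vert; case: e0_joins => -[-> ->]; rewrite !eqxx ?orbT.
exists cv2; split => //; [exists ra; last exists (sa e0)|exists rb; last exists (sb e0)]; try lra.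
  by split => // x; exact: (radial_seg rad2).
split => // x xb; have xa : h <= `|pos a - x|.
  by have := ler_normD (pos a - x) (x - pos b); rewrite addrA subrK (distrC x); lra.
by rewrite keep //; exact: (radial_seg rad1).
Qed.

Lemma spoke_inner cv c c' rho r A x : arc c c' A -> cv e0 = A -> rho < `|c - c'| ->
  spoke cv c rho r -> arc_inner c c' A x -> `|c - x| <= rho ->
  forall y, seg c x y -> y <> c -> arc_inner c c' A y.
Proof.
move=> arcA AE cc' [_ on_spoke] [Ax _ _] xr y sy yc; rewrite -AE in Ax *.
have yr : `|c - y| <= rho := le_trans (seg_dist_le sy) xr.
split => //; last by move=> yc'; move: yr; rewrite yc' leNgt cc'.
by apply/on_spoke => //; apply: (seg_subl _ sy); apply/on_spoke.
Qed.

Lemma uncrossed_inner_free pos cv : plane_drawing Va Ea src dst X pos cv ->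
  arc_inner (pos a) (pos b) (cv e0) `<=` free_point Va (Ea :\ e0)%SET pos cv.
Proof.
move=> D x [cx xa xb].
have freeV w : w \in Va -> pos w <> x.
  move=> wV wx; have cw : cv e0 (pos w) by rewrite wx.
  by case: (pd_joins_avoid D e0E e0_joins wV cw) => wE; [case: xa|case: xb]; rewrite -wx wE.
split=> // e; rewrite !inE => /andP[ee eE] ce.
have cr : crossing Va Ea pos cv e0 e x by split; rewrite // eq_sym.
by have [/(uncrossed eE)] := pd_crossing D cr.
Qed.

Lemma inner_polyarc (pos : V -> P) cv : plane_drawing Va Ea src dst X pos cv ->
  exists (pos' : V -> P) (cv' : E -> set P) (Q : set P), plane_drawing Va Ea src dst X pos' cv' /\
    polyarc (free_point Va (Ea :\ e0)%SET pos' cv') (pos' a) (pos' b) Q.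
Proof.
move=> D0; have [cv' [D [ra rab [sa spoke_a]] [rb rbb [sb spoke_b]]]] := straighten_ends D0.
exists pos, cv'; have [aV bV] := pd_joins_vert D e0E e0_joins.
set W := free_point _ _ _ _; have freeW := uncrossed_inner_free D; rewrite -/W in freeW.
have arc_ab := pd_joins_arc D e0E e0_joins; have arc_ba := arc_rev arc_ab.
have innerC : arc_inner (pos b) (pos a) (cv' e0) = arc_inner (pos a) (pos b) (cv' e0).
  by apply/seteqP; split => x [].
have oW : open W.
  by apply: (@open_free_point _ _ _ _ src dst X _ _ (plane_drawing_restrict D _ _)) => //;
  exact: subD1set.
have aW : ~ W (pos a) by move=> [/(_ a aV)].
have [xa xa_in xa_near] := arc_inner_near (proj1 spoke_a) arc_ab.
have [xb xb_in xb_near] := arc_inner_near (proj1 spoke_b) arc_ba.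
have from_xa : polyarc W (pos a) xa (seg xa (pos a)).
  constructor; first by case: xa_in => _ /eqP.
  rewrite seg_sym => y sy _ ya; apply: freeW.
  exact: (spoke_inner arc_ab erefl rab spoke_a xa_in xa_near sy ya).
have [Qb from_xb] : exists Q, polyarc W (pos a) xb Q.
  apply: (polyarc_connected aW oW (arc_inner_connected arc_ab) freeW); last by rewrite -innerC.
  by exists xa, (seg xa (pos a)).
have [Q from_b] : exists Q, polyarc W (pos a) (pos b) Q; last by exists Q.
apply: (polyarc_extend aW from_xb).
  by have [_ _ /eqP] := arc_ends arc_ba.
move=> y sy yb; apply: freeW; rewrite -innerC.
by apply: (spoke_inner arc_ba erefl _ spoke_b xb_in xb_near sy yb); rewrite distrC.
Qed.

Lemma contract_edge (Eb : {set E}) : drawable R Va Ea src dst X -> Eb \subset Ea :\ e0 ->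
  (forall e, e \in Eb -> ~ joins src dst e a b) ->
  drawable R (Va :\ b)%SET Eb (merge_vert a b \o src) (merge_vert a b \o dst) X.
Proof.
move=> [pos0 [cv0 D0]] EbE no_joins; have [pos [cv [Q [D polyQ]]]] := inner_polyarc D0.
have [aV bV] := pd_joins_vert D e0E e0_joins; have ab := pd_joins_neq D e0E e0_joins.
have Db : plane_drawing Va Eb src dst X pos cv.
  by apply: (plane_drawing_restrict D) => //; apply: fintype.subset_trans EbE (subD1set _ _).
apply: (contract_polyarc aV bV ab no_joins _ polyQ Db) => //.
  by move=> [/(_ a aV)].
move=> x Qx xb xa; case: (polyarc_sub polyQ Qx) => // -[freeV freeE]; split => // e eE.
by apply: freeE; exact: (fintype.subsetP EbE).
Qed.

End ContractUncrossed.
End ContractEdge.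


Section ContractEdges.
Variables (R : realType) (V E : finType) (X : E -> E -> Prop).
Implicit Type L : seq (E * (V * V)).

Fixpoint merge_all L (w : V) : V :=
  if L is (_, (a, b)) :: L' then merge_all L' (merge_vert a b w) else w.

(* Every edge on the list joins the two vertices listed with it, once the edges
   before it have been contracted. *)
Fixpoint contractible (src dst : E -> V) L : Prop :=
  if L is (e, (a, b)) :: L' then
    [/\ joins src dst e a b, a != b &
        contractible (merge_vert a b \o src) (merge_vert a b \o dst) L']
  else True.

Lemma contractible_neq src dst L e : contractible src dst L -> e \in unzip1 L -> src e != dst e.
Proof.
elim: L src dst => //= -[e' [a b]] L IH src dst [ends ab rest].
rewrite inE => /orP[/eqP ->|/(IH _ _ rest)]; first by case: ends => -[-> ->]; rewrite // eq_sym.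
by apply: contraNN => /eqP /= ->.
Qed.

Lemma contract_edges L (Va : {set V}) (Ea : {set E}) (src dst : E -> V) :
  drawable R Va Ea src dst X -> {subset unzip1 L <= Ea} ->
  (forall e f, e \in unzip1 L -> f \in Ea -> ~ X e f) -> contractible src dst L ->
  drawable R [set w in Va | w \notin [seq x.2.2 | x <- L]]%SET
    [set e in Ea | merge_all L (src e) != merge_all L (dst e)]%SET
    (merge_all L \o src) (merge_all L \o dst) X.
Proof.
elim: L Va Ea src dst => [|[e [a b]] L IH] Va Ea src dst D LE uncrossed /=.
  have -> : [set w in Va | w \notin [::]]%SET = Va by apply/finset.setP => w; rewrite !inE andbT.
  case: D => pos [cv D] _; exists pos, cv; apply: (plane_drawing_restrict D) => //.
  by apply/fintype.subsetP => f; rewrite inE => /andP[].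
case=> ends ab rest; have eE : e \in Ea by apply: LE; rewrite inE eqxx.
pose Eb := [set f in Ea | merge_vert a b (src f) != merge_vert a b (dst f)]%SET.
have inEb f : (f \in Eb) = (f \in Ea) && (merge_vert a b (src f) != merge_vert a b (dst f)).
  by rewrite inE.
have merge_a : merge_vert a b a = a by rewrite /merge_vert (negbTE ab).
have merge_b : merge_vert a b b = a by rewrite /merge_vert eqxx.
have Eb_joins f : f \in Eb -> ~ joins src dst f a b.
  by rewrite inEb => /andP[_] + [] [sE dE]; rewrite sE dE merge_a merge_b eqxx.
have sEb : Eb \subset Ea :\ e.
  apply/fintype.subsetP => f fEb; rewrite !inE; move: (fEb); rewrite inEb => /andP[-> _].
  by rewrite andbT; apply/eqP => fe; apply: (Eb_joins f) => //; rewrite fe.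
have Db := contract_edge eE (fun f => uncrossed e f (mem_head _ _)) ends D sEb Eb_joins.
have LEb f : f \in unzip1 L -> f \in Eb.
  by move=> fL; rewrite inEb (contractible_neq rest fL) LE // inE fL orbT.
have unL f g : f \in unzip1 L -> g \in Eb -> ~ X f g.
  by move=> fL; rewrite inEb => /andP[gE _]; apply: uncrossed; rewrite // inE fL orbT.
have := IH _ _ _ _ Db LEb unL rest; congr drawable; apply/finset.setP => w; rewrite !inE.
  by rewrite negb_or -!andbA andbCA.
case: (w \in Ea) => //=; apply: andb_idl.
by apply: contraNN => /eqP ->.
Qed.

End ContractEdges.
(** * Rerouting and inserting edges *)

Section EdgeOperations.
Variable R : realType.
Local Notation P := (R * R)%type.

Definition uncrossed_on (E : eqType) (L : seq E) (X : E -> E -> Prop) (e f : E) : Prop :=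
  [/\ X e f, e \notin L & f \notin L].

Section Uncross.
Variables (V E : finType) (Va : {set V}) (Ea : {set E}) (src dst : E -> V).
Variables (X : E -> E -> Prop) (pos : V -> P) (cv : E -> set P).
Hypothesis D : plane_drawing Va Ea src dst X pos cv.
Variables (e f : E) (p : P).
Hypothesis cef : crossing Va Ea pos cv e f p.

Let eE : e \in Ea. Proof. by case: cef. Qed.
Let fE : f \in Ea. Proof. by case: cef. Qed.
Let ef : e != f. Proof. by case: cef. Qed.
Let pos_neq_p w : w \in Va -> pos w <> p. Proof. by case: cef => _ _ _ _; exact. Qed.

(* The crossing point becomes the vertex None, at which e is cut off. The edge
   None is the part of f up to this vertex, the edge f itself keeps the rest. *)
Section Subdivide.
Variables A B1 B2 : set P.
Hypotheses (arcA : arc (pos (src e)) p A) (subA : A `<=` cv e) (A_dst : ~ A (pos (dst e))).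
Hypotheses (arcB1 : arc (pos (src f)) p B1) (arcB2 : arc p (pos (dst f)) B2).
Hypotheses (curve_f : cv f = B1 `|` B2) (meetB : B1 `&` B2 = [set p]).

Definition subdiv_vert : {set option V} := [set w | oapp (mem Va) true w]%SET.
Definition subdiv_edges : {set option E} := [set g | oapp (mem Ea) true g]%SET.
Definition subdiv_pos (w : option V) : P := oapp pos p w.
Definition subdiv_src (g : option E) : option V :=
  if g is Some g then (if g == f then None else Some (src g)) else Some (src f).
Definition subdiv_dst (g : option E) : option V :=
  if g is Some g then (if g == e then None else Some (dst g)) else None.
Definition subdiv_curve (g : option E) : set P :=
  if g is Some g then (if g == e then A else if g == f then B2 else cv g) else B1.
Definition subdiv_cross (g h : option E) : Prop :=
  if (g, h) is (Some g, Some h) then uncrossed_on [:: e; f] X g h else False.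

Let fe : f == e = false. Proof. by rewrite eq_sym; exact: negbTE ef. Qed.

Let original (g : option E) : E := odflt f g.

Let original_in g : g \in subdiv_edges -> original g \in Ea.
Proof. by case: g => [g|]; rewrite inE /=. Qed.

Let subdiv_curve_sub g : subdiv_curve g `<=` cv (original g).
Proof.
case: g => [g|] /= x; last by rewrite curve_f; left.
by case: eqP => [-> /subA//|_]; case: eqP => [->|//]; rewrite curve_f; right.
Qed.

Let meetB_p x : B1 x -> B2 x -> x = p.
Proof. by move=> x1 x2; have : (B1 `&` B2) x by []; rewrite meetB. Qed.

Let lift_crossing g h q : crossing subdiv_vert subdiv_edges subdiv_pos subdiv_curve g h q ->
  exists g' h', [/\ g = Some g', h = Some h', g' \notin [:: e; f], h' \notin [:: e; f] &
    crossing Va Ea pos cv g' h' q].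
Proof.
case=> gE hE gh [cg ch] nv.
have novert w : w \in Va -> pos w <> q by move=> wV; apply: (nv (Some w)); rewrite inE.
have qp : q <> p by move=> qp; apply: (nv None); rewrite ?inE.
have ogh : original g != original h.
  apply/eqP => gh'; case: g h gh cg ch gh' {gE hE} => [g|] [h|] //= gh cg ch gh'.
  - by rewrite gh' eqxx in gh.
  - by rewrite gh' fe eqxx in cg; apply: qp; exact: meetB_p.
  - by rewrite -gh' fe eqxx in ch; apply: qp; exact: meetB_p.
have cr : crossing Va Ea pos cv (original g) (original h) q.
  by split; rewrite ?original_in //; split; exact: subdiv_curve_sub.
have not_ef k k' : crossing Va Ea pos cv k k' q -> k \notin [:: e; f].
  move=> ckk; rewrite !inE; apply/negP => /orP[] /eqP kE; rewrite kE in ckk; apply: qp.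
    by have [_] := pd_one_crossing D ckk cef.
  by have [_] := pd_one_crossing D ckk (crossing_sym cef).
have g_not := not_ef _ _ cr; have h_not := not_ef _ _ (crossing_sym cr).
have some k : original k \notin [:: e; f] -> k = Some (original k).
  by case: k => //=; rewrite !inE eqxx orbT.
by exists (original g), (original h); split => //; exact: some.
Qed.

Let subdiv_curve_off g : g \notin [:: e; f] -> subdiv_curve (Some g) = cv g.
Proof. by rewrite !inE negb_or /= => /andP[/negbTE -> /negbTE ->]. Qed.

Let subdiv_arc g : g \in subdiv_edges ->
  arc (subdiv_pos (subdiv_src g)) (subdiv_pos (subdiv_dst g)) (subdiv_curve g).
Proof.
case: g => [g|] //; rewrite inE /= => gE; case: (eqVneq g e) => [->|ge].
  by rewrite (negbTE ef).
by case: (eqVneq g f) => [->//|_]; exact: (pd_arc D).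
Qed.

Let subdiv_avoid g w : g \in subdiv_edges -> w \in subdiv_vert ->
  subdiv_curve g (subdiv_pos w) -> w = subdiv_src g \/ w = subdiv_dst g.
Proof.
have [B1s B1p _] := arc_ends arcB1; have [B2p B2d _] := arc_ends arcB2.
case: w => [w|] gE; rewrite !inE /= => wV cw.
  have := pd_avoid D (original_in gE) wV (subdiv_curve_sub cw).
  case: g gE cw => [g|] gE /=; last first.
    by move=> B1w [->|wd]; [left|case: (pos_neq_p wV); apply: meetB_p; rewrite ?wd // -wd].
  case: (eqVneq g e) => [->|_].
    by rewrite (negbTE ef) => Aw [->|wd]; [left|case: A_dst; rewrite -wd].
  case: (eqVneq g f) => [->|_] cw [wE|->]; rewrite ?wE; auto.
  by case: (pos_neq_p (pd_src D fE)); apply: meetB_p; rewrite // -wE.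
case: g gE cw => [g|]; rewrite inE /= => gE; last by right.
case: (eqVneq g e) => [_|ge]; first by right.
case: (eqVneq g f) => [_|gf] cgp; first by left.
have ceg : crossing Va Ea pos cv e g p by case: cef => _ _ _ [cep _] nv; split; rewrite // eq_sym.
by have [fg _] := pd_one_crossing D cef ceg; rewrite fg eqxx in gf.
Qed.

Lemma subdivide_crossing :
  plane_drawing subdiv_vert subdiv_edges subdiv_src subdiv_dst subdiv_cross subdiv_pos subdiv_curve.
Proof.
split; [| |exact: subdiv_arc|exact: subdiv_avoid| |].
- move=> [w|] [w'|]; rewrite !inE //= => wV w'V.
  + by move/(pd_inj D wV w'V) => ->.
  + by move/(pos_neq_p wV).
  + by move/esym/(pos_neq_p w'V).
- move=> [g|]; rewrite !inE /= => gE; last by split; rewrite // (pd_src D).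
  by have [sV dV] := pd_ends D gE; case: eqP => _; case: eqP.
- move=> g h q /lift_crossing[g' [h' [-> -> g_not h_not cr]]].
  by have [Xgh tr] := pd_crossing D cr; rewrite !subdiv_curve_off.
- move=> g h k q r /lift_crossing[g' [h' [-> -> _ _ cr]]].
  by move=> /lift_crossing[_ [k' [[<-] -> _ _ /(pd_one_crossing D cr)[-> ->]]]].
Qed.

End Subdivide.

Lemma uncross : src e != src f ->
  drawable R Va Ea src (fun g => if g == e then src f else dst g) (uncrossed_on [:: e; f] X).
Proof.
move=> s_neq; have [_ _ _ [cep cfp] _] := cef.
have inner g : g \in Ea -> cv g p -> arc_inner (pos (src g)) (pos (dst g)) (cv g) p.
  by move=> gE cgp; split => // pE;
    [apply: (pos_neq_p (pd_src D gE))|apply: (pos_neq_p (pd_dst D gE))].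
have [A [A' [arcA arcA' AE AI]]] := arc_split (pd_arc D eE) (inner _ eE cep).
have [B1 [B2 [arcB1 arcB2 BE BI]]] := arc_split (pd_arc D fE) (inner _ fE cfp).
have subA : A `<=` cv e by rewrite AE => x Ax; left.
have A_dst : ~ A (pos (dst e)).
  have [_ A'd _] := arc_ends arcA' => Ad; apply: (pos_neq_p (pd_dst D eE)).
  by have : (A `&` A') (pos (dst e)) by []; rewrite AI.
have Dsub := subdivide_crossing arcA subA A_dst arcB1 arcB2 BE BI.
have fe : f == e = false by rewrite eq_sym; exact: negbTE ef.
have := @contract_edge R _ _ _ _ _ _ _ None (Some (src f)) None _ _ _ (subdiv_edges :\ None)%SET
  (ex_intro _ _ (ex_intro _ _ Dsub)).
rewrite inE => /(_ isT) /(_ (fun _ _ => id)) /(_ (or_introl (conj erefl erefl)))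
  /(_ (fintype.subxx _)).
move=> contracted; apply: (@drawable_relabel _ _ _ _ _ _ _ _ _ _ _ _ _ _ _ Some Some
  (contracted _)).
- move=> [g|]; rewrite !inE //= => gE; rewrite /joins /=.
  case: (eqVneq g f) => [->|gf]; rewrite ?fe.
    by case=> -[] // _ [] sd; have := pd_neq D fE; rewrite sd eqxx.
  by case: (eqVneq g e) => [->|ge] [] [] // [] ss; rewrite ss eqxx in s_neq.
- by move=> w w' _ _ [].
- by move=> g g' _ _ [].
- by move=> w wV; rewrite !inE.
- by move=> g gE; rewrite !inE.
- move=> g gE; split; [exact: (pd_src D)|by case: eqP => _; [exact: (pd_src D)|exact: (pd_dst D)]|].
  left; rewrite /= /merge_vert.
  by case: (eqVneq g f) => [->|gf] /=; [rewrite fe|case: (eqVneq g e) => [->|]].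
- by [].
Qed.

End Uncross.

Section InsertPath.
Variables (V E : finType) (Va : {set V}) (Ea : {set E}) (src dst : E -> V).
Variables (X : E -> E -> Prop) (pos : V -> P) (cv : E -> set P).
Hypothesis D : plane_drawing Va Ea src dst X pos cv.

Section AddPath.
Variables (u v t : V) (e1 e2 : E) (A A1 A2 : set P) (p : P).
Hypotheses (uV : u \in Va) (vV : v \in Va) (tV : t \notin Va).
Hypotheses (e1E : e1 \notin Ea) (e2E : e2 \notin Ea) (e12 : e1 != e2).
Hypotheses (e1_joins : joins src dst e1 u t) (e2_joins : joins src dst e2 t v).
Hypothesis inner_free : arc_inner (pos u) (pos v) A `<=` free_point Va Ea pos cv.
Hypotheses (p_inner : arc_inner (pos u) (pos v) A p).
Hypotheses (arc1 : arc (pos u) p A1) (arc2 : arc p (pos v) A2).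
Hypotheses (AE : A = A1 `|` A2) (AI : A1 `&` A2 = [set p]).

Let path_vert := (t |: Va)%SET.
Let path_edges := (e1 |: (e2 |: Ea))%SET.
Let path_pos w := if w == t then p else pos w.
Let path_curve e := if e == e1 then A1 else if e == e2 then A2 else cv e.

Let path_pos_old w : w \in Va -> path_pos w = pos w.
Proof. by rewrite /path_pos; case: eqP => // -> tVa; have := tV; rewrite tVa. Qed.

Let path_pos_new : path_pos t = p. Proof. by rewrite /path_pos eqxx. Qed.

Let path_curve1 : path_curve e1 = A1. Proof. by rewrite /path_curve eqxx. Qed.

Let path_curve2 : path_curve e2 = A2.
Proof. by rewrite /path_curve eqxx eq_sym (negbTE e12). Qed.

Let path_curve_old e : e \in Ea -> path_curve e = cv e.
Proof.
move=> eE; rewrite /path_curve; case: eqP => [ee|_]; first by have := e1E; rewrite -ee eE.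
by case: eqP => [ee|//]; have := e2E; rewrite -ee eE.
Qed.

Let path_edgesP e : e \in path_edges ->
  [/\ e = e1, joins src dst e u t, path_curve e = A1 & A1 `<=` A] \/
  [/\ e = e2, joins src dst e t v, path_curve e = A2 & A2 `<=` A] \/
  e \in Ea /\ path_curve e = cv e.
Proof.
rewrite !inE => /or3P[/eqP ->|/eqP ->|eE]; last by right; right; rewrite path_curve_old.
- by left; rewrite path_curve1; split => // x; rewrite AE; left.
- by right; left; rewrite path_curve2; split => // x; rewrite AE; right.
Qed.

Let A12_p x : A1 x -> A2 x -> x = p.
Proof. by move=> x1 x2; have : (A1 `&` A2) x by []; rewrite AI. Qed.

Let lift_crossing g h q : crossing path_vert path_edges path_pos path_curve g h q ->
  crossing Va Ea pos cv g h q.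
Proof.
case=> gE hE gh [cg ch] nv.
have novert w : w \in Va -> pos w <> q.
  by move=> wV; rewrite -path_pos_old //; apply: nv; rewrite !inE wV orbT.
have qp : q <> p by move=> qp; apply: (nv t); rewrite ?path_pos_new // !inE eqxx.
have off k : k \in Ea -> cv k q -> ~ A q.
  move=> kE ck Aq; case: (@inner_free q) => [|_ /(_ k kE)//].
  by split => // /esym; exact: novert.
case: (path_edgesP gE) (path_edgesP hE) => [[gE' _ gC sub]|[[gE' _ gC sub]|[gE' gC]]]
  [[hE' _ hC subh]|[[hE' _ hC subh]|[hE' hC]]]; rewrite gC in cg; rewrite hC in ch.
- by rewrite gE' hE' eqxx in gh.
- by case: qp; exact: A12_p.
- by case: (off h hE' ch); exact: sub.
- by case: qp; exact: A12_p.
- by rewrite gE' hE' eqxx in gh.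
- by case: (off h hE' ch); exact: sub.
- by case: (off g gE' cg); exact: subh.
- by case: (off g gE' cg); exact: subh.
- by [].
Qed.

Let vert_on_path w : w \in Va -> A (pos w) -> w = u \/ w = v.
Proof.
move=> wV Aw; case: (pselect (pos w = pos u)) => [/(pd_inj D wV uV)|wu]; first by left.
case: (pselect (pos w = pos v)) => [/(pd_inj D wV vV)|wv]; first by right.
by have [/(_ w wV)] := inner_free (And3 Aw wu wv).
Qed.

Let path_arc e : e \in path_edges -> arc (path_pos (src e)) (path_pos (dst e)) (path_curve e).
Proof.
have [pu pv] := (path_pos_old uV, path_pos_old vV).
case/path_edgesP=> [[_ ends -> _]|[[_ ends -> _]|[eE ->]]].
- by case: ends => -[-> ->]; rewrite path_pos_new pu //; exact: arc_rev.
- by case: ends => -[-> ->]; rewrite path_pos_new pv //; exact: arc_rev.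
- by have [sV dV] := pd_ends D eE; rewrite !path_pos_old //; exact: (pd_arc D).
Qed.

Let path_avoid e w : e \in path_edges -> w \in path_vert -> path_curve e (path_pos w) ->
  w = src e \/ w = dst e.
Proof.
have p_free := inner_free p_inner; have [_ _ /eqP vp] := arc_ends arc2.
have [A1u _ _] := arc_ends arc1; have [_ A2v _] := arc_ends arc2.
move=> eE; rewrite !inE => /orP[/eqP ->|wV]; rewrite ?path_pos_new ?path_pos_old //.
  case: (path_edgesP eE) => [[_ ends _ _]|[[_ ends _ _]|[eE' ->]]].
  - by case: ends => -[-> ->]; auto.
  - by case: ends => -[-> ->]; auto.
  - by case: p_free => _ /(_ e eE').
case: (path_edgesP eE) => [[_ ends -> sub]|[[_ ends -> sub]|[eE' ->]]]; last exact: (pd_avoid D).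
- move=> A1w; case: (vert_on_path wV (sub _ A1w)) => wE; first by case: ends => -[-> ->]; auto.
  by case: p_free => /(_ w wV); case; apply: A12_p => //; rewrite wE.
- move=> A2w; case: (vert_on_path wV (sub _ A2w)) => wE; last by case: ends => -[-> ->]; auto.
  by case: p_free => /(_ w wV); case; apply: A12_p => //; rewrite wE.
Qed.

Lemma plane_drawing_add_path : plane_drawing path_vert path_edges src dst X path_pos path_curve.
Proof.
have [p_free _] := inner_free p_inner.
split; [| |exact: path_arc|exact: path_avoid| |].
- move=> w w'; rewrite !inE => /orP[/eqP ->|wV] /orP[/eqP ->|w'V] //;
    rewrite ?path_pos_new ?path_pos_old //.
  + by move/esym/(p_free _ w'V).
  + by move/(p_free _ wV).
  + exact: (pd_inj D).
- move=> e /path_edgesP[[_ ends _ _]|[[_ ends _ _]|[eE _]]]; rewrite !inE.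
  + by case: ends => -[-> ->]; rewrite uV eqxx !orbT.
  + by case: ends => -[-> ->]; rewrite vV eqxx !orbT.
  + by have [-> ->] := pd_ends D eE; rewrite !orbT.
- move=> g h q /lift_crossing cr; have [gE hE _ _ _] := cr.
  by rewrite !path_curve_old //; exact: (pd_crossing D).
- by move=> g h k q r /lift_crossing cr /lift_crossing; exact: (pd_one_crossing D).
Qed.

End AddPath.

Lemma add_path (u v t : V) (e1 e2 : E) (A : set P) : u \in Va -> v \in Va -> t \notin Va ->
  e1 \notin Ea -> e2 \notin Ea -> e1 != e2 -> joins src dst e1 u t -> joins src dst e2 t v ->
  arc (pos u) (pos v) A -> arc_inner (pos u) (pos v) A `<=` free_point Va Ea pos cv ->
  drawable R (t |: Va)%SET (e1 |: (e2 |: Ea))%SET src dst X.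
Proof.
move=> uV vV tV e1E e2E e12 joins1 joins2 arcA free.
have [p p_inner _] := arc_inner_near ltr01 arcA.
have [A1 [A2 [arc1 arc2 AE AI]]] := arc_split arcA p_inner.
by do 2!eexists; exact: (plane_drawing_add_path uV vV tV e1E e2E e12 joins1 joins2 free p_inner
  arc1 arc2 AE AI).
Qed.

Lemma walk_arc (F : {set E}) (r : rel V) (u v : V) : F \subset Ea ->
  (forall x y, r x y -> exists2 e, e \in F & joins src dst e x y) ->
  connect r u v -> u != v ->
  exists2 A, arc (pos u) (pos v) A & forall x, A x -> exists2 e, e \in F & cv e x.
Proof.
move=> /fintype.subsetP FE rF /connectP[s rs vE] uv.
suff [_ //] : v \in Va /\ exists2 A, arc (pos u) (pos v) A &
    forall x, A x -> exists2 e, e \in F & cv e x.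
elim: s u rs vE uv => [|w s IH] u /=; first by move=> _ ->; rewrite eqxx.
case/andP=> /rF[e eF ends] rs vE uv.
have [uV wV] := pd_joins_vert D (FE _ eF) ends.
have arc_e := pd_joins_arc D (FE _ eF) ends.
case: (eqVneq w v) => [<-|wv]; first by split => //; exists (cv e) => // x cx; exists e.
have [vV [B arcB BF]] := IH w rs vE wv; split => //.
have puv : pos u <> pos v by move/(pd_inj D uV vV)/eqP; rewrite (negbTE uv).
have [C arcC CAB] := arc_join arc_e arcB puv.
by exists C => // x /CAB[cx|/BF]; [exists e|].
Qed.

End InsertPath.
End EdgeOperations.
(** * Sums of drawings *)

Section PuncturedPlane.
Variable R : realType.
Local Notation P := (R * R)%type.

Lemma open_embedding_inverse (psi phi : P -> P) (O O' : set P) : open O -> open O' ->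
  (forall x, O x -> O' (psi x)) -> (forall x, O x -> phi (psi x) = x) ->
  (forall y, O' y -> psi (phi y) = y) -> (forall x, O x -> {for x, continuous psi}) ->
  (forall y, O' y -> {for y, continuous phi}) -> open_embedding psi O.
Proof.
move=> oO oO' OO' phiK psiK cpsi cphi; split => //.
  by move=> x y Ox Oy xy; rewrite -(phiK x Ox) xy phiK.
move=> U oU UO; rewrite openE => _ [x Ux <-].
have O'x := OO' _ (UO _ Ux).
have near_U : \forall y \near psi x, U (phi y).
  by apply: (cphi _ O'x); rewrite /= phiK; [exact: open_nbhs_nbhs|exact: UO].
apply: filterS (filterI (open_nbhs_nbhs (conj oO' O'x)) near_U) => y [yO' Uy].
by exists (phi y); rewrite ?psiK.
Qed.

Definition off0 : set P := [set x | x <> 0].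

Lemma off0P x : off0 x <-> 0 < `|x|.
Proof. by rewrite normr_gt0; split=> /eqP. Qed.

Lemma off0_open : open off0.
Proof.
have -> : off0 = [set y | 0 < `|0 - y|]; last exact: open_dist_gt.
by apply/seteqP; split=> x /=; rewrite sub0r normrN => /off0P.
Qed.

Record homogeneous_homeo (k k' : P -> P) : Prop := HomogeneousHomeo {
  homog_continuous : continuous k;
  homog_continuousV : continuous k';
  homogK : cancel k k';
  homogKV : cancel k' k;
  homog_scale : forall c z, 0 < c -> k (c *: z) = c *: k z }.

Lemma homogeneous_homeo_sym k k' : homogeneous_homeo k k' -> homogeneous_homeo k' k.
Proof.
case=> ck ck' kK kKV kZ; split => // c z c0.
by rewrite -{1}(kKV z) -kZ.
Qed.

Lemma homogeneous_homeo_comp k k' h h' : homogeneous_homeo k k' -> homogeneous_homeo h h' ->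
  homogeneous_homeo (h \o k) (k' \o h').
Proof.
move=> [ck ck' kK kKV kZ] [ch ch' hK hKV hZ]; split.
- exact: continuous_fun_comp.
- exact: continuous_fun_comp.
- by move=> z /=; rewrite hK.
- by move=> z /=; rewrite kKV.
- by move=> c z c0 /=; rewrite kZ ?hZ.
Qed.

Lemma homog_off0 k k' z : homogeneous_homeo k k' -> off0 z -> off0 (k z).
Proof.
case=> _ _ kK _ kZ z0 kz; apply: z0; rewrite -(kK z) kz.
have k0 : k 0 = 0.
  have := kZ 2 0 (ltr0Sn _ _); rewrite scaler0 scaler_nat mulr2n => /esym/eqP.
  by rewrite -subr_eq0 addrK => /eqP.
by rewrite -[in LHS]k0 kK.
Qed.

Definition ray_map (k : P -> P) (r : R) (z : P) : P := (r * `|z| / `|k z|) *: k z.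

Section RayMap.
Variables (k k' : P -> P) (r : R).
Hypotheses (r0 : 0 < r) (homeo : homogeneous_homeo k k').

Lemma ray_map_norm z : off0 z -> `|ray_map k r z| = r * `|z|.
Proof.
move=> /(homog_off0 homeo)/off0P kz0; rewrite /ray_map normrZ ger0_norm.
  by rewrite divfK // gt_eqF.
by rewrite divr_ge0 // mulr_ge0 // ltW.
Qed.

Lemma ray_map_off0 z : off0 z -> off0 (ray_map k r z).
Proof. by move=> z0; apply/off0P; rewrite ray_map_norm // mulr_gt0 //; exact/off0P. Qed.

Lemma ray_map_continuous z : off0 z -> {for z, continuous (ray_map k r)}.
Proof.
move=> z0; have ck := homog_continuous homeo.
have kz : `|k z| != 0 by rewrite normr_eq0; apply/eqP; exact: (homog_off0 homeo).
apply: continuousZ; last exact: ck.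
apply: cvgM; first by apply: cvgM; [exact: cvg_cst|exact: norm_continuous].
by apply: cvgV => //; apply: (continuous_comp (ck z)); exact: norm_continuous.
Qed.

End RayMap.

Lemma ray_mapK k k' r z : 0 < r -> homogeneous_homeo k k' -> off0 z ->
  ray_map k' r^-1 (ray_map k r z) = z.
Proof.
move=> r0 homeo z0; have /off0P kz0 := homog_off0 homeo z0; have /off0P nz := z0.
have c0 : 0 < r * `|z| / `|k z| by rewrite divr_gt0 // mulr_gt0.
rewrite {1}/ray_map (ray_map_norm r0 homeo z0) mulKf ?gt_eqF // /ray_map.
rewrite (homog_scale (homogeneous_homeo_sym homeo)) // (homogK homeo).
move: (r * `|z| / `|k z|) c0 => c c0; rewrite scalerA normrZ gtr0_norm //.
by rewrite [X in X *: _](_ : _ = 1) ?scale1r //; field; rewrite !gt_eqF.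
Qed.

Lemma ray_map_embedding k k' r : 0 < r -> homogeneous_homeo k k' ->
  open_embedding (ray_map k r) off0.
Proof.
move=> r0 homeo; have rV0 : 0 < r^-1 by rewrite invr_gt0.
have homeoV := homogeneous_homeo_sym homeo.
apply: (@open_embedding_inverse _ (ray_map k' r^-1) _ off0 off0_open off0_open).
- by move=> x; exact: (ray_map_off0 _ homeo).
- by move=> x; exact: ray_mapK.
- by move=> y y0; rewrite -{1}(invrK r) ray_mapK.
- by move=> x; exact: (ray_map_continuous homeo).
- by move=> y; exact: (ray_map_continuous homeoV).
Qed.

Definition det2 (p q : P) : R := p.1 * q.2 - p.2 * q.1.

Lemma linear_homeo p q : det2 p q != 0 -> exists k k',
  [/\ homogeneous_homeo k k', forall c z, k (c *: z) = c *: k z, k p = (1, 0) & k q = (0, 1)].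
Proof.
move=> d0; exists (fun z => (det2 z q / det2 p q, det2 p z / det2 p q)).
exists (fun z => z.1 *: p + z.2 *: q); rewrite /det2 in d0 *.
split.
- split => [| |z|z|c z _].
  + by continuity.
  + by continuity.
  + by apply: plane_ext; rewrite !planeE /=; field.
  + by rewrite !planeE; apply: plane_ext => /=; field.
  + by apply: plane_ext; rewrite !planeE /=; field.
- by move=> c z; apply: plane_ext; rewrite !planeE /=; field.
- by apply: plane_ext => /=; field.
- by apply: plane_ext => /=; field.
Qed.

(* This map bends the left half of the horizontal axis onto the upper half of
   the vertical axis. *)
Definition fold_plane (z : P) : P := ((z.1 + z.2 + `|z.1|) / 2, (z.2 + `|z.1| - z.1) / 2).
Definition unfold_plane (z : P) : P := (z.1 - z.2, z.1 + z.2 - `|z.1 - z.2|).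

Lemma fold_plane_homeo : homogeneous_homeo fold_plane unfold_plane.
Proof.
split=> [| |z|z|c z c0].
- by rewrite /fold_plane; continuity.
- by rewrite /unfold_plane; continuity.
- rewrite /unfold_plane /fold_plane /=.
  have -> : (z.1 + z.2 + `|z.1|) / 2 - (z.2 + `|z.1| - z.1) / 2 = z.1 by lra.
  by apply: plane_ext => /=; lra.
- by rewrite /unfold_plane /fold_plane /=; apply: plane_ext => /=; lra.
- by rewrite /fold_plane !planeE normrM (gtr0_norm c0); apply: plane_ext; rewrite !planeE /=; ring.
Qed.

Lemma det2_eq0_opp p q : p <> 0 -> `|p| = `|q| -> p <> q -> det2 p q = 0 -> q = - p.
Proof.
move=> p0 pq_norm pq; rewrite /det2 => pq_det.
pose n := p.1 * p.1 + p.2 * p.2.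
have n0 : n != 0.
  apply/eqP => n0; apply: p0; have := sqr_ge0 p.1; have := sqr_ge0 p.2;
    rewrite !expr2 /n in n0 * => sq2 sq1.
  by apply: plane_ext; apply/eqP; rewrite -[_ == _]orbb -mulf_eq0; apply/eqP; lra.
pose l := (q.1 * p.1 + q.2 * p.2) / n.
have ql : q = l *: p.
  apply: plane_ext; rewrite !planeE /l; apply: (mulIf n0); rewrite mulrAC divfK //.
    transitivity ((q.1 * p.1 + q.2 * p.2) * p.1 - p.2 * (p.1 * q.2 - p.2 * q.1)).
      by rewrite /n; ring.
    by rewrite pq_det mulr0 subr0.
  transitivity ((q.1 * p.1 + q.2 * p.2) * p.2 + p.1 * (p.1 * q.2 - p.2 * q.1)).
    by rewrite /n; ring.
  by rewrite pq_det mulr0 addr0.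
have l1 : `|l| = 1.
  apply: (@mulIf _ `|p|); first by rewrite normr_eq0; apply/eqP.
  by rewrite mul1r -normrZ -ql.
case: (lerP 0 l) l1 => l0; first by rewrite ger0_norm // => l1; case: pq; rewrite ql l1 scale1r.
by rewrite ltr0_norm // => l1; rewrite ql -[l]opprK l1 scaleN1r.
Qed.

Definition corner (b : bool) : P := if b then (1, 0) else (0, 1).

Lemma corner_norm b : `|corner b| = 1.
Proof.
by case: b; rewrite /corner plane_norm /= normr0 normr1; [apply/max_idPl|apply/max_idPr].
Qed.

Lemma corner_inj : injective corner.
Proof. by move=> [] [] // [/eqP]; rewrite ?oner_eq0 // eq_sym oner_eq0. Qed.

Lemma straighten_pair p q : p <> 0 -> `|p| = `|q| -> p <> q -> exists k k',
  [/\ homogeneous_homeo k k', k p = corner true & k q = corner false].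
Proof.
move=> p0 pq_norm pq; case: (eqVneq (det2 p q) 0) => [d0|d0]; last first.
  by have [k [k' [homeo _ kp kq]]] := linear_homeo d0; exists k, k'.
have qE := det2_eq0_opp p0 pq_norm pq d0.
have d1 : det2 p (- p.2, p.1) != 0.
  rewrite /det2 /=; apply/eqP => n0; apply: p0.
  have := sqr_ge0 p.1; have := sqr_ge0 p.2; rewrite !expr2 => sq2 sq1.
  by apply: plane_ext; apply/eqP; rewrite -[_ == _]orbb -mulf_eq0; apply/eqP; lra.
have [k [k' [homeo kZ kp _]]] := linear_homeo d1.
have kq : k q = (-1, 0) by rewrite qE -scaleN1r kZ kp; apply: plane_ext; rewrite !planeE /=; ring.
exists (fold_plane \o k), (k' \o unfold_plane); split.
- exact: homogeneous_homeo_comp homeo fold_plane_homeo.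
- by rewrite /= kp /fold_plane /= normr1; apply: plane_ext => /=; lra.
- by rewrite /= kq /fold_plane /= normrN1; apply: plane_ext => /=; lra.
Qed.

Lemma polar_straighten p q rho : 0 < rho -> `|p| = rho -> `|q| = rho -> p <> q ->
  exists psi, [/\ open_embedding psi off0, forall x, off0 x -> `|psi x| = `|x| / rho,
                  psi p = corner true & psi q = corner false].
Proof.
move=> rho0 np nq pq; have p0 : p <> 0 by apply/off0P; rewrite np.
have [k [k' [homeo kp kq]]] := straighten_pair p0 (etrans np (esym nq)) pq.
have rhoV : 0 < rho^-1 by rewrite invr_gt0.
exists (ray_map k rho^-1); split.
- exact: ray_map_embedding homeo.
- by move=> x x0; rewrite (ray_map_norm rhoV homeo x0) mulrC.
- by rewrite /ray_map kp np mulVf ?gt_eqF // corner_norm divr1 scale1r.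
- by rewrite /ray_map kq nq mulVf ?gt_eqF // corner_norm divr1 scale1r.
Qed.

Definition inversion (z : P) : P := (`|z| ^- 2) *: z.

Lemma inversion_norm z : off0 z -> `|inversion z| = `|z|^-1.
Proof.
move=> /off0P z0; rewrite /inversion normrZ ger0_norm; last by rewrite invr_ge0 exprn_ge0.
by rewrite expr2 invfM -mulrA mulVf ?mulr1 // gt_eqF.
Qed.

Lemma inversionK z : off0 z -> inversion (inversion z) = z.
Proof.
move=> z0; rewrite {1}/inversion inversion_norm // /inversion scalerA exprVn invrK.
by rewrite mulfV ?scale1r // expf_neq0 // gt_eqF //; exact/off0P.
Qed.

Lemma inversion_off0 z : off0 z -> off0 (inversion z).
Proof. by move=> z0; apply/off0P; rewrite inversion_norm // invr_gt0; exact/off0P. Qed.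

Lemma inversion_continuous z : off0 z -> {for z, continuous inversion}.
Proof.
move=> /off0P z0; apply: continuousZ; last exact: cvg_id.
apply: cvgV; first by rewrite expf_neq0 // gt_eqF.
by rewrite /continuous_at expr2; apply: cvgM; exact: norm_continuous.
Qed.

Lemma inversion_embedding : open_embedding inversion off0.
Proof.
apply: (@open_embedding_inverse _ inversion _ off0 off0_open off0_open).
- exact: inversion_off0.
- exact: inversionK.
- exact: inversionK.
- exact: inversion_continuous.
- exact: inversion_continuous.
Qed.

Lemma inversion_corner b : inversion (corner b) = corner b.
Proof. by rewrite /inversion corner_norm expr1n invr1 scale1r. Qed.

Lemma translation_embedding (c : P) : open_embedding (fun z => z - c) setT.
Proof.
apply: (@open_embedding_inverse _ (fun z => z + c) setT setT openT openT) => //.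
- by move=> x _; rewrite subrK.
- by move=> y _; rewrite addrK.
- by move=> x _; have shift : continuous (fun z : P => z - c) by [continuity]; exact: shift.
- by move=> y _; have shift : continuous (fun z : P => z + c) by [continuity]; exact: shift.
Qed.

End PuncturedPlane.
Arguments corner R b : simpl never.

Section OpenedDrawings.
Variable R : realType.
Local Notation P := (R * R)%type.

(* A drawing from which a small disc around the vertex t has been removed, so
   that out is what remains of the plane: the edges ending at t now end at the
   points c e on the boundary of the disc. *)
Record opened (V E : finType) (Va : {set V}) (Ea : {set E}) (src dst : E -> V)
    (X : E -> E -> Prop) (t : V) (out : set P) (c : E -> P)
    (pos : V -> P) (cv : E -> set P) : Prop := Opened {
  op_inj : {in (Va :\ t)%SET &, injective pos};
  op_vert : forall w, w \in (Va :\ t)%SET -> out (pos w);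
  op_ends : forall e, e \in Ea -> src e \in (Va :\ t)%SET /\ dst e \in Va;
  op_arc : forall e, e \in Ea ->
    arc (pos (src e)) (if dst e == t then c e else pos (dst e)) (cv e);
  op_curve : forall e x, e \in Ea -> cv e x -> out x \/ (dst e = t /\ x = c e);
  op_avoid : forall e w, e \in Ea -> w \in (Va :\ t)%SET -> cv e (pos w) ->
    w = src e \/ w = dst e;
  op_crossing : forall e f p, crossing (Va :\ t)%SET Ea pos cv e f p -> out p ->
    X e f /\ transversal_at (R := R) p (cv e) (cv f);
  op_one_crossing : forall e f g p q, crossing (Va :\ t)%SET Ea pos cv e f p ->
    crossing (Va :\ t)%SET Ea pos cv e g q -> out p -> out q -> f = g /\ p = q }.

Lemma opened_transport (V E : finType) (Va : {set V}) (Ea : {set E}) (src dst : E -> V)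
    (X : E -> E -> Prop) (t : V) (out out' O : set P) (c c' : E -> P)
    (pos : V -> P) (cv : E -> set P) (psi : P -> P) :
  opened Va Ea src dst X t out c pos cv -> open_embedding psi O -> out `<=` O ->
  (forall e, e \in Ea -> dst e = t -> O (c e) /\ psi (c e) = c' e) ->
  (forall x, O x -> out' (psi x) <-> out x) ->
  opened Va Ea src dst X t out' c' (psi \o pos) (fun e => psi @` cv e).
Proof.
move=> D emb outO ports outE.
have curveO e x : e \in Ea -> cv e x -> O x.
  by move=> eE /(op_curve D eE)[/outO //|[dt ->]]; have [] := ports e eE dt.
have posO w : w \in (Va :\ t)%SET -> O (pos w) by move=> /(op_vert D)/outO.
have image_curve e x : e \in Ea -> O x -> (psi @` cv e) (psi x) <-> cv e x.
  move=> eE Ox; split=> [[y cy /(oe_inj emb (curveO _ _ eE cy) Ox) <-]//|cx].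
  by exists x.
have lift_crossing e f p : crossing (Va :\ t)%SET Ea (psi \o pos) (fun g => psi @` cv g) e f p ->
    out' p -> exists x, [/\ psi x = p, out x & crossing (Va :\ t)%SET Ea pos cv e f x].
  case=> eE fE ef [[x cx <-] [y cy yx]] nv out'x; have Ox := curveO _ _ eE cx.
  exists x; split => //; first exact/(outE _ Ox).
  split => //; first by rewrite -{2}(oe_inj emb (curveO _ _ fE cy) Ox yx).
  by move=> w wV wx; apply: (nv w wV); rewrite /= wx.
split.
- move=> w w' wV w'V /= /(oe_inj emb (posO _ wV) (posO _ w'V)); exact: (op_inj D).
- by move=> w wV; apply/(outE _ (posO _ wV)); exact: (op_vert D).
- exact: (op_ends D).
- move=> e eE; have := op_arc D eE => arc_e.
  have -> : (if dst e == t then c' e else (psi \o pos) (dst e)) =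
      psi (if dst e == t then c e else pos (dst e)).
    by case: eqP => // dt; have [_ ->] := ports e eE dt.
  apply: (arc_image _ _ arc_e) => [x cx|x y cx cy].
    by apply: (oe_continuous emb); exact: curveO cx.
  by apply: (oe_inj emb); [exact: curveO cx|exact: curveO cy].
- move=> e _ eE [x cx <-]; case: (op_curve D eE cx) => [out_x|[dt ->]].
    by left; apply/outE; [exact: curveO cx|].
  by right; have [_ ->] := ports e eE dt.
- by move=> e w eE wV /(image_curve _ _ eE (posO _ wV)); exact: (op_avoid D).
- move=> e f p cef /(lift_crossing _ _ _ cef)[x [<- out_x cx]]; have [eE fE _ _ _] := cef.
  have [Xef tr] := op_crossing D cx out_x; split => //.
  apply: (transversal_transport emb (outO _ out_x) _ _ tr) => y Oy; exact: image_curve.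
- move=> e f g p q /lift_crossing cef /lift_crossing ceg /cef[x [<- ox cx]] /ceg[y [<- oy cy]].
  by have [-> ->] := op_one_crossing D cx cy ox oy.
Qed.

Lemma extend_ports (E : finType) (F : {set E}) (lab : E -> bool) (z : E -> P) (rho : R) :
  0 < rho -> (forall e, e \in F -> `|z e| = rho) ->
  (forall e f, e \in F -> f \in F -> z e = z f <-> lab e = lab f) ->
  exists r : bool -> P, [/\ forall b, `|r b| = rho, r true <> r false &
    forall e, e \in F -> z e = r (lab e)].
Proof.
move=> rho0 znorm zlab.
have opp_neq (p : P) : `|p| = rho -> p <> - p.
  move=> np /eqP; rewrite -subr_eq0 opprK -mulr2n -scaler_nat scaler_eq0 pnatr_eq0 /= => /eqP p0.
  by move: np; rewrite p0 normr0; lra.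
have [p [np p_true p_false]] : exists p, [/\ `|p| = rho,
    forall e, e \in F -> lab e -> z e = p & forall e, e \in F -> ~~ lab e -> z e <> p].
  case: (pickP [pred e in F | lab e]) => [e /andP[eF le]|no_true].
    exists (z e); split; [exact: znorm| |] => f fF lf.
      by apply/(zlab _ _ fF eF); rewrite le lf.
    by move/(zlab _ _ fF eF); rewrite le (negbTE lf).
  have absurd e : e \in F -> ~~ lab e by move=> eF; have := no_true e; rewrite /= eF /= => ->.
  case: (pickP [in F]) => [e eF|F0].
    exists (- z e); split => [|f fF|f fF _]; rewrite ?normrN ?znorm // ?(negbTE (absurd f fF)) //.
    have -> : z f = z e by apply/(zlab _ _ fF eF); rewrite !(negbTE (absurd _ _)).
    exact/opp_neq/znorm.
  exists (rho, 0); split => [|f|f]; rewrite ?[f \in F]F0 //.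
  by rewrite plane_norm /= normr0 gtr0_norm //; apply/max_idPl/ltW.
case: (pickP [pred e in F | ~~ lab e]) => [e /andP[eF le]|no_false].
  exists (fun b => if b then p else z e); split.
  - by case=> //; exact: znorm.
  - by move/esym; exact: p_false.
  - move=> f fF; case: ifPn => lf; first exact: p_true.
    by apply/(zlab _ _ fF eF); rewrite (negbTE le) (negbTE lf).
exists (fun b => if b then p else - p); split.
- by case; rewrite ?normrN.
- exact: opp_neq.
- by move=> f fF; have := no_false f; rewrite /= fF /= => /negbFE lf; rewrite lf; exact: p_true.
Qed.

Section OpenVertex.
Variables (V E : finType) (Va : {set V}) (Ea : {set E}) (src dst : E -> V).
Variables (X : E -> E -> Prop) (t : V) (lab : E -> bool) (pos : V -> P) (cv : E -> set P).
Hypothesis D : plane_drawing Va Ea src dst X pos cv.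
Hypotheses (tV : t \in Va) (src_neq : forall e, e \in Ea -> src e != t).
Hypothesis lab_inj : {in [set e in Ea | dst e == t]%SET &, injective lab}.

Let at_vert_dst e : e \in Ea -> at_vert src dst t e = (dst e == t).
Proof. by move=> eE; rewrite /at_vert (negbTE (src_neq eE)). Qed.

Section Cut.
Variables (r0 rho : R) (rr : E -> P) (A : E -> set P).
Hypotheses (rho0 : 0 < rho) (cut : radial_cut Va Ea src dst pos cv t r0 rho rr A).

Let tail e : e \in Ea -> dst e == t -> curve_tail (pos t) (pos (src e)) (cv e) r0 rho (rr e) (A e).
Proof.
move=> eE dt; have := cut_tail cut eE; rewrite at_vert_dst // => /(_ dt).
by rewrite /other_end (negbTE (src_neq eE)).
Qed.

Let out : set P := [set x | rho < `|pos t - x|].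
Let cut_curve e := if dst e == t then A e else cv e.

Let cut_curve_near e x : e \in Ea -> cut_curve e x -> out x ->
  cv e x /\ \forall y \near x, cut_curve e y <-> cv e y.
Proof.
rewrite /cut_curve => eE; case: ifPn => dt cx xr; last first.
  by split => //; apply: (@nearW _ (nbhs x)) => y; split.
split; first exact: (tail_sub (tail eE dt)).
have xn : x <> rr e by move=> xe; move: xr; rewrite /out /= xe (tail_dist (tail eE dt)) ltxx.
by apply: filterS (tail_near (tail eE dt) cx xn) => y ->.
Qed.

Let cut_crossing_old e f p : crossing (Va :\ t)%SET Ea pos cut_curve e f p -> out p ->
  crossing Va Ea pos cv e f p.
Proof.
case=> eE fE ef [ce cf] nv out_p; split => //.
  by have [[? _] [? _]] := (cut_curve_near eE ce out_p, cut_curve_near fE cf out_p).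
move=> w wV wp; have := nv w; rewrite !inE wV andbT; case: (eqVneq w t) => [wt _|wt /(_ isT)//].
by move: out_p; rewrite /out /= -wp wt subrr normr0 ltNge ltW.
Qed.

Lemma cut_opened : opened Va Ea src dst X t out rr pos cut_curve.
Proof.
split.
- by move=> w w'; rewrite !inE => /andP[_ wV] /andP[_ w'V]; exact: (pd_inj D).
- by move=> w; rewrite !inE => /andP[wt wV]; exact: (cut_vert cut).
- by move=> e eE; rewrite !inE src_neq //; have [-> ->] := pd_ends D eE.
- move=> e eE; rewrite /cut_curve; case: ifPn => dt; last exact: (pd_arc D).
  exact: arc_rev (tail_arc (tail eE dt)).
- move=> e x eE; rewrite /cut_curve; case: ifPn => dt cx; last first.
    by left; apply: (cut_edge cut eE _ cx); rewrite at_vert_dst.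
  case: (lerP `|pos t - x| rho) => xr; last by left.
  by right; split; [exact/eqP|exact: (tail_out (tail eE dt) cx xr)].
- move=> e w eE; rewrite !inE => /andP[wt wV] ce.
  by apply: (pd_avoid D eE wV); have [] := cut_curve_near eE ce (cut_vert cut wV wt).
- move=> e f p cef out_p; have [eE fE _ [ce cf] _] := cef.
  have [Xef tr] := pd_crossing D (cut_crossing_old cef out_p); split => //.
  have [[_ near_e] [_ near_f]] := (cut_curve_near eE ce out_p, cut_curve_near fE cf out_p).
  exact: transversal_near near_e near_f tr.
- move=> e f g p q cef ceg out_p out_q.
  exact: (pd_one_crossing D (cut_crossing_old cef out_p) (cut_crossing_old ceg out_q)).
Qed.

Lemma cut_ports : exists r : bool -> P, [/\ forall b, `|r b| = rho, r true <> r false &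
  forall e, e \in Ea -> dst e = t -> rr e - pos t = r (lab e)].
Proof.
have inF e : (e \in [set e in Ea | dst e == t]%SET) = (e \in Ea) && (dst e == t) by rewrite inE.
have [||r [r_norm r_neq rE]] :=
    @extend_ports _ [set e in Ea | dst e == t]%SET lab (fun e => rr e - pos t) rho rho0.
- by move=> e; rewrite inF => /andP[eE dt]; rewrite distrC; exact: (tail_dist (tail eE dt)).
- move=> e f eF fF; split=> [/addIr rE|/(lab_inj eF fF) ->//].
  apply: contrapT => lef; apply: (radial_cut_end_neq rho0 cut _ _ _ _ _ rE).
  + by move: eF; rewrite inF => /andP[].
  + by move: fF; rewrite inF => /andP[].
  + by move: eF; rewrite inF => /andP[eE]; rewrite at_vert_dst.
  + by move: fF; rewrite inF => /andP[fE]; rewrite at_vert_dst.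
  + by apply/eqP => ef; apply: lef; rewrite ef.
by exists r; split => // e eE dt; apply: rE; rewrite inF eE dt eqxx.
Qed.

End Cut.

Lemma open_vertex : exists pos' cv',
  opened Va Ea src dst X t [set x | 1 < `|x|] (corner R \o lab) pos' cv'.
Proof.
have [rho [rr [A [/andP[rho0 _] cut]]]] := radial_cut_exists D tV (@ltr01 R).
have [r [r_norm r_neq rE]] := cut_ports rho0 cut.
have [psi [emb psi_norm psi_true psi_false]] :=
  polar_straighten rho0 (r_norm true) (r_norm false) r_neq.
have [pos1 [cv1 centered]] : exists pos1 cv1,
    opened Va Ea src dst X t [set x | rho < `|x|] (r \o lab) pos1 cv1.
  do 2!eexists; apply: (opened_transport (cut_opened rho0 cut) (translation_embedding (pos t)))
    => //.
  - by move=> e eE dt; split; rewrite //= rE.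
  - by move=> x _ /=; rewrite distrC.
do 2!eexists; apply: (opened_transport centered emb).
- by move=> x /= xr; apply/off0P; exact: lt_trans rho0 xr.
- move=> e eE _ /=; split; first by apply/off0P; rewrite r_norm.
  by case: (lab e).
- by move=> x x0 /=; rewrite psi_norm // ltr_pdivlMr // mul1r.
Qed.

Lemma open_vertex_inside : exists pos' cv',
  opened Va Ea src dst X t [set x | 0 < `|x| < 1] (corner R \o lab) pos' cv'.
Proof.
have [pos' [cv' opened_out]] := open_vertex.
do 2!eexists; apply: (opened_transport opened_out (inversion_embedding R)).
- by move=> x /= x1; apply/off0P; exact: lt_trans ltr01 x1.
- by move=> e eE _ /=; rewrite inversion_corner; split => //; apply/off0P; rewrite corner_norm.
- move=> x x0 /=; have nx : 0 < `|x| by apply/off0P.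
  by rewrite inversion_norm // invr_gt0 nx invf_lt1.
Qed.

End OpenVertex.
End OpenedDrawings.

Section Glue.
Variable R : realType.
Local Notation P := (R * R)%type.
Variables (V1 E1 : finType) (Va1 : {set V1}) (Ea1 : {set E1}) (src1 dst1 : E1 -> V1).
Variables (X1 : E1 -> E1 -> Prop) (t1 : V1) (lab1 : E1 -> bool).
Variables (V2 E2 : finType) (Va2 : {set V2}) (Ea2 : {set E2}) (src2 dst2 : E2 -> V2).
Variables (X2 : E2 -> E2 -> Prop) (t2 : V2) (lab2 : E2 -> bool).

Definition glue_port (b : bool) : V1 + V2 := if b then inl t1 else inr t2.
Definition glue_src (e : E1 + E2) : V1 + V2 :=
  match e with inl e => inl (src1 e) | inr e => inr (src2 e) end.
Definition glue_dst (e : E1 + E2) : V1 + V2 :=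
  match e with
  | inl e => if dst1 e == t1 then glue_port (lab1 e) else inl (dst1 e)
  | inr e => if dst2 e == t2 then glue_port (lab2 e) else inr (dst2 e)
  end.
Definition glue_cross (e f : E1 + E2) : Prop :=
  match e, f with
  | inl e, inl f => X1 e f | inr e, inr f => X2 e f | _, _ => False
  end.
Definition glue_vert : {set V1 + V2} :=
  [set w | match w with inl w => w \in Va1 | inr w => w \in Va2 end]%SET.
Definition glue_edge : {set E1 + E2} :=
  [set e | match e with inl e => e \in Ea1 | inr e => e \in Ea2 end]%SET.

(* The two points where the edges of t1 meet those of t2 take over the names of
   t1 and t2. *)
Section GlueOpened.
Variables (out1 out2 : set P) (port : bool -> P).
Variables (pos1 : V1 -> P) (cv1 : E1 -> set P) (pos2 : V2 -> P) (cv2 : E2 -> set P).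
Hypothesis O1 : opened Va1 Ea1 src1 dst1 X1 t1 out1 (port \o lab1) pos1 cv1.
Hypothesis O2 : opened Va2 Ea2 src2 dst2 X2 t2 out2 (port \o lab2) pos2 cv2.
Hypotheses (t1V : t1 \in Va1) (t2V : t2 \in Va2) (port_inj : injective port).
Hypotheses (port1 : forall b, ~ out1 (port b)) (port2 : forall b, ~ out2 (port b)).
Hypothesis out_disjoint : forall x, out1 x -> ~ out2 x.

Definition glue_pos (w : V1 + V2) : P :=
  match w with
  | inl w => if w == t1 then port true else pos1 w
  | inr w => if w == t2 then port false else pos2 w
  end.
Definition glue_curve (e : E1 + E2) : set P :=
  match e with inl e => cv1 e | inr e => cv2 e end.

Let glue_pos_port b : glue_pos (glue_port b) = port b.
Proof. by case: b; rewrite /= eqxx. Qed.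

Let glue_port_vert b : glue_port b \in glue_vert.
Proof. by case: b; rewrite inE. Qed.

Variant glue_vert_spec : V1 + V2 -> P -> Prop :=
  | GluePort b : glue_vert_spec (glue_port b) (port b)
  | GlueVert1 w of w \in (Va1 :\ t1)%SET & out1 (pos1 w) : glue_vert_spec (inl w) (pos1 w)
  | GlueVert2 w of w \in (Va2 :\ t2)%SET & out2 (pos2 w) : glue_vert_spec (inr w) (pos2 w).

Let glue_vertP w : w \in glue_vert -> glue_vert_spec w (glue_pos w).
Proof.
case: w => w; rewrite inE => wV /=.
  case: eqVneq => [->|wt]; first exact: (GluePort true).
  by have wV1 : w \in (Va1 :\ t1)%SET; [rewrite !inE wt|exact: (GlueVert1 wV1 (op_vert O1 wV1))].
case: eqVneq => [->|wt]; first exact: (GluePort false).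
by have wV2 : w \in (Va2 :\ t2)%SET; [rewrite !inE wt|exact: (GlueVert2 wV2 (op_vert O2 wV2))].
Qed.

Let glue_curve_out1 e x : e \in Ea1 -> cv1 e x -> (forall b, x <> port b) -> out1 x.
Proof. by move=> eE /(op_curve O1 eE)[//|[_ ->]] /(_ (lab1 e)). Qed.

Let glue_curve_out2 e x : e \in Ea2 -> cv2 e x -> (forall b, x <> port b) -> out2 x.
Proof. by move=> eE /(op_curve O2 eE)[//|[_ ->]] /(_ (lab2 e)). Qed.

Let glue_avoid_port e b : e \in glue_edge -> glue_curve e (port b) -> glue_port b = glue_dst e.
Proof.
case: e => e; rewrite inE /= => eE.
  by case/(op_curve O1 eE) => [/port1//|[-> /port_inj ->]]; rewrite eqxx.
by case/(op_curve O2 eE) => [/port2//|[-> /port_inj ->]]; rewrite eqxx.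
Qed.

Let glue_pos_inj : {in glue_vert &, injective glue_pos}.
Proof.
move=> w w' /glue_vertP[b|v vV ov|v vV ov] /glue_vertP[b'|v' v'V ov'|v' v'V ov'] E.
- by rewrite (port_inj E).
- by case: (port1 (b := b)); rewrite E.
- by case: (port2 (b := b)); rewrite E.
- by case: (port1 (b := b')); rewrite -E.
- by rewrite (op_inj O1 vV v'V E).
- by case: (out_disjoint ov); rewrite E.
- by case: (port2 (b := b')); rewrite -E.
- by case: (out_disjoint ov'); rewrite -E.
- by rewrite (op_inj O2 vV v'V E).
Qed.

Let glue_avoid e w : e \in glue_edge -> w \in glue_vert -> glue_curve e (glue_pos w) ->
  w = glue_src e \/ w = glue_dst e.
Proof.
have not_port1 x b : out1 x -> x <> port b by move=> + xb; rewrite xb; exact: port1.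
have not_port2 x b : out2 x -> x <> port b by move=> + xb; rewrite xb; exact: port2.
move=> eE /glue_vertP[b|v vV ov|v vV ov]; first by move/(glue_avoid_port eE); right.
- case: e eE => e; rewrite inE /= => eE ce; last first.
    case: (out_disjoint ov); apply: glue_curve_out2 ce _ => // b.
    exact: not_port1.
  have /andP[vt _] : (v != t1) && (v \in Va1) by rewrite -in_setD1.
  by case: (op_avoid O1 eE vV ce) => vE; rewrite -vE ?(negbTE vt); auto.
- case: e eE => e; rewrite inE /= => eE ce.
    by case: (out_disjoint _ ov); apply: glue_curve_out1 ce _ => // b; exact: not_port2.
  have /andP[vt _] : (v != t2) && (v \in Va2) by rewrite -in_setD1.
  by case: (op_avoid O2 eE vV ce) => vE; rewrite -vE ?(negbTE vt); auto.
Qed.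

Let glue_crossingP e f p : crossing glue_vert glue_edge glue_pos glue_curve e f p ->
  (exists e' f', [/\ e = inl e', f = inl f',
      crossing (Va1 :\ t1)%SET Ea1 pos1 cv1 e' f' p & out1 p]) \/
  (exists e' f', [/\ e = inr e', f = inr f',
      crossing (Va2 :\ t2)%SET Ea2 pos2 cv2 e' f' p & out2 p]).
Proof.
case=> eE fE ef [ce cf] nv.
have not_port b : p <> port b.
  by move=> pb; apply: (nv _ (glue_port_vert b)); rewrite glue_pos_port.
have nv1 w : w \in (Va1 :\ t1)%SET -> pos1 w <> p.
  rewrite !inE => /andP[wt wV]; have := nv (inl w).
  by rewrite inE /= (negbTE wt); exact.
have nv2 w : w \in (Va2 :\ t2)%SET -> pos2 w <> p.
  rewrite !inE => /andP[wt wV]; have := nv (inr w).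
  by rewrite inE /= (negbTE wt); exact.
case: e f eE fE ef ce cf => [e|e] [f|f]; rewrite !inE => eE fE ef ce cf.
- by left; exists e, f; split; [| |split|exact: glue_curve_out1 ce _].
- by case: (@out_disjoint p); [exact: glue_curve_out1 ce _|exact: glue_curve_out2 cf _].
- by case: (@out_disjoint p); [exact: glue_curve_out1 cf _|exact: glue_curve_out2 ce _].
- by right; exists e, f; split; [| |split|exact: glue_curve_out2 ce _].
Qed.

Lemma glue_opened : plane_drawing glue_vert glue_edge glue_src glue_dst glue_cross glue_pos
  glue_curve.
Proof.
split; [exact: glue_pos_inj| | |exact: glue_avoid| |].
- move=> [e|e]; rewrite !inE => eE /=.
    have [sV dV] := op_ends O1 eE; split; first by move: sV; rewrite !inE => /andP[].
    by case: eqP => // _; have := glue_port_vert (lab1 e); rewrite inE.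
  have [sV dV] := op_ends O2 eE; split; first by move: sV; rewrite !inE => /andP[].
  by case: eqP => // _; have := glue_port_vert (lab2 e); rewrite inE.
- move=> [e|e]; rewrite inE => eE /=.
    have [] := op_ends O1 eE; rewrite !inE => /andP[/negbTE -> _] _.
    by have := op_arc O1 eE; case: eqVneq => [_|/negbTE dt]; rewrite ?glue_pos_port //= dt.
  have [] := op_ends O2 eE; rewrite !inE => /andP[/negbTE -> _] _.
  by have := op_arc O2 eE; case: eqVneq => [_|/negbTE dt]; rewrite ?glue_pos_port //= dt.
- move=> e f p /glue_crossingP[[e' [f' [-> -> cef out_p]]]|[e' [f' [-> -> cef out_p]]]].
    exact: (op_crossing O1 cef out_p).
  exact: (op_crossing O2 cef out_p).
- move=> e f g p q /glue_crossingP[[e' [f' [-> -> cef out_p]]]|[e' [f' [-> -> cef out_p]]]].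
    case/glue_crossingP=> [[_ [g' [[<-] -> ceg out_q]]]|[_ [_ [//]]]].
    by have [-> ->] := op_one_crossing O1 cef ceg out_p out_q.
  case/glue_crossingP=> [[_ [_ [//]]]|[_ [g' [[<-] -> ceg out_q]]]].
  by have [-> ->] := op_one_crossing O2 cef ceg out_p out_q.
Qed.

End GlueOpened.

(* The second drawing is placed inside the disc left free by t1. *)
Lemma glue_drawable : drawable R Va1 Ea1 src1 dst1 X1 -> drawable R Va2 Ea2 src2 dst2 X2 ->
  t1 \in Va1 -> t2 \in Va2 ->
  (forall e, e \in Ea1 -> src1 e != t1) -> (forall e, e \in Ea2 -> src2 e != t2) ->
  {in [set e in Ea1 | dst1 e == t1]%SET &, injective lab1} ->
  {in [set e in Ea2 | dst2 e == t2]%SET &, injective lab2} ->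
  drawable R glue_vert glue_edge glue_src glue_dst glue_cross.
Proof.
move=> [p1 [c1 D1]] [p2 [c2 D2]] t1V t2V s1 s2 lab1_inj lab2_inj.
have [pos1 [cv1 O1]] := open_vertex D1 t1V s1 lab1_inj.
have [pos2 [cv2 O2]] := open_vertex_inside D2 t2V s2 lab2_inj.
do 2!eexists; apply: (glue_opened O1 O2 t1V t2V (@corner_inj R)).
- by move=> b /=; rewrite corner_norm ltxx.
- by move=> b /=; rewrite corner_norm ltxx andbF.
- by move=> x /= x1 /andP[_]; rewrite ltNge ltW.
Qed.

End Glue.

Lemma sum_eqE (A B : eqType) :
  (forall x y : A, ((inl x : A + B) == inl y) = (x == y)) *
  (forall x y : B, ((inr x : A + B) == inr y) = (x == y)) *
  (forall (x : A) (y : B), ((inl x : A + B) == inr y) = false) *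
  (forall (x : B) (y : A), ((inr x : A + B) == inl y) = false).
Proof. by []. Qed.

Section IntoSum.
Variables (T : finType) (A : {set T}).

Definition into_sum (x : T) : T + T := if x \in A then inl x else inr x.

Lemma into_sum_inj : injective into_sum.
Proof. by move=> x y; rewrite /into_sum; case: ifP => _; case: ifP => _ // []. Qed.

Lemma into_suml x : x \in A -> into_sum x = inl x.
Proof. by rewrite /into_sum => ->. Qed.

Lemma into_sumr x : x \notin A -> into_sum x = inr x.
Proof. by rewrite /into_sum => /negbTE ->. Qed.

End IntoSum.

Section TwoSum.
Variable R : realType.
Variables (V E : finType) (Va1 Va2 : {set V}) (Ea1 Ea2 : {set E}) (src dst : E -> V).
Variables (X : E -> E -> Prop) (u v t1 t2 : V) (f1 g1 f2 g2 : E).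
Hypotheses (D1 : drawable R Va1 Ea1 src dst X) (D2 : drawable R Va2 Ea2 src dst X).
Hypotheses (uv : u != v) (meetV : (Va1 :&: Va2)%SET = [set u; v]%SET).
Hypotheses (t1V : t1 \in Va1) (t2V : t2 \in Va2) (t1n : t1 \notin Va2) (t2n : t2 \notin Va1).
Hypotheses (f1E : f1 \in Ea1) (g1E : g1 \in Ea1) (f2E : f2 \in Ea2) (g2E : g2 \in Ea2).
Hypotheses (f1s : src f1 = u) (f1d : dst f1 = t1) (g1s : src g1 = v) (g1d : dst g1 = t1).
Hypotheses (f2s : src f2 = u) (f2d : dst f2 = t2) (g2s : src g2 = v) (g2d : dst g2 = t2).
Hypothesis at1 : forall e, e \in Ea1 -> src e != t1 /\ (dst e = t1 -> e = f1 \/ e = g1).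
Hypothesis at2 : forall e, e \in Ea2 -> src e != t2 /\ (dst e = t2 -> e = f2 \/ e = g2).
Hypothesis uncrossed : forall e h, e \in [:: f1; g1; f2; g2] -> ~ X e h.

Let in_both w : w \in Va1 -> w \in Va2 -> w = u \/ w = v.
Proof.
move=> w1 w2; have : w \in (Va1 :&: Va2)%SET by rewrite inE w1.
by rewrite meetV !inE => /orP[/eqP|/eqP]; auto.
Qed.

Let u_in : u \in Va1 /\ u \in Va2.
Proof. by apply/andP; rewrite -finset.in_setI meetV !inE eqxx. Qed.

Let v_in : v \in Va1 /\ v \in Va2.
Proof. by apply/andP; rewrite -finset.in_setI meetV !inE eqxx orbT. Qed.

Let neq_t1 w : w \in Va2 -> w != t1. Proof. by apply: contraTneq => ->. Qed.
Let neq_t2 w : w \in Va1 -> w != t2. Proof. by apply: contraTneq => ->. Qed.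

Let vu : v == u = false. Proof. by rewrite eq_sym; exact: negbTE. Qed.
Let t2u : t2 == u = false. Proof. by rewrite eq_sym; exact/negbTE/neq_t2/(proj1 u_in). Qed.

Let at_u e : bool := src e == u.
Let gsrc : E + E -> V + V := glue_src src src.
Let gdst : E + E -> V + V := glue_dst dst t1 at_u dst t2 at_u.
Let gcross : E + E -> E + E -> Prop := glue_cross X X.

(* In the glued drawing each of u and v occurs twice, and the two copies are
   joined by a path of two edges through a port. *)
Let paths : seq ((E + E) * ((V + V) * (V + V))) :=
  [:: (inl f1, (inl u, inl t1)); (inr f2, (inl u, inr u));
      (inl g1, (inl v, inr t2)); (inr g2, (inl v, inr v))].

Let glued : drawable R (glue_vert Va1 Va2) (glue_edge Ea1 Ea2) gsrc gdst gcross.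
Proof.
have lab_inj (Ea : {set E}) t f g : src f = u -> src g = v ->
    (forall e, e \in Ea -> src e != t /\ (dst e = t -> e = f \/ e = g)) ->
    {in [set e in Ea | dst e == t]%SET &, injective at_u}.
  move=> fu gv at_t e e'; rewrite !inE => /andP[eE /eqP et] /andP[e'E /eqP e't].
  rewrite /at_u; case: ((at_t e eE).2 et) ((at_t e' e'E).2 e't) => -> [] ->;
    by rewrite // fu gv eqxx vu.
apply: glue_drawable => //.
- by move=> e /at1[].
- by move=> e /at2[].
- exact: lab_inj at1.
- exact: lab_inj at2.
Qed.

Let merge : V + V -> V + V := merge_all paths.

Let merge_inl w : w != t1 -> merge (inl w) = inl w.
Proof. by move=> wt; rewrite /merge /= /merge_vert sum_eqE (negbTE wt). Qed.

Let merge_inr w : w \in Va2 -> w != t2 -> merge (inr w) = into_sum Va1 w.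
Proof.
move=> wV /negbTE wt; rewrite /into_sum /merge /= /merge_vert !sum_eqE.
case: (eqVneq w u) => [->|wu]; first by rewrite (proj1 u_in).
rewrite !sum_eqE wt !sum_eqE; case: (eqVneq w v) => [->|wv]; first by rewrite (proj1 v_in).
by case: ifPn => // w1; case: (in_both w1 wV) => wE; [rewrite wE eqxx in wu|rewrite wE eqxx in wv].
Qed.

Let paths_contractible : contractible gsrc gdst paths.
Proof.
have ut1 : u != t1 by apply: neq_t1; case: u_in.
have vt1 : v != t1 by apply: neq_t1; case: v_in.
have vt2 : v != t2 by apply: neq_t2; case: v_in.
rewrite /= /joins /gsrc /gdst /= f1d f2d g1d g2d /at_u f1s f2s g1s g2s !eqxx vu /=.
rewrite /merge_vert !(sum_eqE, eqxx, t2u, vu, negbTE ut1, negbTE vt1, negbTE vt2).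
by do ![split; auto].
Qed.

Let final_src e : e \in (Ea1 :|: Ea2)%SET -> merge (gsrc (into_sum Ea1 e)) = into_sum Va1 (src e).
Proof.
have [[p1 [c1 P1]] [p2 [c2 P2]]] := (D1, D2).
rewrite inE; case: (boolP (e \in Ea1)) => [e1 _|e1 /= e2].
  rewrite into_suml // merge_inl; last by have [] := at1 e1.
  by rewrite into_suml // (pd_src P1).
by rewrite into_sumr // merge_inr // ?(pd_src P2) //; have [] := at2 e2.
Qed.

Let final_edge e : e \in ((Ea1 :|: Ea2) :\: [set f1; g1; f2; g2])%SET ->
  [/\ e \in (Ea1 :|: Ea2)%SET, src e \in ((Va1 :|: Va2) :\: [set t1; t2])%SET,
      dst e \in ((Va1 :|: Va2) :\: [set t1; t2])%SET, src e != dst e &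
      merge (gdst (into_sum Ea1 e)) = into_sum Va1 (dst e)].
Proof.
have [[p1 [c1 P1]] [p2 [c2 P2]]] := (D1, D2).
rewrite !inE !negb_or -!andbA => /and5P[ef1 eg1 ef2 eg2].
case: (boolP (e \in Ea1)) => [e1 _|e1 /= e2]; rewrite ?orbT.
  have [sV dV] := pd_ends P1 e1; have [st dt] := at1 e1.
  have {}dt : dst e != t1.
    by apply/eqP => /dt[ee|ee]; [rewrite ee eqxx in ef1|rewrite ee eqxx in eg1].
  rewrite sV dV st dt !neq_t2 // (pd_neq P1) //; split => //.
  by rewrite into_suml // /gdst /= (negbTE dt) merge_inl // into_suml.
have [sV dV] := pd_ends P2 e2; have [st dt] := at2 e2.
have {}dt : dst e != t2.
  by apply/eqP => /dt[ee|ee]; [rewrite ee eqxx in ef2|rewrite ee eqxx in eg2].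
rewrite sV dV st dt !neq_t1 // !orbT (pd_neq P2) //; split => //.
by rewrite into_sumr // /gdst /= (negbTE dt) merge_inr.
Qed.

Lemma two_sum : drawable R ((Va1 :|: Va2) :\: [set t1; t2])%SET
  ((Ea1 :|: Ea2) :\: [set f1; g1; f2; g2])%SET src dst X.
Proof.
have D : drawable R _ _ _ _ _ := contract_edges glued _ _ paths_contractible.
apply: (@drawable_relabel _ _ _ _ _ _ _ _ _ _ _ _ _ _ _ (into_sum Va1) (into_sum Ea1) (D _ _)).
- by move=> e; rewrite !inE => /or4P[] /eqP ->.
- move=> e f; rewrite !inE => /or4P[] /eqP -> _; case: f => f;
    rewrite /gcross //=; by apply: uncrossed; rewrite !inE eqxx ?orbT.
- by move=> w w' _ _; exact: into_sum_inj.
- by move=> e e' _ _; exact: into_sum_inj.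
- move=> w; rewrite !inE negb_or => /andP[/andP[wt1 wt2] wV]; rewrite /into_sum.
  case: ifPn => w1; rewrite !sum_eqE /=.
    by rewrite w1 orbF.
  move: wV; rewrite (negbTE w1) /= => ->; rewrite (negbTE wt2) /=.
  by apply/norP; split; apply: contraNneq w1 => ->; [case: u_in|case: v_in].
- move=> e /final_edge[eE _ _ sd dE]; rewrite inE -/merge final_src // dE
    (inj_eq (@into_sum_inj _ _)) sd andbT.
  by move: eE; rewrite !inE /into_sum; case: ifPn => // _ /= ->.
- by move=> e /final_edge[eE sV dV _ dE]; split => //; left; rewrite /comp -/merge final_src.
- by move=> e f _ _ _; rewrite /into_sum; case: ifP => _; case: ifP => _.
Qed.

End TwoSum.

Section Pendant.
Variable R : realType.
Local Notation P := (R * R)%type.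

Lemma free_direction (I : finType) (f : I -> P) (c : P) (rho : R) : 0 < rho ->
  exists2 r, `|c - r| = rho & forall i, r <> f i.
Proof.
move=> rho0; apply: contrapT => none; set n := #|I|.
pose dir (k : 'I_n.+1) : P := c + (rho, rho * (k%:R / n.+1%:R)).
have dir_norm k : `|c - dir k| = rho.
  rewrite /dir opprD addrA subrr sub0r normrN plane_norm /= (gtr0_norm rho0).
  have k0 : 0 <= k%:R / n.+1%:R :> R by rewrite divr_ge0 ?ler0n.
  have k1 : k%:R / n.+1%:R <= 1 :> R by rewrite ler_pdivrMr ?ltr0n // mul1r ler_nat ltnW.
  move: (_ / _) k0 k1 => s s0 s1; rewrite ger0_norm; last by nra.
  by apply/max_idPl; nra.
have /boolp.choice[g gE] : forall k, exists i, dir k = f i.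
  move=> k; apply: contrapT => fresh; apply: none; exists (dir k) => // i ki.
  by apply: fresh; exists i.
have g_inj : injective g.
  move=> k k' gk; have : dir k = dir k' by rewrite !gE gk.
  have n0 : n.+1%:R != 0 :> R by rewrite pnatr_eq0.
  by move/addrI => -[] /(mulfI (lt0r_neq0 rho0))/(divIf n0)/eqP; rewrite eqr_nat => /eqP/val_inj.
by have := leq_card g g_inj; rewrite card_ord ltnn.
Qed.

Variables (V E : finType) (Va : {set V}) (Ea : {set E}) (src dst : E -> V).
Variables (X : E -> E -> Prop) (v : V).

Definition pendant_src (e : option E) : option V := if e is Some e then Some (src e) else Some v.
Definition pendant_dst (e : option E) : option V := if e is Some e then Some (dst e) else None.
Definition pendant_cross (e f : option E) : Prop :=
  if (e, f) is (Some e, Some f) then X e f else False.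
Definition pendant_vert : {set option V} := [set w | oapp (mem Va) true w]%SET.
Definition pendant_edge : {set option E} := [set e | oapp (mem Ea) true e]%SET.

Section AddSpoke.
Variables (pos : V -> P) (cv : E -> set P) (r : P).
Hypotheses (D : plane_drawing Va Ea src dst X pos cv) (vV : v \in Va) (vr : pos v != r).
Hypothesis vert_meets : forall w, w \in Va -> seg (pos v) r (pos w) -> w = v.
Hypothesis edge_meets : forall e x, e \in Ea -> cv e x -> seg (pos v) r x -> x = pos v.

Lemma add_spoke : plane_drawing pendant_vert pendant_edge pendant_src pendant_dst pendant_cross
  (oapp pos r) (oapp cv (seg (pos v) r)).
Proof.
have vert_off w : w \in Va -> pos w <> r.
  move=> wV wr; have wv : w = v by apply: vert_meets; rewrite // wr; exact: seg_r.
  by move: vr; rewrite -wr wv eqxx.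
have edge_off e : e \in Ea -> ~ cv e r.
  by move=> eE cr; move: vr; rewrite -(edge_meets eE cr (seg_r _ _)) eqxx.
have lift_crossing e f p :
    crossing pendant_vert pendant_edge (oapp pos r) (oapp cv (seg (pos v) r)) e f p ->
    exists e' f', [/\ e = Some e', f = Some f' & crossing Va Ea pos cv e' f' p].
  case=> eE fE ef [ce cf] nv; have novert w : w \in Va -> pos w <> p.
    by move=> wV; apply: (nv (Some w)); rewrite inE.
  case: e f eE fE ef ce cf => [e|] [f|]; rewrite !inE //= => eE fE ef ce cf.
  - by exists e, f; split.
  - by case: (novert v vV); rewrite (edge_meets eE ce cf).
  - by case: (novert v vV); rewrite (edge_meets fE cf ce).
split.
- move=> [w|] [w'|]; rewrite !inE //= => wV w'V.
  + by move/(pd_inj D wV w'V) ->.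
  + by move/(vert_off _ wV).
  + by move/esym/(vert_off _ w'V).
- by move=> [e|]; rewrite !inE //= => /(pd_ends D).
- by move=> [e|]; rewrite !inE /=; [exact: (pd_arc D)|move=> _; exact: seg_arc].
- move=> [e|] [w|]; rewrite !inE /= => eE wV.
  + by move/(pd_avoid D eE wV) => [->|->]; [left|right].
  + by move/(edge_off _ eE).
  + by move/(vert_meets wV) ->; left.
  + by right.
- by move=> e f p /lift_crossing[e' [f' [-> -> cef]]]; exact: (pd_crossing D cef).
- move=> e f g p q /lift_crossing[e' [f' [-> -> cef]]] /lift_crossing[_ [g' [[<-] -> ceg]]].
  by have [-> ->] := pd_one_crossing D cef ceg.
Qed.

End AddSpoke.

Lemma add_pendant : drawable R Va Ea src dst X -> v \in Va ->
  drawable R pendant_vert pendant_edge pendant_src pendant_dst pendant_cross.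
Proof.
move=> [pos [cv0 D0]] vV.
have [rho [rr [cv [/andP[rho0 _] D rad _]]]] := radial_redraw D0 vV (@ltr01 R).
have [r r_norm r_free] := free_direction rr (pos v) rho0.
have near x : seg (pos v) r x -> `|pos v - x| <= rho by move=> /seg_dist_le; rewrite r_norm.
do 2!eexists; apply: (@add_spoke pos cv r D vV).
- by apply: contraTneq rho0 => vr; rewrite -r_norm vr subrr normr0 ltxx.
- by move=> w wV /near; apply: contraTeq => wv; rewrite -ltNge; exact: (radial_vert rad).
- move=> e x eE cx sx; have xr := near x sx.
  case: (boolP (at_vert src dst v e)) => ev; last first.
    by have := radial_edge rad eE ev cx; rewrite ltNge xr.
  apply: contrapT => xv; apply: (r_free e).
  apply: (seg_meet rho0 r_norm (radial_dist rad eE ev) sx _ xv).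
  exact/(radial_seg rad eE ev xr).
Qed.

End Pendant.

Section SmallSums.
Variable R : realType.
Variables (V E : finType) (Va1 Va2 : {set V}) (Ea1 Ea2 : {set E}) (src dst : E -> V).
Variables (X : E -> E -> Prop).
Hypotheses (D1 : drawable R Va1 Ea1 src dst X) (D2 : drawable R Va2 Ea2 src dst X).

Let lsrc v1 v2 := glue_src (pendant_src src v1) (pendant_src src v2).
Let ldst := glue_dst (pendant_dst dst) None (fun=> true) (pendant_dst dst) None (fun=> true).

Lemma link_drawable v1 v2 : v1 \in Va1 -> v2 \in Va2 -> drawable R
  (glue_vert (pendant_vert Va1) (pendant_vert Va2))
    (glue_edge (pendant_edge Ea1) (pendant_edge Ea2))
  (lsrc v1 v2) ldst (glue_cross (pendant_cross X) (pendant_cross X)).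
Proof.
move=> v1V v2V; apply: glue_drawable (add_pendant D1 v1V) (add_pendant D2 v2V) _ _ _ _ _ _.
- by rewrite inE.
- by rewrite inE.
- by case.
- by case.
- by move=> [e|] [f|]; rewrite !inE ?andbF.
- by move=> [e|] [f|]; rewrite !inE ?andbF.
Qed.

Let vert_copy w : option V + option V := if w \in Va1 then inl (Some w) else inr (Some w).
Let edge_copy e : option E + option E := if e \in Ea1 then inl (Some e) else inr (Some e).

Let vert_copy_inj : injective vert_copy.
Proof. by move=> w w'; rewrite /vert_copy; case: ifP => _; case: ifP => _ // []. Qed.

Let edge_copy_inj : injective edge_copy.
Proof. by move=> e e'; rewrite /edge_copy; case: ifP => _; case: ifP => _ // []. Qed.

Let copies_drawable paths v1 v2 (m := merge_all paths) : v1 \in Va1 -> v2 \in Va2 ->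
  {subset unzip1 paths <= [:: inl None; inr None]} -> contractible (lsrc v1 v2) ldst paths ->
  (forall w, w \in (Va1 :|: Va2)%SET -> vert_copy w \notin [seq x.2.2 | x <- paths]) ->
  (forall w, w \in Va1 -> m (inl (Some w)) = vert_copy w) ->
  (forall w, w \in Va2 -> m (inr (Some w)) = vert_copy w) ->
  drawable R (Va1 :|: Va2)%SET (Ea1 :|: Ea2)%SET src dst X.
Proof.
move=> v1V v2V pendants contr not_merged m1 m2.
have [[p1 [c1 P1]] [p2 [c2 P2]]] := (D1, D2).
have ends e : e \in (Ea1 :|: Ea2)%SET -> [/\ src e \in (Va1 :|: Va2)%SET,
    dst e \in (Va1 :|: Va2)%SET, src e != dst e &
    m (lsrc v1 v2 (edge_copy e)) = vert_copy (src e) /\ m (ldst (edge_copy e)) = vert_copy (dst e)].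
  rewrite !inE /edge_copy; case: ifPn => [e1 _|e1 /= e2].
    by have [sV dV] := pd_ends P1 e1; rewrite sV dV (pd_neq P1) //= !m1.
  by have [sV dV] := pd_ends P2 e2; rewrite sV dV (pd_neq P2) //= !m2 ?orbT.
have D := contract_edges (link_drawable v1V v2V) _ _ contr.
apply: (@drawable_relabel _ _ _ _ _ _ _ _ _ _ _ _ _ _ _ vert_copy edge_copy (D _ _)) => //.
- by move=> e /pendants; rewrite !inE => /orP[] /eqP -> /=; rewrite inE.
- by move=> e f /pendants; rewrite !inE => /orP[] /eqP -> _; case: f => -[f|] [].
- by move=> w w' _ _; exact: vert_copy_inj.
- by move=> e e' _ _; exact: edge_copy_inj.
- move=> w wV; rewrite inE not_merged // andbT; move: wV; rewrite !inE /vert_copy.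
  by case: ifPn => [w1|w1 /= w2]; rewrite inE.
- move=> e eE; have [_ _ sd [sE dE]] := ends e eE;
    rewrite inE -/m sE dE (inj_eq vert_copy_inj) sd andbT.
  by move: eE; rewrite !inE /edge_copy; case: ifPn => [e1|e1 /= e2]; rewrite inE.
- by move=> e /ends[sV dV _ [sE dE]]; split => //; left.
- by move=> e f _ _ _; rewrite /edge_copy; case: ifP => _; case: ifP.
Qed.

Lemma zero_sum : (Va1 :&: Va2)%SET = finset.set0 ->
  drawable R (Va1 :|: Va2)%SET (Ea1 :|: Ea2)%SET src dst X.
Proof.
move=> disjV; have [[p1 [c1 P1]] [p2 [c2 P2]]] := (D1, D2).
have notin1 w : w \in Va2 -> w \in Va1 = false.
  by move=> w2; apply/negP => w1; have := finset.in_set0 w; rewrite -disjV inE w1 w2.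
have [V10|[v1 v1V]] := set_0Vmem Va1.
  have E10 : Ea1 = finset.set0.
    by apply/finset.setP => e; rewrite inE; apply/negP => /(pd_src P1); rewrite V10 inE.
  by rewrite V10 E10 !finset.set0U.
have [V20|[v2 v2V]] := set_0Vmem Va2.
  have E20 : Ea2 = finset.set0.
    by apply/finset.setP => e; rewrite inE; apply/negP => /(pd_src P2); rewrite V20 inE.
  by rewrite V20 E20 !finset.setU0.
apply: (@copies_drawable [::] v1 v2 v1V v2V) => //.
- by move=> w w1; rewrite /vert_copy w1.
- by move=> w w2; rewrite /vert_copy notin1.
Qed.

Lemma one_sum v : (Va1 :&: Va2)%SET = [set v]%SET ->
  drawable R (Va1 :|: Va2)%SET (Ea1 :|: Ea2)%SET src dst X.
Proof.
move=> meetV; have [v1V v2V] : v \in Va1 /\ v \in Va2.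
  by apply/andP; rewrite -finset.in_setI meetV inE.
have shared w : w \in Va2 -> w \in Va1 -> w = v.
  by move=> w2 w1; apply/set1P; rewrite -meetV inE w1.
have someE (T : eqType) (x y : T) : (Some x == Some y) = (x == y) by [].
apply: (@copies_drawable [:: (inl None, (inl (Some v), inl None));
    (inr None, (inl (Some v), inr (Some v)))] v v v1V v2V) => [e|||w w1|w w2].
- by rewrite !inE.
- by rewrite /= /joins /=; do ![split; auto].
- move=> w _; rewrite /= !inE /vert_copy.
  by case: ifPn => // w1; rewrite !sum_eqE someE; apply: contraNneq w1 => ->.
- by rewrite /= /merge_vert !sum_eqE /vert_copy w1.
- rewrite /= /merge_vert !sum_eqE someE /vert_copy; case: eqVneq => [->|wv]; first by rewrite v1V.
  by case: ifPn => // /(shared _ w2) wE; rewrite wE eqxx in wv.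
Qed.

End SmallSums.

Section BookDrawing.
Variable R : realType.
Local Notation P := (R * R)%type.

Definition parabola (l h x : R) : R := (x - l) * (h - x).

Definition parabola_arc (s l h : R) : set P :=
  [set q | l <= q.1 <= h /\ q.2 = s * parabola l h q.1].

Lemma arc_parabola s l h : l < h -> arc (l, 0) (h, 0) (parabola_arc s l h).
Proof.
move=> lh; pose f (t : R) := l + clamp t * (h - l).
have f_continuous : continuous f by have cc := @clamp_continuous R; rewrite /f; continuity.
exists (fun t => (f t, s * parabola l h (f t))); split.
- by rewrite /parabola; continuity.
- move=> t t' tI t'I [] /addrI + _; rewrite !clamp_id //; apply: mulIf.
  by rewrite subr_eq0 gt_eqF.
- rewrite /f !clamp_id ?in01_0 ?in01_1 // mul0r addr0 mul1r addrC subrK.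
  by rewrite /parabola !subrr mul0r !mulr0.
- move=> t; split => //=; have /andP[c0 c1] := clamp_in01 t; rewrite /f.
  by apply/andP; split; nra.
- move=> [x y] [/andP[/= x0 x1] yE]; have tI : in01 ((x - l) / (h - l)).
    by rewrite /in01 divr_ge0 ?ler_pdivrMr ?mul1r; lra.
  exists ((x - l) / (h - l)) => //.
  have -> : f ((x - l) / (h - l)) = x.
    by rewrite /f clamp_id // divfK; [lra|rewrite subr_eq0 gt_eqF].
  by rewrite yE.
Qed.

Lemma parabola_eq0 l h x : parabola l h x = 0 -> x = l \/ x = h.
Proof. by move/eqP; rewrite mulf_eq0 !subr_eq0 => /orP[] /eqP ->; auto. Qed.

Lemma parabola_nested l h l' h' x : l <= l' -> h' <= h -> l' < x < h' ->
  parabola l h x = parabola l' h' x -> l = l' /\ h = h'.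
Proof. by rewrite /parabola => ll hh /andP[lx xh] E; split; nra. Qed.

Variables (V E : finType) (Va : {set V}) (Ea : {set E}) (src dst : E -> V).
Variables (X : E -> E -> Prop) (ord : V -> nat) (page : E -> bool).

Definition low_end (e : E) : nat := minn (ord (src e)) (ord (dst e)).
Definition high_end (e : E) : nat := maxn (ord (src e)) (ord (dst e)).

Hypothesis ord_inj : {in Va &, injective ord}.
Hypothesis ends : forall e, e \in Ea -> [/\ src e \in Va, dst e \in Va & src e != dst e].
Hypothesis simple : forall e f, e \in Ea -> f \in Ea ->
  low_end e = low_end f -> high_end e = high_end f -> e = f.
Hypothesis laminar : forall e f, e \in Ea -> f \in Ea -> e != f -> page e = page f ->
  [|| (high_end e <= low_end f)%N, (high_end f <= low_end e)%N,
      (low_end e <= low_end f)%N && (high_end f <= high_end e)%N |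
      (low_end f <= low_end e)%N && (high_end e <= high_end f)%N].

Let side e : R := if page e then 1 else -1.
Let book_pos w : P := ((ord w)%:R, 0).
Let book_curve e := parabola_arc (side e) (low_end e)%:R (high_end e)%:R.

Let side_neq0 e : side e != 0.
Proof. by rewrite /side; case: ifP; rewrite ?oppr_eq0 oner_eq0. Qed.

Let low_high e : e \in Ea -> (low_end e < high_end e)%N.
Proof.
move=> eE; have [sV dV sd] := ends eE; rewrite /low_end /high_end.
have : ord (src e) != ord (dst e) by apply: contraNN sd => /eqP /ord_inj ->.
by case: (ltngtP (ord (src e)) (ord (dst e))).
Qed.

Let end_positions e :
  (book_pos (src e) = ((low_end e)%:R, 0) /\ book_pos (dst e) = ((high_end e)%:R, 0)) \/
  (book_pos (src e) = ((high_end e)%:R, 0) /\ book_pos (dst e) = ((low_end e)%:R, 0)).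
Proof.
by rewrite /book_pos /low_end /high_end; case: (leqP (ord (src e)) (ord (dst e))) => _; auto.
Qed.

Let on_axis e p : e \in Ea -> book_curve e p -> p.2 = 0 ->
  p = book_pos (src e) \/ p = book_pos (dst e).
Proof.
case: p => x y eE [_ /= yE] y0; have := end_positions e.
have [xE|xE] : x = (low_end e)%:R \/ x = (high_end e)%:R.
  by apply: parabola_eq0; apply: (mulfI (side_neq0 e)); rewrite -yE y0 mulr0.
- by case=> -[-> ->]; rewrite xE y0; auto.
- by case=> -[-> ->]; rewrite xE y0; auto.
Qed.

Let off_axis e p : book_curve e p -> p.2 != 0 ->
  (low_end e)%:R < p.1 < (high_end e)%:R /\ (0 < p.2) = page e.
Proof.
case=> /andP[lx xh] yE y0.
have inner : (low_end e)%:R < p.1 < (high_end e)%:R.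
  rewrite !lt_neqAle lx xh !andbT; apply/andP; split; apply: contraNneq y0.
    by rewrite yE /parabola => ->; rewrite subrr mul0r mulr0.
  by rewrite yE /parabola => ->; rewrite subrr !mulr0.
split => //; case/andP: inner => lx' xh'; rewrite yE /side /parabola.
by case: (page e); nra.
Qed.

Let uncrossed e f p : ~ crossing Va Ea book_pos book_curve e f p.
Proof.
case=> eE fE ef [ce cf] nv; have [sV dV _] := ends eE.
case: (eqVneq p.2 0) => [/(on_axis eE ce)[pE|pE]|y0].
- by case: (nv _ sV).
- by case: (nv _ dV).
have [/andP[le he] pe] := off_axis ce y0; have [/andP[lf hf] pf] := off_axis cf y0.
have pg : page e = page f by rewrite -pe -pf.
have heights :
    parabola (low_end e)%:R (high_end e)%:R p.1 = parabola (low_end f)%:R (high_end f)%:R p.1.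
  by apply: (mulfI (side_neq0 e)); case: ce cf => _ <- [_ ->]; rewrite /side pg.
have nested g g' : g \in Ea -> g' \in Ea -> g != g' ->
    (low_end g')%:R < p.1 < (high_end g')%:R -> (low_end g <= low_end g')%N ->
    (high_end g' <= high_end g)%N -> parabola (low_end g)%:R (high_end g)%:R p.1 =
    parabola (low_end g')%:R (high_end g')%:R p.1 -> False.
  move=> gE g'E gg' inner; rewrite -!(ler_nat R) => lg hg same.
  have [/eqP + /eqP] := parabola_nested lg hg inner same; rewrite !eqr_nat => /eqP ll /eqP hh.
  by rewrite (simple gE g'E ll hh) eqxx in gg'.
case/or4P: (laminar eE fE ef pg) => [|||/andP[ll hh]].
- by rewrite -(ler_nat R); lra.
- by rewrite -(ler_nat R); lra.
- by case/andP=> ll hh; apply: (nested e f) => //; apply/andP.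
- by apply: (nested f e); rewrite // 1?eq_sym //; apply/andP.
Qed.

Lemma book_drawing : drawable R Va Ea src dst X.
Proof.
exists book_pos, book_curve; split.
- by move=> w w' wV w'V [] /eqP; rewrite eqr_nat => /eqP; exact: ord_inj.
- by move=> e /ends[].
- move=> e eE; have : arc ((low_end e)%:R, 0) ((high_end e)%:R, 0) (book_curve e).
    by apply: arc_parabola; rewrite ltr_nat low_high.
  by case: (end_positions e) => -[-> ->] //; exact: arc_rev.
- move=> e w eE wV /(on_axis eE) /(_ erefl) wE; have [sV dV _] := ends eE.
  case: wE => -[] /eqP; rewrite eqr_nat => /eqP /ord_inj wE; [left|right]; exact: wE.
- by move=> e f p /uncrossed.
- by move=> e f g p q /uncrossed.
Qed.

End BookDrawing.

(** * Drawings of simple graphs *)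

Section EdgeEnds.
Variable V : finType.
Implicit Type a : {set V}.

Definition some_vertex (x0 : V) a : V := odflt x0 [pick x in a].
Definition other_vertex (x : V) a : V := some_vertex x (a :\ x)%SET.

Lemma some_vertex_in x0 a : #|a| = 2 -> some_vertex x0 a \in a.
Proof.
move=> a2; rewrite /some_vertex; case: pickP => //= a0.
by move: a2; rewrite (eq_card a0) card0.
Qed.

Lemma other_vertex_edge x y : x != y -> other_vertex x (edge x y) = y.
Proof.
move=> xy; rewrite /other_vertex /some_vertex; case: pickP => [z|/(_ y)] /=.
  by rewrite !inE => /andP[/negbTE -> /eqP].
by rewrite !inE eq_sym xy eqxx orbT.
Qed.

Lemma edge_other x a : #|a| = 2 -> x \in a -> a = edge x (other_vertex x a).
Proof. by move=> a2 xa; have [y {1 2}-> xy] := card2_edge a2 xa; rewrite other_vertex_edge. Qed.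

Lemma other_vertex_neq x a : #|a| = 2 -> x \in a -> other_vertex x a != x.
Proof.
by move=> a2 xa; have [y -> xy] := card2_edge a2 xa; rewrite other_vertex_edge // eq_sym.
Qed.

Lemma joins_edge (src dst : {set V} -> V) u v : u != v ->
  edge u v = edge (src (edge u v)) (dst (edge u v)) -> joins src dst (edge u v) u v.
Proof. by move=> uv /(edge_inj uv)[[uE vE]|[uE vE]]; [left|right]. Qed.

End EdgeEnds.

Section SimpleDrawings.
Variable R : realType.
Local Notation P := (R * R)%type.

Section Definitions.
Variables (V : finType) (Va : {set V}) (Ea : {set {set V}}) (X : {set V} -> {set V} -> Prop).

Definition orients (src dst : {set V} -> V) : Prop :=
  forall a, a \in Ea -> a = edge (src a) (dst a).

(* For simple graphs, where an edge is the set of its two ends. *)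
Definition simple_drawing (pos : V -> P) (cv : {set V} -> set P) : Prop :=
  exists src dst, orients src dst /\ plane_drawing Va Ea src dst X pos cv.

Definition simple_drawable : Prop := exists pos cv, simple_drawing pos cv.

Lemma drawable_simple src dst : drawable R Va Ea src dst X -> orients src dst -> simple_drawable.
Proof. by move=> [pos [cv D]] sd; exists pos, cv, src, dst. Qed.

Lemma simple_drawing_orient pos cv src dst : simple_drawing pos cv -> orients src dst ->
  plane_drawing Va Ea src dst X pos cv.
Proof.
case=> src0 [dst0 [oriented0 D]] oriented.
apply: (@plane_drawing_relabel R V _ Va Ea src0 dst0 X pos cv D V _ Va Ea src dst X id id)
  => // a aE.
have [sV dV] := pd_ends D aE; have := oriented0 a aE; rewrite {1}(oriented a aE) => /esym.
by move=> /(edge_inj (pd_neq D aE))[[<- <-]|[<- <-]]; split; rewrite // /joins; auto.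
Qed.

Lemma simple_drawable_orient src dst : simple_drawable -> orients src dst ->
  drawable R Va Ea src dst X.
Proof. by move=> [pos [cv D]] oriented; exists pos, cv; exact: simple_drawing_orient. Qed.

End Definitions.

Section Basics.
Variables (V : finType) (Va : {set V}) (Ea : {set {set V}}).
Variables (X : {set V} -> {set V} -> Prop) (pos : V -> P) (cv : {set V} -> set P).
Hypothesis D : simple_drawing Va Ea X pos cv.

Lemma sd_card a : a \in Ea -> #|a| = 2.
Proof.
by case: D => s [d [oriented D0]] aE; rewrite (oriented a aE) card_edge // (pd_neq D0 aE).
Qed.

Lemma sd_sub a w : a \in Ea -> w \in a -> w \in Va.
Proof.
case: D => s [d [oriented D0]] aE; rewrite {1}(oriented a aE) in_edge.
by have [sV dV] := pd_ends D0 aE; case/orP => /eqP ->.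
Qed.

Lemma sd_crossing a b p : crossing Va Ea pos cv a b p -> X a b.
Proof. by case: D => s [d [_ D0]] /(pd_crossing D0)[]. Qed.

Lemma simple_drawing_restrict (Va' : {set V}) (Ea' : {set {set V}}) X' : Va' \subset Va ->
  (forall a, a \in Ea' -> a \in Ea /\ a \subset Va') ->
  (forall a b p, a \in Ea' -> b \in Ea' -> crossing Va Ea pos cv a b p -> X a b -> X' a b) ->
  simple_drawing Va' Ea' X' pos cv.
Proof.
case: D => s [d [oriented D0]] /fintype.subsetP subV subE XX'; exists s, d.
split; first by move=> a /subE[aE _]; exact: oriented.
have D1 : plane_drawing Va Ea' s d X' pos cv.
  by apply: (plane_drawing_restrict D0) => //; apply/fintype.subsetP => a /subE[].
apply: (@plane_drawing_relabel R V _ Va Ea' s d X' pos cv D1 V _ Va' Ea' s d X' id id) => //.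
move=> a aE'; have [aE /fintype.subsetP sub] := subE a aE'; rewrite {1}(oriented a aE) in sub.
by split; [apply: sub; exact: edge_l|apply: sub; exact: edge_r|left].
Qed.

Lemma orients_other (h : {set V} -> V) : (forall a, a \in Ea -> h a \in a) ->
  orients Ea h (fun a => other_vertex (h a) a).
Proof. by move=> hP a aE; apply: edge_other; [exact: sd_card|exact: hP]. Qed.

Lemma sd_uncross a b p u v : crossing Va Ea pos cv a b p -> u \in a -> v \in b -> u != v ->
  exists src dst, [/\ drawable R Va Ea src dst (uncrossed_on [:: a; b] X), src a = u, dst a = v &
    forall c, c \in Ea -> c != a -> c = edge (src c) (dst c)].
Proof.
move=> cab ua vb uv; have [aE bE ab _ _] := cab.
pose src c := if c == a then u else if c == b then v else some_vertex u c.
have src_in c : c \in Ea -> src c \in c.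
  move=> cE; rewrite /src; case: eqP => [->//|_]; case: eqP => [->//|_].
  exact: some_vertex_in (sd_card cE).
have [sa sb] : src a = u /\ src b = v by rewrite /src eqxx eq_sym (negbTE ab) eqxx.
have := uncross (simple_drawing_orient D (orients_other src_in)) cab; rewrite sa sb => /(_ uv) D'.
exists src, (fun c => if c == a then v else other_vertex (src c) c); split=> //;
  first by rewrite eqxx.
by move=> c cE /negbTE ->; apply: edge_other; [exact: sd_card|exact: src_in].
Qed.

Lemma sd_add_path (u v t : V) (A : set P) : u \in Va -> v \in Va -> t \notin Va ->
  arc (pos u) (pos v) A -> arc_inner (pos u) (pos v) A `<=` free_point Va Ea pos cv ->
  simple_drawable (t |: Va)%SET (edge u t |: (edge v t |: Ea))%SET X.
Proof.
move=> uV vV tV arcA free.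
have uv : u != v by have [_ _] := arc_ends arcA; apply: contraNneq => ->.
have ut : u != t by apply: contraNneq tV => <-.
have vt : v != t by apply: contraNneq tV => <-.
have tE a : a \in Ea -> t \notin a by move=> aE; apply: contraNN tV; exact: sd_sub.
have utE : edge u t \notin Ea by apply/negP => /tE; rewrite edge_r.
have vtE : edge v t \notin Ea by apply/negP => /tE; rewrite edge_r.
have utvt : edge u t != edge v t.
  by apply/eqP => /(edge_inj ut)[[uE _]|[uE _]]; [rewrite uE eqxx in uv|rewrite uE eqxx in ut].
pose dst (a : {set V}) := if t \in a then t else some_vertex u a.
pose src a := other_vertex (dst a) a.
have ends_t w : w != t -> joins src dst (edge w t) w t.
  by left; rewrite /src /dst edge_r edgeC other_vertex_edge // eq_sym.
have oriented a : a \in (edge u t |: (edge v t |: Ea))%SET -> a = edge (src a) (dst a).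
  move=> aE; have a2 : #|a| = 2.
    by move: aE; rewrite !inE => /or3P[/eqP ->|/eqP ->|/sd_card//]; exact: card_edge.
  rewrite edgeC; apply: edge_other => //; rewrite /dst; case: ifP => // _.
  exact: some_vertex_in.
apply: (@drawable_simple _ _ _ _ src dst) => //.
have D1 : plane_drawing Va Ea src dst X pos cv.
  by apply: (simple_drawing_orient D) => a aE; apply: oriented; rewrite !inE aE !orbT.
exact: (add_path D1 uV vV tV utE vtE utvt (ends_t u ut) (joinsC (ends_t v vt)) arcA free).
Qed.

End Basics.

(* The walk from u to v along the edges in F becomes the path from u through t to v. *)
Lemma sd_replace_walk (V : finType) (Va Vb : {set V}) (Ea Eb F : {set {set V}}) src dst
    X X' (pos : V -> P) (cv : {set V} -> set P)
    (r : rel V) (u v t : V) :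
  plane_drawing Va Ea src dst X pos cv -> Vb \subset Va ->
  (forall d, d \in Eb -> [/\ d \in Ea, d = edge (src d) (dst d) & d \subset Vb]) ->
  (forall c d, c \in Eb -> d \in Eb -> X c d -> X' c d) ->
  F \subset Ea -> (forall c d, c \in F -> d \in Eb -> c != d /\ ~ X c d) ->
  (forall c w, c \in F -> w \in Vb -> w = src c \/ w = dst c -> w = u \/ w = v) ->
  (forall x y, r x y -> exists2 c, c \in F & joins src dst c x y) -> connect r u v -> u != v ->
  u \in Vb -> v \in Vb -> t \notin Vb ->
  simple_drawable (t |: Vb)%SET (edge u t |: (edge v t |: Eb))%SET X'.
Proof.
move=> D /fintype.subsetP subV keep XX' FE FX endsF rF con uv uV vV tV.
have [A arcA AF] := walk_arc D FE rF con uv.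
have D' : simple_drawing Vb Eb X' pos cv.
  exists src, dst; split; first by move=> d /keep[].
  apply: (@plane_drawing_relabel R V _ Va Ea src dst X pos cv D V _ Vb Eb src dst X' id id) => //.
  - by move=> d /keep[].
  - by move=> d /keep[_ dE]; rewrite {1}dE edge_sub => /andP[sV dV]; split=> //; left.
  - by move=> c d cE dE _; exact: XX'.
apply: (sd_add_path D' uV vV tV arcA) => x [/AF[c cF cx] xu xv].
have cE := fintype.subsetP FE c cF.
have off w : w \in Vb -> pos w <> x.
  move=> wV wx; rewrite -wx in cx xu xv.
  by case: (endsF c w cF wV (pd_avoid D cE (subV w wV) cx)) => wE; [apply: xu|apply: xv];
    rewrite wE.
split=> // d dEb dx; have [dE ordE /fintype.subsetP dV] := keep d dEb;
  have [cd nX] := FX c d cF dEb.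
case: (pselect (exists2 w, w \in Va & pos w = x)) => [[w wV wx]|free].
  have wd : w \in d by rewrite ordE in_edge; rewrite -wx in dx;
    case: (pd_avoid D dE wV dx) => ->; rewrite eqxx ?orbT.
  exact: (off w (dV w wd)).
have ccd : crossing Va Ea pos cv c d x by split=> // w wV wx; apply: free; exists w.
by case: (pd_crossing D ccd).
Qed.

Lemma sd_relabel (V V' : finType) (x0 : V') (Va : {set V}) (Ea : {set {set V}}) X
    (Va' : {set V'}) (Ea' : {set {set V'}}) X' (s : V' -> V) :
  simple_drawable Va Ea X -> {in Va' &, injective s} -> (forall w, w \in Va' -> s w \in Va) ->
  (forall a, a \in Ea' -> [/\ #|a| = 2, a \subset Va' & (s @: a)%SET \in Ea]) ->
  (forall a b, a \in Ea' -> b \in Ea' -> a != b -> X (s @: a)%SET (s @: b)%SET -> X' a b) ->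
  simple_drawable Va' Ea' X'.
Proof.
move=> [pos [cv [src [dst [oriented0 D]]]]] s_inj sV sE sX.
pose h := some_vertex x0; pose h' a := other_vertex (h a) a.
have oriented : orients Ea' h h'.
  by move=> a /sE[a2 _ _]; apply: edge_other; rewrite // some_vertex_in.
apply: (drawable_simple _ oriented).
have sub a w : a \in Ea' -> w \in a -> w \in Va' by case/sE => _ /fintype.subsetP aV _; exact: aV.
have image_sub a b : a \in Ea' -> b \in Ea' -> (s @: a = s @: b)%SET -> {subset a <= b}.
  move=> aE bE ab w wa; have : s w \in (s @: b)%SET by rewrite -ab imset_f.
  by case/imsetP=> w' w'b /(s_inj _ _ (sub _ _ aE wa) (sub _ _ bE w'b)) ->.
apply: (@drawable_relabel R V _ V' _ Va Ea src dst X Va' Ea' _ _ X' s (fun a => s @: a)%SET) => //.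
- by exists pos, cv.
- by move=> a b aE bE ab; apply/finset.setP => w; apply/idP/idP; exact: image_sub.
- by move=> a /sE[].
- move=> a aE; have [_ _ saE] := sE a aE.
  split; first by apply: (sub a); rewrite // {2}(oriented a aE) edge_l.
    by apply: (sub a); rewrite // {2}(oriented a aE) edge_r.
  have := oriented0 _ saE; rewrite {1}(oriented a aE) imset_edge => /esym.
  by rewrite /joins; case/(edge_inj (pd_neq D saE)) => -[-> ->]; auto.
Qed.

Lemma sd_restrict (V : finType) (Va Va' : {set V}) (Ea Ea' : {set {set V}}) X X' :
  simple_drawable Va Ea X -> Va' \subset Va -> (forall a, a \in Ea' -> a \in Ea /\ a \subset Va') ->
  (forall a b, a \in Ea' -> b \in Ea' -> X a b -> X' a b) -> simple_drawable Va' Ea' X'.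
Proof.
move=> [pos [cv D]] subV subE XX'; exists pos, cv;
  apply: (simple_drawing_restrict D) => // a b p aE bE _.
exact: XX'.
Qed.

Section Sums.
Variables (V : finType) (Va1 Va2 : {set V}) (Ea1 Ea2 : {set {set V}}).
Variable (X : {set V} -> {set V} -> Prop).
Hypotheses (D1 : simple_drawable Va1 Ea1 X) (D2 : simple_drawable Va2 Ea2 X).

Let card_sum a : a \in (Ea1 :|: Ea2)%SET -> #|a| = 2.
Proof.
have [p1 [c1 S1]] := D1; have [p2 [c2 S2]] := D2.
by rewrite inE => /orP[/(sd_card S1)|/(sd_card S2)].
Qed.

Let orientedl src dst : orients (Ea1 :|: Ea2)%SET src dst -> drawable R Va1 Ea1 src dst X.
Proof.
by move=> oriented; apply: (simple_drawable_orient D1) => a aE; apply: oriented; rewrite inE aE.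
Qed.

Let orientedr src dst : orients (Ea1 :|: Ea2)%SET src dst -> drawable R Va2 Ea2 src dst X.
Proof.
move=> oriented; apply: (simple_drawable_orient D2) => a aE.
by apply: oriented; rewrite inE aE orbT.
Qed.

Let orients_some x0 : orients (Ea1 :|: Ea2)%SET (some_vertex x0)
  (fun a => other_vertex (some_vertex x0 a) a).
Proof. by move=> a /card_sum a2; apply: edge_other; rewrite // some_vertex_in. Qed.

Lemma sd_zero_sum : (Va1 :&: Va2)%SET = finset.set0 ->
  simple_drawable (Va1 :|: Va2)%SET (Ea1 :|: Ea2)%SET X.
Proof.
have [_ [_ [s _]]] := D1; have oriented := orients_some (s finset.set0).
move=> disjV; apply: (drawable_simple _ oriented).
exact: (zero_sum (orientedl oriented) (orientedr oriented) disjV).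
Qed.

Lemma sd_one_sum v : (Va1 :&: Va2)%SET = [set v]%SET ->
  simple_drawable (Va1 :|: Va2)%SET (Ea1 :|: Ea2)%SET X.
Proof.
have oriented := orients_some v; move=> meetV; apply: (drawable_simple _ oriented).
exact: (one_sum (orientedl oriented) (orientedr oriented) meetV).
Qed.

Section TwoSum.
Variables u v t1 t2 : V.
Hypotheses (uv : u != v) (meetV : (Va1 :&: Va2)%SET = edge u v).
Hypotheses (t1V : t1 \in Va1) (t2V : t2 \in Va2) (t1n : t1 \notin Va2) (t2n : t2 \notin Va1).
Hypotheses (ut1 : edge u t1 \in Ea1) (vt1 : edge v t1 \in Ea1).
Hypotheses (ut2 : edge u t2 \in Ea2) (vt2 : edge v t2 \in Ea2).
Hypothesis at1 : forall a, a \in Ea1 -> t1 \in a -> a = edge u t1 \/ a = edge v t1.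
Hypothesis at2 : forall a, a \in Ea2 -> t2 \in a -> a = edge u t2 \/ a = edge v t2.
Hypothesis uncrossed : forall a b : {set V}, (t1 \in a) || (t2 \in a) -> ~ X a b.

Let sdst (a : {set V}) := if t1 \in a then t1 else if t2 \in a then t2 else some_vertex u a.
Let ssrc (a : {set V}) := other_vertex (sdst a) a.

Let sdst_in a : a \in (Ea1 :|: Ea2)%SET -> sdst a \in a.
Proof. by move=> /card_sum a2; rewrite /sdst; do 2!case: ifP => //; rewrite some_vertex_in. Qed.

Let orients_t : orients (Ea1 :|: Ea2)%SET ssrc sdst.
Proof. by move=> a aE; rewrite edgeC; apply: edge_other; [exact: card_sum|exact: sdst_in]. Qed.

Let sdst_t1 (a : {set V}) : t1 \in a -> sdst a = t1. Proof. by rewrite /sdst => ->. Qed.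

Let sdst_t2 a : a \in Ea2 -> t2 \in a -> sdst a = t2.
Proof.
have [p2 [c2 S2]] := D2; move=> aE ta; rewrite /sdst ta; case: ifP => // t1a.
by move: t1n; rewrite (sd_sub S2 aE t1a).
Qed.

Let ssrc_edge w t : edge w t \in (Ea1 :|: Ea2)%SET -> sdst (edge w t) = t -> ssrc (edge w t) = w.
Proof.
rewrite /ssrc => /card_sum wt ->; rewrite edgeC other_vertex_edge // eq_sym.
by move: wt; rewrite cards2; case: eqP.
Qed.

Let away_from t (Ea : {set {set V}}) : {subset Ea <= (Ea1 :|: Ea2)%SET} ->
  (forall a, a \in Ea -> t \in a -> sdst a = t) ->
  (forall a, a \in Ea -> t \in a -> a = edge u t \/ a = edge v t) ->
  forall a, a \in Ea -> ssrc a != t /\ (sdst a = t -> a = edge u t \/ a = edge v t).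
Proof.
move=> sub dt at_t a aE; have aE' := sub a aE; split; last first.
  by move=> dE; apply: at_t => //; rewrite -[X in X \in _]dE sdst_in.
apply/eqP => sE; have ta : t \in a by rewrite (orients_t aE') sE edge_l.
by have := other_vertex_neq (card_sum aE') (sdst_in aE'); rewrite -/(ssrc a) sE dt // eqxx.
Qed.

Lemma sd_two_sum : simple_drawable ((Va1 :|: Va2) :\: edge t1 t2)%SET
  [set a in (Ea1 :|: Ea2)%SET | (t1 \notin a) && (t2 \notin a)]%SET X.
Proof.
have [p1 [c1 S1]] := D1; have [p2 [c2 S2]] := D2.
have subl : {subset Ea1 <= (Ea1 :|: Ea2)%SET} by move=> a aE; rewrite inE aE.
have subr : {subset Ea2 <= (Ea1 :|: Ea2)%SET} by move=> a aE; rewrite inE aE orbT.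
have D := @two_sum R V _ Va1 Va2 Ea1 Ea2 ssrc sdst X u v t1 t2 _ _ _ _
  (orientedl orients_t) (orientedr orients_t) uv meetV t1V t2V t1n t2n ut1 vt1 ut2 vt2.
have [dut1 dvt1] : sdst (edge u t1) = t1 /\ sdst (edge v t1) = t1 by rewrite !sdst_t1 ?edge_r.
have [dut2 dvt2] : sdst (edge u t2) = t2 /\ sdst (edge v t2) = t2 by rewrite !sdst_t2 ?edge_r.
have {}D : simple_drawable _ _ X := drawable_simple
  (D (ssrc_edge (subl _ ut1) dut1) dut1 (ssrc_edge (subl _ vt1) dvt1) dvt1
     (ssrc_edge (subr _ ut2) dut2) dut2 (ssrc_edge (subr _ vt2) dvt2) dvt2 _ _ _) _.
apply: (sd_restrict (D _ _ _ _)) => //.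
- by apply: away_from => // a _; exact: sdst_t1.
- by apply: away_from => // a; exact: sdst_t2.
- by move=> a b; rewrite !inE => /or4P[] /eqP -> ; apply: uncrossed; rewrite !edge_r ?orbT.
- by move=> a; rewrite inE => /andP[_ aE]; exact: orients_t.
- move=> a; rewrite !inE => /andP[aE /andP[ta1 ta2]]; split; last first.
    apply/fintype.subsetP => w wa; rewrite !inE.
    have -> : (w == t1) || (w == t2) = false.
      by apply: contraTF wa => /orP[] /eqP ->.
    by case/orP: aE => aE; rewrite ?(sd_sub S1 aE wa) ?(sd_sub S2 aE wa) ?orbT.
  rewrite aE andbT !negb_or -!andbA.
  by apply/and4P; split; [apply: contraNneq ta1|apply: contraNneq ta1|apply: contraNneq ta2|
    apply: contraNneq ta2] => ->; rewrite edge_r.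
Qed.

End TwoSum.
End Sums.

Lemma sd_book (V : finType) (x0 : V) (Va : {set V}) (Ea : {set {set V}}) X
    (ord : V -> nat) (page : {set V} -> bool) :
  {in Va &, injective ord} ->
  (forall a, a \in Ea -> #|a| = 2 /\ a \subset Va) ->
  (forall u v x y, edge u v \in Ea -> edge x y \in Ea -> (ord u < ord v)%N -> (ord x < ord y)%N ->
     page (edge u v) = page (edge x y) ->
     [|| (ord v <= ord x)%N, (ord y <= ord u)%N, (ord u <= ord x)%N && (ord y <= ord v)%N |
      (ord x <= ord u)%N && (ord v <= ord y)%N]) ->
  simple_drawable Va Ea X.
Proof.
move=> ord_inj ends laminar; pose src := some_vertex x0; pose dst a := other_vertex (src a) a.
have oriented : orients Ea src dst.
  by move=> a /ends[a2 _]; apply: edge_other; rewrite // some_vertex_in.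
have endsV a : a \in Ea -> [/\ src a \in Va, dst a \in Va & src a != dst a].
  move=> aE; have [a2 /fintype.subsetP aV] := ends a aE; split.
  - by apply: aV; rewrite {2}(oriented a aE) edge_l.
  - by apply: aV; rewrite {2}(oriented a aE) edge_r.
  - by rewrite eq_sym other_vertex_neq // some_vertex_in.
have ordered a : a \in Ea -> exists u v, [/\ a = edge u v, u \in Va /\ v \in Va, (ord u < ord v)%N,
    low_end src dst ord a = ord u & high_end src dst ord a = ord v].
  move=> aE; have [sV dV sd] := endsV a aE; rewrite /low_end /high_end.
  case: (ltngtP (ord (src a)) (ord (dst a))) => [lt|lt|/(ord_inj _ _ sV dV) E].
  - by exists (src a), (dst a); split => //; exact: oriented.
  - by exists (dst a), (src a); split => //; rewrite edgeC; exact: oriented.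
  - by rewrite E eqxx in sd.
apply: (drawable_simple _ oriented).
apply: (@book_drawing R V _ Va Ea src dst X ord page ord_inj endsV) => a b aE bE;
  have [u [v [aE' [uV vV] uv -> ->]]] := ordered a aE;
  have [x [y [bE' [xV yV] xy -> ->]]] := ordered b bE.
- by move=> /(ord_inj _ _ uV xV) ux /(ord_inj _ _ vV yV) vy; rewrite aE' bE' ux vy.
- by move=> _; rewrite aE' bE' in aE bE *; exact: laminar.
Qed.

Section Restricted.
Variables (S : set crossing_type) (G : sgraph).

Definition allowed (a b : {set G}) : Prop :=
  (a :&: b)%SET = finset.set0 /\
  forall u v x y, a = edge u v -> b = edge x y -> S (type_of_crossing u v x y).

Lemma crossesE (D : drawing_data R G) a b p :
  crosses D a b p <-> crossing [set: G]%SET (edges G) (Defs.pos D) (curve D) a b p.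
Proof.
split=> -[aE bE ab cab nv]; split => //; first by move=> w _ wp; apply: nv; exists w.
by move=> [w _ wp]; exact: (nv w).
Qed.

Lemma restricted_simple_drawable (x0 : G) : restricted R S G ->
  simple_drawable [set: G]%SET (edges G) allowed.
Proof.
move=> [D [[dD one dis] typ]].
pose src := some_vertex x0; pose dst a := other_vertex (src a) a.
have oriented : orients (edges G) src dst.
  by move=> a /card_edges a2; apply: edge_other; rewrite // some_vertex_in.
exists (Defs.pos D), (curve D), src, dst; split=> //; split.
- by move=> u v _ _; exact: (pos_inj dD).
- by move=> a _; rewrite !inE.
- move=> a aE; apply/simple_curveP; rewrite {3}(oriented a aE); apply: (curve_simple dD).
  by rewrite -edge_edges -oriented.
- move=> a w aE _ cw; have : w \in a.
    by apply: contrapT => /negP wa; exact: (curve_avoids dD aE wa).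
  by rewrite {1}(oriented a aE) in_edge => /orP[/eqP|/eqP]; auto.
- move=> a b p /crossesE cr; split; last exact: (crosses_transversal dD).
  split; first exact: (dis _ _ _ cr).
  by move=> u v x y aE bE; apply: (typ u v x y p); rewrite -aE -bE.
- by move=> a b c p q /crossesE cab /crossesE; exact: (one a b c).
Qed.

Lemma simple_drawable_restricted : simple_drawable [set: G]%SET (edges G) allowed ->
  restricted R S G.
Proof.
move=> [pos [cv [src [dst [oriented D]]]]]; pose data := DrawingData pos cv; exists data.
have one a b c p q : crosses data a b p -> crosses data a c q -> b = c /\ p = q.
  by move=> /crossesE cab /crossesE; exact: (pd_one_crossing D cab).
have crossing_allowed a b p : crosses data a b p -> allowed a b.
  by move=> /crossesE /(pd_crossing D)[].
split; last by move=> u v x y p /crossing_allowed[_]; exact.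
split=> //; last by move=> a b p /crossing_allowed[].
split.
- by move=> u v; apply: (pd_inj D).
- move=> u v uv; apply/simple_curveP; have uvE : edge u v \in edges G by rewrite edge_edges.
  have := pd_arc D uvE; have := oriented _ uvE => /(edge_inj (adj_neq uv))[[<- <-]//|[<- <-]].
  exact: arc_rev.
- move=> a w aE; rewrite {1}(oriented a aE) in_edge negb_or => /andP[/eqP ws /eqP wd] cw.
  by have [] := pd_avoid D aE (finset.in_setT w) cw.
- move=> a b; case: (pselect (exists p, crosses data a b p)) => [[p cab]|no].
    apply: (@sub_finite_set _ _ [set p]); last exact: finite_set1.
    by move=> q /= cab'; have [_ ->] := one _ _ _ _ _ cab cab'.
  have -> : [set p | crosses data a b p] = set0; last exact: finite_set0.
  by apply/seteqP; split => p //= cab; apply: no; exists p.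
- by move=> a b p /crossesE /(pd_crossing D)[].
Qed.

Lemma restricted_empty : (forall v : G, False) -> restricted R S G.
Proof.
move=> emp; pose data := @DrawingData R G (fun=> (0, 0)) (fun=> set0); exists data.
have no_crossing a b p : ~ crosses data a b p by case=> /edgesP[u]; case: (emp u).
split; last by move=> u; case: (emp u).
split; [|by move=> a b c p q /no_crossing|by move=> a b p /no_crossing].
split; [by move=> u|by move=> u|by move=> a w; case: (emp w)| |by move=> a b p /no_crossing].
move=> a b; have -> : [set p | crosses data a b p] = set0; last exact: finite_set0.
by apply/seteqP; split => p //= /no_crossing.
Qed.

End Restricted.
End SimpleDrawings.
(** * Cycles in multigraphs *)

Lemma index_next (V : eqType) (c : seq V) v : uniq c -> v \in c ->
  index (next c v) c = if (index v c).+1 == size c then 0%N else (index v c).+1.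
Proof.
move=> uc vc; rewrite next_nth vc; case: c uc vc => // y c uc vc.
have lt_v : (index v (y :: c) < (size c).+1)%N by rewrite -index_mem in vc.
case: (eqVneq (index v (y :: c)) (size c)) => [vE|v_last].
  by rewrite vE eqxx nth_default //= eqxx.
rewrite eqSS (negbTE v_last); have lt_next : (index v (y :: c) < size c)%N.
  by rewrite ltn_neqAle v_last.
by rewrite -[nth _ c _]/(nth y (y :: c) (index v (y :: c)).+1) index_uniq.
Qed.

Section Multigraph.
Variables (V K : finType) (ends : K -> {set V}).
Implicit Types (C : {set V}) (F : {set K}).

Definition joined F : rel V := fun u v => [exists e in F, ends e == edge u v].

Lemma joinedP F u v : reflect (exists2 e, e \in F & ends e = edge u v) (joined F u v).
Proof. by apply: (iffP exists_inP) => -[e eF /eqP]; exists e => //; apply/eqP. Qed.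

Lemma joined_sym F : symmetric (joined F).
Proof. by move=> u v; rewrite /joined edgeC. Qed.

Definition cycle_multigraph C F : Prop :=
  [/\ (2 < #|C|)%N, connected_on (joined F) C &
      {in C, forall v, #|[set e in F | v \in ends e]%SET| = 2}].

Lemma degree_minus_edge F e v : e \in F ->
  (#|[set f in F :\ e | v \in ends f]%SET| + (v \in ends e))%N = #|[set f in F | v \in ends f]%SET|.
Proof.
move=> eF; rewrite [RHS](cardsD1 e) inE eF addnC /=; congr (_ + _)%N.
by apply: eq_card => f; rewrite !inE andbA.
Qed.

End Multigraph.

Section CycleMultigraph.
Variables (V K : finType) (C : {set V}) (F : {set K}) (ends : K -> {set V}).
Local Notation joined := (joined ends).
Hypotheses (ends2 : forall e, e \in F -> #|ends e| = 2).
Hypothesis (ends_sub : forall e, e \in F -> ends e \subset C).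
Hypothesis degree2 : {in C, forall v, #|[set e in F | v \in ends e]%SET| = 2}.

Let edge_in e v : e \in F -> v \in ends e -> v \in C.
Proof. by move=> /ends_sub/fintype.subsetP; apply. Qed.

Let joined_in u v : joined F u v -> [/\ u \in C, v \in C & u != v].
Proof.
case/joinedP=> e eF eE; have e2 := ends2 eF; rewrite eE cards2 in e2.
split; [by apply: (edge_in eF); rewrite eE edge_l|by apply: (edge_in eF); rewrite eE edge_r|].
by case: eqP e2.
Qed.

(* Otherwise the component of u would contain exactly one vertex of odd degree. *)
Lemma cycle_minus_edge e u v : e \in F -> ends e = edge u v -> connect (joined (F :\ e)%SET) u v.
Proof.
move=> eF eE; apply: contraT => uv.
have [uC _ _] : [/\ u \in C, v \in C & u != v] by apply: joined_in; apply/joinedP; exists e.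
pose A := [set w in C | connect (joined (F :\ e)%SET) u w]%SET.
pose degree w := #|[set f in (F :\ e)%SET | w \in ends f]%SET|.
have uA : u \in A by rewrite inE uC connect0.
have degreeE w : w \in C -> (degree w + (w \in ends e))%N = 2.
  by move=> wC; rewrite -(degree2 wC) -(degree_minus_edge ends w eF).
have degree_u : degree u = 1%N.
  by have := degreeE u uC; rewrite eE edge_l addn1 => -[].
have degree_w w : w \in A -> w != u -> degree w = 2.
  rewrite inE => /andP[wC uw] wu; have := degreeE w wC; rewrite eE in_edge (negbTE wu) /=.
  by case: eqP => [wv|_]; [rewrite wv (negbTE uv) in uw|rewrite addn0].
have handshake : (\sum_(w in A) degree w)%N = (\sum_(f in (F :\ e)%SET) #|A :&: ends f|)%N.
  under eq_bigr do rewrite /degree -sum1dep_card big_mkcondr /=.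
  rewrite exchange_big /=; apply: eq_bigr => f _.
  by rewrite -sum1_card; under [RHS]eq_bigl do rewrite finset.in_setI; rewrite [RHS]big_mkcondr.
have even_meet f : f \in (F :\ e)%SET -> (2 %| #|(A :&: ends f)%SET|)%N.
  move=> fFe; have fF : f \in F by move: fFe; rewrite inE => /andP[].
  case: (set_0Vmem (A :&: ends f)%SET) => [->|[w]]; first by rewrite cards0.
  rewrite inE => /andP[wA wf]; rewrite (_ : _ :&: _ = ends f)%SET ?ends2 //.
  apply/finset.setIidPr/fintype.subsetP => z zf; have := wA; rewrite !inE => /andP[_ uw].
  rewrite (edge_in fF zf); case: (eqVneq w z) => [<-//|wz]; apply: (connect_trans uw);
    apply: connect1.
  have [z' fE wz'] := card2_edge (ends2 fF) wf; apply/joinedP; exists f => //; rewrite fE.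
  by move: zf; rewrite fE in_edge eq_sym (negbTE wz) /= => /eqP ->.
have : (2 %| \sum_(w in A) degree w)%N by rewrite handshake; apply: dvdn_sum.
rewrite (bigD1 u) //= degree_u (eq_bigr (fun=> 2)) => [|w /andP[]]; last exact: degree_w.
by rewrite sum_nat_const dvdn_addl // dvdn_mull.
Qed.

Hypotheses (C3 : (2 < #|C|)%N) (conn : connected_on (joined F) C).

Let two_edges v y z : y != z -> joined F v y -> joined F v z ->
  (forall e, e \in F -> v \in ends e -> ends e = edge v y \/ ends e = edge v z) /\
  (forall e e', e \in F -> e' \in F -> v \in ends e -> ends e = ends e' -> e = e').
Proof.
move=> yz ry rz; have [vC _ _] := joined_in ry.
case/joinedP: ry => e1 e1F E1; case/joinedP: rz => e2 e2F E2.
have e12 : e1 != e2 by apply: contraNneq yz => E; rewrite E E2 in E1; rewrite (edge_injr E1).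
have at_v e : e \in F -> v \in ends e -> e = e1 \/ e = e2.
  move=> eF ve; have : [set e1; e2]%SET = [set e in F | v \in ends e]%SET.
    apply/eqP; rewrite eqEcard degree2 // cards2 e12 andbT; apply/fintype.subsetP => f.
    by rewrite !inE => /orP[] /eqP ->; rewrite ?e1F ?e2F ?E1 ?E2 edge_l.
  move/finset.setP/(_ e); rewrite !inE eF ve /= => /orP[/eqP|/eqP]; auto.
split=> [e eF ve|e e' eF e'F ve EE]; first by case: (at_v e eF ve) => ->; auto.
have ve' : v \in ends e' by rewrite -EE.
have ne : edge v y <> edge v z by move/edge_injr => E; rewrite E eqxx in yz.
case: (at_v e eF ve) (at_v e' e'F ve') => -> [] -> // in EE *; move: EE; rewrite E1 E2 //.
by move/esym.
Qed.

Let cover (A : {pred V}) u : u \in C -> u \in A ->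
  (forall v w, v \in A -> joined F v w -> w \in A) -> {subset C <= A}.
Proof.
move=> uC uA closedA v vC; apply: contraT => vA.
have [a [b [/and3P[_ _ ab] aA bA]]] := connect_exit (conn uC vC) uA vA.
by rewrite (closedA a b aA ab) in bA.
Qed.

Let simple_cycle : exists c, [/\ uniq c, (2 < size c)%N & cycle (joined F) c].
Proof.
have [x xC] : exists x, x \in C by apply/card_gt0P; exact: leq_trans C3.
have /card_gt0P[f] : (0 < #|[set e in F | x \in ends e]%SET|)%N by rewrite degree2.
rewrite inE => /andP[fF xf]; have [y fE xy] := card2_edge (ends2 fF) xf.
have /connectP[p0 p0P yE] := cycle_minus_edge fF fE.
case/shortenP: p0P yE => p pP up _ yE.
have weaken u v : joined (F :\ f)%SET u v -> joined F u v.
  by case/joinedP=> e; rewrite inE => /andP[_ eF] eE; apply/joinedP; exists e.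
have fyx : joined F y x by rewrite joined_sym; apply/joinedP; exists f.
exists (x :: p); split => //; last by rewrite /= rcons_path -yE fyx andbT (sub_path weaken).
case: p pP up yE => [|z [|//]] /=; first by move=> _ _ E; rewrite E eqxx in xy.
rewrite andbT => xz _ yz; rewrite -{}yz in xz; case/joinedP: xz => g.
rewrite !inE => /andP[gf gF] gE; exfalso.
have only v e : v \in edge x y -> e \in F -> v \in ends e -> e = f \/ e = g.
  move=> vxy eF ve; have vC : v \in C by apply: (edge_in fF); rewrite fE.
  have : [set f; g]%SET = [set k in F | v \in ends k]%SET.
    apply/eqP; rewrite eqEcard degree2 // cards2 eq_sym gf andbT; apply/fintype.subsetP => k.
    by rewrite !inE => /orP[] /eqP ->; rewrite ?fF ?gF ?fE ?gE.
  by move/finset.setP/(_ e); rewrite !inE eF ve => /orP[] /eqP; auto.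
have sub : C \subset edge x y.
  apply/fintype.subsetP; apply: (@cover [pred v | v \in edge x y] x) => //; first exact: edge_l.
  move=> v w vxy /joinedP[e eF eE]; have [ee|ee] := only v e vxy eF ltac:(by rewrite eE edge_l).
    by rewrite -[_ \in _]/(w \in edge x y) -fE -ee eE edge_r.
  by rewrite -[_ \in _]/(w \in edge x y) -gE -ee eE edge_r.
by have := leq_trans C3 (subset_leq_card sub); rewrite card_edge.
Qed.

Let next_next_neq (c : seq V) v : uniq c -> (2 < size c)%N -> v \in c -> next c (next c v) != v.
Proof.
move=> uc c3 vc; have [i s cE] := rot_to vc; rewrite -!(next_rot i uc) cE.
have : uniq (v :: s) by rewrite -cE rot_uniq.
have : (2 < size (v :: s))%N by rewrite -cE size_rot.
case: s {cE} => [|a [|b s]] //= _; rewrite !inE eqxx !negb_or -!andbA.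
by case/and5P=> va vb _ ab _; rewrite [a == v]eq_sym (negbTE va) eqxx eq_sym.
Qed.

Lemma cyclic_order : exists c : seq V, [/\ uniq c, c =i C, {in F &, injective ends} &
  forall e, e \in F -> exists2 v, v \in c & ends e = edge v (next c v)].
Proof.
have [c [uc c3 cP]] := simple_cycle; exists c.
have cC : {subset c <= C}.
  by move=> v vc; have [] := joined_in (next_cycle cP vc).
have neighbors v : v \in c ->
    [/\ next c v != prev c v, joined F v (next c v) & joined F v (prev c v)].
  move=> vc; split; [|exact: next_cycle|by rewrite joined_sym prev_cycle].
  by apply: contraNneq (next_next_neq uc c3 vc) => ->; rewrite next_prev.
have edge_at e v : e \in F -> v \in c -> v \in ends e ->
    exists2 w, w \in c & ends e = edge w (next c w).
  move=> eF vc ve; have [np rn rp] := neighbors v vc; have [two _] := two_edges np rn rp.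
  case: (two e eF ve) => ->; first by exists v.
  by exists (prev c v); rewrite ?mem_prev // next_prev // edgeC.
have Cc : {subset C <= c}.
  have [x xc] : exists x, x \in c by case: (c) c3 => // x s _; exists x; rewrite mem_head.
  apply: (@cover [pred w | w \in c] x) => //; first exact: cC.
  move=> v w vc /joinedP[e eF eE]; have [u' uc' eE'] :=
    edge_at e v eF vc ltac:(by rewrite eE edge_l).
  have : w \in edge u' (next c u') by rewrite -eE' eE edge_r.
  by rewrite in_edge => /orP[] /eqP ->; rewrite inE /= ?mem_next.
have some_end e : e \in F -> exists2 v, v \in c & v \in ends e.
  move=> eF; have /card_gt0P[v ve] : (0 < #|ends e|)%N by rewrite ends2.
  by exists v => //; apply: Cc; exact: (edge_in eF).
split => //.
- by move=> v; apply/idP/idP; [exact: cC|exact: Cc].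
- move=> e e' eF e'F; have [v vc ve] := some_end e eF.
  by have [np rn rp] := neighbors v vc; have [_ uni] := two_edges np rn rp; exact: uni.
- by move=> e eF; have [v vc ve] := some_end e eF; exact: edge_at ve.
Qed.

End CycleMultigraph.


Section GlueCycles.
Variables (V K : finType) (ends : K -> {set V}) (C1 C2 : {set V}) (F1 F2 : {set K}) (e1 e2 : K).
Hypothesis ends2 : forall e, #|ends e| = 2.
Hypotheses (ends_sub1 : forall e, e \in F1 -> ends e \subset C1).
Hypotheses (ends_sub2 : forall e, e \in F2 -> ends e \subset C2).
Hypotheses (cycle1 : cycle_multigraph ends C1 F1) (cycle2 : cycle_multigraph ends C2 F2).
Hypotheses (e1F : e1 \in F1) (e2F : e2 \in F2) (e12 : ends e1 = ends e2).
Hypotheses (meetC : (C1 :&: C2)%SET = ends e1) (meetF : (F1 :&: F2)%SET = finset.set0).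

Let C := (C1 :|: C2)%SET.
Let F := ((F1 :\ e1) :|: (F2 :\ e2))%SET.

Let degree_in (C0 : {set V}) (F0 : {set K}) e0 v : (forall e, e \in F0 -> ends e \subset C0) ->
  cycle_multigraph ends C0 F0 -> e0 \in F0 ->
  (#|[set f in F0 :\ e0 | v \in ends f]%SET| + (v \in ends e0))%N = if v \in C0 then 2 else 0%N.
Proof.
move=> ends_sub [_ _ degree2] e0F; rewrite degree_minus_edge //; case: ifPn => [/degree2//|vC].
apply/eqP; rewrite cards_eq0; apply/eqP/finset.setP => f; rewrite finset.in_set0 !inE.
by apply: contraNF vC => /andP[/ends_sub/fintype.subsetP]; apply.
Qed.

Let degree2 v : v \in C -> #|[set f in F | v \in ends f]%SET| = 2.
Proof.
have := degree_in v ends_sub1 cycle1 e1F; have := degree_in v ends_sub2 cycle2 e2F.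
have -> : [set f in F | v \in ends f]%SET =
    ([set f in F1 :\ e1 | v \in ends f] :|: [set f in F2 :\ e2 | v \in ends f])%SET.
  by apply/finset.setP => f; rewrite !inE andb_orl.
have disj : ([set f in F1 :\ e1 | v \in ends f] :&: [set f in F2 :\ e2 | v \in ends f])%SET =
  finset.set0.
  apply/finset.setP => f; rewrite !inE; have /finset.setP/(_ f) := meetF; rewrite !inE.
  by case: (f \in F1) (f \in F2) => [] [] //= _; rewrite ?andbF.
rewrite cardsU disj cards0 subn0 -e12 -meetC !inE.
by case: (v \in C1) (v \in C2) => [] []; rewrite ?addn0 ?addn1 // => -[->] [->].
Qed.

Let connect_in (C0 : {set V}) (F0 : {set K}) e0 :
  (forall e, e \in F0 -> ends e \subset C0) -> cycle_multigraph ends C0 F0 -> e0 \in F0 ->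
  C0 \subset C -> (F0 :\ e0)%SET \subset F ->
  {in C0 &, forall u v, connect [rel a b | [&& a \in C, b \in C & joined ends F a b]] u v}.
Proof.
move=> ends_sub [_ conn deg] e0F /fintype.subsetP subC /fintype.subsetP subF u v uC vC.
have step a b : joined ends (F0 :\ e0) a b ->
    connect [rel a b | [&& a \in C, b \in C & joined ends F a b]] a b.
  case/joinedP=> f fF fE; apply: connect1 => /=.
  have /fintype.subsetP f_sub : ends f \subset C0.
    by apply: ends_sub; move: fF; rewrite inE => /andP[].
  have in_C w : w \in edge a b -> w \in C by rewrite -fE => /f_sub/subC.
  by rewrite !in_C ?edge_l ?edge_r //=; apply/joinedP; exists f => //; exact: subF.
apply: (connect_sub _ (conn u v uC vC)) => {uC vC}{}u {}v /and3P[_ _ /joinedP[f fF fE]].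
case: (eqVneq f e0) => [fe|fe]; last first.
  by apply: step; apply/joinedP; exists f; rewrite // !inE fe.
have e0E : ends e0 = edge u v by rewrite -fe.
apply: (connect_sub _ (cycle_minus_edge (fun e _ => ends2 e) ends_sub deg e0F e0E)) => a b.
exact: step.
Qed.

Lemma glue_cycles : cycle_multigraph ends C F.
Proof.
split; last exact: degree2.
- by case: cycle1 => C3 _ _; apply: (leq_trans C3); apply: subset_leq_card; exact: finset.subsetUl.
have [z ze] : exists z, z \in ends e1 by apply/card_gt0P; rewrite ends2.
have [z1 z2] : z \in C1 /\ z \in C2 by apply/andP; rewrite -meetC inE in ze.
have con1 := connect_in ends_sub1 cycle1 e1F (finset.subsetUl _ _) (finset.subsetUl _ _).
have con2 := connect_in ends_sub2 cycle2 e2F (finset.subsetUr _ _) (finset.subsetUr _ _).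
move=> u v; rewrite !inE => uC vC; apply: (@connect_trans _ _ z).
  by case/orP: uC => uC; [exact: con1|exact: con2].
by case/orP: vC => vC; [exact: con1|exact: con2].
Qed.

End GlueCycles.
(** * From skeletons to the graph *)

Section ClearVertex.
Variables (R : realType) (V : finType) (Va : {set V}) (Ea : {set {set V}}).
Variable (X : {set V} -> {set V} -> Prop).

Definition uncrossed_at (Q : {pred V}) (a b : {set V}) : Prop :=
  X a b /\ {in Q, forall t, (t \notin a) && (t \notin b)}.

(* The new path from u through t to v runs along the first part of the edge
   {u, t} and then along b towards v. *)
Lemma sd_reroute u v t b (pos : V -> R * R) cv p : u != v -> edge v t \in Ea ->
  (forall a, a \in Ea -> t \in a -> a = edge u t \/ a = edge v t) ->
  simple_drawing Va Ea X pos cv -> crossing Va Ea pos cv (edge u t) b p -> v \in b -> t \notin b ->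
  simple_drawable R Va Ea (uncrossed_at (pred1 t)).
Proof.
move=> uv vtE at_t; set a := edge u t => D cab vb tb; have [aE _ _ _ _] := cab.
have ut : u != t by have := sd_card D aE; rewrite /a cards2; case: eqP.
have vt : v != t by apply: contraNneq tb => <-.
pose away := [set c in Ea | t \notin c]%SET.
have not_a c : c \in away -> c != a.
  by rewrite inE => /andP[_]; apply: contraNneq => ->; exact: edge_r.
have [src [dst [[pos2 [cv2 D2]] sa da ends]]] := sd_uncross D cab (edge_l u t) vb uv.
have only_a c d : c \in [set a]%SET -> d \in away -> c != d /\ ~ uncrossed_on [:: a; b] X c d.
  by rewrite inE => /eqP -> /not_a da'; rewrite eq_sym da'; split=> // -[_]; rewrite mem_head.
have := sd_replace_walk (Vb := (Va :\ t)%SET) (Eb := away) (X' := uncrossed_at (pred1 t)) (t := t)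
  (r := [rel x y | (x == u) && (y == v)]) D2 _ _ _ _ only_a _ _ _ uv.
move=> bypass; apply: (sd_restrict (bypass _ _ _ _ _ _ _ _ _ _)) => //.
- exact: finset.subsetDl.
- move=> d dA; have := dA; rewrite inE => /andP[dE td]; split; [by []|exact: ends (not_a d dA)|].
  apply/fintype.subsetP => w wd; rewrite !inE (sd_sub D dE wd) andbT.
  by apply: contraNneq td => <-.
- move=> c d; rewrite !inE => /andP[_ tc] /andP[_ td] [Xcd _ _]; split=> // w.
  by rewrite inE => /eqP ->; rewrite tc td.
- by rewrite finset.sub1set.
- by move=> c w; rewrite inE => /eqP -> _; rewrite sa da.
- by move=> x y /andP[/eqP -> /eqP ->]; exists a; rewrite ?inE //; left.
- by apply: connect1; rewrite /= !eqxx.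
- by rewrite !inE ut; exact: (sd_sub D aE (edge_l _ _)).
- by rewrite !inE vt; exact: (sd_sub D vtE (edge_l _ _)).
- by rewrite !inE eqxx.
- by apply/fintype.subsetP => w wV; rewrite !inE wV andbT orbN.
- move=> c cE; split; last by apply/fintype.subsetP => w; exact: (sd_sub D).
  rewrite !inE cE /=; case: (boolP (t \in c)) => [/(at_t c cE)[] ->|]; rewrite ?eqxx ?orbT //.
Qed.

Lemma sd_clear_vertex u v t : u != v -> edge u t \in Ea -> edge v t \in Ea ->
  (forall a, a \in Ea -> t \in a -> a = edge u t \/ a = edge v t) ->
  (forall b, b \in Ea -> X (edge u t) b -> v \in b /\ t \notin b) ->
  (forall b, b \in Ea -> X (edge v t) b -> u \in b /\ t \notin b) ->
  simple_drawable R Va Ea X -> simple_drawable R Va Ea (uncrossed_at (pred1 t)).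
Proof.
move=> uv utE vtE at_t crossed_ut crossed_vt [pos [cv D]].
case: (pselect (exists b p, crossing Va Ea pos cv (edge u t) b p)) => [[b [p cab]]|no_ut].
  have [_ bE _ _ _] := cab; have [vb tb] := crossed_ut b bE (sd_crossing D cab).
  exact: (sd_reroute uv vtE at_t D cab vb tb).
case: (pselect (exists b p, crossing Va Ea pos cv (edge v t) b p)) => [[b [p cab]]|no_vt].
  have [_ bE _ _ _] := cab; have [ub tb] := crossed_vt b bE (sd_crossing D cab).
  rewrite eq_sym in uv; apply: (sd_reroute uv utE _ D cab ub tb) => a aE /(at_t a aE)[]; auto.
have no_crossing a b p : crossing Va Ea pos cv a b p -> t \notin a.
  move=> cab; apply/negP => ta; have [aE _ _ _ _] := cab.
  by case: (at_t a aE ta) cab => -> cab; [apply: no_ut|apply: no_vt]; exists b, p.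
exists pos, cv; apply: (simple_drawing_restrict D) => [|a aE|a b p aE bE cab Xab].
- exact: subxx.
- by split=> //; apply/fintype.subsetP => w; exact: (sd_sub D).
- split=> // w; rewrite inE => /eqP ->.
  by rewrite (no_crossing _ _ _ cab) (no_crossing _ _ _ (crossing_sym cab)).
Qed.

End ClearVertex.

Section AllowedCrossings.
Variable S : set crossing_type.

Lemma crossing_disjoint_edges (G : sgraph) (u v x y : G) :
  S `<=` [set Full; AlmostFull; Bowtie]%classic -> S (type_of_crossing u v x y) ->
  (adj u x && adj v y) || (adj u y && adj v x).
Proof.
move=> SS /SS; rewrite /type_of_crossing.
by case: (adj u x); case: (adj u y); case: (adj v x); case: (adj v y) => //= -[[]|].
Qed.

Lemma allowed_at_degree2 (G : sgraph) (u v t : G) (b : {set G}) :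
  S `<=` [set Full; AlmostFull; Bowtie]%classic -> (forall w, adj t w -> w = u \/ w = v) ->
  b \in edges G -> allowed S (edge u t) b -> v \in b /\ t \notin b.
Proof.
move=> SS at_t /edgesP[x [y [_ ->]]] [disj /(_ u t x y erefl erefl) typ].
have avoid w : w \in edge u t -> w \notin edge x y.
  by move=> wut; have /finset.setP/(_ w) := disj; rewrite !inE -!in_edge wut /= => ->.
split; last by apply: avoid; exact: edge_r.
have nbr w : w \in edge x y -> adj t w -> v \in edge x y.
  by move=> wxy /at_t[] wE; rewrite wE in wxy *;
    first by rewrite (negbTE (avoid u (edge_l _ _))) in wxy.
by have := crossing_disjoint_edges SS typ; case/orP=> /andP[_]; apply: nbr; rewrite ?edge_l ?edge_r.
Qed.

Lemma allowed_imset (G G' : sgraph) (s : G' -> G) (W a b : {set G'}) :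
  {in W &, forall u v, adj (s u) (s v) = adj u v} -> a \subset W -> b \subset W ->
  allowed S (s @: a)%SET (s @: b)%SET -> allowed S a b.
Proof.
move=> s_adj aW bW [disj typ]; split.
  apply/finset.setP => w; rewrite !inE; apply/negP => /andP[wa wb].
  by have /finset.setP/(_ (s w)) := disj; rewrite finset.in_set0 finset.in_setI !imset_f.
move=> u v x y aE bE; rewrite aE edge_sub in aW; rewrite bE edge_sub in bW.
case/andP: aW => uW vW; case/andP: bW => xW yW.
have := typ (s u) (s v) (s x) (s y); rewrite aE bE !imset_edge => /(_ erefl erefl).
by rewrite /type_of_crossing !s_adj.
Qed.

End AllowedCrossings.

Definition drawable_on (R : realType) (G : sgraph) (W : {set G}) (X : {set G} -> {set G} -> Prop) :=
  simple_drawable R W (edges_in W) X.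

Section DrawableOn.
Variable R : realType.

Lemma drawable_on_weaken (G : sgraph) (W : {set G}) X X' : drawable_on R W X ->
  (forall a b, a \in edges_in W -> b \in edges_in W -> X a b -> X' a b) -> drawable_on R W X'.
Proof.
by move=> D XX'; apply: (sd_restrict D) => // a aE; split=> //; exact: edges_in_sub aE.
Qed.

Lemma drawable_on_relabel (G G' : sgraph) (x0 : G') (W : {set G}) (W' : {set G'})
    (s : G' -> G) X X' :
  drawable_on R W X -> {in W' &, injective s} -> (forall w, w \in W' -> s w \in W) ->
  {in W' &, forall u v, adj (s u) (s v) = adj u v} ->
  (forall a b, a \in edges_in W' -> b \in edges_in W' -> X (s @: a)%SET (s @: b)%SET -> X' a b) ->
  drawable_on R W' X'.
Proof.
move=> D s_inj sW s_adj XX'; apply: (sd_relabel x0 D s_inj sW) => [a aE|a b aE bE _];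
  last exact: XX'.
split; [exact: edges_in_card aE|exact: edges_in_sub aE|].
case/edges_inP: aE => u [v [-> uv uW vW]].
by rewrite imset_edge edge_edges_in s_adj // uv !sW.
Qed.

Lemma drawable_on_restricted (S : set crossing_type) (G : sgraph) (x0 : G) :
  restricted R S G <-> drawable_on R [set: G]%SET (@allowed S G).
Proof.
rewrite /drawable_on edges_inT.
by split; [exact: restricted_simple_drawable|exact: simple_drawable_restricted].
Qed.

Lemma restricted_on_image (S : set crossing_type) (G G' : sgraph) (i : G -> G') (W : {set G'}) :
  G -> restricted R S G -> (forall u v, adj (i u) (i v) = adj u v) ->
  (forall w, w \in W -> exists v, i v = w) -> drawable_on R W (@allowed S G').
Proof.
move=> x0 /(drawable_on_restricted S x0) D i_adj coverW.
pose s w := odflt x0 [pick v | i v == w].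
have sK w : w \in W -> i (s w) = w.
  by move=> /coverW[v <-]; rewrite /s; case: pickP => [? /eqP|/(_ v)] //=; rewrite eqxx.
have s_adj : {in W &, forall u v, adj (s u) (s v) = adj u v}.
  by move=> u v uW vW; rewrite -i_adj !sK.
apply: (drawable_on_relabel (i x0) D (can_in_inj sK) _ s_adj)
  => [w _|a b /edges_in_sub aW /edges_in_sub bW].
  by rewrite finset.in_setT.
exact: (allowed_imset s_adj aW bW).
Qed.

Lemma restricted_embedding (S : set crossing_type) (G G' : sgraph) (i : G' -> G) (W : {set G}) :
  G' -> drawable_on R W (@allowed S G) -> injective i -> (forall u v, adj (i u) (i v) = adj u v) ->
  (forall w, i w \in W) -> restricted R S G'.
Proof.
move=> x0 D i_inj i_adj iW; apply/(@drawable_on_restricted S G' x0).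
have i_adj' : {in [set: G']%SET &, forall u v, adj (i u) (i v) = adj u v} by move=> u v _ _.
apply: (drawable_on_relabel x0 D _ _ i_adj') => [u v _ _|w _|a b /edges_in_sub aT /edges_in_sub bT].
- exact: i_inj.
- exact: iW.
- exact: (allowed_imset i_adj' aT bT).
Qed.

End DrawableOn.
Section ExpandedGraph.
Variables (H : sgraph) (T : spr_data H).
Hypothesis treeT : pre_tree T.
Implicit Types (A : {set node T}) (x y z : node T) (e f g : sk_edge T).

Definition expanded_adj : rel (H + sk_edge T) := fun a b =>
  match a, b with
  | inl u, inl v => adj u v
  | inl u, inr f => u \in sk_ends f
  | inr f, inl u => u \in sk_ends f
  | inr _, inr _ => false
  end.

Lemma expanded_adj_sym : symmetric expanded_adj.
Proof. by move=> [u|f] [v|g] //=; rewrite adj_sym. Qed.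

Lemma expanded_adj_irrefl : irreflexive expanded_adj.
Proof. by move=> [u|f] //=; rewrite adj_irrefl. Qed.

Definition expanded : sgraph := SGraph expanded_adj_sym expanded_adj_irrefl.

Definition virtual_vertex : pred expanded := fun w => if w is inr _ then true else false.

Lemma expanded_adj_inr f u v w : sk_ends f = edge u v -> adj (inr f : expanded) w ->
  w = inl u \/ w = inl v.
Proof. by case: w => //= w ->; rewrite in_edge => /orP[] /eqP ->; auto. Qed.

Lemma expanded_edge_inr f u v (a : {set expanded}) : sk_ends f = edge u v -> a \in edges expanded ->
  inr f \in a -> a = edge (inl u) (inr f) \/ a = edge (inl v) (inr f).
Proof.
move=> fE aE fa; have [w aw fw] := card2_edge (card_edges aE) fa.
rewrite {}aw edge_edges in aE *.
by case: (expanded_adj_inr fE aE) => ->; rewrite edgeC; auto.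
Qed.

(* The part of the graph covered by the nodes in A, with a vertex for each
   virtual edge whose twin lies outside A. *)
Definition piece A : {set expanded} :=
  [set w : expanded | match w with
    | inl v => [exists x in A, v \in sk_vert x]
    | inr f => [&& virtual f, sk_node f \in A & sk_node (twin f) \notin A]
    end]%SET.

Lemma piece_inlP A v : reflect (exists2 x, x \in A & v \in sk_vert x) (inl v \in piece A).
Proof. by rewrite inE; exact: exists_inP. Qed.

Lemma piece_inr A f :
  (inr f \in piece A) = [&& virtual f, sk_node f \in A & sk_node (twin f) \notin A].
Proof. by rewrite inE. Qed.

Lemma piece1_inl x v : (inl v \in piece [set x]%SET) = (v \in sk_vert x).
Proof.
apply/piece_inlP/idP => [[z]|vx]; first by rewrite inE => /eqP ->.
by exists x; rewrite ?inE.
Qed.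

Lemma piece1_inr x f : (inr f \in piece [set x]%SET) = virtual f && (sk_node f == x).
Proof.
rewrite piece_inr !inE; case: (boolP (virtual f)) => vf //=.
by case: eqP => [<-|] //=; rewrite (pt_twin_node treeT).
Qed.

Lemma sk_ends_vert e v : v \in sk_ends e -> v \in sk_vert (sk_node e).
Proof. exact: (fintype.subsetP (pt_ends_sub treeT e)). Qed.

Lemma piece_ends A f v : inr f \in piece A -> v \in sk_ends f -> inl v \in piece A.
Proof.
rewrite piece_inr => /and3P[_ fA _] vf; apply/piece_inlP; exists (sk_node f) => //.
exact: sk_ends_vert.
Qed.

Lemma piece_edge_inr A f v : inr f \in piece A -> v \in sk_ends f ->
  edge (inl v : expanded) (inr f) \in edges_in (piece A).
Proof.
by move=> fA vf; rewrite (@edge_edges_in expanded) /= vf fA (piece_ends fA vf).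
Qed.

Definition skeleton_plus_expanded x (w : skeleton_plus x) : expanded :=
  match w with inl v => inl (val v) | inr f => inr (val f) end.

Lemma skeleton_plus_expanded_inj x : injective (@skeleton_plus_expanded x).
Proof. by move=> [u|f] [v|g] //= [] /val_inj ->. Qed.

Lemma skeleton_plus_expanded_adj x (w w' : skeleton_plus x) :
  adj (skeleton_plus_expanded w) (skeleton_plus_expanded w') = adj w w'.
Proof.
case: w w' => [u|f] [v|g] //=; apply/idP/andP => [uv|[_ /exists_inP[e _ /andP[/eqP eE]]]].
  split; first by rewrite -(inj_eq val_inj) adj_neq.
  have [e ex eE] := sk_edge_of_adj treeT (valP u) (valP v) uv.
  by apply/exists_inP; exists e; rewrite // eE eqxx uv implybT.
case: (boolP (virtual e)) => //= ve _.
by rewrite -edge_edges -eE; exact: (pt_real_edge treeT).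
Qed.

Definition subtree A : Prop := forall f z, virtual f -> sk_node f \in A ->
  sk_node (twin f) \notin A -> z \in A -> z \notin far f.

Lemma subtree1 x : subtree [set x]%SET.
Proof.
by move=> f z vf; rewrite !finset.in_set1 => /eqP fx _ /eqP ->;
  rewrite -fx (sk_node_notin_far treeT).
Qed.

Lemma leaving_edge A x y : x \in A -> y \notin A ->
  exists e, [/\ virtual e, sk_node e \in A & sk_node (twin e) \notin A].
Proof.
move=> xA yA; have := connect_exit (pt_connected treeT x y) xA yA.
by case=> a [b [/existsP[e /and3P[ve /eqP <- /eqP <-]] aA bA]]; exists e.
Qed.

Section Extension.
Variables (A : {set node T}) (e : sk_edge T).
Hypotheses (treeA : subtree A) (ve : virtual e) (eA : sk_node e \in A)
  (yA : sk_node (twin e) \notin A).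
Let y := sk_node (twin e).

Let y_far : y \in far e. Proof. exact: twin_node_in_far. Qed.

Let twin_virtual := pt_twin_virtual treeT ve.

Lemma subtreeU1 : subtree (y |: A)%SET.
Proof.
move=> f z vf; rewrite !finset.in_setU1 negb_or => fA /andP[fy fA'] zA.
have fe : f != e by apply: contraNneq fy => ->.
case/orP: fA => fA.
  have ef : twin e != f by apply: contraNneq fA' => <-; rewrite (pt_twinK treeT).
  case/orP: zA => [/eqP ->|zA]; first by rewrite -(eqP fA) (sk_node_notin_far treeT).
  apply: (far_disjoint treeT twin_virtual vf _ ef); first by rewrite (eqP fA).
  by rewrite (far_twin treeT) // treeA.
case/orP: zA => [/eqP ->|zA]; last exact: treeA.
rewrite (far_twin_node treeT vf ve); first exact: treeA.
  by rewrite eq_sym.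
by apply: contraNneq fA' => <-.
Qed.

Let pieceU1_inl v : inl v \in piece (y |: A)%SET ->
  inl v \in piece A \/ inl v \in piece [set y]%SET.
Proof.
case/piece_inlP=> z; rewrite finset.in_setU1 => /orP[/eqP ->|zA] vz.
  by right; rewrite piece1_inl.
by left; apply/piece_inlP; exists z.
Qed.

Let pieceU1_inr f : inr f \in piece (y |: A)%SET ->
  inr f \in piece A \/ inr f \in piece [set y]%SET.
Proof.
rewrite piece1_inr !piece_inr !inE negb_or => /and3P[-> fA /andP[_ ->]].
by case/orP: fA => ->; auto.
Qed.

Lemma piece_meet u v : sk_ends e = edge u v ->
  (piece A :&: piece [set y])%SET = edge (inl u : expanded) (inl v).
Proof.
move=> eE; apply/finset.setP => -[w|f]; rewrite finset.in_setI in_edge.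
  have -> : (inl w == inl u :> expanded) || (inl w == inl v :> expanded) = (w \in sk_ends e).
    by rewrite eE in_edge.
  apply/andP/idP => [[/piece_inlP[z zA wz]]|we]; rewrite piece1_inl.
    exact: (shared_vertex_in_ends treeT ve (treeA ve eA yA zA) y_far wz).
  split; last by apply: sk_ends_vert; rewrite (pt_twin_ends treeT).
  by apply/piece_inlP; exists (sk_node e); rewrite ?sk_ends_vert.
rewrite piece1_inr piece_inr; apply/negP => /andP[/and3P[_ fA _] /andP[_ /eqP fy]].
by rewrite fy (negbTE yA) in fA.
Qed.

Lemma pieceU1_sub : piece (y |: A)%SET \subset
  ((piece A :|: piece [set y]) :\: edge (inr e : expanded) (inr (twin e)))%SET.
Proof.
apply/fintype.subsetP => -[v|f] wA; rewrite finset.in_setD finset.in_setU in_edge.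
  by case: (pieceU1_inl wA) => ->; rewrite ?orbT.
have -> /= : (inr f == inr e :> expanded) || (inr f == inr (twin e) :> expanded) = false.
  rewrite piece_inr !inE negb_or in wA; have /and3P[_ _ /andP[fy fA]] := wA.
  apply/negP => /orP[] /eqP -[fE]; first by rewrite fE eqxx in fy.
  by rewrite fE (pt_twinK treeT) // eA in fA.
by case: (pieceU1_inr wA) => ->; rewrite ?orbT.
Qed.

Let piece_side v z : inl v \in piece (y |: A)%SET -> v \in sk_vert z ->
  if z \in far e then inl v \in piece [set y]%SET else inl v \in piece A.
Proof.
move=> /pieceU1_inl vA vz; case: ifPn => zf; case: vA => //.
  case/piece_inlP=> x xA vx; rewrite piece1_inl; apply: sk_ends_vert;
    rewrite (pt_twin_ends treeT) //.
  exact: (shared_vertex_in_ends treeT ve (treeA ve eA yA xA) zf vx).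
rewrite piece1_inl => vy; apply/piece_inlP; exists (sk_node e) => //; apply: sk_ends_vert.
exact: (shared_vertex_in_ends treeT ve zf y_far vz).
Qed.

Lemma pieceU1_edges (a : {set expanded}) : a \in edges_in (piece (y |: A)%SET) ->
  a \in (edges_in (piece A) :|: edges_in (piece [set y]))%SET.
Proof.
case/edges_inP=> p [q [-> pq pA qA]]; rewrite finset.in_setU !(@edge_edges_in expanded) pq /=.
case: p q pq pA qA => [u|f] [v|g] //= pq pA qA.
- have uvE : edge u v \in edges H by rewrite edge_edges.
  have [g _ gE] := pt_real_ex treeT uvE.
  have in_g w : w \in edge u v -> w \in sk_vert (sk_node g) by rewrite -gE; exact: sk_ends_vert.
  have := piece_side pA (in_g u (edge_l _ _)); have := piece_side qA (in_g v (edge_r _ _)).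
  by case: ifP => _ -> ->; rewrite ?orbT.
- by case: (pieceU1_inr qA) => gA; rewrite gA (piece_ends gA pq) ?orbT.
- by case: (pieceU1_inr pA) => fA; rewrite fA (piece_ends fA pq) ?orbT.
Qed.

End Extension.
End ExpandedGraph.
Section Pieces.
Variables (R : realType) (S : set crossing_type) (H : sgraph) (T : spr_data H).
Hypothesis treeT : is_spr_tree T.
Let preT := spr_pre_tree treeT.
Implicit Types (A : {set node T}) (x : node T) (e f : sk_edge T).

Definition drawable_piece A : Prop :=
  drawable_on R (piece A) (uncrossed_at (@allowed S (expanded T)) (@virtual_vertex H T)).

Lemma drawable_pieceU1 A e : subtree A -> virtual e -> sk_node e \in A ->
  sk_node (twin e) \notin A ->
  drawable_piece A -> drawable_piece [set sk_node (twin e)]%SET ->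
  drawable_piece (sk_node (twin e) |: A)%SET.
Proof.
move=> treeA ve eA yA DA Dy; have [u [v [eE uv]]] := sk_ends_edge preT e.
have tE : sk_ends (twin e) = edge u v by rewrite (pt_twin_ends preT).
have e_piece : (inr e : expanded T) \in piece A by rewrite piece_inr ve eA.
have t_piece : (inr (twin e) : expanded T) \in piece [set sk_node (twin e)]%SET.
  by rewrite piece1_inr // eqxx (pt_twin_virtual preT).
have sub := pieceU1_sub preT ve eA.
apply: (sd_restrict (@sd_two_sum R _ _ _ _ _ _ DA Dy (inl u) (inl v) (inr e) (inr (twin e))
  _ _ _ _ _ _ _ _ _ _ _ _ _) sub) => //.
- exact: (piece_meet preT treeA ve eA yA eE).
- by rewrite piece1_inr // ve eq_sym (negbTE (pt_twin_node preT ve)).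
- by rewrite piece_inr (negbTE yA) andbF.
- by apply: piece_edge_inr => //; rewrite eE edge_l.
- by apply: piece_edge_inr => //; rewrite eE edge_r.
- by apply: piece_edge_inr => //; rewrite tE edge_l.
- by apply: piece_edge_inr => //; rewrite tE edge_r.
- by move=> a; rewrite edges_inE => /andP[aE _]; exact: expanded_edge_inr.
- by move=> a; rewrite edges_inE => /andP[aE _]; exact: expanded_edge_inr.
- by move=> a b /orP[] ta [_ free]; [have := free (inr e) isT|have := free (inr (twin e)) isT];
    rewrite ta.
- move=> a aE; have aU := pieceU1_edges preT treeA ve eA yA aE.
  have /fintype.subsetP a_sub := fintype.subset_trans (edges_in_sub aE) sub.
  split; last exact: edges_in_sub aE.
  rewrite inE aU /=; apply/andP; split; apply/negP => /a_sub; rewrite finset.in_setD.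
    by rewrite edge_l.
  by rewrite edge_r.
Qed.

Lemma drawable_piece_tree : (forall x, drawable_piece [set x]%SET) ->
  drawable_piece [set: node T]%SET.
Proof.
move=> base; have /card_gt0P[x0 _] := pt_nonempty preT.
suff grow n A : (#|~: A| <= n)%N -> x0 \in A -> subtree A -> drawable_piece A ->
    drawable_piece [set: node T]%SET.
  by apply: (grow _ [set x0]%SET (leqnn _)); [rewrite inE|exact: subtree1|exact: base].
elim: n A => [|n IH] A An x0A treeA DA.
  suff -> : [set: node T]%SET = A by [].
  by apply: finset.setC_inj; rewrite finset.setCT; apply/esym/eqP; rewrite -cards_eq0 -leqn0.
case: (set_0Vmem (~: A)%SET) => [A0|[y]]; first by apply: (IH A) => //; rewrite A0 cards0.
rewrite finset.in_setC => yA; have [e [ve eA tA]] := leaving_edge preT x0A yA.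
apply: (IH (sk_node (twin e) |: A)%SET); last exact: drawable_pieceU1.
- rewrite -ltnS; apply: leq_trans An; apply: proper_card; apply/properP.
  split; first by rewrite finset.setCS; exact: finset.subsetUr.
  by exists (sk_node (twin e)); rewrite !inE ?eqxx.
- by rewrite !inE x0A orbT.
- exact: subtreeU1.
Qed.

Lemma spr_vertex x : exists v : H, v \in sk_vert x.
Proof.
apply/card_gt0P; apply: (@leq_trans 2) => //.
by have := spr_kind treeT x; case: (kind x) => [[/ltnW]|[->]|[_ [/ltnW/ltnW]]].
Qed.

Lemma pieces_restricted : (forall x, drawable_piece [set x]%SET) -> restricted R S H.
Proof.
move=> base; have /card_gt0P[x0 _] := pt_nonempty preT; have [v0 _] := spr_vertex x0.
have D : drawable_on R (piece [set: node T]%SET) (@allowed S (expanded T)).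
  by apply: (drawable_on_weaken (drawable_piece_tree base)) => a b _ _ [].
apply: (restricted_embedding (i := fun v : H => inl v : expanded T) v0 D) => // [u v []//|v].
by have [x vx] := pt_vert_ex preT v; apply/piece_inlP; exists x.
Qed.

Lemma piece1_edge x u v : edge (inl u : expanded T) (inl v) \in edges_in (piece [set x]%SET) ->
  exists2 e, e \in sk_edges x & sk_ends e = edge u v.
Proof.
rewrite (@edge_edges_in (expanded T)) /= !piece1_inl => /and3P[uv ux vx].
exact: sk_edge_of_adj preT _ _ _ ux vx uv.
Qed.

(* The two poles are the extreme vertices of the spine; the edges at the lower
   pole go to one page and the remaining edges, all at the upper pole, to the other. *)
Section PolarNode.
Variables (x : node T) (u v : H).
Hypotheses (uv : u != v) (xE : sk_vert x = edge u v).

Let top := #|sk_edge T|.+1.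

Let height (w : expanded T) : nat :=
  match w with inl w' => if w' == u then 0 else top | inr f => (enum_rank f).+1 end.

Let height_u : height (inl u) = 0%N. Proof. by rewrite /= eqxx. Qed.
Let height_v : height (inl v) = top. Proof. by rewrite /= eq_sym (negbTE uv). Qed.

Let height_inr f : (0 < height (inr f) < top)%N. Proof. by rewrite /= /top ltnS ltn_ord. Qed.

Let pole w : (inl w : expanded T) \in piece [set x]%SET -> w = u \/ w = v.
Proof. by rewrite piece1_inl xE in_edge => /orP[] /eqP; auto. Qed.

Let height_inj : {in piece [set x]%SET &, injective height}.
Proof.
move=> [w|f] [w'|g].
- by move=> /pole[] -> /pole[] -> //; rewrite height_u height_v.
- move=> /pole[] -> _; rewrite ?height_u ?height_v => gE; have := height_inr g; rewrite -gE //.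
  by rewrite ltnn andbF.
- move=> _ /pole[] ->; rewrite ?height_u ?height_v => fE; have := height_inr f; rewrite fE //.
  by rewrite ltnn andbF.
- by move=> _ _ /= -[/ord_inj/enum_rank_inj ->].
Qed.

Let low_end w w' : inl u \in edge w w' -> (height w < height w')%N -> height w = 0%N.
Proof. by rewrite in_edge => /orP[] /eqP <-; rewrite height_u. Qed.

Let high_end w w' : edge w w' \in edges_in (piece [set x]%SET) -> inl u \notin edge w w' ->
  (height w < height w')%N -> height w' = top.
Proof.
rewrite (@edge_edges_in (expanded T)) in_edge negb_or => /and3P[ww' wx w'x] /andP[uw uw'].
case: w' ww' w'x uw' => [w'|g] ww' w'x uw' lt_ww'.
  by case: (pole w'x) uw' => ->; rewrite ?eqxx.
case: w ww' wx uw lt_ww' => [w|//] _ wx uw.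
case: (pole wx) uw => ->; rewrite ?eqxx // height_v => _ /ltnW.
by have /andP[_] := height_inr g; rewrite ltnNge => /negbTE ->.
Qed.

Lemma drawable_piece_polar : drawable_piece [set x]%SET.
Proof.
apply: (@sd_book R (expanded T) (inl u) _ _ _ height (fun a => inl u \in a) height_inj).
  by move=> a aE; split; [exact: edges_in_card aE|exact: edges_in_sub aE].
move=> w w' z z' wE zE ww' zz' page_eq; case: (boolP (inl u \in edge w w')) page_eq => wu zu.
  rewrite (low_end wu ww') (low_end (esym zu) zz') /=.
  by case/orP: (leq_total (height w') (height z')) => ->; rewrite ?orbT.
rewrite (high_end wE wu ww') (high_end zE _ zz') ?leqnn -?zu //.
by case/orP: (leq_total (height w) (height z)) => ->; rewrite ?orbT.
Qed.

End PolarNode.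
(* Along the spine of a drawing on a single page the vertices of the cycle alternate
   with the vertices of its virtual edges. *)
Section CyclicNode.
Variables (x : node T) (v0 : H) (c : seq H).
Hypotheses (uc : uniq c) (c3 : (2 < size c)%N) (cE : c =i sk_vert x).
Hypothesis ends_inj : {in sk_edges x &, injective (@sk_ends H T)}.
Hypothesis cycle_edges : forall f, f \in sk_edges x ->
  exists2 v, v \in c & sk_ends f = edge v (next c v).

Let slot f : nat := find (fun v => sk_ends f == edge v (next c v)) c.

Let place (w : expanded T) : nat :=
  match w with inl v => (index v c).*2 | inr f => (slot f).*2.+1 end.

Let incident f (w : expanded T) : bool :=
  match w with inl v => v \in sk_ends f | inr g => g == f end.

Let slotP f : f \in sk_edges x ->
  exists v, [/\ v \in c, index v c = slot f & sk_ends f = edge v (next c v)].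
Proof.
move=> fx; have [v vc fE] := cycle_edges fx.
have has_f : has (fun v => sk_ends f == edge v (next c v)) c.
  by apply/hasP; exists v; rewrite ?fE.
have lt_f : (slot f < size c)%N by rewrite -has_find.
exists (nth v c (slot f)); rewrite mem_nth // index_uniq //; split=> //.
by apply/eqP; exact: (nth_find v has_f).
Qed.

Let slot_inj : {in sk_edges x &, injective slot}.
Proof.
move=> f g fx gx fg; apply: ends_inj => //.
have [v [vc vE ->]] := slotP fx; have [w [wc wE ->]] := slotP gx.
by rewrite -(nth_index v vc) vE fg -wE nth_index.
Qed.

Let place_inj : {in piece [set x]%SET &, injective place}.
Proof.
move=> [v|f] [w|g]; rewrite ?piece1_inl ?piece1_inr //=.
- by rewrite -!cE => vc wc /double_inj E; rewrite -(nth_index v vc) E nth_index.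
- by move=> _ _ /(congr1 odd); rewrite /= !odd_double.
- by move=> _ _ /(congr1 odd); rewrite /= !odd_double.
- by move=> /andP[_ fx] /andP[_ gx] [/double_inj/slot_inj ->] //; rewrite inE.
Qed.

Let place_incident f w : f \in sk_edges x -> incident f w ->
  (slot f < size c)%N /\ [\/ place w = (slot f).*2, place w = (slot f).*2.+1 |
    place w = if (slot f).+1 == size c then 0%N else (slot f).*2.+2].
Proof.
move=> /slotP[v [vc vE fE]]; rewrite -vE index_mem vc; case: w => [w|g] /=.
  rewrite fE in_edge => /orP[] /eqP ->; split=> //; first exact: Or31.
  by apply: Or33; rewrite index_next //; case: eqP.
by move=> /eqP ->; rewrite vE; split=> //; exact: Or32.
Qed.

Let edge_incident w w' : edge w w' \in edges_in (piece [set x]%SET) ->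
  exists2 f, f \in sk_edges x & incident f w /\ incident f w'.
Proof.
case: w w' => [u|f] [v|g].
- by case/piece1_edge => f fx fE; exists f; rewrite //= fE edge_l edge_r.
- rewrite (@edge_edges_in (expanded T)) piece1_inr // => /and3P[ug _ /andP[_ gx]].
  by exists g; rewrite ?inE //= eqxx.
- rewrite (@edge_edges_in (expanded T)) piece1_inr // => /and3P[vf /andP[_ fx] _].
  by exists f; rewrite ?inE //= eqxx.
- by rewrite (@edge_edges_in (expanded T)).
Qed.

Let edge_span w w' : edge w w' \in edges_in (piece [set x]%SET) -> (place w < place w')%N ->
  (exists i, [/\ (i < size c)%N, (i.*2 <= place w)%N, (place w' <= i.*2.+2)%N &
    (place w' <= (size c).*2.-1)%N]) \/
  place w = 0%N /\ ((size c).-1.*2 <= place w' <= (size c).*2.-1)%N.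
Proof.
case/edge_incident=> f fx [/(place_incident fx)[lt_f pw] /(place_incident fx)[_ pw']].
move: (place w) (place w') pw pw' lt_f c3 => l h; case: eqP => [last_f|not_last].
  case=> ->; case=> -> lt_f n3 lt_lh; try (right; lia); left; exists (slot f); split; lia.
by case=> ->; case=> -> lt_f n3 lt_lh; left; exists (slot f); split; lia.
Qed.

Lemma drawable_piece_cyclic : drawable_piece [set x]%SET.
Proof.
apply: (@sd_book R (expanded T) (inl v0) _ _ _ place (fun=> true) place_inj).
  by move=> a aE; split; [exact: edges_in_card aE|exact: edges_in_sub aE].
move=> w w' z z' wE zE lt_w lt_z _; move: (edge_span wE lt_w) (edge_span zE lt_z) (lt_w) (lt_z).
move: (place w) (place w') (place z) (place z') => l h l' h'.
by move=> [[i [i1 i2 i3 i4]]|[-> i1]] [[j [j1 j2 j3 j4]]|[-> j1]] lh lh'; move: c3; lia.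
Qed.

End CyclicNode.

Lemma drawable_piece1 (x : node T) : restricted R S (skeleton_plus x) ->
  drawable_on R (piece [set x]%SET) (@allowed S (expanded T)).
Proof.
move=> res; have [v0 v0x] := spr_vertex x.
apply: (restricted_on_image (i := @skeleton_plus_expanded H T x) _ res).
- exact: inl (Sub v0 v0x).
- exact: skeleton_plus_expanded_adj.
- move=> [v|f]; rewrite ?piece1_inl ?piece1_inr // => wx; first by exists (inl (Sub v wx)).
  have fx : (f \in sk_edges x) && virtual f by rewrite inE andbC.
  by exists (inr (Sub f fx)).
Qed.

(* An edge crossing one of the two edges at the vertex of f ends at the other pole. *)
Lemma clear_virtual_vertex x f (Q : {pred expanded T}) :
  S `<=` [set Full; AlmostFull; Bowtie]%classic ->
  drawable_on R (piece [set x]%SET) (uncrossed_at (@allowed S (expanded T)) Q) ->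
  drawable_on R (piece [set x]%SET) (uncrossed_at (@allowed S (expanded T)) [predU1 inr f & Q]).
Proof.
move=> SS D; case: (boolP (inr f \in piece [set x]%SET)) => [f_piece|f_out]; last first.
  apply: (drawable_on_weaken D) => a b /edges_in_sub aP /edges_in_sub bP [al free]; split=> // w.
  case/predU1P=> [->|/free //].
  by apply/andP; split; apply: contraNN f_out;
    [exact: (fintype.subsetP aP)|exact: (fintype.subsetP bP)].
have [u [v [fE uv]]] := sk_ends_edge preT f.
have clear := @sd_clear_vertex R (expanded T) _ _ _ (inl u) (inl v) (inr f) uv _ _ _ _ _ D.
apply: (@drawable_on_weaken R (expanded T) _ _ _ (clear _ _ _ _ _)).
- by apply: piece_edge_inr; rewrite // fE edge_l.
- by apply: piece_edge_inr; rewrite // fE edge_r.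
- by move=> a; rewrite edges_inE => /andP[aE _]; exact: expanded_edge_inr.
- move=> b; rewrite edges_inE => /andP[bE _] [al _].
  by apply: (allowed_at_degree2 SS _ bE al) => w; exact: expanded_adj_inr.
- move=> b; rewrite edges_inE => /andP[bE _] [al _].
  by apply: (allowed_at_degree2 SS _ bE al) => w; apply: expanded_adj_inr; rewrite edgeC.
- move=> a b _ _ [[al free_Q] free_f]; split=> // w /predU1P[->|/free_Q //].
  by apply: free_f; rewrite inE.
Qed.

Lemma drawable_piece_restricted (x : node T) :
  S `<=` [set Full; AlmostFull; Bowtie]%classic -> restricted R S (skeleton_plus x) ->
  drawable_piece [set x]%SET.
Proof.
move=> SS /drawable_piece1 D.
suff clear (L : seq (sk_edge T)) : drawable_on R (piece [set x]%SET)
    (uncrossed_at (@allowed S (expanded T)) [pred w | w \in [seq inr f | f <- L]]).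
  apply: (drawable_on_weaken (clear (enum (sk_edge T)))) => a b _ _ [al free]; split=> // -[//|f] _.
  by apply: free; rewrite inE /= map_f // mem_enum.
elim: L => [|f L IH]; first exact: (drawable_on_weaken D).
apply: (drawable_on_weaken (clear_virtual_vertex f SS IH)) => a b _ _ [al free].
by split=> // w; exact: free.
Qed.

Lemma tree_restricted : S `<=` [set Full; AlmostFull; Bowtie]%classic ->
  (forall x, kind x = Rnode -> restricted R S (skeleton_plus x)) -> restricted R S H.
Proof.
move=> SS res; apply: pieces_restricted => x; have := spr_kind treeT x; have := res x;
  case: (kind x).
- move=> _ [x3 conn degree2]; have [v0 v0x] := spr_vertex x.
  have ends2 e : e \in sk_edges x -> #|sk_ends e| = 2 by move=> _; exact: (pt_ends_card preT).
  have ends_sub e : e \in sk_edges x -> sk_ends e \subset sk_vert x.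
    by rewrite inE => /eqP <-; exact: (pt_ends_sub preT).
  have [c [uc cE ends_inj cycle_edges]] := cyclic_order ends2 ends_sub degree2 x3 conn.
  have c3 : (2 < size c)%N by rewrite -(card_uniqP uc) (eq_card cE).
  exact: (@drawable_piece_cyclic x v0 c).
- by move=> _ [/eqP/cards2P[u [v [uv xE]]] _]; exact: drawable_piece_polar uv xE.
- by move=> /(_ erefl) res_x _; exact: drawable_piece_restricted SS res_x.
Qed.

End Pieces.

Section Separation.
Variables (G : sgraph) (U W C : {set G}).
Hypothesis (C_sub : C \subset (U :\: W)%SET).
Hypothesis closed_C : forall a b, a \in C -> b \in (U :\: W)%SET -> adj a b -> b \in C.

Let near_side := (C :|: U :&: W)%SET.
Let far_side := (U :\: C)%SET.

Let in_U v : v \in C -> v \in U.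
Proof. by move/(fintype.subsetP C_sub); rewrite inE => /andP[]. Qed.

Let notin_W v : v \in C -> v \notin W.
Proof. by move/(fintype.subsetP C_sub); rewrite inE => /andP[]. Qed.

Lemma separation_meet : (near_side :&: far_side)%SET = (U :&: W)%SET.
Proof.
apply/finset.setP => v; rewrite !(finset.in_setI, finset.in_setU, finset.in_setD).
by case: (boolP (v \in C)) => [/notin_W/negbTE ->|_] /=;
  rewrite ?andbF // -andbA andbCA andbb andbC.
Qed.

Lemma separation_cover : (near_side :|: far_side)%SET = U.
Proof.
apply/finset.setP => v; rewrite !(finset.in_setI, finset.in_setU, finset.in_setD).
by case: (boolP (v \in C)) => [/in_U ->|_] //=; case: (v \in U); rewrite /= ?orbT.
Qed.

Lemma separation_edges : edges_in U \subset (edges_in near_side :|: edges_in far_side)%SET.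
Proof.
have reach a b : a \in C -> b \in U -> adj a b -> b \in near_side.
  move=> aC bU ab; rewrite !inE bU; case: (boolP (b \in W)) => bW; rewrite ?orbT //.
  by rewrite (closed_C aC _ ab) // inE bW.
apply/fintype.subsetP => _ /edges_inP[a [b [-> ab aU bU]]].
rewrite finset.in_setU !edge_edges_in ab !finset.in_setD aU bU /=.
case: (boolP (a \in C)) => aC; first by rewrite (reach a b) // finset.in_setU aC.
case: (boolP (b \in C)) => bC; last by rewrite orbT.
by rewrite (reach b a) 1?adj_sym // finset.in_setU bC.
Qed.

End Separation.

Section Blocks.
Variables (R : realType) (S : set crossing_type) (G : sgraph) (x0 : G).
Hypothesis blocks : forall B : {set G}, biconnected_component B ->
  restricted R S (induced_subgraph B).
Implicit Type U : {set G}.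

Lemma drawable_on_small U X : (#|U| <= 2)%N -> drawable_on R U X.
Proof.
move=> U2; apply: (@sd_book R G x0 _ _ _ (fun v => enum_rank v) (fun=> true)).
- by move=> u v _ _ /ord_inj/enum_rank_inj.
- by move=> a aE; split; [exact: edges_in_card aE|exact: edges_in_sub aE].
have edgeU a : a \in edges_in U -> a = U.
  by move=> aE; apply/eqP; rewrite eqEcard edges_in_sub // (edges_in_card aE).
move=> u v x y /edgeU uvU /edgeU xyU lt_uv lt_xy _.
have uv : u != v by apply: contraTneq lt_uv => ->; rewrite ltnn.
move: uvU; rewrite -xyU => /(edge_inj uv)[[<- <-]|[ux vy]]; first by rewrite !leqnn !orbT.
by have := ltn_trans lt_uv; rewrite ux vy => /(_ _ lt_xy); rewrite ltnn.
Qed.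

Lemma drawable_on_2connected U : k_connected 2 (@adj G) U -> drawable_on R U (@allowed S G).
Proof.
move=> U2; pose P (C : {set G}) := `[< k_connected 2 (@adj G) C >] && (U \subset C).
have PU : P U by rewrite /P subxx andbT; apply/asboolP.
have [C /andP[/asboolP C2 UC] C_max] := arg_maxnP (fun C : {set G} => #|C|) PU.
have blockC : biconnected_component C.
  split => // D CD D2; apply/esym/eqP; rewrite eqEcard CD /=; apply: C_max.
  by rewrite /P (fintype.subset_trans UC CD) andbT; apply/asboolP.
have [v vC] : exists v, v \in C by apply/card_gt0P; exact: leq_trans C2.1.
apply: (@restricted_on_image R S (induced_subgraph C) G val U _ (blocks blockC)) => //.
  exact: Sub v vC.
by move=> w /(fintype.subsetP UC) wC; exists (Sub w wC).
Qed.

Lemma drawable_on_separation (U W C : {set G}) : (#|W| < 2)%N -> C \subset (U :\: W)%SET ->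
  (forall a b, a \in C -> b \in (U :\: W)%SET -> adj a b -> b \in C) ->
  drawable_on R (C :|: U :&: W)%SET (@allowed S G) -> drawable_on R (U :\: C)%SET (@allowed S G) ->
  drawable_on R U (@allowed S G).
Proof.
move=> W1 subC closedC D1 D2; have meet := separation_meet subC;
  have cover := separation_cover subC.
have D : simple_drawable R U (edges_in (C :|: U :&: W) :|: edges_in (U :\: C))%SET (@allowed S G).
  rewrite -[X in simple_drawable _ X]cover; case: (posnP #|(U :&: W)%SET|) => [UW|UW].
    by apply: (sd_zero_sum D1 D2); rewrite meet; apply/eqP; rewrite -cards_eq0 UW.
  have /eqP/cards1P[w wE] : #|(U :&: W)%SET| = 1%N.
    by apply/eqP; rewrite eqn_leq UW andbT (leq_trans (subset_leq_card (finset.subsetIr U W))).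
  by apply: (sd_one_sum (v := w) D1 D2); rewrite meet.
apply: (sd_restrict D) => // a aU; split; last exact: edges_in_sub.
exact: (fintype.subsetP (separation_edges closedC)).
Qed.

Lemma drawable_on_allowed U : drawable_on R U (@allowed S G).
Proof.
have [n] := ubnP #|U|; elim: n U => // n IH U; rewrite ltnS => Un.
case: (leqP #|U| 2) => U2; first exact: drawable_on_small.
case: (pselect (k_connected 2 (@adj G) U)) => [|/not_andP[|/existsNP[W /not_implyP[W2 nc]]]] //.
  exact: drawable_on_2connected.
have [C [u [v [subC uC vC closedC]]]] := disconnected_component nc.
have uU : u \in U by have := fintype.subsetP subC u uC; rewrite inE => /andP[].
apply: (drawable_on_separation W2 subC closedC); apply: IH; apply: leq_trans Un;
  apply: proper_card; apply/properP; split.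
- by have := finset.subsetUl (C :|: U :&: W)%SET (U :\: C)%SET; rewrite (separation_cover subC).
- by exists v; move: vC; rewrite !inE => /and3P[/negbTE vC /negbTE vW vU] //; rewrite vC vW andbF.
- exact: finset.subsetDl.
- by exists u; rewrite // inE uC.
Qed.

End Blocks.

Lemma blocks_restricted (R : realType) (S : set crossing_type) (G : sgraph) :
  (forall B : {set G}, biconnected_component B -> restricted R S (induced_subgraph B)) ->
  restricted R S G.
Proof.
move=> blocks; case: (pickP (fun _ : G => true)) => [x0 _|no_vertex]; last first.
  by apply: restricted_empty => v; have := no_vertex v.
by apply/(@drawable_on_restricted R S G x0); exact: drawable_on_allowed.
Qed.
(** * Existence of SPR-trees *)

Lemma connect_lift (N N' : finType) (r : rel N) (r' : rel N') (proj : N' -> N) (I : pred N') :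
  (forall n m, I n -> I m -> proj n = proj m -> connect r' n m) ->
  (forall a b, r a b -> exists n m, [/\ I n, I m, proj n = a, proj m = b & r' n m]) ->
  forall n m, I n -> I m -> connect r (proj n) (proj m) -> connect r' n m.
Proof.
move=> fiber lift n m In Im /connectP[p]; elim: p n In => [|b p IH] n In /=.
  by move=> _ /esym; exact: fiber.
case/andP=> /lift[n1 [m1 [In1 Im1 n1E m1E r_nm]]] pp mE.
apply: (connect_trans (fiber _ _ In In1 (esym n1E))); apply: (connect_trans (connect1 r_nm)).
by apply: IH => //; rewrite m1E.
Qed.

Lemma connect_image (N N' : finType) (r : rel N) (r' : rel N') (q : N -> N') :
  (forall a b, r a b -> connect r' (q a) (q b)) ->
  forall a b, connect r a b -> connect r' (q a) (q b).
Proof.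
move=> stepq a b /connectP[p pp ->]; elim: p a pp => [|c p IH] a /=; first by rewrite connect0.
by case/andP=> /stepq ac /IH; exact: connect_trans.
Qed.

Section Colorings.
Variables (V K : finType).
Implicit Types (F : {set K}) (ends : K -> {set V}) (c : pred K) (b : bool).

Definition color_class F ends c b : {set V} :=
  [set v | [exists f in F, (c f == b) && (v \in ends f)]]%SET.

Lemma color_classP F ends c b v :
  reflect (exists f, [/\ f \in F, c f = b & v \in ends f]) (v \in color_class F ends c b).
Proof.
rewrite inE; apply: (iffP exists_inP) => [[f fF /andP[/eqP cf vf]]|[f [fF cf vf]]]; exists f => //.
by rewrite cf eqxx.
Qed.

Definition boundary F ends c : {set V} :=
  (color_class F ends c true :&: color_class F ends c false)%SET.

Lemma boundaryP F ends c b v : v \in boundary F ends c ->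
  exists f, [/\ f \in F, c f = b & v \in ends f].
Proof. by rewrite inE => /andP[vT vF]; apply/color_classP; case: b. Qed.

Lemma in_boundary F ends c f g v : f \in F -> g \in F -> c f -> ~~ c g ->
  v \in ends f -> v \in ends g -> v \in boundary F ends c.
Proof.
move=> fF gF cf /negbTE cg vf vg; rewrite inE.
by apply/andP; split; apply/color_classP; [exists f|exists g].
Qed.

(* 2-connectedness of a multigraph, expressed by edge colourings. *)
Definition nonseparable F ends : Prop :=
  forall c, (forall b, exists2 f, f \in F & c f = b) -> (2 <= #|boundary F ends c|)%N.

End Colorings.

Lemma nonseparable_imset (V K K' : finType) (h : K -> K') (F : {set K}) (ends : K' -> {set V}) :
  nonseparable F (ends \o h) -> nonseparable (h @: F)%SET ends.
Proof.
move=> nonsep c colors; apply: leq_trans (nonsep (c \o h) _) _.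
  by move=> b; have [_ /imsetP[f fF ->] cf] := colors b; exists f.
apply: subset_leq_card; apply/fintype.subsetP => v vB; rewrite inE.
have [f [fF cf vf]] := boundaryP true vB; have [g [gF cg vg]] := boundaryP false vB.
by apply/andP; split; apply/color_classP; [exists (h f)|exists (h g)]; rewrite imset_f.
Qed.

Record nonseparable_node (H : sgraph) (T : spr_data H) (x : node T) : Prop := NonseparableNode {
  ns_cover : forall v, v \in sk_vert x -> exists2 f, f \in sk_edges x & v \in sk_ends f;
  ns_nonseparable : nonseparable (sk_edges x) (@sk_ends H T);
  ns_three_edges : (2 < #|sk_edges x|)%N }.

Section Split.
Variables (H : sgraph) (T : spr_data H).
Hypothesis treeT : pre_tree T.
Hypothesis nonsep : forall x : node T, nonseparable_node x.
Variables (x : node T) (c : pred (sk_edge T)).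
Let F := sk_edges x.
Let side (b : bool) := color_class F (@sk_ends H T) c b.
Let B := boundary F (@sk_ends H T) c.
Hypothesis B2 : #|B| = 2.
Hypothesis two_edges : forall b, (2 <= #|[set f in F | c f == b]%SET|)%N.

Let moved (f : sk_edge T) := (sk_node f == x) && ~~ c f.

(* The node x keeps the edges of colour true, the new node None gets the others,
   and a pair of twins with the ends B is added between the two. *)
Definition split_spr : spr_data H := @SprData H (option (node T)) (fun _ => Snode)
  (fun n => match n with Some z => if z == x then side true else sk_vert z | None => side false end)
  (sk_edge T + bool)%type
  (fun f => match f with
    | inl f => if moved f then None else Some (sk_node f)
    | inr b => if b then Some x else None
    end)
  (fun f => match f with inl f => sk_ends f | inr _ => B end)
  (fun f => match f with inl f => virtual f | inr _ => true end)
  (fun f => match f with inl f => inl (twin f) | inr b => inr (~~ b) end).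

Let half (b : bool) : node split_spr := if b then Some x else None.
Let old (f : sk_edge T) : sk_edge split_spr := inl f.
Let origin (n : node split_spr) : node T := if n is Some z then z else x.

Let in_F f : (f \in F) = (sk_node f == x).
Proof. by rewrite inE. Qed.

Let origin_old f : origin (sk_node (old f)) = sk_node f.
Proof. by rewrite /= /moved; case: (eqVneq (sk_node f) x) => [->|] //=; case: ifP. Qed.

Let node_side f : sk_node f = x -> sk_node (old f) = half (c f).
Proof. by move=> fx; rewrite /= /moved fx eqxx /=; case: (c f). Qed.

Let node_far f : sk_node f != x -> sk_node (old f) = Some (sk_node f).
Proof. by rewrite /= /moved => /negbTE ->. Qed.

Let origin_half n : origin n = x -> n = half true \/ n = half false.
Proof. by case: n => [z /= ->|]; [left|right]. Qed.

Let vert_half b : sk_vert (half b) = side b.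
Proof. by case: b; rewrite /= ?eqxx. Qed.

Let vert_far z : z != x -> sk_vert (Some z : node split_spr) = sk_vert z.
Proof. by move=> /negbTE /= ->. Qed.

Let B_side b v : v \in B -> v \in side b.
Proof. by rewrite finset.in_setI; case: b => /andP[]. Qed.

Let side_sub b v : v \in side b -> v \in sk_vert x.
Proof.
case/color_classP=> f [fF _ vf]; rewrite in_F in fF; rewrite -(eqP fF).
exact: sk_ends_vert.
Qed.

Let vert_origin n v : v \in sk_vert n -> v \in sk_vert (origin n).
Proof.
case: n => [z|]; last exact: side_sub.
rewrite /=; case: (eqVneq z x) => [->|]//; exact: side_sub.
Qed.

Let vert_old f v : v \in sk_ends f -> v \in sk_vert (sk_node (old f)).
Proof.
move=> vf; case: (eqVneq (sk_node f) x) => [fx|fx].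
  by rewrite node_side // vert_half; apply/color_classP; exists f; rewrite in_F fx eqxx.
by rewrite node_far // vert_far //; exact: sk_ends_vert.
Qed.

Let fiber_connected (r : rel (node split_spr)) (I : pred (node split_spr)) :
  (forall b, I (half b) -> I (half (~~ b)) -> r (half b) (half (~~ b))) ->
  forall n m, I n -> I m -> origin n = origin m -> connect r n m.
Proof.
move=> bridge n m In Im nm; case: (eqVneq (origin n) x) => [nx|nx].
  have mx : origin m = x by rewrite -nm.
  have := bridge true; have := bridge false.
  case: (origin_half nx) (origin_half mx) In Im => -> [] -> In Im; rewrite ?connect0 // => bF bT.
    by apply: connect1; exact: bT.
  by apply: connect1; exact: bF.
case: n m nm nx {In Im} => [z|] [w|] //=; rewrite ?eqxx //; first by move=> -> _; rewrite connect0.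
by move=> -> /eqP.
Qed.

Let split_connected n m : connect (@tree_adj H split_spr) n m.
Proof.
apply: (connect_lift (r := @tree_adj H T) (proj := origin) (I := predT)) => //.
- apply: fiber_connected => b _ _; apply/existsP; exists (inr b).
  by case: b; rewrite /= !eqxx.
- move=> a b /existsP[f /and3P[vf /eqP fa /eqP fb]].
  exists (sk_node (old f)), (sk_node (old (twin f))); rewrite !origin_old; split => //.
  by apply/existsP; exists (old f); rewrite /= vf !eqxx.
- exact: (pt_connected treeT).
Qed.

Let split_vert_connected v n m : v \in sk_vert n -> v \in sk_vert m ->
  connect (@tree_adj_at H split_spr v) n m.
Proof.
move=> vn vm; apply: (connect_lift (r := @tree_adj_at H T v) (proj := origin)
  (I := fun n => v \in sk_vert n)) => //.
- apply: fiber_connected => b; rewrite !vert_half => vb vnb; apply/existsP; exists (inr b).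
  have vB : v \in B by rewrite inE; case: b vb vnb => /= -> ->.
  by case: b {vb vnb}; rewrite /= !eqxx vB.
- move=> a b /existsP[f /and4P[vf vE /eqP fa /eqP fb]].
  exists (sk_node (old f)), (sk_node (old (twin f))); rewrite !origin_old; split => //.
  + exact: vert_old.
  + by apply: vert_old; rewrite (pt_twin_ends treeT).
  + by apply/existsP; exists (old f); rewrite /= vf vE !eqxx.
- by apply: (pt_vert_connected treeT); exact: vert_origin.
Qed.

Let split_acyclic : #|[set f : sk_edge split_spr | virtual f]%SET| = (#|node split_spr|.-1).*2.
Proof.
have -> : [set f : sk_edge split_spr | virtual f]%SET =
    (inr true |: (inr false |: (inl @: [set f : sk_edge T | virtual f])))%SET.
  apply/finset.setP => -[f|[]]; rewrite !inE ?eqxx ?orbT //=.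
  apply/idP/imsetP => [vf|[g]]; first by exists f; rewrite ?inE.
  by rewrite inE => vg [->].
have not_old b (A : {set sk_edge T}) : (inr b : sk_edge split_spr) \notin (inl @: A)%SET.
  by apply/imsetP => -[].
rewrite !cardsU1 !inE !negb_or /= !not_old /= card_imset; last by move=> f g [].
rewrite (pt_acyclic treeT) card_option; have := pt_nonempty treeT.
by case: #|node T| => // k _; rewrite doubleS.
Qed.

Lemma split_pre_tree : pre_tree split_spr.
Proof.
split.
- by move=> [f|b]; [exact: (pt_ends_card treeT)|exact: B2].
- move=> [f|b]; first by apply/fintype.subsetP => v; exact: vert_old.
  by apply/fintype.subsetP => v vB; rewrite -/(half b) vert_half; exact: B_side.
- by move=> [f|b] //=; exact: (pt_twin_virtual treeT).
- by move=> [f|b] //=; [move=> vf; rewrite (pt_twinK treeT)|rewrite negbK].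
- by move=> [f|b] //=; exact: (pt_twin_ends treeT).
- move=> [f|[]] //= vf; apply: contraNneq (pt_twin_node treeT vf) => /(congr1 origin).
  by rewrite (origin_old f) (origin_old (twin f)) => ->.
- by rewrite card_option.
- exact: split_connected.
- exact: split_acyclic.
- by move=> [f|b] //=; exact: (pt_real_edge treeT).
- by move=> a aE; have [f vf fE] := pt_real_ex treeT aE; exists (old f).
- by move=> [f|b] [g|b'] //= vf vg E; rewrite (pt_real_inj treeT vf vg E).
- move=> v; have [z vz] := pt_vert_ex treeT v.
  case: (eqVneq z x) vz => [->|zx] vz; last by exists (Some z); rewrite vert_far.
  have [f fF vf] := ns_cover (nonsep x) vz.
  by exists (half (c f)); rewrite vert_half; apply/color_classP; exists f.
- exact: split_vert_connected.
Qed.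

Let edges_half b :
  sk_edges (half b) = (inr b |: [set old f | f in [set f in F | c f == b]%SET])%SET.
Proof.
apply/finset.setP => -[f|b']; rewrite [LHS]inE finset.in_setU1; last first.
  rewrite (_ : (_ \in imset _ _) = false) ?orbF; last by apply/imsetP => -[].
  by case: b b' => [] [] //=; rewrite ?eqxx.
rewrite mem_imset; last by move=> g g' [].
rewrite inE in_F -/(old f); case: (eqVneq (sk_node f) x) => [fx|fx].
  by rewrite node_side //; case: (c f); case: b; rewrite /= ?eqxx.
by rewrite node_far //; case: b => //=; apply/eqP => -[/eqP]; rewrite (negbTE fx).
Qed.

Let edges_far z : z != x -> sk_edges (Some z : node split_spr) = [set old f | f in sk_edges z]%SET.
Proof.
move=> zx; have xz : (x == z) = false by rewrite eq_sym; exact: negbTE.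
apply/finset.setP => -[f|b]; rewrite [LHS]inE; last first.
  rewrite (_ : (_ \in imset _ _) = false); last by apply/imsetP => -[].
  by case: b => //=; apply/eqP => -[/eqP]; rewrite xz.
rewrite mem_imset; last by move=> g g' [].
rewrite inE -/(old f); case: (eqVneq (sk_node f) x) => [fx|fx]; last by rewrite node_far.
by rewrite node_side // fx xz; case: (c f) => //; apply/eqP => -[/eqP]; rewrite xz.
Qed.

Let half_nonseparable b : nonseparable (sk_edges (half b)) (@sk_ends H split_spr).
Proof.
move=> c' colors; pose c0 f := if c f == b then c' (old f) else c' (inr b).
have old_half f : f \in F -> c f = b -> old f \in sk_edges (half b).
  by move=> fF fb; rewrite edges_half finset.in_setU1 imset_f ?orbT // inE fF fb eqxx.
have [g gF gb] : exists2 g, g \in F & (c g == b) = false.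
  have /card_gt0P[g] : (0 < #|[set f in F | c f == ~~ b]%SET|)%N by exact: ltnW (two_edges _).
  by rewrite inE => /andP[gF /eqP gb]; exists g; rewrite ?gb; case: (b).
have colors0 b' : exists2 f, f \in F & c0 f = b'.
  have [f + <-] := colors b'; rewrite edges_half => /setU1P[->|/imsetP[f0]].
    by exists g; rewrite /c0 ?gb.
  by rewrite inE => /andP[fF fb] ->; exists f0; rewrite /c0 ?fb.
apply: leq_trans (ns_nonseparable (nonsep x) colors0) _; apply: subset_leq_card.
apply/fintype.subsetP => v vB0; have [f [fF cf vf]] := boundaryP true vB0.
have [f' [f'F cf' vf']] := boundaryP false vB0.
have via_bridge h b' : c' (inr b) = b' -> h \in F -> c h = b -> v \in sk_ends h ->
    v \in side (~~ b) -> v \in color_class (sk_edges (half b)) (@sk_ends H split_spr) c' b'.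
  move=> cb hF hb vh vnb; apply/color_classP; exists (inr b); rewrite edges_half finset.setU11.
  split=> //=; have vb : v \in side b by apply/color_classP; exists h.
  by rewrite inE; case: (b) vb vnb => /= -> ->.
have direct h b' : h \in F -> c h = b -> c0 h = b' -> v \in sk_ends h ->
    v \in color_class (sk_edges (half b)) (@sk_ends H split_spr) c' b'.
  by move=> hF hb; rewrite /c0 hb eqxx => ch vh; apply/color_classP; exists (old h);
    rewrite old_half.
have other_side h : h \in F -> c h != b -> v \in sk_ends h -> v \in side (~~ b).
  by move=> hF hb vh; apply/color_classP; exists h; split=> //; case: (c h) (b) hb => [] [].
rewrite inE; case: (eqVneq (c f) b) => fb; case: (eqVneq (c f') b) => f'b.
- by rewrite (direct f) // (direct f').
- rewrite (direct f) // (via_bridge f) //; last exact: other_side f'b vf'.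
  by rewrite -cf' /c0 (negbTE f'b).
- rewrite andbC (direct f') // (via_bridge f') //; last exact: other_side fb vf.
  by rewrite -cf /c0 (negbTE fb).
- by rewrite /c0 (negbTE fb) in cf; rewrite /c0 (negbTE f'b) cf in cf'.
Qed.

Let half_node b : nonseparable_node (half b).
Proof.
split; last 1 first.
- rewrite edges_half cardsU1 card_imset; last by move=> f g [].
  rewrite (_ : inr b \notin _) //; last by apply/imsetP => -[].
  by rewrite add1n ltnS; exact: two_edges.
- move=> v; rewrite vert_half => /color_classP[f [fF cf vf]]; exists (old f) => //.
  by rewrite edges_half finset.in_setU1 imset_f ?orbT // inE fF cf eqxx.
- exact: half_nonseparable.
Qed.

Lemma split_nonseparable (n : node split_spr) : nonseparable_node n.
Proof.
case: n => [z|]; last exact: (half_node false).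
case: (eqVneq z x) => [->|zx]; first exact: (half_node true).
split; rewrite edges_far //.
- move=> v; rewrite vert_far // => /(ns_cover (nonsep z))[f fz vf].
  by exists (old f); rewrite ?imset_f.
- by apply: nonseparable_imset; exact: (ns_nonseparable (nonsep z)).
- by rewrite card_imset; [exact: (ns_three_edges (nonsep z))|move=> f g []].
Qed.

End Split.

Section InitialTree.
Variable H : sgraph.
Hypothesis connected2 : k_connected 2 (@adj H) [set: H]%SET.

Definition one_node_spr : spr_data H := @SprData H unit (fun _ => Snode) (fun _ => [set: H]%SET)
  {a : {set H} | a \in edges H} (fun _ => tt) (fun e => val e) (fun _ => false) id.

Lemma one_node_pre_tree : pre_tree one_node_spr.
Proof.
split => //.
- by move=> e; apply: card_edges; exact: (valP e).
- by move=> e; exact: finset.subsetT.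
- by rewrite card_unit.
- by move=> [] [].
- rewrite card_unit /=; apply/eqP; rewrite cards_eq0; apply/eqP/finset.setP => e.
  by rewrite !finset.inE.
- by move=> e _; exact: (valP e).
- by move=> a aE; exists (Sub a aE : sk_edge one_node_spr).
- by move=> e f _ _; exact: val_inj.
- by move=> v; exists tt; rewrite finset.in_setT.
- by move=> v [] [].
Qed.

Let in_sk_edges (f : sk_edge one_node_spr) (n : node one_node_spr) : f \in sk_edges n.
Proof. by rewrite inE; case: n. Qed.

Let edge_of_adj u v : adj u v -> exists f : sk_edge one_node_spr, sk_ends f = edge u v.
Proof. by rewrite -edge_edges => uvE; exists (Sub (edge u v) uvE). Qed.

Let some_edge (v : H) : exists f : sk_edge one_node_spr, v \in sk_ends f.
Proof.
have [H3 conn] := connected2.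
have [w wv] : exists w, w != v.
  have /card_gt0P[w] : (0 < #|[set: H] :\ v|)%N.
    by move: H3; rewrite (cardsD1 v) finset.in_setT /= => /ltnW.
  by rewrite !inE andbT; exists w.
have := conn finset.set0 _ v w; rewrite cards0 finset.setD0 !finset.in_setT => /(_ isT isT isT) vw.
have wv' : w \notin pred1 v by rewrite inE.
have [a [b [/and3P[_ _ ab] /eqP av _]]] := connect_exit vw (eqxx v : v \in pred1 v) wv'.
by have [f fE] := edge_of_adj ab; exists f; rewrite fE -av edge_l.
Qed.

(* If fewer than two vertices were incident to edges of both colours, deleting them
   would separate the edges of the two colours. *)
Let one_node_nonseparable n : nonseparable (@sk_edges H one_node_spr n) (@sk_ends H one_node_spr).
Proof.
move=> c colors; rewrite leqNgt; apply/negP => B2; set B := boundary _ _ _ in B2.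
have outside (f : sk_edge one_node_spr) : exists2 p, p \in sk_ends f & p \notin B.
  apply/fintype.subsetPn; apply: contraTN B2 => /subset_leq_card.
  by rewrite (pt_ends_card one_node_pre_tree) -leqNgt.
have [f _ cf] := colors true; have [g _ cg] := colors false.
have [p pf pB] := outside f; have [q qg qB] := outside g.
pose A := [set w | [exists h : sk_edge one_node_spr, c h && (w \in sk_ends h)]]%SET.
have pA : p \in A by rewrite inE; apply/existsP; exists f; rewrite cf.
have qA : q \notin A.
  apply: contra qB; rewrite inE => /existsP[h /andP[ch qh]].
  by apply: (in_boundary (f := h) (g := g)); rewrite ?in_sk_edges ?cg.
have := connected2.2 B B2 p q; rewrite !finset.in_setD !finset.in_setT pB qB => /(_ isT isT) pq.
have [a [b [/and3P[aB _ ab] aA bA]]] := connect_exit pq pA qA.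
have [h hE] := edge_of_adj ab; case ch: (c h).
  by rewrite inE in bA; case/existsP: bA; exists h; rewrite ch hE edge_r.
move: aB; rewrite finset.in_setD finset.in_setT andbT => /negP; apply.
move: aA; rewrite inE => /existsP[k /andP[ck ak]].
by apply: (in_boundary (f := k) (g := h)); rewrite ?in_sk_edges ?ch // hE edge_l.
Qed.

Let one_node_three_edges n : (2 < #|@sk_edges H one_node_spr n|)%N.
Proof.
rewrite ltnNge; apply/negP => F2; have [H3 _] := connected2.
have /card_gt0P[v0 _] : (0 < #|[set: H]%SET|)%N := ltnW (ltnW H3).
have [e ve0] := some_edge v0.
have /fintype.subsetPn[v _ ve] : ~~ ([set: H]%SET \subset sk_ends e).
  apply: contraTN H3 => /subset_leq_card.
  by rewrite (pt_ends_card one_node_pre_tree) -leqNgt.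
have [f vf] := some_edge v; have ef : e != f by apply: contraNneq ve => ->.
have edgesE : sk_edges n = [set e; f]%SET.
  apply/esym/eqP; rewrite eqEcard cards2 ef F2 andbT.
  by apply/fintype.subsetP => g _; exact: in_sk_edges.
have colors b : exists2 g, g \in sk_edges n & pred1 e g = b.
  by case: b; [exists e|exists f]; rewrite ?in_sk_edges //= ?eqxx // eq_sym; exact/negbTE.
have := @one_node_nonseparable n (pred1 e) colors; set B := boundary _ _ _.
have Be : B \subset sk_ends e.
  by apply/fintype.subsetP => w /(boundaryP true)[g [_ /eqP ->]].
have Bf : B \subset sk_ends f.
  apply/fintype.subsetP => w /(boundaryP false)[g [+ /= ge wg]].
  by rewrite edgesE !inE ge /= => /eqP <-.
have : (#|B| < #|sk_ends f|)%N.
  apply: proper_card; apply/properP; split=> //; exists v => //.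
  by apply: contra ve; exact: (fintype.subsetP Be).
by rewrite (pt_ends_card one_node_pre_tree) ltnNge => /negP.
Qed.

Lemma one_node_nonseparable_node (n : node one_node_spr) : nonseparable_node n.
Proof.
split; [|exact: one_node_nonseparable|exact: one_node_three_edges].
by move=> v _; have [f vf] := some_edge v; exists f.
Qed.

End InitialTree.

Definition skeleton_ok (V K : finType) (k : node_kind) (W : {set V}) (F : {set K})
    (ends : K -> {set V}) : Prop :=
  match k with
  | Snode => cycle_multigraph ends W F
  | Pnode => #|W| = 2 /\ (2 < #|F|)%N
  | Rnode => {in F &, injective ends} /\ k_connected 3 (joined ends F) W
  end.

Definition node_ok (H : sgraph) (T : spr_data H) (x : node T) : Prop :=
  skeleton_ok (kind x) (sk_vert x) (sk_edges x) (@sk_ends H T).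

Section Unsplittable.
Variables (H : sgraph) (T : spr_data H).
Hypothesis treeT : pre_tree T.
Variable x : node T.
Hypothesis nonsep : nonseparable_node x.
Let F := sk_edges x.
Let ends := @sk_ends H T.
Hypothesis unsplit : forall c : pred (sk_edge T),
  (forall b, (2 <= #|[set f in F | c f == b]%SET|)%N) -> #|boundary F ends c| <> 2.

Let ends_vert f v : f \in F -> v \in ends f -> v \in sk_vert x.
Proof. by rewrite inE => /eqP <-; exact: sk_ends_vert. Qed.

Let ends2 f : #|ends f| = 2.
Proof. exact: (pt_ends_card treeT). Qed.

Lemma unsplittable_boundary (c : pred (sk_edge T)) : (forall b, exists2 f, f \in F & c f = b) ->
  (#|boundary F ends c| <= 2)%N -> exists b f,
  [/\ f \in F, c f = b, forall g, g \in F -> c g = b -> g = f & ends f = boundary F ends c].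
Proof.
move=> colors B2; have {}B2 : #|boundary F ends c| = 2.
  by apply/eqP; rewrite eqn_leq B2 (ns_nonseparable nonsep).
have [b few] : exists b, (#|[set f in F | c f == b]%SET| <= 1)%N.
  apply: contrapT => many; apply: (@unsplit c) => // b; rewrite ltnNge; apply/negP => few.
  by apply: many; exists b.
have [f fF cf] := colors b; exists b, f.
have only g : g \in F -> c g = b -> g = f.
  by move=> gF cg; have /card_le1_eqP := few; apply; rewrite inE ?gF ?fF ?cg ?cf eqxx.
split=> //; apply/esym/eqP; rewrite eqEcard B2 ends2 leqnn andbT; apply/fintype.subsetP => v.
by case/(boundaryP b)=> g [gF cg vg]; rewrite -(only g).
Qed.

Let simple : (2 < #|sk_vert x|)%N -> {in F &, injective ends}.
Proof.
move=> V3 e f eF fF ef; apply: contrapT => /eqP ne; pose c : pred (sk_edge T) := pred2 e f.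
have ends_c g : c g -> ends g = ends e by case/pred2P=> ->.
have /fintype.subsetPn[g gF] : ~~ (F \subset [set e; f]%SET).
  apply: contraTN (ns_three_edges nonsep) => /subset_leq_card.
  by rewrite cards2 ne -leqNgt.
rewrite finset.in_set2 -[_ || _]/(c g) => cg.
have colors b : exists2 g, g \in F & c g = b.
  by case: b; [exists e; rewrite /c /= ?eqxx|exists g; rewrite // (negbTE cg)].
have Be : boundary F ends c \subset ends e.
  by apply/fintype.subsetP => v /(boundaryP true)[k [_ /ends_c <-]].
have B2 : (#|boundary F ends c| <= 2)%N by have := subset_leq_card Be; rewrite ends2.
have [[] [k [kF ck only kE]]] := unsplittable_boundary colors B2.
  by case/eqP: ne; transitivity k; [|symmetry]; apply: only; rewrite // /c /= eqxx ?orbT.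
have ke : ends k = ends e by apply/eqP; rewrite eqEcard {1}kE Be !ends2.
suff : sk_vert x \subset ends e by move/subset_leq_card; rewrite ends2 leqNgt V3.
apply/fintype.subsetP => v /(ns_cover nonsep)[h hF vh]; case ch: (c h);
  first by rewrite -(ends_c h).
by rewrite -ke -(only h).
Qed.

Lemma unsplittable_cycle : #|sk_vert x| = 3 -> cycle_multigraph ends (sk_vert x) F.
Proof.
move=> V3; have inj : {in F &, injective ends} by apply: simple; rewrite V3.
have imE : (ends @: F)%SET = [set a : {set H} | a \subset sk_vert x & #|a| == 2]%SET.
  apply/eqP; rewrite eqEcard cards_draws V3 (card_in_imset inj) (ns_three_edges nonsep) andbT.
  apply/fintype.subsetP => a /imsetP[f fF ->]; rewrite inE ends2 eqxx andbT.
  by apply/fintype.subsetP => v; exact: ends_vert.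
have pair u v : u \in sk_vert x -> v \in sk_vert x -> u != v ->
    exists2 f, f \in F & ends f = edge u v.
  move=> ux vx uv; have : edge u v \in (ends @: F)%SET.
    by rewrite imE inE card_edge // edge_sub ux vx.
  by case/imsetP=> f fF ->; exists f.
split => [|u v ux vx|v vx]; first by rewrite V3.
  case: (eqVneq u v) => [->|uv]; first by rewrite connect0.
  by apply: connect1; rewrite /= ux vx; apply/joinedP; exact: pair.
have injv : {in [set e in F | v \in ends e]%SET &, injective ends}.
  by move=> e f; rewrite !(finset.in_set (fun e => (e \in F) && _)) => /andP[eF _] /andP[fF _];
    exact: inj.
rewrite -(card_in_imset injv).
have -> : (ends @: [set e in F | v \in ends e])%SET = (edge v @: (sk_vert x :\ v))%SET.
  apply/finset.setP => a; apply/imsetP/imsetP.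
    case=> f; rewrite finset.in_set => /andP[fF vf] ->.
    have [w fE vw] := card2_edge (ends2 f) vf; exists w => //.
    by rewrite !inE eq_sym vw; apply: (ends_vert fF); rewrite fE edge_r.
  case=> w; rewrite !inE eq_sym => /andP[vw wx] ->; have [f fF fE] := pair v w vx wx vw.
  by exists f => //; rewrite finset.in_set fF fE edge_l.
rewrite card_imset; last by move=> u w /edge_injr.
by have := cardsD1 v (sk_vert x); rewrite V3 vx add1n => -[<-].
Qed.

(* The edges meeting a component C of the skeleton without X get one colour and the
   other edges the other colour, so that the boundary lies in X. *)
Let unsplittable_connected (X : {set H}) : (#|X| < 3)%N ->
  connected_on (joined ends F) (sk_vert x :\: X)%SET.
Proof.
move=> X3; apply: contrapT => /disconnected_component[C [u [v [subC uC vC closedC]]]].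
pose c : pred (sk_edge T) := fun f => [exists z in C, z \in ends f].
have touch f z : z \in C -> z \in ends f -> c f by move=> zC zf; apply/exists_inP; exists z.
have inA w : w \in C -> w \in sk_vert x /\ w \notin X.
  by move/(fintype.subsetP subC); rewrite inE => /andP[].
have closed f w : f \in F -> c f -> w \in ends f -> w \notin X -> w \in C.
  move=> fF /exists_inP[z zC zf] wf wX; case: (eqVneq z w) => [<-//|zw].
  have [w' fE _] := card2_edge (ends2 f) zf; move: wf;
    rewrite fE in_edge eq_sym (negbTE zw) /= => /eqP wE.
  apply: (closedC z); rewrite // ?inE ?wX ?(ends_vert fF) ?wE ?fE ?edge_r //.
  by apply/joinedP; exists f.
have [vA vnC] : v \in (sk_vert x :\: X)%SET /\ v \notin C by move: vC; rewrite inE => /andP[].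
have [vx vX] : v \in sk_vert x /\ v \notin X by move: vA; rewrite inE => /andP[].
have [f fF uf] := ns_cover nonsep (inA u uC).1; have [g gF vg] := ns_cover nonsep vx.
have cg : c g = false by apply: contraNF vnC => cg; exact: (closed g).
have colors b : exists2 h, h \in F & c h = b.
  by case: b; [exists f|exists g]; rewrite // (touch f u).
have BX : boundary F ends c \subset X.
  apply/fintype.subsetP => w wB; have [h [hF ch wh]] := boundaryP true wB.
  have [k [kF ck wk]] := boundaryP false wB; apply: contraFT ck => wX.
  by apply: (touch k w) => //; exact: (closed h).
have B2 : (#|boundary F ends c| <= 2)%N by apply: leq_trans (subset_leq_card BX) _.
have [b [k [kF ck only kE]]] := unsplittable_boundary colors B2.
have kX w : w \in ends k -> w \notin X -> False by rewrite kE => /(fintype.subsetP BX) ->.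
case: b ck only => [/exists_inP[z zC zk] _|_ only]; first exact: kX zk (inA z zC).2.
by apply: kX vX; rewrite -(only g).
Qed.

Lemma unsplittable_3connected : (3 < #|sk_vert x|)%N ->
  {in F &, injective ends} /\ k_connected 3 (joined ends F) (sk_vert x).
Proof.
by move=> V4; split; [exact: simple (ltnW V4)|split=> // X; exact: unsplittable_connected].
Qed.

End Unsplittable.

Lemma nonseparable_tree_bound (H : sgraph) (T : spr_data H) : pre_tree T ->
  (forall x : node T, nonseparable_node x) -> (#|node T| <= #|edges H|)%N.
Proof.
move=> treeT nonsep.
have lower : (#|node T| * 3 <= #|sk_edge T|)%N.
  rewrite -sum_nat_const -[#|sk_edge T|]sum1_card (partition_big (@sk_node H T) predT) //=.
  by apply: leq_sum => x _; rewrite sum1dep_card; exact: (ns_three_edges (nonsep x)).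
have real : (#|[set e : sk_edge T | ~~ virtual e]%SET| <= #|edges H|)%N.
  rewrite -(@card_in_imset _ _ (@sk_ends H T)); last first.
    by move=> e f; rewrite !inE => ve vf; exact: (pt_real_inj treeT).
  apply: subset_leq_card; apply/fintype.subsetP => a /imsetP[e]; rewrite inE => ve ->.
  exact: (pt_real_edge treeT).
have : #|sk_edge T| = (#|[set e : sk_edge T | virtual e]%SET| +
  #|[set e : sk_edge T | ~~ virtual e]%SET|)%N.
  by rewrite -(cardsC [set e : sk_edge T | virtual e]%SET); congr addn; apply: eq_card => e;
    rewrite !inE.
rewrite (pt_acyclic treeT); have := pt_nonempty treeT; move: lower real.
by move: #|node T| #|sk_edge T| #|edges H| #|_| => n k m j; lia.
Qed.

(* Split the nodes along boundaries of size two until no further split is possible. *)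
Lemma unreduced_spr_tree (H : sgraph) : k_connected 2 (@adj H) [set: H]%SET ->
  exists T : spr_data H, pre_tree T /\ forall x : node T, node_ok x.
Proof.
move=> connected2; pose P n := `[< exists T : spr_data H,
  [/\ pre_tree T, forall x : node T, nonseparable_node x & #|node T| = n] >].
have exP : exists n, P n.
  exists #|node (one_node_spr H)|; apply/asboolP; exists (one_node_spr H).
  by split; [exact: one_node_pre_tree|exact: one_node_nonseparable_node|].
have boundP n : P n -> (n <= #|edges H|)%N.
  by case/asboolP=> T [treeT nonsep <-]; exact: nonseparable_tree_bound.
case: (ex_maxnP exP boundP) => n /asboolP[T [treeT nonsep nE]] n_max.
have unsplit x (c : pred (sk_edge T)) :
    (forall b, (2 <= #|[set f in sk_edges x | c f == b]%SET|)%N) ->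
    #|boundary (sk_edges x) (@sk_ends H T) c| <> 2.
  move=> two_edges B2; have : (#|node (split_spr x c)| <= n)%N.
    apply: n_max; apply/asboolP; exists (split_spr x c).
    by split; [exact: split_pre_tree|move=> y; exact: split_nonseparable|].
  by rewrite card_option nE ltnn.
pose k (x : node T) :=
  if #|sk_vert x| == 2 then Pnode else if #|sk_vert x| == 3 then Snode else Rnode.
exists (@SprData H (node T) k (@sk_vert H T) (sk_edge T) (@sk_node H T) (@sk_ends H T)
  (@virtual H T) (@twin H T)).
split; first by case: treeT => *; split.
move=> x; rewrite /node_ok /= /k; case: eqP => V2; first by split => //;
  exact: (ns_three_edges (nonsep x)).
case: eqP => V3; first exact: (unsplittable_cycle treeT (nonsep x) (unsplit x) V3).
apply: (unsplittable_3connected treeT (nonsep x) (unsplit x)).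
have /card_gt0P[f fx] : (0 < #|sk_edges x|)%N := ltnW (ltnW (ns_three_edges (nonsep x))).
have := subset_leq_card (pt_ends_sub treeT f); rewrite (pt_ends_card treeT).
by move: fx V2 V3; rewrite inE => /eqP ->; lia.
Qed.

Lemma joined_imset (V K K' : finType) (h : K' -> K) (F : {set K'}) (ends : K -> {set V}) :
  joined ends (h @: F)%SET = joined (ends \o h) F.
Proof.
apply: funext => u; apply: funext => v; apply/joinedP/joinedP => [[_ /imsetP[f fF ->]]|[f fF fE]].
  by exists f.
by exists (h f); rewrite ?imset_f.
Qed.

Lemma skeleton_ok_imset (V K K' : finType) (h : K' -> K) k (W : {set V}) (F : {set K'})
    (ends : K -> {set V}) :
  injective h -> skeleton_ok k W (h @: F)%SET ends -> skeleton_ok k W F (ends \o h).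
Proof.
move=> h_inj; case: k; rewrite /= /cycle_multigraph ?(joined_imset h F ends).
- case=> W3 conn degree2; split=> // v vW; rewrite -(degree2 v vW).
  rewrite -(card_imset _ h_inj); apply: eq_card => e; rewrite [RHS]inE.
  apply/imsetP/andP => [[f + ->]|[/imsetP[f fF ->] vf]]; last by exists f; rewrite ?inE ?fF.
  by rewrite inE => /andP[fF vf]; rewrite imset_f.
- by rewrite card_imset.
- by case=> inj conn; split=> // f g fF gF /inj fg; apply: h_inj; apply: fg; rewrite imset_f.
Qed.

Section Merge.
Variables (H : sgraph) (T : spr_data H).
Hypotheses (treeT : pre_tree T) (nodes_ok : forall x : node T, node_ok x).
Variable e : sk_edge T.
Hypothesis ve : virtual e.
Let x := sk_node e.
Let y := sk_node (twin e).

Let xy : x != y.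
Proof. by rewrite eq_sym; exact: (pt_twin_node treeT). Qed.

Let other_node : finType := {n : node T | n != y}.
Let other_edge : finType := {f : sk_edge T | (f != e) && (f != twin e)}.
Let merged : other_node := Sub x xy.
Let retract (n : node T) : other_node := insubd merged n.

Definition merge_spr : spr_data H := @SprData H other_node (fun n => kind (val n))
  (fun n => if val n == x then (sk_vert x :|: sk_vert y)%SET else sk_vert (val n))
  other_edge (fun f => retract (sk_node (val f))) (fun f => sk_ends (val f))
    (fun f => virtual (val f))
  (fun f => insubd f (twin (val f))).

Let val_retract n : val (retract n) = if n == y then x else n.
Proof. by rewrite /retract val_insubd /=; case: eqP. Qed.

Let retract_val (n : other_node) : retract (val n) = n.
Proof. by apply: val_inj; rewrite val_retract (negbTE (valP n)). Qed.

Let retract_x : retract x = merged.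
Proof. exact: (retract_val merged). Qed.

Let retract_y : retract y = merged.
Proof. by apply: val_inj; rewrite val_retract eqxx. Qed.

Let val_twin (f : sk_edge merge_spr) : virtual f -> val (twin f) = twin (val f).
Proof.
move=> vf; rewrite /= val_insubd; case: ifP => // /negbT.
have /andP[fe ft] := valP f; rewrite negb_and !negbK => /orP[] /eqP fE.
  by have := congr1 (@twin H T) fE; rewrite (pt_twinK treeT vf) => fE'; case/eqP: ft.
by have fE' := twin_inj treeT vf ve fE; case/eqP: fe.
Qed.

Let sk_node_twin (f : sk_edge merge_spr) : virtual f ->
  sk_node (twin f) = retract (sk_node (twin (val f))).
Proof. by move=> vf; rewrite -[LHS]/(retract (sk_node (val (twin f)))) val_twin. Qed.

Let vert_retract n v : v \in sk_vert n -> v \in sk_vert (retract n : node merge_spr).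
Proof.
rewrite /= val_retract; case: (eqVneq n y) => [->|ny] vn; first by rewrite eqxx inE vn orbT.
by case: (eqVneq n x) vn => [->|] //; rewrite inE => ->.
Qed.

Let vert_lift (n : node merge_spr) v : v \in sk_vert n ->
  exists2 m, retract m = n & v \in sk_vert m.
Proof.
rewrite /=; case: eqP => [nx|_] vn; last by exists (val n); rewrite ?retract_val.
have -> : n = merged by exact: val_inj.
by move: vn; rewrite inE => /orP[vn|vn]; [exists x|exists y].
Qed.

Let twin_node_neq f : virtual f -> f != e -> f != twin e ->
  retract (sk_node (twin f)) != retract (sk_node f).
Proof.
move=> vf fe ft; apply/eqP => /(congr1 val); rewrite !val_retract.
have same_side := esym (far_twin_node treeT ve vf fe ft).
have yf : y \in far e := twin_node_in_far e; have xf : x \notin far e := sk_node_notin_far treeT ve.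
case: eqP => [ty|_]; case: eqP => [fy|_] fE.
- by have := pt_twin_node treeT vf; rewrite ty fy eqxx.
- by rewrite -fE ty yf (negbTE xf) in same_side.
- by rewrite fy fE yf (negbTE xf) in same_side.
- by have := pt_twin_node treeT vf; rewrite fE eqxx.
Qed.

Let retract_step (r : rel (node merge_spr)) f : virtual f ->
  (forall f' : sk_edge merge_spr, val f' = f -> r (sk_node f') (sk_node (twin f'))) ->
  connect r (retract (sk_node f)) (retract (sk_node (twin f))).
Proof.
move=> vf rf; case: (eqVneq f e) => [->|fe]; first by rewrite retract_x retract_y connect0.
case: (eqVneq f (twin e)) => [->|ft].
  by rewrite (pt_twinK treeT) // retract_x retract_y connect0.
have f_other : (f != e) && (f != twin e) by rewrite fe.
have := rf (Sub f f_other) erefl; rewrite sk_node_twin //.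
exact: connect1.
Qed.

Lemma merge_card : #|node merge_spr| = #|node T|.-1.
Proof. by rewrite card_sig -(cardC1 y); apply: eq_card. Qed.

Let merge_acyclic : #|[set f : sk_edge merge_spr | virtual f]%SET| = (#|node merge_spr|.-1).*2.
Proof.
have valE : (val @: [set f : sk_edge merge_spr | virtual f])%SET =
    ([set f : sk_edge T | virtual f] :\ e :\ twin e)%SET.
  apply/finset.setP => f; rewrite !inE; apply/imsetP/and3P.
    by case=> f'; rewrite inE => vf ->; have /andP[] := valP f'.
  case=> ft fe vf; have f_other : (f != e) && (f != twin e) by rewrite fe.
  by exists (Sub f f_other); rewrite ?inE.
rewrite -(card_imset _ val_inj) valE merge_card.
have := pt_acyclic treeT; rewrite (cardsD1 e) inE ve (cardsD1 (twin e)) !inE (twin_neq treeT) //.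
by rewrite (pt_twin_virtual treeT) //=; lia.
Qed.

Let merge_connected n m : connect (@tree_adj H merge_spr) n m.
Proof.
rewrite -(retract_val n) -(retract_val m).
apply: (connect_image (r := @tree_adj H T)); last exact: (pt_connected treeT).
move=> a b /existsP[f /and3P[vf /eqP <- /eqP <-]]; apply: retract_step => // f' fE.
by apply/existsP; exists f'; rewrite !eqxx [virtual f']/= fE vf.
Qed.

Let merge_vert_connected v n m : v \in sk_vert n -> v \in sk_vert m ->
  connect (@tree_adj_at H merge_spr v) n m.
Proof.
move=> /vert_lift[a <- va] /vert_lift[b <- vb].
apply: (connect_image (r := @tree_adj_at H T v)); last exact: (pt_vert_connected treeT).
move=> {va vb}a {}b /existsP[f /and4P[vf vE /eqP <- /eqP <-]]; apply: retract_step => // f' fE.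
by apply/existsP; exists f'; rewrite !eqxx [virtual f']/= [sk_ends f']/= fE vf vE.
Qed.

Lemma merge_pre_tree : pre_tree merge_spr.
Proof.
split.
- by move=> f; exact: (pt_ends_card treeT).
- by move=> f; apply/fintype.subsetP => v vf; apply: vert_retract; exact: sk_ends_vert.
- by move=> f vf; rewrite -[virtual _]/(virtual (val (twin f))) val_twin //;
    exact: (pt_twin_virtual treeT).
- move=> f vf; have vt : virtual (twin f).
    by rewrite -[virtual _]/(virtual (val (twin f))) val_twin //; exact: (pt_twin_virtual treeT).
  by apply: val_inj; rewrite !val_twin //; exact: (pt_twinK treeT).
- by move=> f vf; rewrite -[LHS]/(sk_ends (val (twin f))) val_twin //; exact: (pt_twin_ends treeT).
- by move=> f vf; rewrite sk_node_twin //; have /andP[fe ft] := valP f; exact: twin_node_neq.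
- by apply/card_gt0P; exists merged.
- exact: merge_connected.
- exact: merge_acyclic.
- by move=> f; exact: (pt_real_edge treeT).
- move=> a aE; have [f vf fE] := pt_real_ex treeT aE.
  have f_other : (f != e) && (f != twin e).
    by apply/andP; split; apply: contraNneq vf => ->; rewrite ?(pt_twin_virtual treeT).
  by exists (Sub f f_other).
- by move=> f g vf vg fg; apply: val_inj; exact: (pt_real_inj treeT vf vg fg).
- by move=> v; have [n vn] := pt_vert_ex treeT v; exists (retract n); exact: vert_retract.
- exact: merge_vert_connected.
Qed.

Let in_edges (n : node merge_spr) f : (f \in val @: sk_edges n)%SET =
  [&& f != e, f != twin e & retract (sk_node f) == n].
Proof.
apply/imsetP/and3P => [[f' f'n ->]|[fe ft fn]].
  by have /andP[] := valP f'; move: f'n; rewrite inE.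
have f_other : (f != e) && (f != twin e) by rewrite fe.
by exists (Sub f f_other); rewrite // inE.
Qed.

Let edges_other (n : node merge_spr) : val n != x -> (val @: sk_edges n)%SET = sk_edges (val n).
Proof.
move=> nx; apply/finset.setP => f; rewrite in_edges inE.
apply/and3P/eqP => [[_ _ /eqP fn]|fn].
  have := congr1 val fn; rewrite val_retract; case: eqP => // fy xn.
  by rewrite -xn eqxx in nx.
split; [apply: contraNneq nx => fE|apply: contraNneq (valP n) => fE|by rewrite fn retract_val];
  by rewrite -fn fE.
Qed.

Let edges_merged : (val @: sk_edges (merged : node merge_spr))%SET =
  ((sk_edges x :\ e) :|: (sk_edges y :\ twin e))%SET.
Proof.
apply/finset.setP => f; rewrite in_edges !inE -(inj_eq val_inj) val_retract /=.
case: (eqVneq (sk_node f) y) => [fy|fy].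
  have fe : f != e by apply: contraNneq xy => fE; rewrite -fy fE.
  by rewrite fe fy eqxx [y == x]eq_sym (negbTE xy); case: (f == twin e).
have ft : f != twin e by apply: contraNneq fy => ->.
by rewrite ft; case: (f == e); case: (sk_node f == x).
Qed.

Let other_node_ok (n : node merge_spr) : val n != x -> node_ok n.
Proof.
move=> nx; apply: (skeleton_ok_imset val_inj); rewrite edges_other //= (negbTE nx).
exact: nodes_ok.
Qed.

Hypotheses (same_kind : kind x = kind y) (not_R : kind x <> Rnode).

Let vert_meet : (sk_vert x :&: sk_vert y)%SET = sk_ends e.
Proof.
apply/finset.setP => v; rewrite inE; apply/andP/idP => [[vx vy]|vE].
  exact: shared_vertex_in_ends treeT _ _ _ _ ve (sk_node_notin_far treeT ve) (twin_node_in_far e)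
    vx vy.
by rewrite !sk_ends_vert // (pt_twin_ends treeT).
Qed.

Let edges_meet : (sk_edges x :&: sk_edges y)%SET = finset.set0.
Proof.
apply/finset.setP => f; rewrite !inE; apply/negP => /andP[/eqP ->].
exact/negP.
Qed.

Let merged_edges_ok : skeleton_ok (kind x) (sk_vert x :|: sk_vert y)%SET
  ((sk_edges x :\ e) :|: (sk_edges y :\ twin e))%SET (@sk_ends H T).
Proof.
have ex : e \in sk_edges x by rewrite inE.
have ty : twin e \in sk_edges y by rewrite inE.
have ends_sub (z : node T) f : f \in sk_edges z -> sk_ends f \subset sk_vert z.
  by rewrite inE => /eqP <-; exact: (pt_ends_sub treeT).
have := nodes_ok x; have := nodes_ok y; rewrite /node_ok -same_kind.
case: (kind x) not_R => //= _ y_ok x_ok.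
  apply: (glue_cycles (pt_ends_card treeT) (ends_sub x) (ends_sub y)
    x_ok y_ok ex ty _ vert_meet edges_meet).
  by rewrite (pt_twin_ends treeT).
have [[Vx2 Ex3] [Vy2 Ey3]] := (x_ok, y_ok).
have ends_vert f (z : node T) : f \in sk_edges z -> #|sk_vert z| = 2 -> sk_vert z = sk_ends f.
  by move=> fz Vz2; apply/esym/eqP; rewrite eqEcard (pt_ends_card treeT) Vz2 ends_sub.
split.
  rewrite (ends_vert e x) // (ends_vert (twin e) y) // (pt_twin_ends treeT) // finset.setUid.
  exact: (pt_ends_card treeT).
rewrite cardsU (_ : _ :&: _ = finset.set0)%SET ?cards0; last first.
  apply/eqP; rewrite -finset.subset0 -edges_meet; apply: finset.setISS; exact: finset.subD1set.
by have := cardsD1 e (sk_edges x); have := cardsD1 (twin e) (sk_edges y); rewrite ex ty; lia.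
Qed.

Lemma merge_ok (n : node merge_spr) : node_ok n.
Proof.
case: (eqVneq (val n) x) => [nx|nx]; last exact: other_node_ok.
have -> : n = merged by exact: val_inj.
by apply: (skeleton_ok_imset val_inj); rewrite edges_merged /= eqxx; exact: merged_edges_ok.
Qed.

End Merge.

(* Merge adjacent S-nodes and adjacent P-nodes until there are none. *)
Lemma spr_tree_exists (H : sgraph) : k_connected 2 (@adj H) [set: H]%SET ->
  exists T : spr_data H, is_spr_tree T.
Proof.
move=> connected2; pose P n := `[< exists T : spr_data H,
  [/\ pre_tree T, forall x : node T, node_ok x & #|node T| = n] >].
have exP : exists n, P n.
  have [T [treeT nodes_ok]] := unreduced_spr_tree connected2.
  by exists #|node T|; apply/asboolP; exists T.
case: (ex_minnP exP) => n /asboolP[T [treeT nodes_ok nE]] n_min; exists T.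
have reduced (x y : node T) : tree_adj x y -> kind x = kind y -> kind x = Rnode.
  move=> /existsP[e /and3P[ve /eqP ex /eqP ey]] same; apply: contrapT => not_R.
  have : (n <= #|node (merge_spr treeT ve)|)%N.
    apply: n_min; apply/asboolP; exists (merge_spr treeT ve); split => //;
      first exact: merge_pre_tree.
    by apply: merge_ok => //; rewrite ex ?ey.
  by rewrite merge_card nE; have := pt_nonempty treeT; rewrite nE; lia.
by case: treeT => *; split.
Qed.
(** * From the graph to skeletons *)

Section Interior.
Variables (H : sgraph) (T : spr_data H).
Hypothesis treeT : is_spr_tree T.
Let preT := spr_pre_tree treeT.
Implicit Types (f g : sk_edge T) (z : node T).

(* The vertices that the 2-separator sk_ends f cuts off from the node of f. *)
Definition interior f : {set H} :=
  [set w | (w \notin sk_ends f) && [exists z in far f, w \in sk_vert z]]%SET.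

Lemma interiorP f w : reflect (w \notin sk_ends f /\ exists2 z, z \in far f & w \in sk_vert z)
  (w \in interior f).
Proof. by rewrite inE; apply: (iffP andP) => -[wf /exists_inP]. Qed.

Lemma interior_adj f a p : virtual f -> a \in interior f -> adj a p ->
  p \in interior f \/ p \in sk_ends f.
Proof.
move=> vf /interiorP[ae az] ap; case: (boolP (p \in sk_ends f)) => pe; first by right.
by left; apply/interiorP; split=> //; exact: (adj_far preT vf az ae ap).
Qed.

Lemma interior_skeleton f a : virtual f -> a \in interior f -> a \notin sk_vert (sk_node f).
Proof.
move=> vf /interiorP[ae [z zf az]]; apply: contraNN ae => ax.
exact: (shared_vertex_in_ends preT vf (sk_node_notin_far preT vf) zf).
Qed.

Lemma interior_disjoint f g a : virtual f -> virtual g -> sk_node f = sk_node g -> f != g ->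
  a \in interior f -> a \notin interior g.
Proof.
move=> vf vg fg ne /interiorP[ae [z zf az]]; apply: contraNN ae => /interiorP[_ [z' z'g az']].
apply: (shared_vertex_in_ends preT vf _ zf az' az); apply: (far_disjoint preT vg vf) => //.
by rewrite eq_sym.
Qed.

Let interior_large_node f z : z \in far f -> (2 < #|sk_vert z|)%N -> exists a, a \in interior f.
Proof.
move=> zf z3; have /fintype.subsetPn[a az ae] : ~~ (sk_vert z \subset sk_ends f).
  by apply: contraTN z3 => /subset_leq_card; rewrite (pt_ends_card preT) -leqNgt.
by exists a; apply/interiorP; split=> //; exists z.
Qed.

Let dipole_other_virtual f y : f \in sk_edges y -> is_dipole y ->
  exists g, [/\ sk_node g = y, g != f & virtual g].
Proof.
move=> fy [V2 E3].
have endsE g : g \in sk_edges y -> sk_ends g = sk_vert y.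
  rewrite inE => /eqP gy; apply/eqP; rewrite eqEcard V2 (pt_ends_card preT) leqnn andbT -gy.
  exact: (pt_ends_sub preT).
apply: contrapT => no; move: E3; rewrite (cardsD1 f) fy add1n ltnS ltnNge => /negP; apply.
have real g : g \in (sk_edges y :\ f)%SET -> ~~ virtual g.
  by rewrite !inE => /andP[gf /eqP gy]; apply/negP => vg; apply: no; exists g.
apply/card_le1_eqP => g h gF hF; apply: (pt_real_inj preT); rewrite ?real //.
by move: gF hF; rewrite !finset.in_setD1 => /andP[_ /endsE ->] /andP[_ /endsE ->].
Qed.

(* If the neighbouring node is a P-node, the node behind it is larger, as no two
   P-nodes are adjacent. *)
Lemma interior_nonempty f : virtual f -> exists a, a \in interior f.
Proof.
move=> vf; have yf := twin_node_in_far f; set y := sk_node (twin f) in yf.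
have large z : kind z <> Pnode -> (2 < #|sk_vert z|)%N.
  by have := spr_kind treeT z; case: (kind z) => // [[]|[_ [/ltnW]]].
case: (pselect (kind y = Pnode)) => [ky|ky]; last exact: interior_large_node (large y ky).
have ty : twin f \in sk_edges y by rewrite inE.
have [g [gy gt vg]] : exists g, [/\ sk_node g = y, g != twin f & virtual g].
  by apply: dipole_other_virtual => //; have := spr_kind treeT y; rewrite ky.
have gf : g != f by apply: contraTneq yf => gf; rewrite -gy gf (sk_node_notin_far preT).
apply: (interior_large_node (z := sk_node (twin g))); first by rewrite (far_twin_node preT) // gy.
apply: large => kz; have yz : tree_adj y (sk_node (twin g)).
  by apply/existsP; exists g; rewrite vg gy !eqxx.
by have := spr_reduced treeT yz; rewrite ky kz => /(_ erefl).
Qed.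

Hypothesis connected2 : k_connected 2 (@adj H) [set: H]%SET.

Definition interior_rel f : rel H :=
  fun p q => adj p q && ((p \in interior f) || (q \in interior f)).

Lemma interior_rel_sym f : symmetric (interior_rel f).
Proof. by move=> p q; rewrite /interior_rel adj_sym orbC. Qed.

Let interior_walk_to f a w w' : virtual f -> a \in interior f -> sk_ends f = edge w w' -> w != w' ->
  connect (interior_rel f) a w.
Proof.
move=> vf aI fE ww'; have end_out (z : H) : z \in edge w w' -> z \notin interior f.
  by rewrite -fE inE => ->.
have aw' : a != w' by apply: contraTneq aI => ->; rewrite end_out ?edge_r.
pose A := [set p in interior f | connect (interior_rel f) a p]%SET.
have aA : a \in A by rewrite inE aI connect0.
have wA : w \notin A by rewrite inE (negbTE (end_out w (edge_l _ _))).
have w'1 : (#|[set w']%SET| < 2)%N by rewrite cards1.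
have := connected2.2 _ w'1 a w; rewrite !inE aw' ww' => /(_ isT isT) aw.
have [p [q [/and3P[_ qw' pq] + qA]]] := connect_exit aw aA wA.
rewrite inE => /andP[pI ap]; have aq : connect (interior_rel f) a q.
  by apply: (connect_trans ap); apply: connect1; rewrite /interior_rel pq pI.
case: (interior_adj vf pI pq) => [qI|]; first by rewrite inE qI aq in qA.
by rewrite fE in_edge => /orP[/eqP <-//|/eqP qE]; rewrite qE !inE eqxx in qw'.
Qed.

Lemma interior_walk f u v : virtual f -> sk_ends f = edge u v -> u != v ->
  connect (interior_rel f) u v.
Proof.
move=> vf fE uv; have [a aI] := interior_nonempty vf.
have au := interior_walk_to vf aI fE uv; rewrite (sym_connect_sym (interior_rel_sym f)) in au.
by apply: (connect_trans au); apply: (interior_walk_to (w' := u)); rewrite // 1?edgeC // eq_sym.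
Qed.

End Interior.

Section Contraction.
Variables (R : realType) (S : set crossing_type) (H : sgraph) (T : spr_data H).
Hypothesis treeT : is_spr_tree T.
Hypothesis SS : S `<=` [set Full; AlmostFull; Bowtie]%classic.
Hypothesis connected2 : k_connected 2 (@adj H) [set: H]%SET.
Let preT := spr_pre_tree treeT.
Variable x : node T.
Local Notation G := (expanded T).
Implicit Types (f g : sk_edge T) (L : seq (sk_edge T)).

(* The virtual edges in L have been replaced by their new vertices; those not
   in L are still represented by the vertices that they separate. *)
Definition partial_skeleton L : {set G} :=
  [set w : G | match w with
    | inl v => (v \in sk_vert x) ||
        [exists f, [&& virtual f, sk_node f == x, f \notin L & v \in interior f]]
    | inr f => [&& virtual f, sk_node f == x & f \in L]
    end]%SET.

Lemma partial_inlP L v : reflect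
  (v \in sk_vert x \/ exists f, [/\ virtual f, sk_node f = x, f \notin L & v \in interior f])
  ((inl v : G) \in partial_skeleton L).
Proof.
rewrite inE; apply: (iffP orP) => -[]; auto.
  by case/existsP=> f /and4P[vf /eqP fx fL vI]; right; exists f.
by case=> f [vf fx fL vI]; right; apply/existsP; exists f; rewrite vf fx eqxx fL.
Qed.

Lemma partial_inr L f :
  ((inr f : G) \in partial_skeleton L) = [&& virtual f, sk_node f == x & f \in L].
Proof. by rewrite inE. Qed.

Section Step.
Variables (L : seq (sk_edge T)) (f : sk_edge T) (u v : H).
Hypotheses (vf : virtual f) (fx : sk_node f = x) (fL : f \notin L).
Hypotheses (fE : sk_ends f = edge u v) (uv : u != v).
Local Notation before := (partial_skeleton L).
Local Notation after := (partial_skeleton (f :: L)).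
Local Notation t := (inr f : G).
Local Notation il p := (inl p : G).

Let inl_neq p q : p != q -> il p != il q.
Proof. by apply: contraNneq => -[->]. Qed.

Let ends_skeleton p : p \in sk_ends f -> p \in sk_vert x.
Proof. by rewrite -fx; exact: sk_ends_vert. Qed.

Let ends_partial K p : p \in sk_ends f -> il p \in partial_skeleton K.
Proof. by move=> pf; apply/partial_inlP; left; exact: ends_skeleton. Qed.

Let ends_interior p : p \in sk_ends f -> p \notin interior f.
Proof. by move=> pf; rewrite inE pf. Qed.

Let interior_before a : a \in interior f -> il a \in before.
Proof. by move=> aI; apply/partial_inlP; right; exists f. Qed.

Let interior_after a : a \in interior f -> il a \notin after.
Proof.
move=> aI; apply/partial_inlP => -[ax|[g [vg gx]]].
  by have := interior_skeleton treeT vf aI; rewrite fx ax.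
rewrite inE negb_or => /andP[gf _] ag; have := interior_disjoint treeT vg vf _ gf ag.
by rewrite gx fx aI => /(_ erefl).
Qed.

Let after_before w : w \in after -> w != t -> w \in before.
Proof.
case: w => [p /partial_inlP[px|[g [vg gx gL pg]]] _|g]; first by apply/partial_inlP; left.
  by apply/partial_inlP; right; exists g; move: gL; rewrite inE negb_or => /andP[].
rewrite !partial_inr inE => /and3P[-> -> /predU1P[->|->]] //.
by rewrite eqxx.
Qed.

Let u_end : u \in sk_ends f. Proof. by rewrite fE edge_l. Qed.
Let v_end : v \in sk_ends f. Proof. by rewrite fE edge_r. Qed.

Let interior_nbr a w : a \in interior f -> w \in before -> adj (il a) w ->
  exists2 p, w = il p & p \in interior f \/ p \in sk_ends f.
Proof.
move=> aI; case: w => [p _ ap|g]; first by exists p => //; exact: (interior_adj treeT vf aI ap).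
rewrite partial_inr => /and3P[_ /eqP gx _] /(sk_ends_vert preT).
by rewrite gx -fx (negbTE (interior_skeleton treeT vf aI)).
Qed.

Let interior_nbr_after a w : a \in interior f -> w \in after -> w != t -> adj (il a) w ->
  exists2 p, w = il p & p \in sk_ends f.
Proof.
move=> aI wV wt aw; have [p wE [pI|pf]] := interior_nbr aI (after_before wV wt) aw;
  last by exists p.
by rewrite wE (negbTE (interior_after pI)) in wV.
Qed.

Let edge_away c : c \in edges_in after -> t \notin c -> c \in edges_in before.
Proof.
case/edges_inP=> w [w' [-> ww' wV w'V]]; rewrite in_edge negb_or => /andP[tw tw'].
by rewrite (@edge_edges_in G) ww' !after_before // eq_sym.
Qed.

Let edge_at_t c : c \in edges_in after -> t \in c -> c = edge (il u) t \/ c = edge (il v) t.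
Proof. by rewrite edges_inE => /andP[cE _]; exact: expanded_edge_inr. Qed.

Lemma contract_common_neighbor a : a \in interior f -> adj a u -> adj a v ->
  drawable_on R before (@allowed S G) -> drawable_on R after (@allowed S G).
Proof.
move=> aI au av D; pose s (w : G) : G := if w == t then il a else w.
have not_a w : w \in after -> w != il a.
  by apply: contraTneq => ->; exact: interior_after.
have s_inj : {in after &, injective s}.
  move=> w w' wV w'V; rewrite /s; case: eqP => [->|_]; case: eqP => [->|_] // wE.
    by have := not_a w' w'V; rewrite -wE eqxx.
  by have := not_a w wV; rewrite wE eqxx.
have s_vert w : w \in after -> s w \in before.
  by move=> wV; rewrite /s; case: eqP => [_|/eqP]; [exact: interior_before|exact: after_before].
have adj_t w : w \in after -> w != t -> adj (il a) w = adj t w.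
  move=> wV wt; apply/idP/idP => [aw|/(expanded_adj_inr fE)[] -> //].
  by have [p -> pf] := interior_nbr_after aI wV wt aw.
have s_adj : {in after &, forall w w', adj (s w) (s w') = adj w w'}.
  move=> w w' wV w'V; rewrite /s; case: (eqVneq w t) => [->|wt]; case: (eqVneq w' t) => [->|wt'] //.
  - by rewrite !adj_irrefl.
  - exact: adj_t.
  - by rewrite adj_sym adj_t // adj_sym.
apply: (drawable_on_relabel (il u) D s_inj s_vert s_adj) => c d /edges_in_sub cV /edges_in_sub dV.
exact: (allowed_imset s_adj cV dV).
Qed.

Hypothesis no_common : forall a, a \in interior f -> adj a u -> adj a v -> False.

Let allowed_interior_crossing a (c d : {set G}) : a \in interior f -> il a \in c ->
  c \in edges_in before ->
  d \in edges_in after -> t \notin d -> allowed S c d ->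
  exists b, [/\ b \in interior f, c = edge (il a) (il b) & d = edge (il u) (il v)].
Proof.
move=> aI ac cE dE td [disj typ]; have [c2 cE' _] := card2_edge (edges_in_card cE) ac.
have := cE; rewrite {1}cE' (@edge_edges_in G) => /and3P[ac2 _ c2V].
have [b c2E bI] := interior_nbr aI c2V ac2; rewrite {}c2E in cE' ac2 c2V.
have [d1 [d2 [dE' ad1 bd2]]] : exists d1 d2, [/\ d = edge d1 d2, adj (il a) d1 & adj (il b) d2].
  have /edges_inP[d1 [d2 [dE' _ _ _]]] := dE.
  by case/orP: (crossing_disjoint_edges SS (typ _ _ _ _ cE' dE')) => /andP[ad bd];
    [exists d1, d2|exists d2, d1]; rewrite // edgeC.
have in_d w : w \in edge d1 d2 -> w \in after /\ w != t.
  rewrite -dE' => wd; split; last by apply: contraNneq td => <-.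
  exact: (fintype.subsetP (edges_in_sub dE)).
have [[d1V d1t] [d2V d2t]] := (in_d d1 (edge_l _ _), in_d d2 (edge_r _ _)).
have [p d1E pf] := interior_nbr_after aI d1V d1t ad1; rewrite {}d1E in dE' ad1.
case: bI => [bI|bf].
  have [q d2E qf] := interior_nbr_after bI d2V d2t bd2; rewrite {}d2E in dE'.
  exists b; split=> //; rewrite dE'.
  have pq : p != q by have := edges_in_card dE; rewrite dE' cards2; case: (eqVneq p q) => // ->;
    rewrite eqxx.
  by move: pf qf pq; rewrite fE !in_edge => /orP[] /eqP -> /orP[] /eqP ->; rewrite ?eqxx // edgeC.
exfalso; have pb : p != b.
  apply/eqP => pE; have /finset.setP/(_ (il b)) := disj.
  by rewrite !inE cE' dE' pE edge_r edge_l.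
move: pf bf pb ad1 ac2; rewrite fE !in_edge => /orP[] /eqP -> /orP[] /eqP ->;
  rewrite ?eqxx // => _ au av.
  exact: (no_common aI au av).
exact: (no_common aI av au).
Qed.

Let away := [set c in edges_in after | t \notin c]%SET.

Let replace_interior_walk (F : {set {set G}}) src dst X (pos : G -> R * R) cv (r : rel G) :
  plane_drawing before (edges_in before) src dst X pos cv ->
  (forall d, d \in away -> d = edge (src d) (dst d)) ->
  (forall c d, X c d -> @allowed S G c d) -> F \subset edges_in before ->
  (forall c, c \in F -> exists2 a, a \in interior f & il a \in c) ->
  (forall c d, c \in F -> d \in away -> ~ X c d) ->
  (forall c w, c \in F -> w = src c \/ w = dst c ->
    exists2 p, w = il p & p \in interior f \/ p \in sk_ends f) ->
  (forall w w', r w w' -> exists2 c, c \in F & joins src dst c w w') -> connect r (il u) (il v) ->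
  drawable_on R after (@allowed S G).
Proof.
move=> D or_away X_allowed FE meetF FX endsF rF con.
have afterE (w : G) : (w \in (after :\ t)%SET) = (w != t) && (w \in after).
  by rewrite finset.in_setD1.
have awayE (c : {set G}) : (c \in away) = (c \in edges_in after) && (t \notin c).
  by rewrite [LHS]inE.
have := sd_replace_walk (Vb := (after :\ t)%SET) (Eb := away) (X' := @allowed S G) (t := t)
  D _ _ _ FE _ _ rF con (inl_neq uv).
move=> bypass; apply: (sd_restrict (bypass _ _ _ _ _ _ _ _)) => //.
- by apply/fintype.subsetP => w; rewrite afterE => /andP[wt wV]; exact: after_before.
- move=> d dA; have := dA; rewrite awayE => /andP[dE td]; split; [exact: edge_away|exact: or_away|].
  apply/fintype.subsetP => w wd; rewrite afterE (fintype.subsetP (edges_in_sub dE)) // andbT.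
  by apply: contraNneq td => <-.
- by move=> c d _ _; exact: X_allowed.
- move=> c d cF dA; split; last exact: FX.
  have [a aI ac] := meetF c cF; apply: contraNneq (interior_after aI) => cd; rewrite cd in ac.
  by move: dA; rewrite awayE => /andP[/edges_in_sub/fintype.subsetP sub _]; exact: sub.
- move=> c w cF; rewrite afterE => /andP[_ wV] /(endsF c w cF)[p wE [pI|]].
    by rewrite wE (negbTE (interior_after pI)) in wV.
  by rewrite wE fE in_edge => /orP[] /eqP ->; auto.
- by rewrite afterE ends_partial.
- by rewrite afterE ends_partial.
- by rewrite afterE eqxx.
- by apply/fintype.subsetP => w wV; rewrite finset.in_setU1 afterE wV andbT orbN.
- move=> c cE; split; last exact: edges_in_sub.
  rewrite !finset.in_setU1 awayE cE /=.
  by case: (boolP (t \in c)) => [/(edge_at_t cE)[] ->|]; rewrite ?eqxx ?orbT.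
Qed.

Variables (pos : G -> R * R) (cv : {set G} -> set (R * R)).
Hypothesis D : simple_drawing before (edges_in before) (@allowed S G) pos cv.

(* After removing the crossing of ab and uv, the walk u, a, v is free. *)
Let contract_crossed a b p : a \in interior f -> b \in interior f -> adj a u ->
  crossing before (edges_in before) pos cv (edge (il a) (il b)) (edge (il u) (il v)) p ->
  drawable_on R after (@allowed S G).
Proof.
move=> aI bI au cab; have [abE _ _ _ _] := cab.
have ends_neq c w : c \in interior f -> w \in sk_ends f -> c != w.
  by move=> cI wf; apply: contraTneq cI => ->; exact: ends_interior.
have av := ends_neq a v aI v_end; have ua : u != a by rewrite eq_sym ends_neq.
have [src [dst [[pos2 [cv2 D2]] sa da oriented]]] :=
  sd_uncross D cab (edge_l (il a) (il b)) (edge_r (il u) (il v)) (inl_neq av).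
have ua_ab : edge (il u) (il a) != edge (il a) (il b).
  by rewrite edgeC; apply: contraNneq (ends_neq b u bI u_end) => /edge_injr[->].
have uaE : edge (il u) (il a) \in edges_in before.
  by rewrite (@edge_edges_in G) /= adj_sym au ends_partial // interior_before.
have ua_joins : joins src dst (edge (il u) (il a)) (il u) (il a).
  by apply: joins_edge; [exact: inl_neq|exact: oriented].
pose F := [set edge (il u) (il a); edge (il a) (il b)]%SET.
have not_away d : d \in away -> d \in edges_in after /\ t \notin d by rewrite inE => /andP[].
pose r := [rel w w' | (w == il u) && (w' == il a) || (w == il a) && (w' == il v)].
apply: (replace_interior_walk (F := F) (r := r) D2).
- move=> d /not_away[dE td]; apply: oriented; first exact: edge_away.
  apply: contraNneq (interior_after aI) => dE'; apply: (fintype.subsetP (edges_in_sub dE)).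
  by rewrite dE' edge_l.
- by move=> c d [].
- by apply/fintype.subsetP => c /set2P[] ->.
- by move=> c /set2P[] ->; exists a; rewrite ?edge_l ?edge_r.
- move=> c d /set2P[] -> /not_away[dE td] [al ab_free _]; last by rewrite mem_head in ab_free.
  have [b' [b'I /(edge_inj (inl_neq _))]] := allowed_interior_crossing aI (edge_r _ _) uaE dE td al.
  case=> // -[[uE] _] _; first by rewrite uE eqxx in ua.
  by rewrite -uE (negbTE (ends_interior u_end)) in b'I.
- move=> c w /set2P[] -> wE.
    by case: ua_joins wE => -[-> ->] [] ->; [exists u|exists a|exists a|exists u]; auto.
  by case: wE => ->; rewrite ?sa ?da; [exists a|exists v]; auto.
- move=> w w' /= /orP[] /andP[/eqP -> /eqP ->];
    [exists (edge (il u) (il a))|exists (edge (il a) (il b))];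
    by rewrite ?inE ?eqxx ?orbT //; left.
- by apply: (@connect_trans _ _ (il a)); apply: connect1; rewrite /= !eqxx ?orbT.
Qed.

Let contract_uncrossed : (forall a b p, a \in interior f -> b \in interior f ->
    ~ crossing before (edges_in before) pos cv (edge (il a) (il b)) (edge (il u) (il v)) p) ->
  drawable_on R after (@allowed S G).
Proof.
move=> no_crossing.
pose X c d := @allowed S G c d /\ forall a b, a \in interior f -> b \in interior f ->
  c = edge (il a) (il b) -> d <> edge (il u) (il v).
have DX : simple_drawing before (edges_in before) X pos cv.
  apply: (simple_drawing_restrict D) => [|c cE|c d p _ _ ccd al];
    [exact: subxx|by rewrite edges_in_sub|].
  by split=> // a b aI bI cE dE; apply: (no_crossing a b p aI bI); rewrite -cE -dE.
have [src [dst [oriented DX']]] := DX.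
pose F := [set c in edges_in before | [exists a in interior f, il a \in c]]%SET.
have inF c : c \in F -> c \in edges_in before /\ exists2 a, a \in interior f & il a \in c.
  by rewrite inE => /andP[cE /exists_inP].
apply: (replace_interior_walk (F := F) (r := [rel w w' | edge w w' \in F]) DX').
- by move=> d; rewrite inE => /andP[dE td]; apply: oriented; exact: edge_away.
- by move=> c d [].
- by apply/fintype.subsetP => c /inF[].
- by move=> c /inF[].
- move=> c d /inF[cE [a aI ac]]; rewrite inE => /andP[dE td] [al no_uv].
  have [b [bI cE' dE']] := allowed_interior_crossing aI ac cE dE td al.
  exact: (no_uv a b).
- move=> c w /inF[cE [a aI ac]] wE; have [w' cE' _] := card2_edge (edges_in_card cE) ac.
  have : w \in c by rewrite (oriented c cE) in_edge; case: wE => ->; rewrite eqxx ?orbT.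
  have := cE; rewrite {1}cE' (@edge_edges_in G) cE' in_edge => /and3P[aw' _ w'V] /orP[] /eqP ->.
    by exists a; auto.
  exact: interior_nbr w'V aw'.
- move=> w w' /= wF; exists (edge w w') => //; have [wE _] := inF _ wF.
  by apply: joins_edge; [have := edges_in_card wE; rewrite cards2; case: eqP|exact: oriented].
- apply: (connect_image (r := interior_rel f) (q := fun p => il p));
    last exact: (interior_walk treeT).
  have reach p q : p \in interior f -> adj p q -> edge (il p) (il q) \in F.
    move=> pI pq; rewrite inE (@edge_edges_in G) /= pq interior_before //=; apply/andP; split.
      by case: (interior_adj treeT vf pI pq) => [/interior_before|/ends_partial].
    by apply/exists_inP; exists p; rewrite ?edge_l.
  move=> p q /andP[pq /orP[pI|qI]]; apply: connect1; rewrite /=; first exact: reach.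
  by rewrite edgeC reach // adj_sym.
Qed.

Lemma contract_no_common : drawable_on R after (@allowed S G).
Proof.
case: (pselect (exists a b p, [/\ a \in interior f, b \in interior f &
    crossing before (edges_in before) pos cv (edge (il a) (il b)) (edge (il u) (il v)) p]));
  last first.
  by move=> no; apply: contract_uncrossed => a b p aI bI cab; apply: no; exists a, b, p.
case=> a [b [p [aI bI cab]]]; have [_ typ] := sd_crossing D cab.
have /orP[/andP[/= au _]|/andP[/= _ bu]] := crossing_disjoint_edges SS (typ _ _ _ _ erefl erefl).
  exact: (contract_crossed aI bI au cab).
by apply: (contract_crossed bI aI bu (p := p)); rewrite [edge (il b) _]edgeC.
Qed.

End Step.

Lemma contract_virtual_edge L f : virtual f -> sk_node f = x -> f \notin L ->
  drawable_on R (partial_skeleton L) (@allowed S G) ->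
  drawable_on R (partial_skeleton (f :: L)) (@allowed S G).
Proof.
move=> vf fx fL D; have [u [v [fE uv]]] := sk_ends_edge preT f.
case: (pselect (exists a, [/\ a \in interior f, adj a u & adj a v])) => [[a [aI au av]]|no].
  exact: (contract_common_neighbor vf fx fL fE aI au av D).
have [pos [cv D']] := D; apply: (contract_no_common vf fx fL fE uv _ D') => a aI au av.
by apply: no; exists a.
Qed.

Lemma skeleton_plus_restricted : restricted R S H -> restricted R S (skeleton_plus x).
Proof.
move=> res; have [v0 v0x] := spr_vertex treeT x.
have start : drawable_on R (partial_skeleton [::]) (@allowed S G).
  apply: (restricted_on_image (i := fun v : H => inl v : G) v0 res) => // -[v _|f].
    by exists v.
  by rewrite partial_inr !andbF.
pose L := enum [set f | virtual f && (sk_node f == x)]%SET.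
have LE f : (f \in L) = virtual f && (sk_node f == x) by rewrite mem_enum inE.
have D : drawable_on R (partial_skeleton L) (@allowed S G).
  have : {in L, forall f, virtual f && (sk_node f == x)} by move=> f; rewrite LE.
  elim: L {LE} (enum_uniq _ : uniq L) => [//|f L IH] /= /andP[fL uL] L_virtual.
  have /andP[vf /eqP fx] := L_virtual f (mem_head _ _).
  by apply: contract_virtual_edge => //; apply: IH => // g gL; apply: L_virtual;
    rewrite inE gL orbT.
apply: (restricted_embedding (i := @skeleton_plus_expanded H T x) _ D) => [||w w'|[v|f]].
- exact: inl (Sub v0 v0x).
- exact: skeleton_plus_expanded_inj.
- exact: skeleton_plus_expanded_adj.
- by apply/partial_inlP; left; exact: valP.
- by have /andP[fx vf] := valP f; rewrite inE in fx; rewrite partial_inr LE vf fx.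
Qed.

End Contraction.

Section InducedSubgraph.
Variables (G : sgraph) (B : {set G}).

Lemma induced_k_connected k : k_connected k (@adj G) B ->
  k_connected k (@adj (induced_subgraph B)) [set: induced_subgraph B]%SET.
Proof.
case=> Bk conn; split; first by rewrite cardsT card_sig (eq_card (_ : _ =i B)).
move=> X Xk u v; rewrite !finset.in_setD !finset.in_setT !andbT => uX vX.
have Xk' : (#|(val @: X)%SET| < k)%N by rewrite card_imset //; exact: val_inj.
have inX (w : induced_subgraph B) : w \notin X -> val w \in (B :\: val @: X)%SET.
  by move=> wX; rewrite finset.in_setD (valP w) andbT;
    apply: contraNN wX => /imsetP[z zX /val_inj ->].
have lift a : a \in (B :\: val @: X)%SET -> exists2 n : induced_subgraph B, n \notin X & val n = a.
  rewrite finset.in_setD => /andP[aX aB]; exists (Sub a aB : induced_subgraph B) => //.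
  by apply: contraNN aX => nX; apply/imsetP; exists (Sub a aB).
apply: (connect_lift (proj := val) (I := fun n => n \notin X)
  _ _ uX vX (conn _ Xk' _ _ (inX u uX) (inX v vX))).
  by move=> n m _ _ /val_inj ->; rewrite connect0.
move=> a b /and3P[/lift[n nX <-] /lift[m mX <-] ab]; exists n, m; split => //=.
by rewrite !finset.in_setD !finset.in_setT nX mX.
Qed.

Lemma induced_restricted (R : realType) (S : set crossing_type) (v : G) : v \in B ->
  restricted R S G -> restricted R S (induced_subgraph B).
Proof.
move=> vB /(@drawable_on_restricted R S G v) D.
apply: (@restricted_embedding R S G (induced_subgraph B) val [set: G]%SET _ D) => //.
exact: Sub v vB.
Qed.

End InducedSubgraph.

Theorem theorem3p1 (R : realType) (S : set crossing_type) (G : sgraph) :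
  S !=set0 -> S `<=` [set Full; AlmostFull; Bowtie] ->
  (restricted R S G <->
   forall (B : {set G}) (T : spr_data (induced_subgraph B)) (x : node T),
     biconnected_component B -> is_spr_tree T -> kind x = Rnode ->
     restricted R S (skeleton_plus x)).
Proof.
move=> _ SS; split=> [res B T x [B2 _] treeT _|res].
  have [v vB] : exists v, v \in B by apply/card_gt0P; case: B2 => B3 _; exact: leq_trans B3.
  exact: (skeleton_plus_restricted treeT SS (induced_k_connected B2) x (induced_restricted vB res)).
apply: blocks_restricted => B bB; have [T treeT] := spr_tree_exists (induced_k_connected bB.1).
by apply: (tree_restricted treeT SS) => x kx; exact: (res B T x bB treeT kx).
Qed.
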